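(* Let $x$ be a real number with $x<-4$ or $x>4$, and suppose $x$ is not a multiple of four. For real $t$ put $m_x(t)=\left|1-\frac{n(x)}{n(x+it)}\right|^{1/2}$ (with $m_x(t)=\infty$ if $n(x+it)=0$), and put $d_x(t_1,t_2)=m_x(t_1-t_2)$ for real $t_1,t_2$. Then $m_x$ is a finite-valued metric norm on the real line, and $d_x$ is a translation invariant metric on the real line.
   Context: $\zeta$ is the Riemann zeta-function, $\xi(s)=\tfrac12\pi^{-s/2}s(s-1)\Gamma(s/2)\zeta(s)$ and $n(s)=\sin(\pi s/4)\cdot2\xi(\tfrac12+s)$. A metric norm on $\mathbb R$ is a function $m:\mathbb R\to[0,\infty)$ with $m(t)=0$ if and only if $t=0$, $m(-t)=m(t)$, and $m(t_1+t_2)\le m(t_1)+m(t_2)$ (so that $(t_1,t_2)\mapsto m(t_1-t_2)$ is a translation invariant metric). *)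

(* Defs.v *)
From Stdlib Require Import Reals Factorial ClassicalEpsilon.
From Coquelicot Require Import Coquelicot.
Open Scope R_scope.

(** Complex exponential, sine, and the powers [a ^ s] of a real base [a > 0]. *)
Definition Cexp (z : C) : C :=
  (RtoC (exp (Re z)) * (cos (Im z), sin (Im z)))%C.

Definition Csin (z : C) : C :=
  ((Cexp (Ci * z) - Cexp (- (Ci * z))) / (2 * Ci))%C.

Definition Rcpow (a : R) (s : C) : C := Cexp (s * RtoC (ln a))%C.

Definition Clim_seq (u : nat -> C) : C :=
  (real (Lim_seq (fun n => Re (u n))), real (Lim_seq (fun n => Im (u n)))).

(** Gauss's limit [n! n^s / (s (s+1) ... (s+n))], valid for every complex [s]
    other than the poles [0, -1, -2, ...]; the value at a pole is junk. *)
Fixpoint rising (s : C) (n : nat) : C :=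
  match n with
  | O => s
  | S p => (rising s p * (s + RtoC (INR n)))%C
  end.

Definition Gamma (s : C) : C :=
  Clim_seq (fun n =>
    (RtoC (INR (fact n)) * Rcpow (INR n) s / rising s n)%C).

Definition analytic_at (f : C -> C) (s0 : C) : Prop :=
  exists (a : nat -> C) (r : R), 0 < r /\
    forall s : C, Cmod (s - s0)%C < r ->
      is_pseries (K := C_AbsRing) (V := C_NormedModule) a (s - s0)%C (f s).

(** Analytic continuation to the punctured plane of the Dirichlet series
    [1^(-s) + 2^(-s) + 3^(-s) + ...]. *)
Definition is_riemann_zeta (f : C -> C) : Prop :=
  (forall s : C, s <> RtoC 1 -> analytic_at f s) /\
  (forall s : C, 1 < Re s ->
    is_series (K := C_AbsRing) (V := C_NormedModule)
      (fun k : nat => Rcpow (INR (S k)) (- s)%C) (f s)).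

(** [is_riemann_zeta] determines the function except at its pole [s = 1],
    where the value chosen here is irrelevant to [xi]. *)
Definition zeta : C -> C :=
  epsilon (inhabits (fun _ : C => RtoC 0)) is_riemann_zeta.

Definition xi_formula (s : C) : C :=
  (/ 2 * Rcpow PI (- s / 2) * s * (s - 1) * Gamma (s / 2) * zeta s)%C.

(** The entire function given by the formula: the limit over the punctured
    neighbourhood fills in the removable singularities at [1, 0, -2, -4, ...]
    (poles of [zeta] or of [Gamma (s / 2)]). [C_lim] is computed along the
    horizontal line through [s], and is the limit in [C] whenever that exists. *)
Definition xi (s : C) : C := C_lim xi_formula s.

Definition n (s : C) : C :=
  (Csin (RtoC PI * s / 4) * (2 * xi (/ 2 + s)))%C.

(** Here [(x, t)] is the complex number [x + i t]. *)
Definition m (x t : R) : Rbar :=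
  if Ceq_dec (n (x, t)) (RtoC 0) then p_infty
  else Finite (sqrt (Cmod (1 - n (RtoC x) / n (x, t))%C)).

Definition d (x t1 t2 : R) : Rbar := m x (t1 - t2).

Definition metric_norm (f : R -> R) : Prop :=
  (forall t, 0 <= f t) /\
  (forall t, f t = 0 <-> t = 0) /\
  (forall t, f (- t) = f t) /\
  (forall t1 t2, f (t1 + t2) <= f t1 + f t2).

Definition metric (dist : R -> R -> R) : Prop :=
  (forall a b, 0 <= dist a b) /\
  (forall a b, dist a b = 0 <-> a = b) /\
  (forall a b, dist a b = dist b a) /\
  (forall a b c, dist a c <= dist a b + dist b c).

Definition translation_invariant (dist : R -> R -> R) : Prop :=
  forall a b c, dist (a + c) (b + c) = dist a b.

(* Main.v *)
Require Import Defs.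
From Stdlib Require Import Reals Lra Lia Psatz List Factorial ClassicalEpsilon.
From Coquelicot Require Import Coquelicot.
Open Scope R_scope.

(** For [x > 4] not a multiple of four, [phi t = n x / n (x + i t)] is a limit of positive combinations of characters,
    with [phi 0 = 1].  The covariance bound [|phi (s + t) - phi s * phi t|^2 <= (1 - |phi s|^2) (1 - |phi t|^2)] then
    makes [|1 - phi|^(1/2)] subadditive.

    Write [4 (p + 1) < x < 4 (p + 2)] and [v = s / 4 - p - 1], so that [0 < Re v < 1].  By the reflection and duplication
    formulas, [1 / n s] is a constant times the product of [1 / (s - 1/2)], [1 / (s / 2 + 1/4)], a power of [PI],
    [1 / ((s - 2) zeta (s + 1/2))], [Gamma (s / 2) / Gamma (s / 2 + 1/4)], the [1 / (s / 2 - j)] for [2 <= j <= 2 p + 1],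
    and [M v], the integral of [(1 - cos y) y^(- 2 v - 1)] over [y > 0].  Each factor is positive definite on the vertical
    line: [M v] because [1 - cos y >= 0]; the zeta factor because, for [Re s > 5/2], the coefficients of [1 / zeta] other
    than the first have absolute sum at most [1] and [(1 - exp (- u s)) / s] is the integral of [exp (- y s)] over
    [0 <= y <= u].  The bounded factor [1 / (s - 1/2)] makes [|phi t| < 1] for [t <> 0].

    [M v] is computed in terms of [Gamma] by approximating [cos] by Gegenbauer polynomials, whose truncated Mellin
    transforms are partial fraction expansions of Gauss's product.  For [x < -4] one needs the functional equation of
    [xi], up to a constant only; zeta is continued by integrals of [(y - j) (j + 1 - y) y^(- s - 2)] over [[j, j + 1]],
    and the Fourier series of [u (1 - u)] expresses the result through [M]. *)

(** * Convergence of complex sequences and series *)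


(** The obstacle is the factor [1 / Gamma (s / 2 + 1/4)] of [1 / n]: it is unbounded on vertical
    lines, hence cannot be positive definite alone. After reflection, [1 / sin] supplies
    [Gamma v * Gamma (1 - v)]. Multiplying and dividing by [Gamma (v + 1/2)], duplication turns
    [Gamma v * Gamma (v + 1/2)] into a shift of [Gamma (s / 2)], which outweighs the bad factor, and
    leaves [Gamma (1 - v) / Gamma (v + 1/2)], the transform [M]. Positive definiteness is taken as
    closure under approximation on finite sets, since every inequality drawn from it involves at
    most four points; products, limits and Riemann sums then pass through at once. The same closure,
    applied to polynomials with bounded weighted coefficient sums, replaces contour integration:
    such limits are stable under the operations needed and still have power series. As [zeta] is
    picked by [epsilon], only its two defining properties are available; to the left of the
    half-plane of convergence it is identified with an explicit continuation by uniqueness. *)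

Definition Ccv (u : nat -> C) (l : C) : Prop :=
  forall eps, 0 < eps -> exists N, forall k, (N <= k)%nat -> Cmod (u k - l) < eps.

Fixpoint csum (a : nat -> C) (k : nat) : C :=
  match k with O => RtoC 0 | S j => (csum a j + a j)%C end.

Fixpoint rsum (a : nat -> R) (k : nat) : R :=
  match k with O => 0 | S j => rsum a j + a j end.

(** A total sum, so that terms can be rewritten without carrying a limit; it is meaningful once the
    partial sums are known to converge, usually through a summable majorant. *)
Definition Cser (a : nat -> C) : C := Clim_seq (csum a).

Definition summable (b : nat -> R) : Prop := exists B, forall k, rsum b k <= B.

Lemma Cmod_sub_sym (a b : C) : Cmod (a - b)%C = Cmod (b - a)%C.
Proof.
  replace (a - b)%C with (- (b - a))%C by ring. apply Cmod_opp.
Qed.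

Lemma Cmod_RtoC_pos (r : R) : 0 <= r -> Cmod (RtoC r) = r.
Proof. intros H. rewrite Cmod_R. apply Rabs_pos_eq; auto. Qed.

Lemma Cmod_le_abs (z : C) : Cmod z <= Rabs (fst z) + Rabs (snd z).
Proof.
  destruct z as [x y]; simpl.
  replace ((x, y) : C) with (RtoC x + RtoC y * Ci)%C
    by (unfold RtoC, Ci, Cmult, Cplus; simpl; f_equal; ring).
  eapply Rle_trans. apply Cmod_triangle.
  rewrite Cmod_mult, !Cmod_R, Cmod_Ci. lra.
Qed.

Lemma Cmod_fst (z : C) : Rabs (fst z) <= Cmod z.
Proof. eapply Rle_trans; [apply Rmax_l|apply Rmax_Cmod]. Qed.
Lemma Cmod_snd (z : C) : Rabs (snd z) <= Cmod z.
Proof. eapply Rle_trans; [apply Rmax_r|apply Rmax_Cmod]. Qed.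

Lemma Cmod_triangle3 (a b c : C) : Cmod (a - c)%C <= Cmod (a - b)%C + Cmod (b - c)%C.
Proof.
  replace (a - c)%C with ((a - b) + (b - c))%C by ring. apply Cmod_triangle.
Qed.

Lemma Cmod_triangle_rev (a b : C) : Cmod a - Cmod b <= Cmod (a - b)%C.
Proof.
  assert (H := Cmod_triangle (a - b)%C b).
  replace (a - b + b)%C with a in H by ring. lra.
Qed.

Lemma Ccv_const (l : C) : Ccv (fun _ => l) l.
Proof.
  intros e He; exists O; intros. replace (l - l)%C with (RtoC 0) by ring.
  rewrite Cmod_0; auto.
Qed.

Lemma Ccv_eq (u : nat -> C) (l l' : C) : l = l' -> Ccv u l -> Ccv u l'.
Proof. intros <-; auto. Qed.

Lemma Ccv_ext_loc (u v : nat -> C) (l : C) :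
  (exists N, forall k, (N <= k)%nat -> u k = v k) -> Ccv u l -> Ccv v l.
Proof.
  intros [N0 H] Hu e He. destruct (Hu e He) as [N HN].
  exists (max N0 N); intros k Hk. rewrite <- H by lia. apply HN; lia.
Qed.

Lemma Ccv_ext (u v : nat -> C) (l : C) : (forall k, u k = v k) -> Ccv u l -> Ccv v l.
Proof. intros H; apply Ccv_ext_loc; exists O; auto. Qed.

Lemma Ccv_dom (u : nat -> C) (l : C) (b : nat -> R) :
  (exists N, forall k, (N <= k)%nat -> Cmod (u k - l) <= b k) ->
  is_lim_seq b 0 -> Ccv u l.
Proof.
  intros [N0 H] Hb e He. apply is_lim_seq_spec in Hb.
  destruct (Hb (mkposreal e He)) as [N HN]; simpl in HN.
  exists (max N0 N); intros k Hk.
  eapply Rle_lt_trans; [apply H; lia|].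
  specialize (HN k ltac:(lia)). apply Rabs_def2 in HN. lra.
Qed.

Lemma Ccv_plus (u v : nat -> C) (l l' : C) :
  Ccv u l -> Ccv v l' -> Ccv (fun k => u k + v k)%C (l + l')%C.
Proof.
  intros Hu Hv e He.
  destruct (Hu (e/2)) as [N1 H1]; [lra|]. destruct (Hv (e/2)) as [N2 H2]; [lra|].
  exists (max N1 N2); intros k Hk.
  replace (u k + v k - (l + l'))%C with ((u k - l) + (v k - l'))%C by ring.
  eapply Rle_lt_trans; [apply Cmod_triangle|].
  specialize (H1 k ltac:(lia)); specialize (H2 k ltac:(lia)). lra.
Qed.

Lemma Ccv_mult (u v : nat -> C) (l l' : C) :
  Ccv u l -> Ccv v l' -> Ccv (fun k => u k * v k)%C (l * l')%C.
Proof.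
  intros Hu Hv e He.
  set (B := Cmod l + Cmod l' + 1).
  assert (HB : 1 <= B) by (unfold B; generalize (Cmod_ge_0 l) (Cmod_ge_0 l'); lra).
  (* The cap at 1 makes the product of the two errors linear in [d0]; each of the three error terms
     is then at most [e / 3], and [B] exceeds the sum of the moduli of the limits by 1, which gives
     strictness. *)
  set (d0 := Rmin 1 (e / (3 * B))).
  assert (Hd : 0 < d0).
  { unfold d0; apply Rmin_glb_lt; [lra|]. apply Rdiv_lt_0_compat; lra. }
  destruct (Hu d0 Hd) as [N1 H1]. destruct (Hv d0 Hd) as [N2 H2].
  exists (max N1 N2); intros k Hk.
  specialize (H1 k ltac:(lia)); specialize (H2 k ltac:(lia)).
  replace (u k * v k - l * l')%C
    with ((u k - l) * (v k - l') + l * (v k - l') + (u k - l) * l')%C by ring.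
  eapply Rle_lt_trans; [eapply Rle_trans; [apply Cmod_triangle|
     apply Rplus_le_compat_r, Cmod_triangle]|].
  rewrite !Cmod_mult.
  assert (Hd1 : d0 <= 1) by apply Rmin_l.
  assert (Hd2 : d0 * B <= e / 3).
  { apply Rle_trans with (e / (3 * B) * B).
    apply Rmult_le_compat_r; [lra|apply Rmin_r]. apply Req_le; field; lra. }
  generalize (Cmod_ge_0 (u k - l)) (Cmod_ge_0 (v k - l')) (Cmod_ge_0 l) (Cmod_ge_0 l').
  intros.
  set (a := Cmod (u k - l)) in *. set (b := Cmod (v k - l')) in *.
  assert (a * b <= d0 * 1) by (apply Rmult_le_compat; lra).
  assert (Cmod l * b <= Cmod l * d0) by (apply Rmult_le_compat_l; lra).
  assert (a * Cmod l' <= d0 * Cmod l') by (apply Rmult_le_compat_r; lra).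
  unfold B in Hd2. nra.
Qed.

Lemma Ccv_scal (c : C) (u : nat -> C) (l : C) : Ccv u l -> Ccv (fun k => c * u k)%C (c * l)%C.
Proof. intros H; apply Ccv_mult; [apply Ccv_const|auto]. Qed.

Lemma Ccv_opp (u : nat -> C) (l : C) : Ccv u l -> Ccv (fun k => - u k)%C (- l)%C.
Proof.
  intros H e He. destruct (H e He) as [N HN]. exists N; intros k Hk.
  replace (- u k - - l)%C with (- (u k - l))%C by ring. rewrite Cmod_opp; auto.
Qed.

Lemma Ccv_minus (u v : nat -> C) (l l' : C) :
  Ccv u l -> Ccv v l' -> Ccv (fun k => u k - v k)%C (l - l')%C.
Proof. intros; apply Ccv_plus; auto; apply Ccv_opp; auto. Qed.

Lemma Ccv_inv (u : nat -> C) (l : C) : l <> RtoC 0 -> Ccv u l -> Ccv (fun k => / u k)%C (/ l)%C.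
Proof.
  intros Hl Hu e He.
  assert (Hm : 0 < Cmod l) by (apply Cmod_gt_0; auto).
  (* The first bound keeps [u k] at modulus at least [Cmod l / 2], so the denominator [u k * l] is
     at least half of [Cmod l] squared. *)
  set (d0 := Rmin (Cmod l / 2) (e * (Cmod l * Cmod l) / 4)).
  assert (Hd : 0 < d0).
  { apply Rmin_glb_lt; [lra|].
    apply Rdiv_lt_0_compat; [|lra]. apply Rmult_lt_0_compat; nra. }
  destruct (Hu d0 Hd) as [N HN]. exists N; intros k Hk. specialize (HN k Hk).
  assert (H1 : d0 <= Cmod l / 2) by apply Rmin_l.
  assert (H2 : d0 <= e * (Cmod l * Cmod l) / 4) by apply Rmin_r.
  assert (H3 : Cmod l / 2 <= Cmod (u k)).
  { assert (H := Cmod_triangle_rev l (l - u k)%C).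
    replace (l - (l - u k))%C with (u k) in H by ring.
    rewrite (Cmod_sub_sym l) in H. lra. }
  assert (Hk0 : u k <> RtoC 0) by (apply Cmod_gt_0; lra).
  replace (/ u k - / l)%C with (- ((u k - l) / (u k * l)))%C by (field; auto).
  rewrite Cmod_opp, Cmod_div by (apply Cmult_neq_0; auto). rewrite Cmod_mult.
  apply Rlt_div_l. nra.
  apply Rlt_le_trans with d0; [auto|].
  eapply Rle_trans; [apply H2|].
  assert (e * (Cmod l / 2 * Cmod l) <= e * (Cmod (u k) * Cmod l)).
  { apply Rmult_le_compat_l; [lra|]. apply Rmult_le_compat_r; lra. }
  nra.
Qed.

Lemma Ccv_div (u v : nat -> C) (l l' : C) : l' <> RtoC 0 ->
  Ccv u l -> Ccv v l' -> Ccv (fun k => u k / v k)%C (l / l')%C.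
Proof. intros; apply Ccv_mult; auto; apply Ccv_inv; auto. Qed.

Lemma Ccv_unique (u : nat -> C) (l l' : C) : Ccv u l -> Ccv u l' -> l = l'.
Proof.
  intros H H'. destruct (Ceq_dec l l') as [|Hn]; auto. exfalso.
  assert (Hp : 0 < Cmod (l - l')) by (apply Cmod_gt_0; apply Cminus_eq_contra; auto).
  destruct (H (Cmod (l - l') / 2)) as [N1 H1]; [lra|].
  destruct (H' (Cmod (l - l') / 2)) as [N2 H2]; [lra|].
  specialize (H1 (max N1 N2) ltac:(lia)); specialize (H2 (max N1 N2) ltac:(lia)).
  assert (Ht := Cmod_triangle3 l (u (max N1 N2)) l').
  rewrite (Cmod_sub_sym l (u _)) in Ht. lra.
Qed.

Lemma Ccv_bound (u : nat -> C) (l : C) (B : R) :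
  (exists N, forall k, (N <= k)%nat -> Cmod (u k) <= B) -> Ccv u l -> Cmod l <= B.
Proof.
  intros [N0 H] Hu. apply le_epsilon; intros e He.
  destruct (Hu e He) as [N HN].
  specialize (H (max N0 N) ltac:(lia)); specialize (HN (max N0 N) ltac:(lia)).
  rewrite Cmod_sub_sym in HN. assert (Ht := Cmod_triangle_rev l (u (max N0 N))). lra.
Qed.

Lemma Ccv_subseq (f : nat -> nat) (u : nat -> C) (l : C) :
  (forall k, (k <= f k)%nat) -> Ccv u l -> Ccv (fun k => u (f k)) l.
Proof.
  intros Hf Hu e He. destruct (Hu e He) as [N HN]. exists N; intros k Hk.
  apply HN. specialize (Hf k). lia.
Qed.

Lemma Ccv_unshift (u : nat -> C) (l : C) : Ccv (fun k => u (S k)) l -> Ccv u l.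
Proof.
  intros Hu e He. destruct (Hu e He) as [N HN]. exists (S N); intros k Hk.
  destruct k; [lia|]. apply HN; lia.
Qed.

Lemma Ccv_RtoC (u : nat -> R) (l : R) : is_lim_seq u l -> Ccv (fun k => RtoC (u k)) (RtoC l).
Proof.
  intros H e He. apply is_lim_seq_spec in H. destruct (H (mkposreal e He)) as [N HN].
  exists N; intros k Hk. rewrite <- RtoC_minus, Cmod_R. apply HN; auto.
Qed.

Lemma Ccv_fst (u : nat -> C) (l : C) : Ccv u l -> is_lim_seq (fun k => fst (u k)) (fst l).
Proof.
  intros H. apply is_lim_seq_spec. intros e. destruct (H e (cond_pos e)) as [N HN].
  exists N; intros k Hk. specialize (HN k Hk).
  eapply Rle_lt_trans; [|apply HN]. apply (Cmod_fst (u k - l)%C).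
Qed.

Lemma Ccv_snd (u : nat -> C) (l : C) : Ccv u l -> is_lim_seq (fun k => snd (u k)) (snd l).
Proof.
  intros H. apply is_lim_seq_spec. intros e. destruct (H e (cond_pos e)) as [N HN].
  exists N; intros k Hk. specialize (HN k Hk).
  eapply Rle_lt_trans; [|apply HN]. apply (Cmod_snd (u k - l)%C).
Qed.

Lemma Ccv_pair (u : nat -> C) (l : C) :
  is_lim_seq (fun k => fst (u k)) (fst l) -> is_lim_seq (fun k => snd (u k)) (snd l) -> Ccv u l.
Proof.
  intros H1 H2 e He. apply is_lim_seq_spec in H1. apply is_lim_seq_spec in H2.
  destruct (H1 (mkposreal (e/2) ltac:(lra))) as [N1 HN1].
  destruct (H2 (mkposreal (e/2) ltac:(lra))) as [N2 HN2]. simpl in *.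
  exists (max N1 N2); intros k Hk.
  specialize (HN1 k ltac:(lia)); specialize (HN2 k ltac:(lia)).
  eapply Rle_lt_trans; [apply Cmod_le_abs|]. simpl.
  unfold Rminus in *. lra.
Qed.

Lemma Ccv_Clim_seq (u : nat -> C) (l : C) : Ccv u l -> Clim_seq u = l.
Proof.
  intros H. unfold Clim_seq.
  rewrite (is_lim_seq_unique (fun k => Re (u k)) _ (Ccv_fst _ _ H)), (is_lim_seq_unique (fun k => Im (u k)) _ (Ccv_snd _ _ H)).
  destruct l; reflexivity.
Qed.

Lemma Ccv_Cmod (u : nat -> C) (l : C) : Ccv u l -> is_lim_seq (fun k => Cmod (u k)) (Cmod l).
Proof.
  intros H. apply is_lim_seq_spec. intros e. destruct (H e (cond_pos e)) as [N HN].
  exists N; intros k Hk. specialize (HN k Hk).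
  assert (H1 := Cmod_triangle_rev (u k) l). assert (H2 := Cmod_triangle_rev l (u k)).
  rewrite Cmod_sub_sym in H2. apply Rabs_def1; lra.
Qed.

Lemma Ccv_complete (u : nat -> C) :
  (forall eps, 0 < eps -> exists N, forall k, (N <= k)%nat -> Cmod (u k - u N) <= eps) ->
  exists l, Ccv u l.
Proof.
  intros H.
  assert (Hc : forall f : C -> R, (forall a b, Rabs (f a - f b) <= Cmod (a - b)%C) ->
     ex_finite_lim_seq (fun k => f (u k))).
  { intros f Hf. apply ex_lim_seq_cauchy_corr. intros e.
    destruct (H (e/3)) as [N HN]. destruct e; simpl; lra.
    exists N. intros p q Hp Hq.
    eapply Rle_lt_trans; [apply Hf|].
    eapply Rle_lt_trans; [apply (Cmod_triangle3 _ (u N))|].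
    rewrite (Cmod_sub_sym (u N)). assert (H1 := HN p Hp). assert (H2 := HN q Hq).
    destruct e; simpl in *; lra. }
  destruct (Hc fst) as [l1 H1].
  { intros a b. apply (Cmod_fst (a - b)%C). }
  destruct (Hc snd) as [l2 H2].
  { intros a b. apply (Cmod_snd (a - b)%C). }
  exists (l1, l2). apply Ccv_pair; auto.
Qed.

(** * Finite sums, absolutely convergent series and dominated convergence *)

Lemma rsum_ext (a b : nat -> R) k : (forall j, (j < k)%nat -> a j = b j) -> rsum a k = rsum b k.
Proof. induction k; intros H; simpl; auto. rewrite IHk, H by (intros; auto; apply H; lia); auto. Qed.

Lemma csum_ext (a b : nat -> C) k : (forall j, (j < k)%nat -> a j = b j) -> csum a k = csum b k.
Proof. induction k; intros H; simpl; auto. rewrite IHk, H by (intros; auto; apply H; lia); auto. Qed.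

Lemma csum_plus (a b : nat -> C) k : csum (fun j => a j + b j)%C k = (csum a k + csum b k)%C.
Proof. induction k; simpl. ring. rewrite IHk; ring. Qed.

Lemma csum_scal (c : C) (a : nat -> C) k : csum (fun j => c * a j)%C k = (c * csum a k)%C.
Proof. induction k; simpl. ring. rewrite IHk; ring. Qed.

Lemma csum_minus (a b : nat -> C) k : csum (fun j => a j - b j)%C k = (csum a k - csum b k)%C.
Proof. induction k; simpl. ring. rewrite IHk; ring. Qed.

Lemma rsum_scal (c : R) (a : nat -> R) k : rsum (fun j => c * a j) k = c * rsum a k.
Proof. induction k; simpl. ring. rewrite IHk; ring. Qed.

Lemma rsum_plus (a b : nat -> R) k : rsum (fun j => a j + b j) k = rsum a k + rsum b k.
Proof. induction k; simpl. ring. rewrite IHk; ring. Qed.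

Lemma rsum_pos (a : nat -> R) k : (forall j, 0 <= a j) -> 0 <= rsum a k.
Proof. intros H; induction k; simpl. lra. specialize (H k); lra. Qed.

Lemma rsum_incr (a : nat -> R) j k : (forall i, 0 <= a i) -> (j <= k)%nat -> rsum a j <= rsum a k.
Proof.
  intros H Hjk. induction Hjk. lra. simpl. specialize (H m). lra.
Qed.

Lemma csum_Cmod (a : nat -> C) (b : nat -> R) k :
  (forall j, (j < k)%nat -> Cmod (a j) <= b j) -> Cmod (csum a k) <= rsum b k.
Proof.
  induction k; intros H; simpl. rewrite Cmod_0; lra.
  eapply Rle_trans; [apply Cmod_triangle|].
  apply Rplus_le_compat; [apply IHk; intros; apply H; lia|apply H; lia].
Qed.

Lemma csum_diff (a : nat -> C) (b : nat -> R) j k :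
  (forall i, (j <= i)%nat -> Cmod (a i) <= b i) -> (j <= k)%nat ->
  Cmod (csum a k - csum a j) <= rsum b k - rsum b j.
Proof.
  intros H Hjk. induction Hjk.
  replace (csum a j - csum a j)%C with (RtoC 0) by ring. rewrite Cmod_0; lra.
  simpl. replace (csum a m + a m - csum a j)%C with ((csum a m - csum a j) + a m)%C by ring.
  eapply Rle_trans; [apply Cmod_triangle|]. specialize (H m Hjk). lra.
Qed.

(** The partial sums increase to their supremum [s], and any index with [s - e < rsum b N]
    serves. *)
Lemma summable_tail (b : nat -> R) : (forall k, 0 <= b k) -> summable b ->
  forall eps, 0 < eps -> exists N, forall k, (N <= k)%nat -> rsum b k - rsum b N <= eps.
Proof.
  intros Hb [B HB] e He.
  destruct (completeness (fun x => exists k, x = rsum b k)) as [s [Hs1 Hs2]].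
  { exists B. intros x [k ->]; auto. }
  { exists (rsum b 0), O; auto. }
  destruct (Classical_Prop.classic (exists N, s - e < rsum b N)) as [[N HN]|Hn].
  - exists N. intros k Hk. assert (rsum b k <= s) by (apply Hs1; eauto). lra.
  - exfalso. assert (s <= s - e); [|lra]. apply Hs2. intros x [k ->].
    apply Rnot_lt_le. intros Hc. apply Hn; eauto.
Qed.

Lemma summable_scal (c : R) (b : nat -> R) : 0 <= c -> summable b -> summable (fun k => c * b k).
Proof.
  intros Hc [B HB]. exists (c * B). intros k. rewrite rsum_scal. apply Rmult_le_compat_l; auto.
Qed.

Lemma csum_cv (a : nat -> C) (b : nat -> R) :
  (forall k, Cmod (a k) <= b k) -> summable b -> Ccv (csum a) (Cser a).
Proof.
  intros Ha Hb.
  assert (Hp : forall k, 0 <= b k) by (intros; eapply Rle_trans; [apply Cmod_ge_0|apply Ha]).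
  destruct (Ccv_complete (csum a)) as [l Hl].
  { intros e He. destruct (summable_tail b Hp Hb e He) as [N HN].
    exists N. intros k Hk. eapply Rle_trans; [apply (csum_diff a b); auto|auto]. }
  unfold Cser. rewrite (Ccv_Clim_seq _ _ Hl). auto.
Qed.

Lemma Cser_unique (a : nat -> C) (l : C) : Ccv (csum a) l -> Cser a = l.
Proof. apply Ccv_Clim_seq. Qed.

Lemma Cser_ext (a b : nat -> C) : (forall k, a k = b k) -> Cser a = Cser b.
Proof.
  intros H. unfold Cser, Clim_seq.
  f_equal; f_equal; apply Lim_seq_ext; intros k; rewrite (csum_ext a b); auto.
Qed.

Lemma Cser_tail (a : nat -> C) (b : nat -> R) N e :
  (forall k, Cmod (a k) <= b k) -> summable b ->
  (forall k, (N <= k)%nat -> rsum b k - rsum b N <= e) -> Cmod (Cser a - csum a N) <= e.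
Proof.
  intros Ha Hb HN. apply (Ccv_bound (fun k => csum a k - csum a N)%C).
  - exists N. intros k Hk. eapply Rle_trans; [apply (csum_diff a b); auto|auto].
  - apply Ccv_minus; [apply csum_cv with b; auto|apply Ccv_const].
Qed.

Lemma csum_Ccv (u : nat -> nat -> C) (v : nat -> C) N :
  (forall j, Ccv (fun k => u k j) (v j)) -> Ccv (fun k => csum (u k) N) (csum v N).
Proof.
  intros H; induction N; simpl. apply Ccv_const. apply Ccv_plus; auto.
Qed.

(** Dominated convergence for series: the common majorant makes both tails beyond some [N] small,
    uniformly in [k], and the head is a finite sum of convergent terms. *)
Lemma tannery (u : nat -> nat -> C) (v : nat -> C) (b : nat -> R) :
  (exists K, forall k j, (K <= k)%nat -> Cmod (u k j) <= b j) -> summable b ->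
  (forall j, Ccv (fun k => u k j) (v j)) ->
  Ccv (fun k => Cser (u k)) (Cser v).
Proof.
  intros [K Hu] Hb Hv.
  assert (Hbp : forall j, 0 <= b j).
  { intros j; eapply Rle_trans; [apply Cmod_ge_0|apply (Hu K j); lia]. }
  assert (Hvb : forall j, Cmod (v j) <= b j).
  { intros j. apply (Ccv_bound (fun k => u k j)); auto. exists K; auto. }
  intros e He.
  destruct (summable_tail b Hbp Hb (e/4)) as [N HN]; [lra|].
  destruct (csum_Ccv u v N Hv (e/4)) as [N1 H1]; [lra|].
  exists (max K N1). intros k Hk. specialize (H1 k ltac:(lia)).
  assert (T1 := Cser_tail (u k) b N (e/4) (fun j => Hu k j ltac:(lia)) Hb HN).
  assert (T2 := Cser_tail v b N (e/4) Hvb Hb HN).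
  rewrite Cmod_sub_sym in T2.
  replace (Cser (u k) - Cser v)%C with
   ((Cser (u k) - csum (u k) N) + (csum (u k) N - csum v N) + (csum v N - Cser v))%C by ring.
  eapply Rle_lt_trans; [eapply Rle_trans; [apply Cmod_triangle|
     apply Rplus_le_compat_r, Cmod_triangle]|]. lra.
Qed.

Lemma Cser_fin (a : nat -> C) N : (forall k, (N <= k)%nat -> a k = RtoC 0) -> Cser a = csum a N.
Proof.
  intros H. apply Cser_unique. apply Ccv_ext_loc with (fun _ => csum a N); [|apply Ccv_const].
  exists N. intros k Hk. induction Hk; auto. simpl. rewrite <- IHHk, H by auto. ring.
Qed.

Lemma Cser_scal (c : C) (a : nat -> C) (b : nat -> R) :
  (forall k, Cmod (a k) <= b k) -> summable b -> Cser (fun k => c * a k)%C = (c * Cser a)%C.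
Proof.
  intros Ha Hb. apply Cser_unique. apply Ccv_ext with (fun k => c * csum a k)%C.
  intros k; rewrite csum_scal; auto. apply Ccv_scal. apply csum_cv with b; auto.
Qed.

Lemma is_series_Ccv (a : nat -> C) (l : C) :
  is_series (K := C_AbsRing) (V := C_NormedModule) a l <-> Ccv (csum a) l.
Proof.
  (* [sum_n] includes its upper index while [csum] stops before it, hence the shift by one. *)
  assert (Hs : forall k, @sum_n C_AbelianMonoid a k = csum a (S k)).
  { induction k. rewrite sum_O; simpl. ring. rewrite sum_Sn, IHk. reflexivity. }
  unfold is_series. split; intros H.
  - apply Ccv_unshift. intros e He.
    assert (He' : 0 < e / 2) by lra.
    assert (H1 := proj1 (filterlim_locally_ball_norm (K:=C_AbsRing) (U:=C_NormedModule) _ _) H (mkposreal e He)).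
    destruct H1 as [N HN]. exists N. intros k Hk. specialize (HN k Hk).
    unfold ball_norm in HN. rewrite <- Hs. exact HN.
  - apply (proj2 (filterlim_locally_ball_norm (K:=C_AbsRing) (U:=C_NormedModule) _ _)).
    intros e. destruct (H e (cond_pos e)) as [N HN].
    exists N. intros k Hk. unfold ball_norm. rewrite Hs. apply (HN (S k)). lia.
Qed.

(** * Complex functions of a real variable *)

Definition cder (f : R -> C) (t : R) (l : C) : Prop :=
  is_derive (fun u => fst (f u)) t (fst l) /\ is_derive (fun u => snd (f u)) t (snd l).

Definition ccont (f : R -> C) (t : R) : Prop :=
  continuous (fun u => fst (f u)) t /\ continuous (fun u => snd (f u)) t.

Definition cint (f : R -> C) (a b : R) (l : C) : Prop :=
  is_RInt (fun u => fst (f u)) a b (fst l) /\ is_RInt (fun u => snd (f u)) a b (snd l).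

Definition CInt (f : R -> C) (a b : R) : C :=
  (RInt (fun u => fst (f u)) a b, RInt (fun u => snd (f u)) a b).

Lemma cder_ext f g t l : (forall u, f u = g u) -> cder f t l -> cder g t l.
Proof.
  intros H [H1 H2]; split; eapply is_derive_ext; try eassumption; intros; simpl; rewrite H; auto.
Qed.

Lemma cder_const c t : cder (fun _ => c) t (RtoC 0).
Proof. split; apply (is_derive_const (K:=R_AbsRing) (V:=R_NormedModule)). Qed.

Lemma cder_plus f g t l k : cder f t l -> cder g t k -> cder (fun u => f u + g u)%C t (l + k)%C.
Proof.
  intros [H1 H2] [K1 K2]; split; simpl;
  apply (is_derive_plus (K:=R_AbsRing) (V:=R_NormedModule)); auto.
Qed.

Lemma is_derive_mul_R (f g : R -> R) t l k :
  is_derive f t l -> is_derive g t k -> is_derive (fun u => f u * g u) t (l * g t + f t * k).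
Proof.
  intros Hf Hg. apply (is_derive_mult f g t l k Hf Hg). intros; apply Rmult_comm.
Qed.

Lemma cder_mult f g t l k : cder f t l -> cder g t k ->
  cder (fun u => f u * g u)%C t (l * g t + f t * k)%C.
Proof.
  intros [H1 H2] [K1 K2]; split; simpl.
  - evar_last. apply (is_derive_minus (K:=R_AbsRing) (V:=R_NormedModule));
      apply is_derive_mul_R; eassumption.
    unfold minus, plus, opp; simpl; ring.
  - evar_last. apply (is_derive_plus (K:=R_AbsRing) (V:=R_NormedModule));
      apply is_derive_mul_R; eassumption.
    unfold minus, plus, opp; simpl; ring.
Qed.

Lemma cder_scal c f t l : cder f t l -> cder (fun u => c * f u)%C t (c * l)%C.
Proof.
  intros H. assert (H1 := cder_mult _ _ t _ _ (cder_const c t) H). simpl in H1.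
  replace (c * l)%C with (RtoC 0 * f t + c * l)%C by ring. exact H1.
Qed.

Lemma cder_minus f g t l k : cder f t l -> cder g t k -> cder (fun u => f u - g u)%C t (l - k)%C.
Proof.
  intros [H1 H2] [K1 K2]; split; simpl;
  apply (is_derive_minus (K:=R_AbsRing) (V:=R_NormedModule)); auto.
Qed.

Lemma cder_RtoC (f : R -> R) t l : is_derive f t l -> cder (fun u => RtoC (f u)) t (RtoC l).
Proof. intros H; split; simpl; auto. apply (is_derive_const (K:=R_AbsRing) (V:=R_NormedModule)). Qed.

Lemma cder_csum (f : nat -> R -> C) (l : nat -> C) k t :
  (forall j, (j < k)%nat -> cder (f j) t (l j)) -> cder (fun u => csum (fun j => f j u) k) t (csum l k).
Proof.
  induction k; intros H; simpl. apply cder_const.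
  apply cder_plus. apply IHk; intros; apply H; lia. apply H; lia.
Qed.

Lemma cder_ccont f t l : cder f t l -> ccont f t.
Proof.
  intros [H1 H2]; split; apply (ex_derive_continuous (K:=R_AbsRing) (V:=R_NormedModule)); eexists; eassumption.
Qed.

Lemma ccont_const c t : ccont (fun _ => c) t.
Proof. eapply cder_ccont, cder_const. Qed.

Lemma ccont_minus f g t : ccont f t -> ccont g t -> ccont (fun u => f u - g u)%C t.
Proof.
  intros [H1 H2] [K1 K2]; split; simpl; apply (continuous_minus (K:=R_AbsRing) (V:=R_NormedModule)); auto.
Qed.

Lemma ccont_mult f g t : ccont f t -> ccont g t -> ccont (fun u => f u * g u)%C t.
Proof.
  intros [H1 H2] [K1 K2]; split; simpl.
  - apply (continuous_minus (K:=R_AbsRing) (V:=R_NormedModule)); apply (continuous_mult (K:=R_AbsRing)); auto.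
  - apply (continuous_plus (K:=R_AbsRing) (V:=R_NormedModule)); apply (continuous_mult (K:=R_AbsRing)); auto.
Qed.

Lemma ccont_RtoC (f : R -> R) t : continuous f t -> ccont (fun u => RtoC (f u)) t.
Proof. intros H; split; simpl; auto. apply continuous_const. Qed.

Lemma CInt_correct f a b : a <= b -> (forall t, a <= t <= b -> ccont f t) -> cint f a b (CInt f a b).
Proof.
  intros Hab H. split; simpl; apply (RInt_correct (V:=R_CompleteNormedModule));
  apply (ex_RInt_continuous (V:=R_CompleteNormedModule));
  rewrite Rmin_left, Rmax_right by auto; intros t Ht; apply H; auto.
Qed.

Lemma cint_unique f a b l : cint f a b l -> CInt f a b = l.
Proof.
  intros [H1 H2]. unfold CInt. rewrite (is_RInt_unique _ _ _ _ H1), (is_RInt_unique _ _ _ _ H2).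
  destruct l; auto.
Qed.

Lemma cint_ext f g a b l : a <= b -> (forall t, a < t < b -> f t = g t) -> cint f a b l -> cint g a b l.
Proof.
  intros Hab H [H1 H2]; split; eapply is_RInt_ext; try eassumption;
  rewrite Rmin_left, Rmax_right by auto; intros t Ht; simpl; rewrite H; auto.
Qed.

Lemma cint_plus f g a b l k : cint f a b l -> cint g a b k -> cint (fun u => f u + g u)%C a b (l + k)%C.
Proof.
  intros [H1 H2] [K1 K2]; split; simpl; apply (is_RInt_plus (V:=R_NormedModule)); auto.
Qed.

Lemma cint_minus f g a b l k : cint f a b l -> cint g a b k -> cint (fun u => f u - g u)%C a b (l - k)%C.
Proof.
  intros [H1 H2] [K1 K2]; split; simpl; apply (is_RInt_minus (V:=R_NormedModule)); auto.
Qed.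

Lemma cint_scal c f a b l : cint f a b l -> cint (fun u => c * f u)%C a b (c * l)%C.
Proof.
  intros [H1 H2]; split; simpl.
  - apply (is_RInt_minus (V:=R_NormedModule)); apply (is_RInt_scal (V:=R_NormedModule)); auto.
  - apply (is_RInt_plus (V:=R_NormedModule)); apply (is_RInt_scal (V:=R_NormedModule)); auto.
Qed.

Lemma cint_csum (f : nat -> R -> C) (l : nat -> C) k a b :
  (forall j, (j < k)%nat -> cint (f j) a b (l j)) -> cint (fun u => csum (fun j => f j u) k) a b (csum l k).
Proof.
  induction k; intros H; simpl.
  - split; simpl; evar_last; try apply (is_RInt_const (V:=R_NormedModule));
    unfold scal; simpl; unfold mult; simpl; ring.
  - apply cint_plus. apply IHk; intros; apply H; lia. apply H; lia.
Qed.

Lemma cint_Chasles f a b c l k : cint f a b l -> cint f b c k -> cint f a c (l + k)%C.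
Proof.
  intros [H1 H2] [K1 K2]; split; simpl; eapply (is_RInt_Chasles (V:=R_NormedModule)); eauto.
Qed.

Lemma cint_FTC f g a b : a <= b -> (forall t, a <= t <= b -> cder f t (g t)) ->
  (forall t, a <= t <= b -> ccont g t) -> cint g a b (f b - f a)%C.
Proof.
  intros Hab Hd Hc. split; simpl.
  - apply (is_RInt_derive (V:=R_CompleteNormedModule) (fun u => fst (f u)) (fun u => fst (g u)));
    rewrite Rmin_left, Rmax_right by auto; intros t Ht; [apply Hd|apply Hc]; auto.
  - apply (is_RInt_derive (V:=R_CompleteNormedModule) (fun u => snd (f u)) (fun u => snd (g u)));
    rewrite Rmin_left, Rmax_right by auto; intros t Ht; [apply Hd|apply Hc]; auto.
Qed.

(** The factor 2 comes from estimating real and imaginary parts separately. Later estimates are only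
    needed up to constants and absorb it. *)
Lemma cint_bound f (g : R -> R) a b l L : a <= b ->
  (forall t, a <= t <= b -> Cmod (f t) <= g t) -> cint f a b l -> is_RInt g a b L -> Cmod l <= 2 * L.
Proof.
  intros Hab H [H1 H2] HL.
  eapply Rle_trans; [apply Cmod_le_abs|].
  assert (Rabs (fst l) <= L).
  { apply (norm_RInt_le (V:=R_NormedModule) (fun u => fst (f u)) g a b); auto.
    intros t Ht. eapply Rle_trans; [apply Cmod_fst|auto]. }
  assert (Rabs (snd l) <= L).
  { apply (norm_RInt_le (V:=R_NormedModule) (fun u => snd (f u)) g a b); auto.
    intros t Ht. eapply Rle_trans; [apply Cmod_snd|auto]. }
  lra.
Qed.

Lemma cint_bound_const f a b l B : a <= b ->
  (forall t, a <= t <= b -> Cmod (f t) <= B) -> cint f a b l -> Cmod l <= 2 * (B * (b - a)).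
Proof.
  intros Hab H Hl. apply (cint_bound f (fun _ => B) a b); auto.
  evar_last. apply (is_RInt_const (V:=R_NormedModule)). unfold scal; simpl; unfold mult; simpl; ring.
Qed.

(** * The complex exponential along a real variable *)

Lemma Cexp_plus (z w : C) : Cexp (z + w)%C = (Cexp z * Cexp w)%C.
Proof.
  destruct z as [a b], w as [c d]. unfold Cexp, Cmult, Cplus, RtoC, Re, Im; simpl.
  rewrite exp_plus, cos_plus, sin_plus. f_equal; ring.
Qed.

Lemma Cexp_0 : Cexp (RtoC 0) = RtoC 1.
Proof. unfold Cexp, Cmult, RtoC, Re, Im; simpl. rewrite exp_0, cos_0, sin_0. f_equal; ring. Qed.

Lemma Cexp_RtoC (r : R) : Cexp (RtoC r) = RtoC (exp r).
Proof. unfold Cexp, Cmult, RtoC, Re, Im; simpl. rewrite cos_0, sin_0. f_equal; ring. Qed.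

Lemma Cexp_Ci (r : R) : Cexp (Ci * RtoC r)%C = (cos r, sin r).
Proof.
  unfold Cexp, Cmult, Ci, RtoC, Re, Im; simpl.
  replace (0 * r - 1 * 0) with 0 by ring. replace (0 * 0 + 1 * r) with r by ring.
  rewrite exp_0. f_equal; ring.
Qed.

Lemma Cmod_cs (r : R) : Cmod (cos r, sin r) = 1.
Proof.
  unfold Cmod, fst, snd. replace (cos r ^ 2 + sin r ^ 2) with 1. apply sqrt_1.
  generalize (sin2_cos2 r); unfold Rsqr; lra.
Qed.

Lemma Cmod_Cexp (z : C) : Cmod (Cexp z) = exp (fst z).
Proof.
  unfold Cexp. rewrite Cmod_mult, Cmod_cs, Cmod_RtoC_pos by (left; apply exp_pos).
  unfold Re; ring.
Qed.

Lemma Cexp_neq0 z : Cexp z <> RtoC 0.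
Proof. apply Cmod_gt_0. rewrite Cmod_Cexp. apply exp_pos. Qed.

Lemma Cexp_opp z : Cexp (- z)%C = (/ Cexp z)%C.
Proof.
  assert (H : (Cexp (- z) * Cexp z)%C = RtoC 1).
  { rewrite <- Cexp_plus. replace (- z + z)%C with (RtoC 0) by ring. apply Cexp_0. }
  replace (/ Cexp z)%C with ((Cexp (- z) * Cexp z) * / Cexp z)%C by (rewrite H; ring).
  field. apply Cexp_neq0.
Qed.

Lemma Cexp_conj z : Cconj (Cexp z) = Cexp (Cconj z).
Proof.
  destruct z as [a b]. unfold Cexp, Cconj, Cmult, RtoC, Re, Im; simpl. rewrite cos_neg, sin_neg. f_equal; ring.
Qed.

Lemma cder_Cexp (f : R -> C) t l : cder f t l -> cder (fun u => Cexp (f u)) t (l * Cexp (f t))%C.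
Proof.
  intros [H1 H2]. unfold Cexp, Re, Im. split; simpl.
  - evar_last.
    { apply (is_derive_minus (K:=R_AbsRing) (V:=R_NormedModule)).
      - apply is_derive_mul_R.
        apply (is_derive_comp exp); [apply is_derive_exp|exact H1].
        apply (is_derive_comp cos); [apply is_derive_cos|exact H2].
      - apply is_derive_mul_R. apply (is_derive_const (K:=R_AbsRing) (V:=R_NormedModule)).
        apply (is_derive_comp sin); [apply is_derive_sin|exact H2]. }
    unfold minus, plus, opp, scal, zero; simpl; unfold mult; simpl. ring.
  - evar_last.
    { apply (is_derive_plus (K:=R_AbsRing) (V:=R_NormedModule)).
      - apply is_derive_mul_R.
        apply (is_derive_comp exp); [apply is_derive_exp|exact H1].
        apply (is_derive_comp sin); [apply is_derive_sin|exact H2].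
      - apply is_derive_mul_R. apply (is_derive_const (K:=R_AbsRing) (V:=R_NormedModule)).
        apply (is_derive_comp cos); [apply is_derive_cos|exact H2]. }
    unfold minus, plus, opp, scal, zero; simpl; unfold mult; simpl. ring.
Qed.

Lemma cder_Cexp_lin (a : C) t : cder (fun u => Cexp (a * RtoC u)%C) t (a * Cexp (a * RtoC t))%C.
Proof.
  apply (cder_Cexp (fun u => a * RtoC u)%C).
  assert (H := cder_scal a _ t _ (cder_RtoC (fun u => u) t 1 (is_derive_id t))).
  rewrite Cmult_1_r in H. exact H.
Qed.

(** * Approximation on finite sets *)

(* Closure in the topology of pointwise convergence on [D]. *)
Definition Cl {X : Type} (D : X -> Prop) (G : (X -> C) -> Prop) (f : X -> C) : Prop :=
  forall (l : list X) eps, 0 < eps -> (forall x, In x l -> D x) ->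
    exists g, G g /\ forall x, In x l -> Cmod (f x - g x) <= eps.

Section Closure.
Context {X : Type} (D : X -> Prop).

Lemma Cl_in (G : (X -> C) -> Prop) f : G f -> Cl D G f.
Proof.
  intros H l e He _. exists f; split; auto. intros x _.
  replace (f x - f x)%C with (RtoC 0) by ring. rewrite Cmod_0; lra.
Qed.

Lemma Cl_ext (G : (X -> C) -> Prop) f g : (forall x, D x -> f x = g x) -> Cl D G f -> Cl D G g.
Proof.
  intros H Hf l e He Hl. destruct (Hf l e He Hl) as [h [Hh H1]].
  exists h; split; auto. intros x Hx. rewrite <- H by auto. auto.
Qed.

Lemma Cl_idem (G G' : (X -> C) -> Prop) f : (forall g, G g -> Cl D G' g) -> Cl D G f -> Cl D G' f.
Proof.
  intros H Hf l e He Hl. destruct (Hf l (e/2) ltac:(lra) Hl) as [h [Hh H1]].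
  destruct (H h Hh l (e/2) ltac:(lra) Hl) as [k [Hk H2]].
  exists k; split; auto. intros x Hx. eapply Rle_trans; [apply (Cmod_triangle3 _ (h x))|].
  specialize (H1 x Hx); specialize (H2 x Hx); lra.
Qed.

(** Membership in the closure tests finitely many points at a time, so pointwise convergence is
    uniform on each test. *)
Lemma Cl_lim (G : (X -> C) -> Prop) (u : nat -> X -> C) f :
  (exists N, forall k, (N <= k)%nat -> Cl D G (u k)) -> (forall x, D x -> Ccv (fun k => u k x) (f x)) -> Cl D G f.
Proof.
  intros [N0 Hu] Hf. apply (Cl_idem (fun g => exists k, (N0 <= k)%nat /\ g = u k)).
  { intros g [k [Hk ->]]; auto. }
  intros l e He Hl.
  assert (H : exists N, forall k, (N <= k)%nat -> forall x, In x l -> Cmod (f x - u k x) <= e).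
  { clear Hu. induction l as [|x l IH].
    - exists O; intros k _ x [].
    - destruct IH as [N HN]. intros; apply Hl; right; auto.
      destruct (Hf x (Hl x (or_introl eq_refl)) e He) as [N' HN'].
      exists (max N N'). intros k Hk y [<-|Hy].
      + rewrite Cmod_sub_sym. left; apply HN'; lia.
      + apply HN; auto; lia. }
  destruct H as [N HN]. exists (u (max N0 N)). split.
  exists (max N0 N); split; auto; lia. apply HN; lia.
Qed.

Lemma Cl_plus (G1 G2 G3 : (X -> C) -> Prop) f f' :
  (forall g h, G1 g -> G2 h -> G3 (fun x => g x + h x)%C) ->
  Cl D G1 f -> Cl D G2 f' -> Cl D G3 (fun x => f x + f' x)%C.
Proof.
  intros H Hf Hf' l e He Hl.
  destruct (Hf l (e/2) ltac:(lra) Hl) as [h [Hh H1]].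
  destruct (Hf' l (e/2) ltac:(lra) Hl) as [k [Hk H2]].
  exists (fun x => h x + k x)%C. split; auto. intros x Hx.
  replace (f x + f' x - (h x + k x))%C with ((f x - h x) + (f' x - k x))%C by ring.
  eapply Rle_trans; [apply Cmod_triangle|]. specialize (H1 x Hx); specialize (H2 x Hx); lra.
Qed.

Lemma list_bound (f : X -> R) (l : list X) : exists B, 0 <= B /\ forall x, In x l -> f x <= B.
Proof.
  induction l as [|x l [B [HB H]]].
  - exists 0; split; [lra|intros x []].
  - exists (Rmax B (f x)). split. eapply Rle_trans; [apply HB|apply Rmax_l].
    intros y [<-|Hy]. apply Rmax_r. eapply Rle_trans; [apply H; auto|apply Rmax_l].
Qed.

Lemma Cl_mult (G1 G2 G3 : (X -> C) -> Prop) f f' :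
  (forall g h, G1 g -> G2 h -> G3 (fun x => g x * h x)%C) ->
  Cl D G1 f -> Cl D G2 f' -> Cl D G3 (fun x => f x * f' x)%C.
Proof.
  intros H Hf Hf' l e He Hl.
  destruct (list_bound (fun x => Cmod (f x) + Cmod (f' x)) l) as [B [HB HBl]].
  set (d0 := Rmin 1 (e / (B + 1))).
  assert (Hd : 0 < d0).
  { apply Rmin_glb_lt; [lra|]. apply Rdiv_lt_0_compat; lra. }
  assert (Hd1 : d0 <= 1) by apply Rmin_l.
  assert (Hd2 : d0 * (B + 1) <= e).
  { apply Rle_trans with (e / (B + 1) * (B + 1)).
    apply Rmult_le_compat_r; [lra|apply Rmin_r]. apply Req_le; field; lra. }
  destruct (Hf l d0 Hd Hl) as [h [Hh H1]].
  destruct (Hf' l d0 Hd Hl) as [k [Hk H2]].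
  exists (fun x => h x * k x)%C. split; auto. intros x Hx.
  specialize (H1 x Hx); specialize (H2 x Hx); specialize (HBl x Hx); simpl in HBl.
  replace (f x * f' x - h x * k x)%C
    with (f x * (f' x - k x) + (f x - h x) * f' x - (f x - h x) * (f' x - k x))%C by ring.
  eapply Rle_trans; [eapply Rle_trans; [apply Cmod_triangle|apply Rplus_le_compat_r, Cmod_triangle]|].
  rewrite Cmod_opp, !Cmod_mult.
  generalize (Cmod_ge_0 (f x - h x)) (Cmod_ge_0 (f' x - k x)) (Cmod_ge_0 (f x)) (Cmod_ge_0 (f' x)).
  intros.
  set (p := Cmod (f x - h x)) in *. set (q := Cmod (f' x - k x)) in *.
  assert (p * q <= d0 * 1) by (apply Rmult_le_compat; lra).
  assert (Cmod (f x) * q <= Cmod (f x) * d0) by (apply Rmult_le_compat_l; lra).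
  assert (p * Cmod (f' x) <= d0 * Cmod (f' x)) by (apply Rmult_le_compat_r; lra).
  nra.
Qed.

(* [G A] is thought of as a ball of radius [A]; a cone is the case where [A] is ignored. *)
Lemma Cl_int (G : R -> (X -> C) -> Prop) (F : R -> X -> C) (f : X -> C) a b A :
  a <= b -> 0 <= A ->
  G 0 (fun _ => RtoC 0) ->
  (forall A B g h, G A g -> G B h -> G (A + B) (fun x => g x + h x)%C) ->
  (forall c A g, 0 <= c -> G A g -> G (c * A) (fun x => RtoC c * g x)%C) ->
  (forall u, a <= u <= b -> Cl D (G A) (F u)) ->
  (forall x, D x -> cint (fun u => F u x) a b (f x)) ->
  Cl D (G ((b - a) * A)) f.
Proof.
  intros Hab HA G0 Gp Gs HF Hf.
  (* Induction on the tagged subdivision: one more interval adds its length times the integrand at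
     the tag, an element of radius length times [A], and the radii sum to the total length times
     [A]. *)
  assert (HR : forall ptd, pointed_subdiv ptd -> a <= SF_h ptd ->
      seq.last (SF_h ptd) (SF_lx ptd) <= b ->
      Cl D (G ((seq.last (SF_h ptd) (SF_lx ptd) - SF_h ptd) * A))
        (fun x => (Riemann_sum (fun u => fst (F u x)) ptd, Riemann_sum (fun u => snd (F u x)) ptd))).
  { intros ptd. apply SF_cons_ind with (s := ptd); clear ptd.
    - intros x0 _ _ _. simpl. replace ((x0 - x0) * A) with 0 by ring. apply Cl_in. exact G0.
    - intros h s IH Hp Ha Hb.
      assert (Hs : pointed_subdiv s) by (eapply ptd_cons; eassumption).
      assert (Hh : fst h <= snd h <= SF_h s).
      { assert (Hp0 := Hp O). rewrite SF_size_cons, SF_lx_cons, SF_ly_cons in Hp0.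
        simpl in Hp0. apply Hp0. lia. }
      assert (Hlast : seq.last (SF_h (SF_cons h s)) (SF_lx (SF_cons h s))
                      = seq.last (SF_h s) (SF_lx s)) by reflexivity.
      rewrite Hlast in *. change (SF_h (SF_cons h s)) with (fst h) in *.
      assert (Hsl : SF_h s <= seq.last (SF_h s) (SF_lx s)).
      { assert (Hq := sorted_last (SF_lx s) 0).
        specialize (Hq (ptd_sort s Hs) ltac:(unfold SF_lx; simpl; lia)).
        simpl. simpl in Hq. exact (Hq 0). }
      specialize (IH Hs ltac:(lra) Hb).
      replace ((seq.last (SF_h s) (SF_lx s) - fst h) * A)
        with ((SF_h s - fst h) * A + (seq.last (SF_h s) (SF_lx s) - SF_h s) * A) by ring.
      apply Cl_ext with (fun x => RtoC (SF_h s - fst h) * F (snd h) x +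
         (Riemann_sum (fun u => fst (F u x)) s, Riemann_sum (fun u => snd (F u x)) s))%C.
      { intros x _. rewrite !Riemann_sum_cons.
        unfold plus, scal; simpl; unfold mult; simpl. unfold Cplus, Cmult, RtoC; simpl.
        f_equal; ring. }
      apply (Cl_plus (G ((SF_h s - fst h) * A)) (G ((seq.last (SF_h s) (SF_lx s) - SF_h s) * A))); auto.
      intros l e He Hl.
      destruct (HF (snd h) ltac:(lra) l (e / (SF_h s - fst h + 1))) as [g [Hg H1]]; auto.
      { apply Rdiv_lt_0_compat; lra. }
      exists (fun x => RtoC (SF_h s - fst h) * g x)%C. split. apply Gs; auto; lra.
      intros x Hx. specialize (H1 x Hx).
      replace (RtoC (SF_h s - fst h) * F (snd h) x - RtoC (SF_h s - fst h) * g x)%C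
        with (RtoC (SF_h s - fst h) * (F (snd h) x - g x))%C by ring.
      rewrite Cmod_mult, Cmod_RtoC_pos by lra.
      apply Rle_trans with ((SF_h s - fst h + 1) * (e / (SF_h s - fst h + 1))).
      apply Rmult_le_compat; try lra. apply Cmod_ge_0. apply Req_le; field; lra. }
  set (cl := Cl D (G ((b - a) * A))).
  apply (Cl_idem cl); [auto|].
  destruct Hab as [Hab|<-].
  2:{ intros l e He Hl. exists (fun _ => RtoC 0). split.
      unfold cl. replace ((a - a) * A) with 0 by ring. apply Cl_in, G0.
      intros x Hx. specialize (Hf x (Hl x Hx)).
      assert (f x = RtoC 0).
      { destruct Hf as [H1 H2].
        assert (E1 := is_RInt_unique _ _ _ _ H1). assert (E2 := is_RInt_unique _ _ _ _ H2).
        rewrite RInt_point in E1, E2. destruct (f x); simpl in *. unfold zero in *; simpl in *. subst; auto. }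
      rewrite H. replace (RtoC 0 - RtoC 0)%C with (RtoC 0) by ring. rewrite Cmod_0; lra. }
  intros l e He Hl.
  (* Each point of the list imposes a condition met by all fine subdivisions. Finitely many such
     conditions hold together, so a single subdivision serves the whole list. *)
  assert (Hfilt : Riemann_fine a b (fun ptd => forall x, In x l ->
     Cmod (f x - (Riemann_sum (fun u => fst (F u x)) ptd, Riemann_sum (fun u => snd (F u x)) ptd)) <= e)).
  { clear HF HR. induction l as [|x l IH].
    - apply filter_forall. intros ptd x [].
    - assert (H0 := IH (fun y Hy => Hl y (or_intror Hy))). clear IH.
      destruct (Hf x (Hl x (or_introl eq_refl))) as [H1 H2].
      unfold is_RInt in H1, H2.
      assert (He2 : 0 < e / 2) by lra.
      assert (K1 := proj1 (filterlim_locally _ _) H1 (mkposreal _ He2)).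
      assert (K2 := proj1 (filterlim_locally _ _) H2 (mkposreal _ He2)).
      assert (K := filter_and _ _ (filter_and _ _ K1 K2) H0). clear K1 K2 H0.
      eapply filter_imp; [|exact K].
      intros ptd [[B1 B2] B3] y [<-|Hy]; auto.
      change (Rabs (scal (sign (b - a)) (Riemann_sum (fun u => fst (F u x)) ptd) - fst (f x)) < e / 2) in B1.
      change (Rabs (scal (sign (b - a)) (Riemann_sum (fun u => snd (F u x)) ptd) - snd (f x)) < e / 2) in B2.
      rewrite sign_eq_1 in B1, B2 by lra. rewrite scal_one in B1, B2 ||
        (change (Rabs (1 * Riemann_sum (fun u => fst (F u x)) ptd - fst (f x)) < e / 2) in B1;
         change (Rabs (1 * Riemann_sum (fun u => snd (F u x)) ptd - snd (f x)) < e / 2) in B2;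
         rewrite Rmult_1_l in B1, B2).
      eapply Rle_trans; [apply Cmod_le_abs|]. simpl.
      rewrite Rabs_minus_sym in B1, B2. unfold Rminus in *. lra. }
  unfold Riemann_fine, within in Hfilt.
  destruct Hfilt as [del Hdel].
  destruct (@filter_ex _ (Riemann_fine a b) (Riemann_fine_filter a b)
    (fun ptd => (pointed_subdiv ptd /\ SF_h ptd = Rmin a b /\ seq.last (SF_h ptd) (SF_lx ptd) = Rmax a b)
       /\ forall x, In x l ->
     Cmod (f x - (Riemann_sum (fun u => fst (F u x)) ptd, Riemann_sum (fun u => snd (F u x)) ptd)) <= e))
    as [ptd [[P1 [P2 P3]] P4]].
  { exists del. intros ptd Hd Hq. split; auto. }
  rewrite Rmin_left in P2 by lra. rewrite Rmax_right in P3 by lra.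
  eexists. split; [|exact P4]. unfold cl.
  assert (Hr := HR ptd P1 ltac:(lra) ltac:(lra)). rewrite P2, P3 in Hr || idtac.
  replace ((b - a) * A) with ((seq.last (SF_h ptd) (SF_lx ptd) - SF_h ptd) * A) by (rewrite P3, P2; auto).
  apply HR; auto; lra.
Qed.
End Closure.

(** * Positive definite functions *)

(** Nonnegative combinations of characters. The last constructor closes the class under pointwise
    equality, in place of functional extensionality. *)
Inductive Trig : (R -> C) -> Prop :=
| Trig_0 : Trig (fun _ => RtoC 0)
| Trig_exp w lam : 0 <= w -> Trig (fun t => RtoC w * Cexp (Ci * RtoC (lam * t)))%C
| Trig_plus f g : Trig f -> Trig g -> Trig (fun t => f t + g t)%C
| Trig_ext f g : (forall t, f t = g t) -> Trig f -> Trig g.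

Definition PD : (R -> C) -> Prop := Cl (fun _ => True) Trig.

Lemma Trig_scal c f : 0 <= c -> Trig f -> Trig (fun t => RtoC c * f t)%C.
Proof.
  intros Hc H; induction H.
  - apply Trig_ext with (fun _ => RtoC 0); [intros; ring|apply Trig_0].
  - apply Trig_ext with (fun t => RtoC (c * w) * Cexp (Ci * RtoC (lam * t)))%C.
    intros; rewrite RtoC_mult; ring. apply Trig_exp. apply Rmult_le_pos; auto.
  - eapply Trig_ext; [|apply Trig_plus; [apply IHTrig1|apply IHTrig2]]. intros; simpl; ring.
  - eapply Trig_ext; [|apply IHTrig]. intros; simpl; rewrite H; auto.
Qed.

Lemma Trig_mult_exp w lam f : 0 <= w -> Trig f ->
  Trig (fun t => RtoC w * Cexp (Ci * RtoC (lam * t)) * f t)%C.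
Proof.
  intros Hw H; induction H.
  - eapply Trig_ext; [|apply Trig_0]. intros; simpl; ring.
  - eapply Trig_ext; [|apply (Trig_exp (w * w0) (lam + lam0)); apply Rmult_le_pos; auto].
    intros t; simpl. rewrite RtoC_mult.
    replace (Ci * RtoC ((lam + lam0) * t))%C with (Ci * RtoC (lam * t) + Ci * RtoC (lam0 * t))%C
      by (rewrite !RtoC_mult, RtoC_plus; ring).
    rewrite Cexp_plus. ring.
  - eapply Trig_ext; [|apply Trig_plus; [apply IHTrig1|apply IHTrig2]]. intros; simpl; ring.
  - eapply Trig_ext; [|apply IHTrig]. intros; simpl; rewrite H; auto.
Qed.

(** A product of characters is a character with added frequencies; this is what makes products of
    positive definite functions positive definite here. *)
Lemma Trig_mult f g : Trig f -> Trig g -> Trig (fun t => f t * g t)%C.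
Proof.
  intros H Hg; induction H.
  - eapply Trig_ext; [|apply Trig_0]. intros; simpl; ring.
  - apply Trig_mult_exp; auto.
  - eapply Trig_ext; [|apply Trig_plus; [apply IHTrig1|apply IHTrig2]]. intros; simpl; ring.
  - eapply Trig_ext; [|apply IHTrig]. intros; simpl; rewrite H; auto.
Qed.

Lemma PD_ext f g : (forall t, f t = g t) -> PD f -> PD g.
Proof. intros H; apply Cl_ext; auto. Qed.

Lemma PD_plus f g : PD f -> PD g -> PD (fun t => f t + g t)%C.
Proof. apply Cl_plus. intros; apply Trig_plus; auto. Qed.

Lemma PD_mult f g : PD f -> PD g -> PD (fun t => f t * g t)%C.
Proof. apply Cl_mult. intros; apply Trig_mult; auto. Qed.

Lemma PD_exp lam : PD (fun t => Cexp (Ci * RtoC (lam * t))).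
Proof.
  eapply PD_ext; [|apply Cl_in, (Trig_exp 1 lam); lra]. intros; simpl; ring.
Qed.

Lemma PD_const c : 0 <= c -> PD (fun _ => RtoC c).
Proof.
  intros H. eapply PD_ext; [|apply Cl_in, (Trig_exp c 0); auto].
  intros; simpl. rewrite Rmult_0_l, Cmult_0_r, Cexp_0. ring.
Qed.

Lemma PD_scal c f : 0 <= c -> PD f -> PD (fun t => RtoC c * f t)%C.
Proof. intros; apply PD_mult; auto; apply PD_const; auto. Qed.

Lemma PD_lim (u : nat -> R -> C) f :
  (exists N, forall k, (N <= k)%nat -> PD (u k)) -> (forall t, Ccv (fun k => u k t) (f t)) -> PD f.
Proof. intros; eapply Cl_lim; eauto. Qed.

Lemma PD_int (F : R -> R -> C) f a b : a <= b ->
  (forall u, a <= u <= b -> PD (F u)) -> (forall t, cint (fun u => F u t) a b (f t)) -> PD f.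
Proof.
  intros Hab HF Hf. apply (Cl_int _ (fun _ => Trig) F f a b 0); auto.
  - lra.
  - apply Trig_0.
  - intros; apply Trig_plus; auto.
  - intros; apply Trig_scal; auto.
Qed.

(** An inequality on values at four points that holds for every character survives nonnegative
    combinations and then limits. All consequences of [PD] below are instances, with zero
    coefficients when fewer points are involved. *)
Lemma PD_lin (c1 c2 c3 c4 : C) (x1 x2 x3 x4 : R) f :
  (forall lam, 0 <= Re (c1 * Cexp (Ci * RtoC (lam * x1)) + c2 * Cexp (Ci * RtoC (lam * x2))
     + c3 * Cexp (Ci * RtoC (lam * x3)) + c4 * Cexp (Ci * RtoC (lam * x4)))%C) ->
  PD f -> 0 <= Re (c1 * f x1 + c2 * f x2 + c3 * f x3 + c4 * f x4)%C.
Proof.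
  intros Hc Hf.
  assert (HT : forall g, Trig g -> 0 <= Re (c1 * g x1 + c2 * g x2 + c3 * g x3 + c4 * g x4)%C).
  { intros g H; induction H.
    - replace (_ + _)%C with (RtoC 0) by ring. simpl; lra.
    - match goal with |- _ <= Re ?z => replace z with (RtoC w *
       (c1 * Cexp (Ci * RtoC (lam * x1)) + c2 * Cexp (Ci * RtoC (lam * x2))
     + c3 * Cexp (Ci * RtoC (lam * x3)) + c4 * Cexp (Ci * RtoC (lam * x4))))%C by ring end.
      rewrite re_scal_l. apply Rmult_le_pos; auto.
    - match goal with |- _ <= Re ?z => replace z with
       ((c1 * f0 x1 + c2 * f0 x2 + c3 * f0 x3 + c4 * f0 x4) + (c1 * g x1 + c2 * g x2 + c3 * g x3 + c4 * g x4))%C by ring end.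
      rewrite re_plus. lra.
    - rewrite <- !H. auto. }
  (* [B] bounds the effect on the combination of a unit error at each point; the added 1 keeps it
     positive. *)
  set (B := Cmod c1 + Cmod c2 + Cmod c3 + Cmod c4 + 1).
  assert (HB : 0 < B) by (unfold B; generalize (Cmod_ge_0 c1) (Cmod_ge_0 c2) (Cmod_ge_0 c3) (Cmod_ge_0 c4); lra).
  apply Ropp_le_cancel. rewrite Ropp_0. apply le_epsilon. intros e He.
  destruct (Hf (x1 :: x2 :: x3 :: x4 :: nil) (e / B)) as [g [Hg H]]; auto.
  apply Rdiv_lt_0_compat; auto.
  assert (E1 := H x1 ltac:(simpl; auto)). assert (E2 := H x2 ltac:(simpl; auto)).
  assert (E3 := H x3 ltac:(simpl; auto)). assert (E4 := H x4 ltac:(simpl; auto)).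
  specialize (HT g Hg).
  set (z := (c1 * f x1 + c2 * f x2 + c3 * f x3 + c4 * f x4)%C) in *.
  set (w := (c1 * g x1 + c2 * g x2 + c3 * g x3 + c4 * g x4)%C) in *.
  assert (Hzw : Cmod (z - w)%C <= e).
  { replace (z - w)%C with (c1 * (f x1 - g x1) + c2 * (f x2 - g x2) + c3 * (f x3 - g x3) + c4 * (f x4 - g x4))%C
      by (unfold z, w; ring).
    eapply Rle_trans; [apply Cmod_triangle|]. eapply Rle_trans; [apply Rplus_le_compat_r, Cmod_triangle|].
    eapply Rle_trans; [apply Rplus_le_compat_r, Rplus_le_compat_r, Cmod_triangle|].
    rewrite !Cmod_mult.
    apply Rle_trans with (B * (e / B)); [|apply Req_le; field; lra].
    assert (0 < e / B) by (apply Rdiv_lt_0_compat; auto).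
    assert (T : forall c x, x <= e / B -> Cmod c * x <= Cmod c * (e / B)).
    { intros; apply Rmult_le_compat_l; auto; apply Cmod_ge_0. }
    generalize (T c1 _ E1) (T c2 _ E2) (T c3 _ E3) (T c4 _ E4). unfold B at 5. intros.
    assert (B * (e/B) = Cmod c1 * (e/B) + Cmod c2 * (e/B) + Cmod c3 * (e/B) + Cmod c4 * (e/B) + e/B) by (unfold B at 1; ring).
    lra. }
  assert (Hre := Rle_trans _ _ _ (re_le_Cmod (z - w)%C) Hzw).
  unfold Cminus in Hre. rewrite re_plus, re_opp in Hre.
  apply Rabs_le_between in Hre. lra.
Qed.

Lemma PD_0_re f : PD f -> f 0 = RtoC (Re (f 0)) /\ 0 <= Re (f 0).
Proof.
  intros H.
  assert (E : forall lam, Cexp (Ci * RtoC (lam * 0)) = RtoC 1).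
  { intros; rewrite Rmult_0_r, Cmult_0_r, Cexp_0; auto. }
  assert (H1 := PD_lin (RtoC 1) 0 0 0 0 0 0 0 f).
  assert (H2 := PD_lin Ci 0 0 0 0 0 0 0 f).
  assert (H3 := PD_lin (-Ci)%C 0 0 0 0 0 0 0 f).
  split.
  - destruct (f 0) as [a b]. unfold Re, RtoC; simpl. f_equal.
    specialize (H2 ltac:(intros; rewrite E; unfold Ci, RtoC; simpl; lra) H).
    specialize (H3 ltac:(intros; rewrite E; unfold Ci, RtoC; simpl; lra) H).
    simpl in H2, H3. lra.
  - specialize (H1 ltac:(intros; rewrite E; simpl; lra) H).
    simpl in H1. unfold Re. lra.
Qed.

(** Characters satisfy the identity, and equality is obtained as two opposite inequalities:
    coefficients 1 and -1 compare the real parts, [Ci] and [-Ci] the imaginary parts. *)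
Lemma PD_conj f t : PD f -> f (- t) = Cconj (f t).
Proof.
  intros H.
  assert (E : forall lam, Cexp (Ci * RtoC (lam * - t)) = Cconj (Cexp (Ci * RtoC (lam * t)))).
  { intros lam. rewrite Cexp_conj. f_equal. unfold Ci, Cconj, RtoC, Cmult; simpl. f_equal; ring. }
  assert (H1 := PD_lin 1 (-(1)) 0 0 t (-t) 0 0 f).
  assert (H2 := PD_lin (-(1)) (1) 0 0 t (-t) 0 0 f).
  assert (H3 := PD_lin (Ci) (Ci) 0 0 t (-t) 0 0 f).
  assert (H4 := PD_lin (-Ci) (-Ci) 0 0 t (-t) 0 0 f).
  assert (W : forall lam, exists a b, Cexp (Ci * RtoC (lam * t)) = (a, b)).
  { intros. destruct (Cexp (Ci * RtoC (lam * t))); eauto. }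
  specialize (H1 ltac:(intros lam; rewrite E; destruct (W lam) as [a [b ->]]; simpl; lra) H).
  specialize (H2 ltac:(intros lam; rewrite E; destruct (W lam) as [a [b ->]]; simpl; lra) H).
  specialize (H3 ltac:(intros lam; rewrite E; destruct (W lam) as [a [b ->]]; simpl; lra) H).
  specialize (H4 ltac:(intros lam; rewrite E; destruct (W lam) as [a [b ->]]; simpl; lra) H).
  destruct (f t) as [a b], (f (- t)) as [a' b'].
  simpl in H1, H2, H3, H4. unfold Cconj; simpl. f_equal; lra.
Qed.

Lemma Cunit_phase (z : C) : exists u : C, Cmod u = 1 /\ (u * z)%C = RtoC (Cmod z).
Proof.
  destruct (Ceq_dec z 0) as [->|Hz].
  - exists (RtoC 1). rewrite Cmod_1, Cmod_0. split; [auto|ring].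
  - assert (Hm : 0 < Cmod z) by (apply Cmod_gt_0; auto).
    exists (RtoC (Cmod z) / z)%C. split.
    + rewrite Cmod_div, Cmod_RtoC_pos; auto; [field; lra|lra].
    + field; auto.
Qed.

(** Rotate [f t] onto the positive axis by a phase [u]; for every character
    [1 - Re (u * chi t) >= 0]. *)
Lemma PD_bound f t : PD f -> Cmod (f t) <= Re (f 0).
Proof.
  intros H. destruct (Cunit_phase (f t)) as [u [Hu Hz]].
  assert (H1 := PD_lin 1 (-u)%C 0 0 0 t 0 0 f).
  assert (Hre : 0 <= Re (1 * f 0 + - u * f t + 0 * f 0 + 0 * f 0)%C).
  { apply H1; auto. intros lam. rewrite Rmult_0_r, Cmult_0_r, Cexp_0.
    replace (_ + _)%C with (1 - u * Cexp (Ci * RtoC (lam * t)))%C by ring.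
    unfold Cminus. rewrite re_plus, re_opp, re_RtoC.
    assert (Hb := re_le_Cmod (u * Cexp (Ci * RtoC (lam * t)))%C).
    rewrite Cmod_mult, Hu, Cexp_Ci, Cmod_cs in Hb. apply Rabs_le_between in Hb. rewrite Cexp_Ci. lra. }
  replace (1 * f 0 + - u * f t + 0 * f 0 + 0 * f 0)%C with (f 0 - u * f t)%C in Hre by ring.
  rewrite Hz in Hre. unfold Cminus in Hre. rewrite re_plus, re_opp, re_RtoC in Hre. lra.
Qed.

Lemma re_mul_conj_ge0 (z : C) : 0 <= Re (z * Cconj z)%C.
Proof. destruct z as [a b]; unfold Re, Cconj; simpl. nra. Qed.

(* The covariance bound [|f(s+t) - f(s) f(t)|^2 <= (1 - |f(s)|^2) (1 - |f(t)|^2)], as a quadratic form. *)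
Lemma PD_quad f s t (p q : R) : PD f -> f 0 = RtoC 1 ->
  2 * p * q * Cmod (f (s + t)%R - f s * f t)%C <=
  p ^ 2 * (1 - Cmod (f s) ^ 2) + q ^ 2 * (1 - Cmod (f t) ^ 2).
Proof.
  intros H H0. destruct (Cunit_phase (f (s + t)%R - f s * f t)%C) as [u [Hu Hz]].
  (* Think of [f] as an average of characters [chi]. [A] is minus the average of
     [B * chi s + D * conj (chi t)], which turns the second moment into a variance; the phase [u] in
     [B] makes the cross term real with the desired sign. *)
  set (B := (- RtoC p * u)%C). set (D := RtoC q).
  set (A := (- (B * f s + D * Cconj (f t)))%C).
  assert (H1 := PD_lin (A * Cconj A + B * Cconj B + D * Cconj D)%C (2 * Cconj A * B)%C
     (2 * A * Cconj D)%C (2 * B * Cconj D)%C 0 s t (s + t) f).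
  assert (Hre : 0 <= Re ((A * Cconj A + B * Cconj B + D * Cconj D) * f 0 + (2 * Cconj A * B) * f s +
     (2 * A * Cconj D) * f t + (2 * B * Cconj D) * f (s + t)%R)%C).
  { apply H1; auto. intros lam. rewrite Rmult_0_r, Cmult_0_r, Cexp_0.
    replace (Ci * RtoC (lam * (s + t)))%C with (Ci * RtoC (lam * s) + Ci * RtoC (lam * t))%C
      by (rewrite <- Cmult_plus_distr_l, <- RtoC_plus; do 2 f_equal; ring).
    rewrite Cexp_plus.
    assert (Hs := Cmod_cs (lam * s)). assert (Ht := Cmod_cs (lam * t)).
    rewrite <- Cexp_Ci in Hs, Ht.
    assert (Es : (Cexp (Ci * RtoC (lam * s)) * Cconj (Cexp (Ci * RtoC (lam * s))))%C = 1).
    { rewrite <- Cmod2_conj, Hs. f_equal. ring. }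
    assert (Et : (Cexp (Ci * RtoC (lam * t)) * Cconj (Cexp (Ci * RtoC (lam * t))))%C = 1).
    { rewrite <- Cmod2_conj, Ht. f_equal. ring. }
    set (es := Cexp (Ci * RtoC (lam * s))) in *. set (et := Cexp (Ci * RtoC (lam * t))) in *.
    (* For one character the form is the squared modulus of this sum; its cross terms come in
       conjugate pairs, and the square of each unimodular value is 1. *)
    assert (K := re_mul_conj_ge0 (A + B * es + D * Cconj et)%C).
    rewrite !Cplus_conj, !Cmult_conj, Cconj_conj in K.
    assert (Rc : forall z, Re (Cconj z) = Re z) by apply re_conj.
    replace ((A + B * es + D * Cconj et) * (Cconj A + Cconj B * Cconj es + Cconj D * et))%C with
     (A * Cconj A + B * Cconj B * (es * Cconj es) + D * Cconj D * (et * Cconj et)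
       + (Cconj A * B * es + Cconj (Cconj A * B * es))
       + (A * Cconj D * et + Cconj (A * Cconj D * et))
       + (B * Cconj D * (es * et) + Cconj (B * Cconj D * (es * et))))%C in K
     by (rewrite !Cmult_conj, !Cconj_conj; ring).
    rewrite Es, Et in K.
    rewrite !re_plus, !Rc in K. rewrite !re_plus.
    replace (2 * Cconj A * B * es)%C with (RtoC 2 * (Cconj A * B * es))%C by ring.
    replace (2 * A * Cconj D * et)%C with (RtoC 2 * (A * Cconj D * et))%C by ring.
    replace (2 * B * Cconj D * (es * et))%C with (RtoC 2 * (B * Cconj D * (es * et)))%C by ring.
    rewrite !Cmult_1_r in K. rewrite !Cmult_1_r, !re_plus, !(re_scal_l 2). lra. }
  rewrite H0, !Cmult_1_r in Hre.
  assert (E : (B * Cconj D * (f (s + t)%R - f s * f t))%C = RtoC (- p * q * Cmod (f (s + t)%R - f s * f t)%C)).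
  { replace (B * Cconj D * (f (s + t)%R - f s * f t))%C with
      (- RtoC p * Cconj D * (u * (f (s + t)%R - f s * f t)))%C by (unfold B; ring).
    rewrite Hz. unfold D, Cconj, RtoC, Cmult, Copp; simpl. f_equal; ring. }
  (* After substituting [A], what differs from the variance is a sum of terms [z - Cconj z], whose
     real parts vanish. *)
  assert (E2 : (A * Cconj A + B * Cconj B + D * Cconj D + 2 * Cconj A * B * f s + 2 * A * Cconj D * f t
     + 2 * B * Cconj D * f (s + t)%R)%C =
    ((B * Cconj B * (1 - f s * Cconj (f s)) + D * Cconj D * (1 - f t * Cconj (f t)))
      + 2 * (B * Cconj D * (f (s + t)%R - f s * f t))
      + (Cconj A * B * f s - Cconj (Cconj A * B * f s)) + (A * Cconj D * f t - Cconj (A * Cconj D * f t))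
      + (B * Cconj D * (f s * f t) - Cconj (B * Cconj D * (f s * f t))))%C).
  { unfold A. repeat rewrite ?Copp_conj, ?Cplus_conj, ?Cmult_conj, ?Cconj_conj. ring. }
  rewrite E2, E in Hre.
  rewrite <- !Cmod2_conj in Hre.
  assert (R0 : forall z, Re (z - Cconj z)%C = 0) by (intros [a b]; unfold Re, Cconj; simpl; ring).
  rewrite !re_plus, !R0 in Hre.
  assert (EB : Cmod B = Rabs p).
  { unfold B. rewrite Cmod_mult, Hu, Cmod_opp, Cmod_R. ring. }
  assert (ED : Cmod D = Rabs q) by (unfold D; rewrite Cmod_R; auto).
  rewrite EB, ED in Hre.
  rewrite <- !RtoC_minus, <- !RtoC_mult, !re_RtoC, !pow2_abs in Hre.
  lra.
Qed.

(** With [a], [b] the two distances to 1 and [X] the covariance, [1 - f (s + t)] splits into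
    [1 - f s], [f s * (1 - f t)] and the covariance, so its modulus is at most [a + b + X]. The
    bound [X <= 2 * sqrt (a * b)] makes this the square of [sqrt a + sqrt b]. *)
Lemma PD_subadd f s t : PD f -> f 0 = RtoC 1 ->
  sqrt (Cmod (1 - f (s + t)%R)%C) <= sqrt (Cmod (1 - f s)%C) + sqrt (Cmod (1 - f t)%C).
Proof.
  intros H H0.
  set (a := Cmod (1 - f s)%C). set (b := Cmod (1 - f t)%C).
  set (X := Cmod (f (s + t)%R - f s * f t)%C).
  assert (Ha : 0 <= a) by apply Cmod_ge_0. assert (Hb : 0 <= b) by apply Cmod_ge_0.
  assert (HX : 0 <= X) by apply Cmod_ge_0.
  assert (B1 : forall t, Cmod (f t) <= 1).
  { intros r. assert (K := PD_bound f r H). rewrite H0, re_RtoC in K. auto. }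
  (* [1 - |f|^2 = (1 - |f|) (1 + |f|)], where the second factor is at most 2 and the first at most
     [|1 - f|]. *)
  assert (P1 : forall r, 1 - Cmod (f r) ^ 2 <= 2 * Cmod (1 - f r)%C).
  { intros r. assert (K := Cmod_triangle_rev 1 (f r)). rewrite Cmod_1 in K.
    specialize (B1 r). generalize (Cmod_ge_0 (f r)); intros. simpl. nra. }
  assert (Q : forall p q, 2 * p * q * X <= p ^ 2 * (2 * a) + q ^ 2 * (2 * b)).
  { intros p q. eapply Rle_trans; [apply (PD_quad f s t p q H H0)|].
    apply Rplus_le_compat; apply Rmult_le_compat_l; try apply pow2_ge_0; apply P1. }
  assert (XX : X <= 2 * sqrt (a * b)).
  (* The quadratic form is tested at [p = X], [q = 2 * a]. If [a = 0] this says nothing, and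
     [p = b + 1], [q = X] forces [X = 0]. *)
  { assert (X2 : X ^ 2 <= (2 * a) * (2 * b)).
    { destruct (Req_dec a 0) as [Ea|Ea].
      - assert (K := Q (b + 1) X). rewrite Ea in *. simpl in K.
        assert (K2 : X * X = 0) by nra. simpl; nra.
      - assert (K := Q X (2 * a)).
        assert (Ha' : 0 < a) by lra.
        apply (Rmult_le_reg_l (2 * a)); [lra|]. simpl in *. nra. }
    replace (2 * a * (2 * b)) with (2 ^ 2 * (a * b)) in X2 by ring.
    rewrite <- (sqrt_pow2 X HX). eapply Rle_trans; [apply sqrt_le_1_alt, X2|].
    rewrite sqrt_mult_alt by apply pow2_ge_0. rewrite sqrt_pow2 by lra. lra. }
  assert (Hs : 0 <= sqrt a + sqrt b) by (generalize (sqrt_pos a) (sqrt_pos b); lra).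
  rewrite <- (sqrt_pow2 _ Hs). apply sqrt_le_1_alt.
  replace (1 - f (s + t)%R)%C with ((1 - f s) + f s * (1 - f t) + - (f (s + t)%R - f s * f t))%C by ring.
  eapply Rle_trans; [eapply Rle_trans; [apply Cmod_triangle|apply Rplus_le_compat_r, Cmod_triangle]|].
  rewrite Cmod_opp, Cmod_mult. fold a b X.
  assert (Cmod (f s) * b <= 1 * b) by (apply Rmult_le_compat_r; auto).
  rewrite sqrt_mult in XX by auto.
  assert (E : (sqrt a + sqrt b) ^ 2 = sqrt a * sqrt a + sqrt b * sqrt b + 2 * (sqrt a * sqrt b)) by ring.
  rewrite E, !sqrt_sqrt by auto. lra.
Qed.

Lemma cint_exp_lin (a : C) b c : a <> RtoC 0 -> b <= c ->
  cint (fun u => Cexp (a * RtoC u)) b c ((Cexp (a * RtoC c) - Cexp (a * RtoC b)) / a)%C.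
Proof.
  intros Ha Hbc.
  replace ((Cexp (a * RtoC c) - Cexp (a * RtoC b)) / a)%C
   with (/ a * Cexp (a * RtoC c) - / a * Cexp (a * RtoC b))%C by (field; auto).
  apply (cint_FTC (fun u => / a * Cexp (a * RtoC u))%C); auto.
  - intros t _. replace (Cexp (a * RtoC t)) with (/ a * (a * Cexp (a * RtoC t)))%C by (field; auto).
    apply cder_scal, cder_Cexp_lin.
  - intros t _. eapply cder_ccont, cder_Cexp_lin.
Qed.

Lemma line_neq0 sg t : 0 < sg -> ((sg, t) : C) <> RtoC 0.
Proof. intros H E. injection E as E1 _. lra. Qed.

Lemma PD_exp_line sg u : PD (fun t => Cexp (- RtoC u * (sg, t))%C).
Proof.
  eapply PD_ext; [|apply (PD_scal (exp (- u * sg)) _ ltac:(left; apply exp_pos) (PD_exp (- u)))].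
  intros t. simpl. rewrite <- Cexp_RtoC, <- Cexp_plus. f_equal.
  unfold Ci, RtoC, Cmult, Cplus; simpl. f_equal; ring.
Qed.

Lemma PD_diff_inv sg u : 0 < sg -> 0 <= u -> PD (fun t => (1 - Cexp (- RtoC u * (sg, t))) / (sg, t))%C.
Proof.
  intros Hs Hu.
  apply (PD_int (fun v t => Cexp (- RtoC v * (sg, t))%C) _ 0 u); auto.
  - intros; apply PD_exp_line.
  - intros t. assert (Hn := line_neq0 sg t Hs).
    assert (Hn' : (- ((sg, t) : C))%C <> RtoC 0).
    { intros E. apply Hn. replace ((sg, t) : C) with (- - ((sg, t) : C))%C by ring. rewrite E; ring. }
    assert (K := cint_exp_lin (- ((sg, t):C))%C 0 u Hn' Hu).
    replace ((1 - Cexp (- RtoC u * (sg, t))) / (sg, t))%C with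
      ((Cexp (- ((sg, t):C) * RtoC u) - Cexp (- ((sg, t):C) * RtoC 0)) / (- ((sg, t):C)))%C.
    + apply (cint_ext (fun u => Cexp (- ((sg, t):C) * RtoC u)%C)); auto.
      intros; f_equal; ring.
    + rewrite Cmult_0_r, Cexp_0.
      replace (- ((sg, t):C) * RtoC u)%C with (- RtoC u * (sg, t))%C by ring. field; auto.
Qed.

Lemma is_lim_seq_exp_neg c : 0 < c -> is_lim_seq (fun k => exp (- INR k * c)) 0.
Proof.
  intros Hc.
  apply is_lim_seq_ext with (fun k => (exp (- c)) ^ k).
  - intros k. induction k. simpl. rewrite Ropp_0, Rmult_0_l, exp_0; auto.
    rewrite S_INR. simpl pow. rewrite IHk, <- exp_plus. f_equal; ring.
  - apply is_lim_seq_geom. rewrite Rabs_pos_eq by (left; apply exp_pos).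
    rewrite <- exp_0. apply exp_increasing. lra.
Qed.

(** The limit of [PD_diff_inv] as [u] grows; the exponential dies off because the abscissa [sg] is
    positive. *)
Lemma PD_inv_line sg : 0 < sg -> PD (fun t => / (sg, t))%C.
Proof.
  intros Hs. apply (PD_lim (fun k t => (1 - Cexp (- RtoC (INR k) * (sg, t))) / (sg, t))%C).
  - exists O; intros k _. apply PD_diff_inv; auto. apply pos_INR.
  - intros t. assert (Hn := line_neq0 sg t Hs).
    apply Ccv_dom with (fun k => exp (- INR k * sg) * / Cmod ((sg, t) : C)).
    + exists O; intros k _.
      replace ((1 - Cexp (- RtoC (INR k) * (sg, t))) / (sg, t) - / ((sg, t):C))%C
        with (- (Cexp (- RtoC (INR k) * (sg, t)) / (sg, t)))%C by (field; auto).
      rewrite Cmod_opp, Cmod_div, Cmod_Cexp by auto.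
      replace (fst (- RtoC (INR k) * (sg, t))%C) with (- INR k * sg) by (simpl; ring). apply Rle_refl.
    + replace (Finite 0) with (Rbar_mult 0 (/ Cmod ((sg, t) : C))) by (simpl; f_equal; ring).
      apply is_lim_seq_scal_r. apply is_lim_seq_exp_neg; auto.
Qed.

(* For [c < 0] this is [- c] times the integral of [exp (- y s)] over [0 <= y <= u]. *)
Lemma PD_one_plus_exp_div sg u c : 0 < sg -> 0 <= u ->
  PD (fun t => (RtoC (Rabs c) + RtoC c * Cexp (- RtoC u * (sg, t))) / (sg, t))%C.
Proof.
  intros Hs Hu. destruct (Rle_lt_dec 0 c) as [Hc|Hc].
  - rewrite Rabs_pos_eq by auto.
    apply PD_mult; [|apply PD_inv_line; auto].
    apply PD_plus; [apply PD_const; auto|]. apply PD_scal; auto. apply PD_exp_line.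
  - rewrite Rabs_left by auto.
    eapply PD_ext; [|apply (PD_scal (- c) _ ltac:(lra) (PD_diff_inv sg u Hs Hu))].
    intros t. simpl. rewrite RtoC_opp. field. apply line_neq0; auto.
Qed.

(** * Limits of polynomials *)

(* Polynomials [sum c_k z^k] with [sum |c_k| rho^k <= A]. *)
Inductive Pol (rho : R) : R -> (C -> C) -> Prop :=
| Pol_const c : Pol rho (Cmod c) (fun _ => c)
| Pol_mulz A f : Pol rho A f -> Pol rho (rho * A) (fun z => z * f z)%C
| Pol_plus A B f g : Pol rho A f -> Pol rho B g -> Pol rho (A + B) (fun z => f z + g z)%C
| Pol_ext A B f g : (forall z, f z = g z) -> A <= B -> Pol rho A f -> Pol rho B g.

Lemma Pol_pos rho A f : 0 <= rho -> Pol rho A f -> 0 <= A.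
Proof.
  intros Hr H; induction H; try lra. apply Cmod_ge_0. apply Rmult_le_pos; auto.
Qed.

Lemma Pol_0 rho A : 0 <= A -> Pol rho A (fun _ => RtoC 0).
Proof. intros H. eapply Pol_ext; [| |apply (Pol_const rho 0)]; auto. rewrite Cmod_0; auto. Qed.

Lemma Pol_scal rho c A f : Pol rho A f -> Pol rho (Cmod c * A) (fun z => c * f z)%C.
Proof.
  intros H; induction H.
  - eapply Pol_ext; [| |apply (Pol_const rho (c * c0))]; auto. rewrite Cmod_mult; lra.
  - eapply Pol_ext; [| |apply (Pol_mulz rho _ _ IHPol)]; intros; simpl; try ring. apply Req_le; ring.
  - eapply Pol_ext; [| |apply (Pol_plus rho _ _ _ _ IHPol1 IHPol2)]; intros; simpl; try ring. apply Req_le; ring.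
  - eapply Pol_ext; [| |apply IHPol]; intros; simpl. rewrite H; auto.
    apply Rmult_le_compat_l; auto; apply Cmod_ge_0.
Qed.

Lemma Pol_mult rho A B f g : 0 <= rho -> Pol rho A f -> Pol rho B g -> Pol rho (A * B) (fun z => f z * g z)%C.
Proof.
  intros Hr H Hg. assert (HB := Pol_pos _ _ _ Hr Hg). induction H.
  - apply Pol_scal; auto.
  - eapply Pol_ext; [| |apply (Pol_mulz rho _ _ IHPol)]; intros; simpl; try ring. apply Req_le; ring.
  - eapply Pol_ext; [| |apply (Pol_plus rho _ _ _ _ IHPol1 IHPol2)]; intros; simpl; try ring. apply Req_le; ring.
  - eapply Pol_ext; [| |apply IHPol]; intros; simpl. rewrite H; auto.
    apply Rmult_le_compat_r; auto.
Qed.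

Lemma Pol_bound rho A f z : Pol rho A f -> Cmod z <= rho -> Cmod (f z) <= A.
Proof.
  intros H Hz; induction H.
  - lra.
  - rewrite Cmod_mult. apply Rmult_le_compat; auto; apply Cmod_ge_0.
  - eapply Rle_trans; [apply Cmod_triangle|lra].
  - rewrite <- H. lra.
Qed.

Lemma Pol_shrink rho rho' A f : 0 <= rho' <= rho -> Pol rho A f -> Pol rho' A f.
Proof.
  intros Hr H; induction H.
  - apply Pol_const.
  - eapply Pol_ext; [| |apply (Pol_mulz rho' _ _ IHPol)]; intros; simpl; auto.
    apply Rmult_le_compat_r; [|lra]. eapply Pol_pos; [|apply IHPol]; lra.
  - apply Pol_plus; auto.
  - eapply Pol_ext; eauto.
Qed.

Lemma Pol_comp_scal c rho A f : Pol (Cmod c * rho) A f -> Pol rho A (fun z => f (c * z)%C).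
Proof.
  intros H; induction H.
  - apply Pol_const.
  - eapply Pol_ext; [| |apply (Pol_scal rho c _ _ (Pol_mulz rho _ _ IHPol))]; intros; simpl; try ring.
    apply Req_le; ring.
  - apply Pol_plus; auto.
  - apply Pol_ext with A (fun z => f (c * z)%C); auto.
Qed.

(** Removing the constant term and dividing by [z] divides the weighted norm by [rho]. Iterated on
    limits, this extracts Taylor coefficients with Cauchy's bounds. *)
Lemma Pol_split rho A f : 0 < rho -> Pol rho A f ->
  exists g, Pol rho (A / rho) g /\ forall z, f z = (f 0 + z * g z)%C.
Proof.
  intros Hr H; induction H.
  - exists (fun _ => RtoC 0). split; [|intros; ring].
    apply Pol_0. apply Rmult_le_pos; [apply Cmod_ge_0|left; apply Rinv_0_lt_compat; auto].
  - exists f; split; [|intros; ring]. eapply Pol_ext; [| |apply H]; auto. apply Req_le; field; lra.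
  - destruct IHPol1 as [g1 [H1 E1]], IHPol2 as [g2 [H2 E2]].
    exists (fun z => g1 z + g2 z)%C. split.
    + eapply Pol_ext; [| |apply (Pol_plus _ _ _ _ _ H1 H2)]; auto. apply Req_le; field; lra.
    + intros z. rewrite (E1 z), (E2 z). ring.
  - destruct IHPol as [h [H2 E2]]; auto. exists h; split.
    + eapply Pol_ext; [| |apply H2]; auto. apply Rmult_le_compat_r; [left; apply Rinv_0_lt_compat|]; auto.
    + intros z. rewrite <- !H; auto.
Qed.

(** The stand-in for functions holomorphic on a disc: algebraic closure properties are inherited
    from polynomials, limits and integrals are built in, and [CW_pseries] recovers a convergent
    power series inside the disc. *)
Definition CW rho A f := Cl (fun z => Cmod z <= rho) (Pol rho A) f.

Lemma CW_ext rho A f g : (forall z, Cmod z <= rho -> f z = g z) -> CW rho A f -> CW rho A g.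
Proof. apply Cl_ext. Qed.

Lemma CW_le rho A B f : A <= B -> CW rho A f -> CW rho B f.
Proof.
  intros H Hf. eapply Cl_idem; [|apply Hf]. intros g Hg. apply Cl_in. eapply Pol_ext; eauto.
Qed.

Lemma CW_const rho c : CW rho (Cmod c) (fun _ => c).
Proof. apply Cl_in, Pol_const. Qed.

Lemma CW_id rho : CW rho rho (fun z => z).
Proof.
  apply Cl_in. eapply Pol_ext; [| |apply (Pol_mulz rho _ _ (Pol_const rho 1))]; intros; simpl.
  ring. rewrite Cmod_1; lra.
Qed.

Lemma CW_plus rho A B f g : CW rho A f -> CW rho B g -> CW rho (A + B) (fun z => f z + g z)%C.
Proof. apply Cl_plus; intros; apply Pol_plus; auto. Qed.

Lemma CW_mult rho A B f g : 0 <= rho -> CW rho A f -> CW rho B g -> CW rho (A * B) (fun z => f z * g z)%C.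
Proof. intros Hr; apply Cl_mult; intros; apply Pol_mult; auto. Qed.

Lemma CW_scal rho A c f : 0 <= rho -> CW rho A f -> CW rho (Cmod c * A) (fun z => c * f z)%C.
Proof. intros; apply CW_mult; auto. apply CW_const. Qed.

Lemma CW_opp rho A f : 0 <= rho -> CW rho A f -> CW rho A (fun z => - f z)%C.
Proof.
  intros Hr H. apply CW_ext with (fun z => - (1) * f z)%C. intros; ring.
  eapply CW_le; [|apply CW_scal; eauto]. rewrite Cmod_opp, Cmod_1; lra.
Qed.

Lemma CW_lim rho A (u : nat -> C -> C) f :
  (exists N, forall k, (N <= k)%nat -> CW rho A (u k)) ->
  (forall z, Cmod z <= rho -> Ccv (fun k => u k z) (f z)) -> CW rho A f.
Proof. apply Cl_lim. Qed.

Lemma CW_bound rho A f z : CW rho A f -> Cmod z <= rho -> Cmod (f z) <= A.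
Proof.
  intros H Hz. apply le_epsilon; intros e He.
  destruct (H (z :: nil) e He) as [g [Hg H1]]. intros x [<-|[]]; auto.
  specialize (H1 z (or_introl eq_refl)). assert (H2 := Pol_bound _ _ _ z Hg Hz).
  assert (H3 := Cmod_triangle_rev (f z) (g z)). lra.
Qed.

Lemma CW_pos rho A f : 0 <= rho -> CW rho A f -> 0 <= A.
Proof.
  intros Hr H. eapply Rle_trans; [apply (Cmod_ge_0 (f 0))|]. eapply CW_bound; eauto. rewrite Cmod_0; auto.
Qed.

Lemma CW_shrink rho rho' A f : 0 <= rho' <= rho -> CW rho A f -> CW rho' A f.
Proof.
  intros Hr H l e He Hl. destruct (H l e He) as [g [Hg H1]].
  intros x Hx; specialize (Hl x Hx); simpl in Hl; lra.
  exists g; split; auto. eapply Pol_shrink; eauto.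
Qed.

Lemma CW_comp_scal c rho A f : CW (Cmod c * rho) A f -> CW rho A (fun z => f (c * z)%C).
Proof.
  intros H l e He Hl. destruct (H (map (fun z => c * z)%C l) e He) as [g [Hg H1]].
  { intros x Hx. apply in_map_iff in Hx. destruct Hx as [y [<- Hy]]. rewrite Cmod_mult.
    apply Rmult_le_compat_l; [apply Cmod_ge_0|]. apply Hl; auto. }
  exists (fun z => g (c * z)%C). split. apply Pol_comp_scal; auto.
  intros x Hx. apply H1. apply in_map_iff; eauto.
Qed.

(** A Schwarz-type estimate: the quotient of [Pol_split] has norm [A / rho], and multiplying it by
    [z] on the smaller disc costs only [rho']. *)
Lemma CW_center rho rho' A f : 0 < rho -> 0 <= rho' <= rho -> CW rho A f ->
  CW rho' (rho' * (A / rho)) (fun z => f z - f 0)%C.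
Proof.
  intros Hr Hr' H l e He Hl.
  (* The origin joins the test points so that the polynomial also approximates [f 0]. *)
  destruct (H (RtoC 0 :: l) (e / 2)) as [g [Hg H1]]. lra.
  { intros x [<-|Hx]. rewrite Cmod_0; lra. specialize (Hl x Hx); simpl in Hl; lra. }
  destruct (Pol_split _ _ _ Hr Hg) as [q [Hq E]].
  exists (fun z => z * q z)%C. split.
  - apply Pol_mulz. eapply Pol_shrink; eauto.
  - intros x Hx. replace (f x - f 0 - x * q x)%C with ((f x - g x) + - (f 0 - g 0))%C by (rewrite (E x); ring).
    eapply Rle_trans; [apply Cmod_triangle|]. rewrite Cmod_opp.
    generalize (H1 x (or_intror Hx)) (H1 (RtoC 0) (or_introl eq_refl)). lra.
Qed.

Lemma CW_lip rho A f z : 0 < rho -> CW rho A f -> Cmod z <= rho -> Cmod (f z - f 0)%C <= Cmod z * (A / rho).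
Proof.
  intros Hr H Hz.
  assert (Hz' : 0 <= Cmod z <= rho) by (split; auto; apply Cmod_ge_0).
  apply (CW_bound (Cmod z) _ (fun z => f z - f 0)%C z (CW_center rho (Cmod z) A f Hr Hz' H)); lra.
Qed.

Lemma CW_csum rho (B : nat -> R) (f : nat -> C -> C) k : (forall j, (j < k)%nat -> CW rho (B j) (f j)) ->
  CW rho (rsum B k) (fun z => csum (fun j => f j z) k).
Proof.
  induction k; intros H; simpl.
  - apply Cl_in, Pol_0; lra.
  - apply CW_plus; auto.
Qed.

Lemma CW_Cser rho (B : nat -> R) S (f : nat -> C -> C) : (forall j, CW rho (B j) (f j)) ->
  (forall k, rsum B k <= S) -> CW rho S (fun z => Cser (fun j => f j z)).
Proof.
  intros H HS. apply (CW_lim rho S (fun k z => csum (fun j => f j z) k)).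
  - exists O; intros k _. eapply CW_le; [apply HS|]. apply CW_csum; auto.
  - intros z Hz. apply csum_cv with B. intros k; apply (CW_bound rho _ (f k)); auto.
    exists S; auto.
Qed.

Lemma CW_pow rho A f k : 0 <= rho -> CW rho A f -> CW rho (A ^ k) (fun z => f z ^ k)%C.
Proof.
  intros Hr H; induction k; simpl.
  - eapply CW_le; [|apply (CW_const rho 1)]. rewrite Cmod_1; lra.
  - apply CW_mult; auto.
Qed.

Lemma csum_geom (q : C) k : ((1 - q) * csum (fun j => q ^ j)%C k = 1 - q ^ k)%C.
Proof. induction k; simpl. ring. rewrite Cmult_plus_distr_l, IHk. ring. Qed.

Lemma rsum_geom (q : R) k : (1 - q) * rsum (fun j => q ^ j) k = 1 - q ^ k.
Proof. induction k; simpl. ring. rewrite Rmult_plus_distr_l, IHk. ring. Qed.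

Lemma rsum_geom_le (q : R) k : 0 <= q < 1 -> rsum (fun j => q ^ j) k <= / (1 - q).
Proof.
  intros Hq. apply (Rmult_le_reg_l (1 - q)). lra. rewrite rsum_geom, Rinv_r by lra.
  assert (0 <= q ^ k) by (apply pow_le; lra). lra.
Qed.

Lemma Ccv_pow_0 (q : C) : Cmod q < 1 -> Ccv (fun k => q ^ k)%C 0.
Proof.
  intros H. apply Ccv_dom with (fun k => Cmod q ^ k).
  - exists O; intros k _. replace (q ^ k - 0)%C with (q ^ k)%C by ring. rewrite Cmod_pow; lra.
  - apply is_lim_seq_geom. rewrite Rabs_pos_eq; auto. apply Cmod_ge_0.
Qed.

Lemma Ccv_geom (q : C) : Cmod q < 1 -> Ccv (csum (fun j => q ^ j)%C) (/ (1 - q))%C.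
Proof.
  intros H. assert (Hn : (1 - q)%C <> RtoC 0).
  { intros E. assert (q = RtoC 1) by (replace q with (1 - (1 - q))%C by ring; rewrite E; ring).
    subst q. rewrite Cmod_1 in H; lra. }
  apply Ccv_ext with (fun k => (1 - q ^ k) * / (1 - q))%C.
  - intros k. rewrite <- csum_geom. field; auto.
  - apply Ccv_eq with ((1 - 0) * / (1 - q))%C; [field; auto|].
    apply Ccv_mult; [|apply Ccv_const]. apply Ccv_minus; [apply Ccv_const|apply Ccv_pow_0; auto].
Qed.

(** Expansion in a geometric series in [h / c], whose norm [B / Cmod c] is less than 1. *)
Lemma CW_inv rho B c h : 0 <= rho -> CW rho B h -> B < Cmod c ->
  CW rho (/ (Cmod c - B)) (fun z => / (c - h z))%C.
Proof.
  intros Hr H HB. assert (H0 := CW_pos _ _ _ Hr H).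
  assert (Hc : c <> RtoC 0) by (apply Cmod_gt_0; lra).
  assert (H1 : CW rho (/ Cmod c * B) (fun z => / c * h z)%C).
  { rewrite <- Cmod_inv by auto. apply CW_scal; auto. }
  assert (Hq : 0 <= / Cmod c * B < 1).
  { split. apply Rmult_le_pos; auto. left; apply Rinv_0_lt_compat; lra.
    apply (Rmult_lt_reg_l (Cmod c)); [lra|]. rewrite <- Rmult_assoc, Rinv_r; lra. }
  assert (H2 : forall z, Cmod z <= rho -> Cmod (/ c * h z)%C < 1).
  { intros z Hz. assert (K := CW_bound _ _ _ z H1 Hz). simpl in K. lra. }
  apply CW_ext with (fun z => / c * / (1 - / c * h z))%C.
  - intros z Hz. specialize (H2 z Hz).
    assert (Hne : (c - h z)%C <> RtoC 0).
    { intros E. assert (E2 : (/ c * h z)%C = 1).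
      { replace (h z) with (c - (c - h z))%C by ring. rewrite E. field; auto. }
      rewrite E2, Cmod_1 in H2; lra. }
    field; repeat split; auto.
  - replace (/ (Cmod c - B)) with (Cmod (/ c)%C * / (1 - / Cmod c * B)).
    2:{ rewrite Cmod_inv by auto. field. lra. }
    apply CW_scal; auto.
    apply (CW_lim rho _ (fun k z => csum (fun j => (/ c * h z) ^ j)%C k)).
    + exists O; intros k _. eapply CW_le; [apply rsum_geom_le; eauto|].
      apply (CW_csum rho (fun j => (/ Cmod c * B) ^ j) (fun j z => (/ c * h z) ^ j)%C).
      intros; apply CW_pow; auto.
    + intros z Hz. apply Ccv_geom; auto.
Qed.

(** * Power series of functions in the closed polynomial balls *)

(** The origin is excluded because difference quotients, which are formed by division by [z], carry
    no information there. *)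
Definition CWp rho A f := Cl (fun z : C => z <> RtoC 0 /\ Cmod z <= rho) (Pol rho A) f.

(** The limit of [f] at the origin, read off along [rho / (k + 1)]; the value at 0 itself is never
    consulted. *)
Definition coef0 rho (f : C -> C) : C := Clim_seq (fun k => f (RtoC (rho / (INR k + 1)))).
Definition dquot rho (f : C -> C) (z : C) : C := ((f z - coef0 rho f) / z)%C.

Lemma CWp_bound rho A f z : CWp rho A f -> z <> RtoC 0 -> Cmod z <= rho -> Cmod (f z) <= A.
Proof.
  intros H Hz0 Hz. apply le_epsilon; intros e He.
  destruct (H (z :: nil) e He) as [g [Hg H1]]. intros x [<-|[]]; auto.
  specialize (H1 z (or_introl eq_refl)). assert (H2 := Pol_bound _ _ _ z Hg Hz).
  assert (H3 := Cmod_triangle_rev (f z) (g z)). lra.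
Qed.

Lemma Pol_lip rho A f z w : 0 < rho -> Pol rho A f -> Cmod z <= rho -> Cmod w <= rho ->
  Cmod (f z - f w)%C <= (Cmod z + Cmod w) * (A / rho).
Proof.
  intros Hr H Hz Hw. destruct (Pol_split _ _ _ Hr H) as [q [Hq E]].
  rewrite (E z), (E w).
  replace (f 0 + z * q z - (f 0 + w * q w))%C with (z * q z + - (w * q w))%C by ring.
  eapply Rle_trans; [apply Cmod_triangle|]. rewrite Cmod_opp, !Cmod_mult.
  assert (B1 := Pol_bound _ _ _ z Hq Hz). assert (B2 := Pol_bound _ _ _ w Hq Hw).
  rewrite Rmult_plus_distr_r. apply Rplus_le_compat; apply Rmult_le_compat_l; auto; apply Cmod_ge_0.
Qed.

Lemma CWp_lip rho A f z w : 0 < rho -> CWp rho A f -> z <> RtoC 0 -> w <> RtoC 0 ->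
  Cmod z <= rho -> Cmod w <= rho -> Cmod (f z - f w)%C <= (Cmod z + Cmod w) * (A / rho).
Proof.
  intros Hr H Hz0 Hw0 Hz Hw. apply le_epsilon; intros e He.
  destruct (H (z :: w :: nil) (e/2) ltac:(lra)) as [g [Hg H1]].
  { intros x [<-|[<-|[]]]; auto. }
  assert (G := Pol_lip _ _ _ z w Hr Hg Hz Hw).
  assert (H2 := H1 z (or_introl eq_refl)). assert (H3 := H1 w (or_intror (or_introl eq_refl))).
  assert (T1 := Cmod_triangle3 (f z) (g z) (f w)). assert (T2 := Cmod_triangle3 (g z) (g w) (f w)).
  rewrite (Cmod_sub_sym (g w)) in T2. lra.
Qed.

Lemma seq_point rho k : 0 < rho -> RtoC (rho / (INR k + 1)) <> RtoC 0 /\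
  Cmod (RtoC (rho / (INR k + 1))) = rho / (INR k + 1) /\ 0 < rho / (INR k + 1) <= rho.
Proof.
  intros Hr. assert (Hk := pos_INR k).
  assert (0 < rho / (INR k + 1)) by (apply Rdiv_lt_0_compat; lra).
  split; [|split; [|split]]; auto.
  - intros E. injection E as E. lra.
  - apply Cmod_RtoC_pos; lra.
  - apply Rle_div_l; [lra|]. nra.
Qed.

Lemma lim_seq_point rho : is_lim_seq (fun k => rho / (INR k + 1)) 0.
Proof.
  replace (Finite 0) with (Rbar_mult rho 0) by (simpl; f_equal; ring).
  apply is_lim_seq_scal_l.
  apply (is_lim_seq_ext (fun k => / INR (S k))). intros; rewrite S_INR; auto.
  apply (is_lim_seq_incr_1 (fun k => / INR k)).
  apply (is_lim_seq_inv INR p_infty). apply is_lim_seq_INR. simpl; discriminate.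
Qed.

Lemma CWp_coef0 rho A f : 0 < rho -> CWp rho A f ->
  Ccv (fun k => f (RtoC (rho / (INR k + 1)))) (coef0 rho f).
Proof.
  intros Hr H. unfold coef0.
  assert (HA : 0 <= A / rho).
  { apply Rmult_le_pos; [|left; apply Rinv_0_lt_compat; auto].
    destruct (seq_point rho 0 Hr) as [P0 [P1 P2]].
    eapply Rle_trans; [apply Cmod_ge_0|]. eapply (CWp_bound rho A f); eauto. rewrite P1; lra. }
  destruct (Ccv_complete (fun k => f (RtoC (rho / (INR k + 1))))) as [l Hl].
  - intros e He. assert (L := lim_seq_point rho). apply is_lim_seq_spec in L.
    destruct (L (mkposreal (e / (2 * (A / rho + 1))) ltac:(apply Rdiv_lt_0_compat; lra))) as [N HN].
    simpl in HN. exists N. intros k Hk.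
    destruct (seq_point rho k Hr) as [P0 [P1 P2]]. destruct (seq_point rho N Hr) as [Q0 [Q1 Q2]].
    eapply Rle_trans; [apply (CWp_lip rho A f); auto; lra|]. rewrite P1, Q1.
    assert (E1 := HN k Hk). assert (E2 := HN N (le_n N)).
    rewrite Rminus_0_r, Rabs_pos_eq in E1, E2 by lra.
    apply Rle_trans with (2 * (e / (2 * (A / rho + 1))) * (A / rho + 1)).
    + apply Rmult_le_compat; lra.
    + apply Req_le; field. split; [lra|].
      assert (A / rho + 1 > 0) by lra. intros E. assert (A / rho + 1 = 0); [|lra].
      replace (A / rho + 1) with ((A + rho) / rho) by (field; lra). rewrite E. field. lra.
  - rewrite (Ccv_Clim_seq _ _ Hl); auto.
Qed.

Lemma CWp_coef0_lip rho A f z : 0 < rho -> CWp rho A f -> z <> RtoC 0 -> Cmod z <= rho ->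
  Cmod (f z - coef0 rho f)%C <= Cmod z * (A / rho).
Proof.
  intros Hr H Hz0 Hz.
  assert (HL := CWp_coef0 rho A f Hr H).
  assert (L1 : is_lim_seq (fun k => Cmod (f z - f (RtoC (rho / (INR k + 1))))%C) (Cmod (f z - coef0 rho f)%C)).
  { apply Ccv_Cmod. apply Ccv_minus; auto. apply Ccv_const. }
  assert (L2 : is_lim_seq (fun k => (Cmod z + rho / (INR k + 1)) * (A / rho)) ((Cmod z + 0) * (A / rho))).
  { apply (is_lim_seq_scal_r _ (A/rho) (Cmod z + 0)). apply is_lim_seq_plus'. apply is_lim_seq_const. apply lim_seq_point. }
  rewrite Rplus_0_r in L2.
  apply (is_lim_seq_le _ _ _ _) with (2 := L1) (3 := L2).
  intros k. destruct (seq_point rho k Hr) as [P0 [P1 P2]].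
  eapply Rle_trans; [apply (CWp_lip rho A f); auto; lra|]. rewrite P1; lra.
Qed.

Lemma CWp_coef0_bound rho A f : 0 < rho -> CWp rho A f -> Cmod (coef0 rho f) <= A.
Proof.
  intros Hr H. eapply Ccv_bound; [|apply (CWp_coef0 rho A f Hr H)].
  exists O; intros k _. destruct (seq_point rho k Hr) as [P0 [P1 P2]].
  apply (CWp_bound rho A f); auto; lra.
Qed.

(** If the polynomial [g] approximates [f] at the test points, the quotient of [g] approximates that
    of [f]: the error is divided by the modulus of the test point, and finitely many nonzero points
    give a bound [M] for these inverses. It remains to see that [g 0] is near [coef0 rho f]. *)
Lemma CWp_dquot rho A f : 0 < rho -> CWp rho A f -> CWp rho (A / rho) (dquot rho f).
Proof.
  intros Hr H l e He Hl.
  destruct (list_bound (fun x => / Cmod x) l) as [M [HM0 HM]].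
  assert (HA : 0 <= A / rho).
  { apply Rmult_le_pos; [|left; apply Rinv_0_lt_compat; auto].
    eapply Rle_trans; [apply Cmod_ge_0|apply (CWp_coef0_bound rho A f Hr H)]. }
  set (d0 := e / (M + 1) / 3).
  assert (Hd : 0 < d0) by (unfold d0; apply Rdiv_lt_0_compat; [apply Rdiv_lt_0_compat|]; lra).
  (* an auxiliary point [w] near [0], where [g 0] is compared with [coef0] *)
  assert (Hw : exists w, w <> RtoC 0 /\ Cmod w <= rho /\ Cmod w * (A / rho) <= d0 / 2).
  { assert (L := lim_seq_point rho). apply is_lim_seq_spec in L.
    destruct (L (mkposreal (d0 / (2 * (A / rho + 1))) ltac:(apply Rdiv_lt_0_compat; lra))) as [N HN].
    simpl in HN. specialize (HN N (le_n N)).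
    destruct (seq_point rho N Hr) as [P0 [P1 P2]]. rewrite Rminus_0_r, Rabs_pos_eq in HN by lra.
    exists (RtoC (rho / (INR N + 1))). rewrite P1. split; [auto|split; [lra|]].
    apply Rle_trans with (d0 / (2 * (A / rho + 1)) * (A / rho + 1)).
    apply Rmult_le_compat; lra. apply Req_le. set (q := A / rho) in *. field. lra. }
  destruct Hw as [w [Hw0 [Hw1 Hw2]]].
  destruct (H (w :: l) d0 Hd) as [g [Hg H1]].
  { intros x [<-|Hx]; auto. }
  destruct (Pol_split _ _ _ Hr Hg) as [q [Hq E]].
  exists q; split; auto. intros x Hx. destruct (Hl x Hx) as [Hx0 Hx1].
  assert (E1 : Cmod (g 0 - coef0 rho f)%C <= 2 * d0).
  { assert (G := Pol_lip _ _ _ (RtoC 0) w Hr Hg ltac:(rewrite Cmod_0; lra) Hw1).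
    rewrite Cmod_0, Rplus_0_l in G.
    assert (F := CWp_coef0_lip rho A f w Hr H Hw0 Hw1).
    assert (W := H1 w (or_introl eq_refl)). rewrite Cmod_sub_sym in W.
    assert (T1 := Cmod_triangle3 (g 0) (g w) (coef0 rho f)).
    assert (T2 := Cmod_triangle3 (g w) (f w) (coef0 rho f)). lra. }
  unfold dquot.
  replace ((f x - coef0 rho f) / x - q x)%C with (((f x - g x) + (g 0 - coef0 rho f)) / x)%C
    by (rewrite (E x); field; auto).
  rewrite Cmod_div by auto.
  assert (Hs : Cmod ((f x - g x) + (g 0 - coef0 rho f))%C <= 3 * d0).
  { eapply Rle_trans; [apply Cmod_triangle|]. generalize (H1 x (or_intror Hx)); lra. }
  apply Rle_trans with (3 * d0 * M).
  - apply Rmult_le_compat; auto; try apply Cmod_ge_0. left; apply Rinv_0_lt_compat, Cmod_gt_0; auto.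
  - unfold d0. apply Rle_trans with (e / (M + 1) * (M + 1)).
    + replace (3 * (e / (M + 1) / 3) * M) with (e / (M + 1) * M) by (field; lra).
      apply Rmult_le_compat_l; [left; apply Rdiv_lt_0_compat; lra|lra].
    + apply Req_le; field; lra.
Qed.

Fixpoint dquots rho (f : C -> C) (k : nat) : C -> C :=
  match k with O => f | S j => dquot rho (dquots rho f j) end.

Definition coef rho f k : C := coef0 rho (dquots rho f k).

Lemma CWp_dquots rho A f k : 0 < rho -> CWp rho A f -> CWp rho (A / rho ^ k) (dquots rho f k).
Proof.
  intros Hr H; induction k; simpl.
  - replace (A / 1) with A by field. auto.
  - replace (A / (rho * rho ^ k)) with (A / rho ^ k / rho). apply CWp_dquot; auto.
    field. split; [apply pow_nonzero; lra|lra].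
Qed.

Lemma dquots_expand rho f k z : z <> RtoC 0 ->
  f z = (csum (fun j => coef rho f j * z ^ j) k + z ^ k * dquots rho f k z)%C.
Proof.
  intros Hz; induction k; simpl. ring.
  rewrite IHk at 1. unfold dquot. fold (coef rho f k). field; auto.
Qed.

Lemma CW_CWp rho A f : CW rho A f -> CWp rho A f.
Proof. intros H l e He Hl. apply H; auto. intros x Hx; apply Hl; auto. Qed.

(** The remainder after [k] coefficients is [z^k] times the [k]-th iterated quotient, bounded by
    [A * (Cmod z / rho)^k]. The origin is treated separately, since the expansion divides by [z]. *)
Lemma CW_pseries rho A f z : 0 < rho -> CW rho A f -> Cmod z < rho ->
  Ccv (csum (fun j => coef rho f j * z ^ j)%C) (f z).
Proof.
  intros Hr H Hz. assert (Hp := CW_CWp _ _ _ H).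
  destruct (Ceq_dec z 0) as [->|Hz0].
  - assert (E : coef rho f 0 = f 0).
    { assert (L := CWp_coef0 rho A f Hr Hp). apply (Ccv_unique _ _ _ L).
      apply Ccv_dom with (fun k => rho / (INR k + 1) * (A / rho)).
      - exists O; intros k _. destruct (seq_point rho k Hr) as [P0 [P1 P2]].
        eapply Rle_trans; [apply (CW_lip rho A f); auto; lra|]. rewrite P1; lra.
      - replace (Finite 0) with (Rbar_mult 0 (A / rho)) by (simpl; f_equal; ring).
        apply is_lim_seq_scal_r, lim_seq_point. }
    apply Ccv_ext_loc with (fun _ => f 0); [|apply Ccv_const].
    exists 1%nat. intros k Hk. destruct k; [lia|]. clear Hk. induction k.
    + simpl. unfold coef in E. simpl in E. unfold coef; simpl. rewrite E; ring.
    + simpl in *. rewrite <- IHk. ring.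
  - apply Ccv_dom with (fun k => A * (Cmod z / rho) ^ k).
    + exists O; intros k _. rewrite (dquots_expand rho f k z Hz0) at 1.
      replace (csum (fun j => coef rho f j * z ^ j) k - _)%C with (- (z ^ k * dquots rho f k z))%C by ring.
      rewrite Cmod_opp, Cmod_mult, Cmod_pow.
      assert (B := CWp_bound _ _ _ z (CWp_dquots rho A f k Hr Hp) Hz0 ltac:(lra)).
      apply Rle_trans with (Cmod z ^ k * (A / rho ^ k)).
      apply Rmult_le_compat_l; auto. apply pow_le, Cmod_ge_0.
      unfold Rdiv. rewrite Rpow_mult_distr, pow_inv. apply Req_le; ring.
    + replace (Finite 0) with (Rbar_mult A 0) by (simpl; f_equal; ring).
      apply is_lim_seq_scal_l. apply is_lim_seq_geom.
      rewrite Rabs_pos_eq. apply Rlt_div_l; auto; lra. apply Rmult_le_pos; [apply Cmod_ge_0|left; apply Rinv_0_lt_compat; auto].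
Qed.

(** Zeros accumulating at the origin pass to every iterated quotient: once a coefficient vanishes,
    the next quotient vanishes at the same points, so its limit at 0, the next coefficient, vanishes
    too. *)
Lemma CW_zero rho A f z : 0 < rho -> CW rho A f ->
  (forall e, 0 < e -> exists w, w <> RtoC 0 /\ Cmod w <= rho /\ Cmod w < e /\ f w = RtoC 0) ->
  Cmod z < rho -> f z = RtoC 0.
Proof.
  intros Hr H Hw Hz. assert (Hp := CW_CWp _ _ _ H).
  assert (K : forall k, coef rho f k = RtoC 0 /\ forall w, w <> RtoC 0 -> f w = RtoC 0 -> dquots rho f k w = RtoC 0).
  { assert (Step : forall k, (forall w, w <> RtoC 0 -> f w = RtoC 0 -> dquots rho f k w = RtoC 0) -> coef rho f k = RtoC 0).
    { intros k Hk. assert (Hd := CWp_dquots rho A f k Hr Hp).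
      set (B := A / rho ^ k / rho).
      assert (HB : 0 <= B).
      { unfold B. apply Rmult_le_pos; [|left; apply Rinv_0_lt_compat; auto].
        eapply Rle_trans; [apply Cmod_ge_0|apply (CWp_coef0_bound _ _ _ Hr Hd)]. }
      apply Cmod_eq_0. apply Rle_antisym; [|apply Cmod_ge_0].
      apply le_epsilon. intros e He. rewrite Rplus_0_l.
      destruct (Hw (e / (B + 1))) as [w [W0 [W1 [W2 W3]]]]. apply Rdiv_lt_0_compat; lra.
      assert (L := CWp_coef0_lip _ _ _ w Hr Hd W0 W1). fold (coef rho f k) in L. fold B in L.
      rewrite (Hk w W0 W3) in L. replace (0 - coef rho f k)%C with (- coef rho f k)%C in L by ring.
      rewrite Cmod_opp in L. eapply Rle_trans; [apply L|].
      apply Rle_trans with (e / (B + 1) * (B + 1)). apply Rmult_le_compat; try lra. apply Cmod_ge_0.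
      apply Req_le; field; lra. }
    induction k.
    - split; auto.
    - destruct IHk as [E1 E2].
      assert (E3 : forall w, w <> RtoC 0 -> f w = RtoC 0 -> dquots rho f (S k) w = RtoC 0).
      { intros w W0 W1. simpl. unfold dquot. fold (coef rho f k). rewrite E1, E2 by auto. field. auto. }
      split; auto. }
  apply (Ccv_unique _ _ _ (CW_pseries rho A f z Hr H Hz)).
  apply Ccv_ext with (fun _ => RtoC 0); [|apply Ccv_const].
  intros k. induction k; simpl; auto. rewrite <- IHk, (proj1 (K k)). ring.
Qed.

(** * Holomorphy at a point *)

(** Equivalent to [analytic_at] by the next lemmas, but stable under products, inverses,
    exponentials and limits without any manipulation of coefficients. *)
Definition Hol (f : C -> C) (s : C) : Prop := exists rho A, 0 < rho /\ CW rho A (fun z => f (s + z)%C).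

Lemma pow_n_Cpow (z : C) k : pow_n (K := C_Ring) z k = (z ^ k)%C.
Proof. induction k; simpl; [auto|]. rewrite IHk. auto. Qed.

Lemma Hol_analytic f s : Hol f s -> analytic_at f s.
Proof.
  intros [rho [A [Hr H]]]. exists (coef rho (fun z => f (s + z)%C)), rho. split; auto.
  intros w Hw. unfold is_pseries. apply is_series_Ccv.
  assert (K := CW_pseries rho A _ (w - s)%C Hr H Hw). simpl in K.
  replace (s + (w - s))%C with w in K by ring.
  eapply Ccv_ext; [|apply K]. intros k. apply csum_ext. intros j _.
  rewrite <- pow_n_Cpow. apply Cmult_comm.
Qed.

Lemma analytic_Hol f s : analytic_at f s -> Hol f s.
Proof.
  intros [a [r [Hr H]]].
  assert (Hs : forall z, Cmod z < r -> Ccv (csum (fun k => a k * z ^ k)%C) (f (s + z)%C)).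
  { intros z Hz. specialize (H (s + z)%C). replace (s + z - s)%C with z in H by ring.
    specialize (H Hz). apply is_series_Ccv in H. eapply Ccv_ext; [|apply H].
    intros k. apply csum_ext. intros j _. rewrite <- pow_n_Cpow. apply Cmult_comm. }
  set (q := r / 2).
  assert (Hq : 0 < q < r) by (unfold q; lra).
  (* Convergence at [q] bounds the terms there: late terms are differences of two partial sums, each
     within 1 of the limit, which gives the 2. *)
  assert (B : exists B, forall k, Cmod (a k) * q ^ k <= B).
  { assert (Hc := Hs (RtoC q)). rewrite Cmod_RtoC_pos in Hc by lra. specialize (Hc (proj2 Hq)).
    destruct (Hc 1 ltac:(lra)) as [N HN].
    assert (F : exists B, forall k, (k < N)%nat -> Cmod (a k) * q ^ k <= B).
    { clear HN. induction N. exists 0; intros; lia. destruct IHN as [B HB].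
      exists (Rmax B (Cmod (a N) * q ^ N)). intros k Hk. destruct (Nat.eq_dec k N) as [->|]. apply Rmax_r.
      eapply Rle_trans; [apply HB; lia|apply Rmax_l]. }
    destruct F as [B HB]. exists (Rmax B 2). intros k. destruct (Nat.lt_ge_cases k N).
    eapply Rle_trans; [apply HB; lia|apply Rmax_l].
    eapply Rle_trans; [|apply Rmax_r].
    assert (E1 := HN k ltac:(lia)). assert (E2 := HN (S k) ltac:(lia)). simpl in E2.
    replace (Cmod (a k) * q ^ k) with (Cmod (a k * RtoC q ^ k)%C).
    2:{ rewrite Cmod_mult, Cmod_pow, Cmod_RtoC_pos by lra; auto. }
    set (S0 := csum (fun k => (a k * RtoC q ^ k)%C) k) in *.
    replace (a k * RtoC q ^ k)%C with ((S0 + a k * RtoC q ^ k - f (s + RtoC q)) + - (S0 - f (s + RtoC q)))%C by ring.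
    eapply Rle_trans; [apply Cmod_triangle|]. rewrite Cmod_opp. lra. }
  destruct B as [B HB].
  assert (HB0 : 0 <= B).
  { eapply Rle_trans; [|apply (HB O)]. simpl. rewrite Rmult_1_r. apply Cmod_ge_0. }
  (* At half the radius the bounded terms become [B / 2^j], whose sum is at most [2 * B]. *)
  exists (q / 2), (B * 2). split; [lra|].
  apply (CW_lim _ _ (fun k z => csum (fun j => a j * z ^ j)%C k)).
  - exists O; intros k _.
    eapply CW_le; [|apply (CW_csum (q/2) (fun j => B * (/ 2) ^ j) (fun j z => a j * z ^ j)%C)].
    + rewrite rsum_scal. apply Rmult_le_compat_l; auto.
      eapply Rle_trans; [apply rsum_geom_le; lra|lra].
    + intros j _. eapply CW_le; [|apply CW_scal; [lra|apply CW_pow; [lra|apply CW_id]]].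
      unfold Rdiv. rewrite Rpow_mult_distr, <- Rmult_assoc.
      apply Rmult_le_compat_r; auto. apply pow_le; lra.
  - intros z Hz. apply Hs. lra.
Qed.

Lemma Hol_ext_loc f g s : (exists r, 0 < r /\ forall z, Cmod (z - s)%C < r -> f z = g z) -> Hol f s -> Hol g s.
Proof.
  intros [r [Hr E]] [rho [A [Hrho H]]]. exists (Rmin rho (r/2)), A.
  assert (Hm : 0 < Rmin rho (r/2)) by (apply Rmin_glb_lt; lra). split; auto.
  apply CW_ext with (fun z => f (s + z)%C).
  - intros z Hz. apply E. replace (s + z - s)%C with z by ring.
    assert (Rmin rho (r/2) <= r/2) by apply Rmin_r. lra.
  - eapply CW_shrink; [|apply H]. split; [lra|apply Rmin_l].
Qed.

Lemma Hol_const c s : Hol (fun _ => c) s.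
Proof. exists 1, (Cmod c). split; [lra|]. apply CW_const. Qed.

Lemma Hol_id s : Hol (fun z => z) s.
Proof. exists 1, (Cmod s + 1). split; [lra|]. apply CW_plus. apply CW_const. apply CW_id. Qed.

Lemma Hol_plus f g s : Hol f s -> Hol g s -> Hol (fun z => f z + g z)%C s.
Proof.
  intros [r1 [A [H1 Hf]]] [r2 [B [H2 Hg]]]. exists (Rmin r1 r2), (A + B).
  assert (Hm : 0 < Rmin r1 r2) by (apply Rmin_glb_lt; lra). split; auto.
  apply CW_plus; eapply CW_shrink; try eassumption; split; try lra; [apply Rmin_l|apply Rmin_r].
Qed.

Lemma Hol_mult f g s : Hol f s -> Hol g s -> Hol (fun z => f z * g z)%C s.
Proof.
  intros [r1 [A [H1 Hf]]] [r2 [B [H2 Hg]]]. exists (Rmin r1 r2), (A * B).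
  assert (Hm : 0 < Rmin r1 r2) by (apply Rmin_glb_lt; lra). split; auto.
  apply CW_mult; [lra| |]; eapply CW_shrink; try eassumption; split; try lra; [apply Rmin_l|apply Rmin_r].
Qed.

Lemma Hol_opp f s : Hol f s -> Hol (fun z => - f z)%C s.
Proof.
  intros [r [A [Hr H]]]. exists r, A; split; auto. apply CW_opp; auto; lra.
Qed.

Lemma Hol_minus f g s : Hol f s -> Hol g s -> Hol (fun z => f z - g z)%C s.
Proof. intros; apply Hol_plus; auto; apply Hol_opp; auto. Qed.

Lemma Hol_inv f s : f s <> RtoC 0 -> Hol f s -> Hol (fun z => / f z)%C s.
Proof.
  intros Hs [r [A [Hr H]]].
  assert (Hm : 0 < Cmod (f s)) by (apply Cmod_gt_0; auto).
  assert (HA := CW_pos _ _ _ (Rlt_le _ _ Hr) H).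
  (* On this radius [f - f s] has norm below half of [Cmod (f s)], as [CW_inv] requires; [A + 1]
     avoids dividing by 0. *)
  set (r' := Rmin r (r * (Cmod (f s) / (2 * (A + 1))))).
  assert (Hr' : 0 < r').
  { apply Rmin_glb_lt; auto. apply Rmult_lt_0_compat; auto. apply Rdiv_lt_0_compat; lra. }
  assert (H1 := CW_center r r' A _ Hr (conj (Rlt_le _ _ Hr') (Rmin_l _ _)) H). simpl in H1.
  apply CW_opp in H1; [|lra].
  exists r'. eexists. split; auto.
  apply CW_ext with (fun z => / (f s - - (f (s + z) - f (s + 0))))%C.
  { intros z _. rewrite Cplus_0_r. replace (f s - - (f (s + z) - f s))%C with (f (s + z)%C) by ring. auto. }
  apply CW_inv; [lra|apply H1|].
  apply Rle_lt_trans with (r * (Cmod (f s) / (2 * (A + 1))) * (A / r)).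
  - apply Rmult_le_compat_r. apply Rmult_le_pos; auto. left; apply Rinv_0_lt_compat; auto. apply Rmin_r.
  - replace (r * (Cmod (f s) / (2 * (A + 1))) * (A / r)) with (Cmod (f s) * (A / (2 * (A + 1)))) by (field; lra).
    rewrite <- (Rmult_1_r (Cmod (f s))) at 2. apply Rmult_lt_compat_l; auto. apply Rlt_div_l; lra.
Qed.

Lemma Hol_div f g s : g s <> RtoC 0 -> Hol f s -> Hol g s -> Hol (fun z => f z / g z)%C s.
Proof. intros; apply Hol_mult; auto. apply Hol_inv; auto. Qed.

Lemma Hol_comp_aff f a b s : a <> RtoC 0 -> Hol f (a * s + b)%C -> Hol (fun z => f (a * z + b)%C) s.
Proof.
  intros Ha [r [A [Hr H]]]. assert (Hm : 0 < Cmod a) by (apply Cmod_gt_0; auto).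
  exists (r / Cmod a), A. split. apply Rdiv_lt_0_compat; auto.
  apply CW_ext with (fun z => f (a * s + b + a * z)%C). { intros; f_equal; ring. }
  apply (CW_comp_scal a (r / Cmod a) A (fun z => f (a * s + b + z)%C)).
  replace (Cmod a * (r / Cmod a)) with r by (field; lra). auto.
Qed.

Lemma Hol_continuous f s (u : nat -> C) : Hol f s -> Ccv u s -> Ccv (fun k => f (u k)) (f s).
Proof.
  intros [r [A [Hr H]]] Hu.
  destruct (Hu r Hr) as [N HN].
  apply Ccv_dom with (fun k => Cmod (u k - s)%C * (A / r)).
  - exists N. intros k Hk. assert (L := CW_lip r A _ (u k - s)%C Hr H ltac:(left; apply HN; auto)).
    simpl in L. rewrite Cplus_0_r in L. replace (s + (u k - s))%C with (u k) in L by ring. auto.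
  - replace (Finite 0) with (Rbar_mult (Cmod (s - s)%C) (A / r)).
    apply is_lim_seq_scal_r. apply (Ccv_Cmod (fun k => u k - s)%C). apply Ccv_minus; auto; apply Ccv_const.
    replace (s - s)%C with (RtoC 0) by ring. rewrite Cmod_0. simpl; f_equal; ring.
Qed.

Lemma Hol_zero_near f s : Hol f s ->
  (forall e, 0 < e -> exists w, w <> s /\ Cmod (w - s)%C < e /\ f w = RtoC 0) ->
  exists r, 0 < r /\ forall z, Cmod (z - s)%C < r -> f z = RtoC 0.
Proof.
  intros [r [A [Hr H]]] Hw. exists r; split; auto. intros z Hz.
  replace z with (s + (z - s))%C by ring.
  apply (CW_zero r A (fun z => f (s + z)%C) (z - s)%C); auto.
  intros e He. destruct (Hw (Rmin e r)) as [w [W0 [W1 W2]]]. apply Rmin_glb_lt; auto.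
  exists (w - s)%C. split; [|split; [|split]].
  - apply Cminus_eq_contra; auto.
  - left; eapply Rlt_le_trans; [apply W1|apply Rmin_r].
  - eapply Rlt_le_trans; [apply W1|apply Rmin_l].
  - replace (s + (w - s))%C with w by ring; auto.
Qed.

(* Analytic continuation along a segment, on which [f] vanishes up to a supremum [T]. *)
Lemma Hol_zero_segment f (p q : C) : p <> q ->
  (forall t, 0 <= t <= 1 -> Hol f (p + RtoC t * (q - p))%C) ->
  (exists r, 0 < r /\ forall z, Cmod (z - p)%C < r -> f z = RtoC 0) -> f q = RtoC 0.
Proof.
  intros Hpq Hh [r0 [Hr0 Hp]].
  set (g := fun t : R => (p + RtoC t * (q - p))%C).
  assert (Hm : 0 < Cmod (q - p)%C) by (apply Cmod_gt_0, Cminus_eq_contra; auto).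
  assert (Hg : forall t t', Cmod (g t - g t')%C = Rabs (t - t') * Cmod (q - p)%C).
  { intros t t'. unfold g. replace (p + RtoC t * (q - p) - (p + RtoC t' * (q - p)))%C with (RtoC (t - t') * (q - p))%C
      by (rewrite RtoC_minus; ring). rewrite Cmod_mult, Cmod_R; auto. }
  (* Parameters up to which [f] vanishes on the segment. At the supremum [T] the zeros below
     accumulate, so [f] vanishes on a disc around [g T]; if [T < 1], that disc pushes past [T]. *)
  set (E := fun t => 0 <= t <= 1 /\ forall u, 0 <= u <= t -> f (g u) = RtoC 0).
  assert (E0 : E 0).
  { split; [lra|]. intros u Hu. apply Hp. replace u with 0 by lra.
    unfold g. replace (p + RtoC 0 * (q - p) - p)%C with (RtoC 0) by ring. rewrite Cmod_0; auto. }
  destruct (completeness E) as [T [HT1 HT2]].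
  { exists 1. intros t [Ht _]; lra. } { exists 0; auto. }
  assert (HT : 0 <= T <= 1).
  { split; [apply HT1; auto|apply HT2; intros t [Ht _]; lra]. }
  assert (Hbelow : forall u, 0 <= u < T -> f (g u) = RtoC 0).
  { intros u Hu. destruct (Classical_Prop.classic (exists t, E t /\ u <= t)) as [[t [[_ Ht] Hut]]|Hn].
    apply Ht; lra. exfalso. assert (T <= u); [|lra]. apply HT2. intros t Ht.
    destruct (Rle_lt_dec t u); auto. exfalso; apply Hn. exists t; split; auto; lra. }
  assert (Hnear : exists r, 0 < r /\ forall z, Cmod (z - g T)%C < r -> f z = RtoC 0).
  { destruct (Req_dec T 0) as [->|HT0].
    - exists r0; split; auto. intros z Hz. apply Hp. unfold g in Hz.
      replace (p + RtoC 0 * (q - p))%C with p in Hz by ring. auto.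
    - apply Hol_zero_near. apply Hh; auto. intros e He.
      set (h := Rmin T (e / (2 * Cmod (q - p)%C))).
      assert (Hh0 : 0 < h) by (apply Rmin_glb_lt; [lra|apply Rdiv_lt_0_compat; lra]).
      assert (Hh1 : h <= T) by apply Rmin_l.
      assert (Hh2 : h <= e / (2 * Cmod (q - p)%C)) by apply Rmin_r.
      assert (D : Cmod (g (T - h)%R - g T)%C = h * Cmod (q - p)%C).
      { rewrite Hg. f_equal. replace (T - h - T) with (- h) by ring. rewrite Rabs_Ropp, Rabs_pos_eq; lra. }
      exists (g (T - h)). split; [|split].
      + intros Eq. rewrite Eq in D. replace (g T - g T)%C with (RtoC 0) in D by ring. rewrite Cmod_0 in D. nra.
      + rewrite D. apply Rle_lt_trans with (e / (2 * Cmod (q - p)%C) * Cmod (q - p)%C).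
        apply Rmult_le_compat_r; lra.
        replace (e / (2 * Cmod (q - p)) * Cmod (q - p)) with (e / 2) by (field; lra). lra.
      + apply Hbelow; lra. }
  destruct Hnear as [r [Hr Hz]].
  assert (ET : f (g T) = RtoC 0).
  { apply Hz. replace (g T - g T)%C with (RtoC 0) by ring. rewrite Cmod_0; auto. }
  destruct (Req_dec T 1) as [H1|H1].
  - replace q with (g T); auto. unfold g. rewrite H1. ring.
  - exfalso. set (h := Rmin (1 - T) (r / (2 * Cmod (q - p)%C))).
    assert (Hh0 : 0 < h) by (apply Rmin_glb_lt; [lra|apply Rdiv_lt_0_compat; lra]).
    assert (Hh1 : h <= 1 - T) by apply Rmin_l.
    assert (Hh2 : h <= r / (2 * Cmod (q - p)%C)) by apply Rmin_r.
    assert (T + h <= T); [|lra]. apply HT1. split; [lra|]. intros u Hu.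
    destruct (Rlt_le_dec u T). apply Hbelow; lra.
    apply Hz. rewrite Hg, Rabs_pos_eq by lra.
    apply Rle_lt_trans with (r / (2 * Cmod (q - p)%C) * Cmod (q - p)%C).
    apply Rmult_le_compat_r; lra.
    replace (r / (2 * Cmod (q - p)) * Cmod (q - p)) with (r / 2) by (field; lra). lra.
Qed.

(** * The exponential series *)

Lemma RtoC_neq0 (r : R) : r <> 0 -> RtoC r <> RtoC 0.
Proof. intros H E. apply H. injection E; auto. Qed.

Lemma fact_neq0 k : RtoC (INR (fact k)) <> RtoC 0.
Proof. apply RtoC_neq0, INR_fact_neq_0. Qed.

Definition expterm (z : C) (k : nat) : C := (z ^ k / RtoC (INR (fact k)))%C.

Lemma rsum_exp_le a k : 0 <= a -> rsum (fun j => a ^ j / INR (fact j)) k <= exp a.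
Proof.
  intros Ha. destruct k. simpl. left; apply exp_pos.
  eapply Rle_trans; [|apply (exp_ge_taylor a k Ha)]. right.
  clear. induction k. simpl. ring. simpl in *. rewrite <- IHk. ring.
Qed.

Lemma summable_exp a : 0 <= a -> summable (fun j => a ^ j / INR (fact j)).
Proof. intros Ha. exists (exp a). intros; apply rsum_exp_le; auto. Qed.

Lemma expterm_der z k t : cder (fun u => csum (expterm (RtoC u * z)) (S k)) t (z * csum (expterm (RtoC t * z)) k)%C.
Proof.
  induction k.
  - simpl. rewrite Cmult_0_r. apply cder_ext with (fun _ => (0 + 1 / RtoC (INR 1))%C).
    intros; unfold expterm; simpl. auto. apply cder_const.
  - replace (z * csum (expterm (RtoC t * z)) (S k))%C with
     (z * csum (expterm (RtoC t * z)) k + z * expterm (RtoC t * z) k)%C by (simpl; ring).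
    apply (cder_plus (fun u => csum (expterm (RtoC u * z)) (S k)) (fun u => expterm (RtoC u * z) (S k))); auto.
    unfold expterm.
    assert (D : cder (fun u => RtoC (u ^ S k)) t (RtoC (INR (S k) * t ^ k))).
    { apply cder_RtoC. evar_last. apply is_derive_pow, is_derive_id. simpl. unfold one; simpl. ring. }
    apply (cder_scal (z ^ S k / RtoC (INR (fact (S k))))%C) in D.
    replace (z * ((RtoC t * z) ^ k / RtoC (INR (fact k))))%C
      with (z ^ S k / RtoC (INR (fact (S k))) * RtoC (INR (S k) * t ^ k))%C.
    + eapply cder_ext; [|exact D]. intros u. rewrite Cpow_mult_l, RtoC_pow. unfold Cdiv; ring.
    + rewrite Cpow_mult_l, RtoC_mult, RtoC_pow, fact_simpl, mult_INR, RtoC_mult.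
      rewrite (Cpow_S z). field. split; [apply fact_neq0|apply RtoC_neq0, (not_0_INR (S k)); lia].
Qed.

Lemma is_RInt_pow_0 k t : is_RInt (fun u => u ^ k) 0 t (t ^ S k / INR (S k)).
Proof.
  assert (Hk : INR (S k) <> 0) by (apply not_0_INR; lia).
  replace (t ^ S k / INR (S k)) with (minus (/ INR (S k) * t ^ S k) (/ INR (S k) * 0 ^ S k)).
  2:{ unfold minus, plus, opp; simpl (0 ^ S k). simpl AbelianGroup.opp. simpl. field. auto. }
  apply (is_RInt_derive (V:=R_CompleteNormedModule) (fun u => / INR (S k) * u ^ S k) (fun u => u ^ k)).
  - intros u _. evar_last. apply is_derive_scal. apply is_derive_pow. apply (is_derive_id (K:=R_AbsRing)).
    change (/ INR (S k) * (INR (S k) * 1 * u ^ k) = u ^ k). field. auto.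
  - intros u _. apply (ex_derive_continuous (K:=R_AbsRing) (V:=R_NormedModule)). eexists.
    apply is_derive_pow. apply (is_derive_id (K:=R_AbsRing)).
Qed.

(** Induction on [k]: the derivative in [t] of one remainder is [z] times the previous one, which is
    then integrated from 0. The base [2 * Cmod z] records the factor 2 that [cint_bound] costs at
    each step; the factorial still wins. *)
Lemma Cexp_taylor z k : forall t, 0 <= t <= 1 ->
  Cmod (Cexp (RtoC t * z) - csum (expterm (RtoC t * z)) k)%C
    <= exp (Cmod z) * ((2 * Cmod z) ^ k * t ^ k / INR (fact k)).
Proof.
  assert (Hc := Cmod_ge_0 z).
  induction k; intros t Ht.
  - simpl. replace (Cexp (RtoC t * z) - 0)%C with (Cexp (RtoC t * z)) by ring.
    rewrite Cmod_Cexp. replace (exp (Cmod z) * (1 * 1 / 1)) with (exp (Cmod z)) by field.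
    assert (H := Cmod_fst z). apply Rabs_le_between in H.
    assert (E : fst (RtoC t * z)%C <= Cmod z) by (simpl; nra).
    destruct E as [E|E]. left; apply exp_increasing; auto. rewrite E; lra.
  - set (f := fun u => (Cexp (RtoC u * z) - csum (expterm (RtoC u * z)) (S k))%C).
    assert (D : forall u, cder f u (z * (Cexp (RtoC u * z) - csum (expterm (RtoC u * z)) k))%C).
    { intros u. replace (z * (Cexp (RtoC u * z) - csum (expterm (RtoC u * z)) k))%C
        with (z * Cexp (RtoC u * z) - z * csum (expterm (RtoC u * z)) k)%C by ring.
      apply cder_minus; [|apply expterm_der].
      rewrite (Cmult_comm (RtoC u)). eapply cder_ext; [|apply cder_Cexp_lin]. intros; simpl; f_equal; ring. }
    assert (Hcont : forall u, ccont (fun u => z * (Cexp (RtoC u * z) - csum (expterm (RtoC u * z)) k))%C u).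
    { intros u. apply ccont_mult; [apply ccont_const|]. apply ccont_minus.
      - eapply cder_ccont. apply cder_ext with (2 := cder_Cexp_lin z u). intros; simpl; f_equal; ring.
      - destruct k. apply ccont_const. eapply cder_ccont, expterm_der. }
    assert (I := cint_FTC f (fun u => z * (Cexp (RtoC u * z) - csum (expterm (RtoC u * z)) k))%C 0 t
       (proj1 Ht) (fun u _ => D u) (fun u _ => Hcont u)).
    assert (F0 : f 0 = RtoC 0).
    { unfold f. rewrite Cmult_0_l, Cexp_0. clear. induction k.
      unfold expterm; simpl. replace (RtoC (INR 1)) with (RtoC 1) by (simpl; auto). field.
      transitivity (1 - csum (expterm 0) (S k))%C; [|exact IHk].
      change (csum (expterm 0) (S (S k))) with (csum (expterm 0) (S k) + expterm 0 (S k))%C.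
      assert (E0 : expterm 0 (S k) = RtoC 0) by (unfold expterm; rewrite Cpow_S; unfold Cdiv; ring).
      rewrite E0. ring. }
    rewrite F0 in I. replace (f t - 0)%C with (f t) in I by ring.
    replace (exp (Cmod z) * ((2 * Cmod z) ^ S k * t ^ S k / INR (fact (S k)))) with
      (2 * (exp (Cmod z) * Cmod z * (2 * Cmod z) ^ k / INR (fact k) * (t ^ S k / INR (S k)))).
    2:{ rewrite fact_simpl, mult_INR. simpl pow. field. split; [apply INR_fact_neq_0|apply not_0_INR; lia]. }
    apply (cint_bound _ (fun u => exp (Cmod z) * Cmod z * (2 * Cmod z) ^ k / INR (fact k) * u ^ k) 0 t _ _ (proj1 Ht)) with (2 := I).
    + intros u Hu. rewrite Cmod_mult.
      eapply Rle_trans; [apply Rmult_le_compat_l; [auto|apply IHk; lra]|]. apply Req_le; unfold Rdiv; ring.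
    + apply (is_RInt_scal (V:=R_NormedModule)). apply is_RInt_pow_0.
Qed.

Lemma lim_pow_fact a : 0 <= a -> is_lim_seq (fun k => a ^ k / INR (fact k)) 0.
Proof.
  intros Ha. apply is_lim_seq_spec. intros e.
  destruct (summable_tail (fun j => a ^ j / INR (fact j))) with (eps := e / 2) as [N HN].
  - intros k. apply Rmult_le_pos. apply pow_le; auto. left; apply Rinv_0_lt_compat, INR_fact_lt_0.
  - apply summable_exp; auto.
  - destruct e; simpl; lra.
  - exists N. intros k Hk. rewrite Rminus_0_r, Rabs_pos_eq.
    2:{ apply Rmult_le_pos. apply pow_le; auto. left; apply Rinv_0_lt_compat, INR_fact_lt_0. }
    assert (H := HN (S k) ltac:(lia)).
    assert (H2 := rsum_incr (fun j => a ^ j / INR (fact j)) N k).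
    simpl in H. destruct e as [e He]; simpl in *.
    specialize (H2 ltac:(intros; apply Rmult_le_pos; [apply pow_le; auto|left; apply Rinv_0_lt_compat, INR_fact_lt_0]) Hk). lra.
Qed.

Lemma Ccv_exp z : Ccv (csum (expterm z)) (Cexp z).
Proof.
  apply Ccv_dom with (fun k => exp (Cmod z) * ((2 * Cmod z) ^ k / INR (fact k))).
  - exists O; intros k _. rewrite Cmod_sub_sym.
    assert (H := Cexp_taylor z k 1 ltac:(lra)). rewrite Cmult_1_l, pow1, Rmult_1_r in H. exact H.
  - replace (Finite 0) with (Rbar_mult (exp (Cmod z)) 0) by (simpl; f_equal; ring).
    apply is_lim_seq_scal_l, lim_pow_fact. generalize (Cmod_ge_0 z); lra.
Qed.

Lemma csum_split2 (a : nat -> C) k : csum a (S (S k)) = (a O + a 1%nat + csum (fun j => a (S (S j))) k)%C.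
Proof. induction k. simpl; ring. simpl in *. rewrite IHk. ring. Qed.

Lemma fact_SS k : INR (fact k) <= INR (fact (S (S k))).
Proof. apply le_INR. simpl. nia. Qed.

Lemma CW_exp rho A f : 0 <= rho -> CW rho A f -> CW rho (exp A) (fun z => Cexp (f z)).
Proof.
  intros Hr H. assert (HA := CW_pos _ _ _ Hr H).
  apply (CW_lim rho _ (fun k z => csum (expterm (f z)) k)).
  - exists O; intros k _. eapply CW_le; [apply (rsum_exp_le A k HA)|].
    apply (CW_csum rho (fun j => A ^ j / INR (fact j)) (fun j z => expterm (f z) j)).
    intros j _. unfold expterm, Rdiv, Cdiv.
    apply CW_mult; auto. apply CW_pow; auto.
    eapply CW_le; [|apply CW_const]. rewrite Cmod_inv, Cmod_RtoC_pos; try lra. apply pos_INR. apply fact_neq0.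
  - intros z _. apply Ccv_exp.
Qed.

(** The second-order remainder of the exponential; it yields the inverse-square decay of the factors
    in the product for [1 / Gamma]. *)
Lemma CW_exp2 rho A f : 0 <= rho -> CW rho A f -> CW rho (A ^ 2 * exp A) (fun z => Cexp (f z) - 1 - f z)%C.
Proof.
  intros Hr H. assert (HA := CW_pos _ _ _ Hr H).
  apply (CW_lim rho _ (fun k z => csum (fun j => expterm (f z) (S (S j))) k)).
  - exists O; intros k _. apply CW_le with (rsum (fun j => A ^ 2 * (A ^ j / INR (fact j))) k).
    rewrite rsum_scal. apply Rmult_le_compat_l. apply pow2_ge_0. apply rsum_exp_le; auto.
    apply (CW_csum rho (fun j => A ^ 2 * (A ^ j / INR (fact j))) (fun j z => expterm (f z) (S (S j)))).
    intros j _. unfold expterm, Rdiv, Cdiv.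
    eapply CW_le; [|apply CW_mult; [auto| |apply CW_const]]. 2: apply CW_pow; eauto.
    rewrite Cmod_inv, Cmod_RtoC_pos by (try apply pos_INR; apply fact_neq0).
    replace (A ^ 2 * (A ^ j * / INR (fact j))) with (A ^ S (S j) * / INR (fact j)) by (simpl; ring).
    apply Rmult_le_compat_l. apply pow_le; auto. apply Rinv_le_contravar. apply INR_fact_lt_0. apply fact_SS.
  - intros z _.
    apply Ccv_ext with (fun k => csum (expterm (f z)) (S (S k)) - 1 - f z)%C.
    + intros k. rewrite csum_split2. unfold expterm at 1 2. simpl. field.
    + apply Ccv_minus; [apply Ccv_minus|]; try apply Ccv_const.
      apply (Ccv_subseq (fun k => S (S k))). intros; lia. apply Ccv_exp.
Qed.

(** * Infinite products *)

Fixpoint cprod (a : nat -> C) (k : nat) : C :=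
  match k with O => RtoC 1 | S j => (cprod a j * a j)%C end.

Lemma cprod_ext (a b : nat -> C) k : (forall j, (j < k)%nat -> a j = b j) -> cprod a k = cprod b k.
Proof. induction k; intros H; simpl; auto. rewrite IHk, H by (intros; auto; apply H; lia); auto. Qed.

Lemma cprod_neq0 a k : (forall j, (j < k)%nat -> a j <> RtoC 0) -> cprod a k <> RtoC 0.
Proof.
  induction k; intros H; simpl. apply C1_nz. apply Cmult_neq_0; [apply IHk; intros|]; apply H; lia.
Qed.

Lemma cprod_split a n k : cprod a (n + k) = (cprod a n * cprod (fun j => a (n + j)%nat) k)%C.
Proof.
  induction k. rewrite Nat.add_0_r; simpl; ring. rewrite Nat.add_succ_r; simpl. rewrite IHk; ring.
Qed.

Lemma cprod_bound (a : nat -> C) (b : nat -> R) k : (forall j, Cmod (a j - 1)%C <= b j) ->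
  Cmod (cprod a k) <= exp (rsum b k).
Proof.
  intros H; induction k; simpl. rewrite Cmod_1, exp_0; lra.
  rewrite Cmod_mult, exp_plus. apply Rmult_le_compat; auto; try apply Cmod_ge_0.
  replace (a k) with ((a k - 1) + 1)%C by ring. eapply Rle_trans; [apply Cmod_triangle|].
  rewrite Cmod_1. generalize (exp_ineq1_le (b k)) (H k); lra.
Qed.

Lemma cprod_m1 (a : nat -> C) (b : nat -> R) k : (forall j, Cmod (a j - 1)%C <= b j) ->
  Cmod (cprod a k - 1)%C <= exp (rsum b k) - 1.
Proof.
  intros H; induction k; simpl. replace (1 - 1)%C with (RtoC 0) by ring. rewrite Cmod_0, exp_0; lra.
  replace (cprod a k * a k - 1)%C with (cprod a k * (a k - 1) + (cprod a k - 1))%C by ring.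
  eapply Rle_trans; [apply Cmod_triangle|]. rewrite Cmod_mult, exp_plus.
  assert (B := cprod_bound a b k H). specialize (H k).
  assert (Cmod (cprod a k) * Cmod (a k - 1)%C <= exp (rsum b k) * b k).
  { apply Rmult_le_compat; auto; apply Cmod_ge_0. }
  assert (exp (rsum b k) * (1 + b k) <= exp (rsum b k) * exp (b k)).
  { apply Rmult_le_compat_l. left; apply exp_pos. apply exp_ineq1_le. }
  lra.
Qed.

(** The partial products are 1 plus the telescoping series of [cprod a k * (a k - 1)], in which the
    products stay bounded. *)
Lemma cprod_cv (a : nat -> C) (b : nat -> R) : (forall j, Cmod (a j - 1)%C <= b j) -> summable b ->
  Ccv (cprod a) (Clim_seq (cprod a)).
Proof.
  intros H Hb. assert (Hb0 : forall j, 0 <= b j) by (intros; eapply Rle_trans; [apply Cmod_ge_0|apply H]).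
  destruct Hb as [B HB].
  assert (Hs : summable (fun k => exp B * b k)).
  { apply summable_scal. left; apply exp_pos. exists B; auto. }
  assert (Hd : forall k, Cmod (cprod a k * (a k - 1))%C <= exp B * b k).
  { intros k. rewrite Cmod_mult. apply Rmult_le_compat; auto; try apply Cmod_ge_0.
    eapply Rle_trans; [apply (cprod_bound a b k H)|].
    destruct (HB k) as [E|E]. left; apply exp_increasing; auto. rewrite E; lra. }
  assert (L := csum_cv _ _ Hd Hs).
  assert (L2 : Ccv (cprod a) (1 + Cser (fun k => cprod a k * (a k - 1))%C)).
  { apply Ccv_ext with (fun k => 1 + csum (fun k => cprod a k * (a k - 1))%C k)%C.
    - intros k; induction k; simpl. ring. rewrite Cplus_assoc, IHk. ring.
    - apply Ccv_plus; auto. apply Ccv_const. }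
  rewrite (Ccv_Clim_seq _ _ L2). auto.
Qed.

Lemma cprod_lim_neq0 (a : nat -> C) (b : nat -> R) l : (forall j, Cmod (a j - 1)%C <= b j) -> summable b ->
  (forall j, a j <> RtoC 0) -> Ccv (cprod a) l -> l <> RtoC 0.
Proof.
  intros H Hb Ha Hl. assert (Hb0 : forall j, 0 <= b j) by (intros; eapply Rle_trans; [apply Cmod_ge_0|apply H]).
  (* With tail sum at most [ln (3/2)], every later block of the product lies within [3/2 - 1 = 1/2]
     of 1, so the products stay at least half of the nonzero one at [N]. *)
  destruct (summable_tail b Hb0 Hb (ln (3/2))) as [N HN].
  { rewrite <- ln_1. apply ln_increasing; lra. }
  assert (Hsh : forall k, rsum (fun j => b (N + j)%nat) k = rsum b (N + k) - rsum b N).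
  { intros k; induction k. rewrite Nat.add_0_r; simpl; ring. rewrite Nat.add_succ_r; simpl; rewrite IHk; ring. }
  assert (Hlow : forall k, Cmod (cprod a N) * / 2 <= Cmod (cprod a (N + k))).
  { intros k. rewrite cprod_split, Cmod_mult. apply Rmult_le_compat_l; [apply Cmod_ge_0|].
    assert (M := cprod_m1 (fun j => a (N + j)%nat) (fun j => b (N + j)%nat) k (fun j => H (N + j)%nat)).
    rewrite Hsh in M. assert (E : exp (rsum b (N + k) - rsum b N) <= 3 / 2).
    { rewrite <- (exp_ln (3/2)) by lra. destruct (HN (N + k)%nat ltac:(lia)) as [E|E].
      left; apply exp_increasing; auto. rewrite E; lra. }
    assert (T := Cmod_triangle_rev 1 (cprod (fun j => a (N + j)%nat) k)).
    rewrite Cmod_1, Cmod_sub_sym in T. lra. }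
  apply Cmod_gt_0.
  assert (Hp : 0 < Cmod (cprod a N)) by (apply Cmod_gt_0, cprod_neq0; auto).
  apply Rlt_le_trans with (Cmod (cprod a N) * / 2). lra.
  assert (L := Ccv_Cmod _ _ Hl).
  apply (is_lim_seq_le_loc (fun _ => Cmod (cprod a N) * / 2) (fun k => Cmod (cprod a k)) (Cmod (cprod a N) * / 2) (Cmod l)); auto.
  exists N. intros k Hk. replace k with (N + (k - N))%nat by lia. apply Hlow. apply is_lim_seq_const.
Qed.

Lemma CW_cprod rho (f : nat -> C -> C) (b : nat -> R) k : 0 <= rho ->
  (forall j, CW rho (b j) (fun z => f j z - 1)%C) -> CW rho (exp (rsum b k)) (fun z => cprod (fun j => f j z) k).
Proof.
  intros Hr H; induction k; simpl.
  - eapply CW_le; [|apply (CW_const rho 1)]. rewrite Cmod_1, exp_0; lra.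
  - rewrite exp_plus. apply CW_mult; auto.
    apply CW_ext with (fun z => (f k z - 1) + 1)%C. intros; ring.
    eapply CW_le; [|apply CW_plus; [apply H|apply CW_const]]. rewrite Cmod_1.
    generalize (exp_ineq1_le (b k)); lra.
Qed.

(** * The reciprocal of Gauss's limit *)

Lemma ln_1p_bounds k : 0 <= ln (1 + / INR (S k)) <= / INR (S k) /\
  / INR (S k) - ln (1 + / INR (S k)) <= (/ INR (S k)) ^ 2.
Proof.
  assert (Hk : 0 < INR (S k)) by (apply lt_0_INR; lia).
  set (x := / INR (S k)). assert (Hx : 0 < x) by (apply Rinv_0_lt_compat; auto).
  split; [split|].
  - rewrite <- ln_1. apply ln_le; lra.
  - rewrite <- (ln_exp x) at 2. apply ln_le; [lra|apply exp_ineq1_le].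
  (* The lower bound on the logarithm is [ln y <= y - 1] taken at [y = 1 / (1 + x)]. *)
  - assert (H : ln (/ (1 + x)) <= / (1 + x) - 1).
    { assert (0 < / (1 + x)) by (apply Rinv_0_lt_compat; lra).
      rewrite <- (ln_exp (/ (1 + x) - 1)). apply ln_le; auto.
      eapply Rle_trans; [|apply exp_ineq1_le]. lra. }
    rewrite ln_Rinv in H by lra.
    assert (E : / (1 + x) - 1 = - x + x ^ 2 - x ^ 3 / (1 + x)) by (field; lra).
    assert (0 <= x ^ 3 / (1 + x)).
    { apply Rmult_le_pos. apply pow_le; lra. left; apply Rinv_0_lt_compat; lra. }
    lra.
Qed.

(** Euler's factor [(1 + s/j) (1 + 1/j)^(-s)] with [j = k + 1]. The powers telescope, which links
    the infinite product to Gauss's sequence. *)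
Definition gfac (s : C) (k : nat) : C :=
  ((1 + s / RtoC (INR (S k))) * Cexp (- s * RtoC (ln (1 + / INR (S k)))))%C.

(** With [x = 1 / (k + 1)], [l = ln (1 + x)] and [s = s0 + z], the factor minus 1 is [s (x - l) -
    s^2 l x + (1 + s x) (exp (- s l) - 1 + s l)]. Each summand is of order [x^2], and the constant
    adds the three bounds. *)
Lemma CW_gfac rho s0 a k : 0 <= rho -> Cmod s0 + rho <= a ->
  CW rho ((a + a ^ 2 + (1 + a) * (a ^ 2 * exp a)) * (/ INR (S k)) ^ 2) (fun z => gfac (s0 + z) k - 1)%C.
Proof.
  intros Hr Ha.
  assert (Hk : 0 < INR (S k)) by (apply lt_0_INR; lia).
  assert (Hk1 : 1 <= INR (S k)) by (apply (le_INR 1); lia).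
  assert (Hkc : RtoC (INR (S k)) <> RtoC 0) by (apply RtoC_neq0; lra).
  destruct (ln_1p_bounds k) as [[L1 L2] L3].
  set (l := ln (1 + / INR (S k))) in *.
  set (x := / INR (S k)) in *.
  assert (Hx : 0 < x) by (apply Rinv_0_lt_compat; auto).
  assert (Hx1 : x <= 1) by (unfold x; rewrite <- Rinv_1; apply Rinv_le_contravar; lra).
  assert (Hs : CW rho a (fun z => s0 + z)%C).
  { eapply CW_le; [apply Ha|]. apply CW_plus; [apply CW_const|apply CW_id]. }
  assert (Ha0 : 0 <= a) by (exact (CW_pos _ _ _ Hr Hs)).
  assert (Hl : CW rho (a * l) (fun z => - ((s0 + z) * RtoC l))%C).
  { apply CW_opp; auto. eapply CW_le; [|apply CW_mult; [auto|apply Hs|apply CW_const]].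
    rewrite Cmod_RtoC_pos by auto. lra. }
  assert (H2 := CW_exp2 rho _ _ Hr Hl).
  apply CW_ext with (fun z => (s0 + z) * RtoC (x - l) + (- ((s0 + z) * (s0 + z) * RtoC (l * x))
    + (1 + (s0 + z) * RtoC x) * (Cexp (- ((s0 + z) * RtoC l)) - 1 - - ((s0 + z) * RtoC l))))%C.
  { intros z _. unfold gfac. change (ln (1 + / INR (S k))) with l. unfold x. rewrite RtoC_minus, RtoC_mult, RtoC_inv by lra.
    replace (- (s0 + z) * RtoC l)%C with (- ((s0 + z) * RtoC l))%C by ring. field. auto. }
  eapply CW_le; [|apply CW_plus; [apply CW_mult; [auto|apply Hs|apply CW_const]|
    apply CW_plus; [apply CW_opp; [auto|apply CW_mult; [auto|apply CW_mult; [auto|apply Hs|apply Hs]|apply CW_const]]|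
     apply CW_mult; [auto|apply CW_plus; [apply CW_const|apply CW_mult; [auto|apply Hs|apply CW_const]]|apply H2]]]].
  rewrite Cmod_1, !Cmod_RtoC_pos; try lra. 2: apply Rmult_le_pos; lra.
  assert (E1 : a * (x - l) <= a * x ^ 2) by (apply Rmult_le_compat_l; auto).
  assert (E2 : a * a * (l * x) <= a * a * (x * x)).
  { apply Rmult_le_compat_l. nra. apply Rmult_le_compat_r; lra. }
  assert (E3 : (1 + a * x) * ((a * l) ^ 2 * exp (a * l)) <= (1 + a) * ((a ^ 2 * x ^ 2) * exp a)).
  { apply Rmult_le_compat.
    - nra.
    - apply Rmult_le_pos. apply pow2_ge_0. left; apply exp_pos.
    - nra.
    - apply Rmult_le_compat. apply pow2_ge_0. left; apply exp_pos.
      replace (a ^ 2 * x ^ 2) with ((a * x) ^ 2) by ring. apply pow_incr. split. nra. apply Rmult_le_compat_l; auto.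
      assert (E : a * l <= a) by nra.
      destruct E as [E|E]. left; apply exp_increasing; auto. rewrite E; lra. }
  simpl pow in *. nra.
Qed.

Lemma summable_inv_sq : forall k, rsum (fun j => (/ INR (S j)) ^ 2) k <= 2.
Proof.
  intros k. assert (H : rsum (fun j => (/ INR (S j)) ^ 2) (S k) <= 2 - / INR (S k)).
  { induction k. simpl. lra.
    change (rsum (fun j => (/ INR (S j)) ^ 2) (S (S k))) with (rsum (fun j => (/ INR (S j)) ^ 2) (S k) + (/ INR (S (S k))) ^ 2).
    assert (Hk : 0 < INR (S k)) by (apply lt_0_INR; lia).
    rewrite (S_INR (S k)). set (x := INR (S k)) in *.
    assert ((/ (x + 1)) ^ 2 <= / x - / (x + 1)).
    { replace (/ x - / (x + 1)) with (/ (x * (x + 1))) by (field; lra).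
      replace ((/ (x + 1)) ^ 2) with (/ ((x + 1) * (x + 1))) by (field; lra).
      apply Rinv_le_contravar; nra. }
    lra. }
  simpl rsum in H. assert (0 <= (/ INR (S k)) ^ 2) by apply pow2_ge_0.
  assert (0 < / INR (S k)) by (apply Rinv_0_lt_compat, lt_0_INR; lia). simpl in *. lra.
Qed.

Lemma gfac_bound s k : Cmod (gfac s k - 1)%C <=
  (Cmod s + Cmod s ^ 2 + (1 + Cmod s) * (Cmod s ^ 2 * exp (Cmod s))) * (/ INR (S k)) ^ 2.
Proof.
  assert (H := CW_gfac 0 s (Cmod s) k ltac:(lra) ltac:(lra)).
  assert (K := CW_bound _ _ _ (RtoC 0) H ltac:(rewrite Cmod_0; lra)). simpl in K.
  rewrite Cplus_0_r in K. exact K.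
Qed.

Lemma gK_pos a : 0 <= a -> 0 <= a + a ^ 2 + (1 + a) * (a ^ 2 * exp a).
Proof.
  intros Ha. assert (He := exp_pos a). assert (0 <= a ^ 2) by apply pow2_ge_0.
  assert (0 <= (1 + a) * (a ^ 2 * exp a)). { apply Rmult_le_pos; [lra|]. apply Rmult_le_pos; lra. } lra.
Qed.

Lemma summable_gfac s : summable (fun k => (Cmod s + Cmod s ^ 2 + (1 + Cmod s) * (Cmod s ^ 2 * exp (Cmod s))) * (/ INR (S k)) ^ 2).
Proof.
  apply summable_scal. apply gK_pos, Cmod_ge_0. exists 2. apply summable_inv_sq.
Qed.

(** The entire function [1 / Gamma], by Euler's product. Identities are proved for it, where no
    poles interfere, and transferred by [Gamma_RGam]. *)
Definition RGam (s : C) : C := (s * Clim_seq (cprod (gfac s)))%C.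

Definition nonpole (s : C) : Prop := forall k : nat, (s + RtoC (INR k))%C <> RtoC 0.

Lemma nonpole_pos s : 0 < fst s -> nonpole s.
Proof.
  intros H k E. apply (f_equal fst) in E. simpl in E. generalize (pos_INR k); lra.
Qed.

Lemma cprod_gfac_cv s : Ccv (cprod (gfac s)) (Clim_seq (cprod (gfac s))).
Proof. apply cprod_cv with (2 := summable_gfac s). apply gfac_bound. Qed.

Lemma RGam_neq0 s : nonpole s -> RGam s <> RtoC 0.
Proof.
  intros H. unfold RGam. apply Cmult_neq_0.
  - intros E. apply (H O). simpl. rewrite E. ring.
  - apply (cprod_lim_neq0 (gfac s)) with (2 := summable_gfac s). apply gfac_bound.
    2: apply cprod_gfac_cv. intros k. unfold gfac. apply Cmult_neq_0; [|apply Cexp_neq0].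
    intros E. apply (H (S k)). assert (Hk : RtoC (INR (S k)) <> RtoC 0) by (apply RtoC_neq0, not_0_INR; lia).
    replace (s + RtoC (INR (S k)))%C with (RtoC (INR (S k)) * (1 + s / RtoC (INR (S k))))%C by (field; auto).
    rewrite E; ring.
Qed.

Lemma Hol_RGam s : Hol RGam s.
Proof.
  unfold RGam. apply Hol_mult. apply Hol_id.
  set (a := Cmod s + 1). set (K := a + a ^ 2 + (1 + a) * (a ^ 2 * exp a)).
  assert (Ha : 0 <= a) by (unfold a; generalize (Cmod_ge_0 s); lra).
  exists 1, (exp (K * 2)). split; [lra|].
  apply (CW_lim 1 _ (fun k z => cprod (gfac (s + z)%C) k)).
  - exists O; intros k _. eapply CW_le; [|apply (CW_cprod 1 (fun j z => gfac (s + z)%C j) (fun j => K * (/ INR (S j)) ^ 2)); [lra|]].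
    + rewrite rsum_scal.
      assert (E : K * rsum (fun j => (/ INR (S j)) ^ 2) k <= K * 2).
      { apply Rmult_le_compat_l. apply gK_pos; auto. apply summable_inv_sq. }
      destruct E as [E|E]. left; apply exp_increasing; auto. rewrite E; lra.
    + intros j. apply CW_gfac; unfold a; lra.
  - intros z _. apply cprod_gfac_cv.
Qed.

(** * Complex powers of positive reals *)

Lemma Rcpow_plus a s t : Rcpow a (s + t)%C = (Rcpow a s * Rcpow a t)%C.
Proof. unfold Rcpow. rewrite <- Cexp_plus. f_equal; ring. Qed.

Lemma Rcpow_opp a s : Rcpow a (- s)%C = (/ Rcpow a s)%C.
Proof. unfold Rcpow. rewrite <- Cexp_opp. f_equal; ring. Qed.

Lemma Rcpow_neq0 a s : Rcpow a s <> RtoC 0.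
Proof. apply Cexp_neq0. Qed.

Lemma Rcpow_mult_base a b s : 0 < a -> 0 < b -> Rcpow (a * b) s = (Rcpow a s * Rcpow b s)%C.
Proof. intros Ha Hb. unfold Rcpow. rewrite ln_mult, <- Cexp_plus by auto. f_equal. rewrite RtoC_plus; ring. Qed.

Lemma Rcpow_inv_base a s : 0 < a -> Rcpow (/ a) s = (/ Rcpow a s)%C.
Proof. intros Ha. unfold Rcpow. rewrite ln_Rinv, <- Cexp_opp by auto. f_equal. rewrite RtoC_opp; ring. Qed.

Lemma Rcpow_1 a : 0 < a -> Rcpow a 1 = RtoC a.
Proof. intros Ha. unfold Rcpow. rewrite Cmult_1_l, Cexp_RtoC, exp_ln; auto. Qed.

Lemma Rcpow_0 a : Rcpow a 0 = RtoC 1.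
Proof. unfold Rcpow. rewrite Cmult_0_l. apply Cexp_0. Qed.

Lemma Rcpow_one s : Rcpow 1 s = RtoC 1.
Proof. unfold Rcpow. rewrite ln_1, Cmult_0_r. apply Cexp_0. Qed.

Lemma Rcpow_INR a k : 0 < a -> Rcpow a (RtoC (INR k)) = RtoC (a ^ k).
Proof.
  intros Ha; induction k. simpl INR. rewrite Rcpow_0. auto.
  rewrite S_INR, RtoC_plus, Rcpow_plus, IHk, Rcpow_1, <- RtoC_mult by auto. f_equal; simpl; ring.
Qed.

Lemma Rcpow_RtoC a r : Rcpow a (RtoC r) = RtoC (exp (r * ln a)).
Proof. unfold Rcpow. rewrite <- RtoC_mult. apply Cexp_RtoC. Qed.

Lemma Cmod_Rcpow a s : Cmod (Rcpow a s) = exp (fst s * ln a).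
Proof. unfold Rcpow. rewrite Cmod_Cexp. f_equal. simpl; ring. Qed.

Lemma Ccv_Cexp u l : Ccv u l -> Ccv (fun k => Cexp (u k)) (Cexp l).
Proof.
  intros H. apply Hol_continuous; auto.
  exists 1, (exp (Cmod l + 1)). split; [lra|]. apply CW_exp; [lra|]. apply CW_plus. apply CW_const. apply CW_id.
Qed.

Lemma Hol_Cexp f s : Hol f s -> Hol (fun z => Cexp (f z)) s.
Proof. intros [r [A [Hr H]]]. exists r, (exp A). split; auto. apply CW_exp; auto; lra. Qed.

Lemma Hol_Rcpow a f s : Hol f s -> Hol (fun z => Rcpow a (f z)) s.
Proof. intros H. apply Hol_Cexp. apply Hol_mult; auto. apply Hol_const. Qed.

Lemma Ccv_Rcpow_1 (u : nat -> R) s : (forall k, 0 < u k) -> is_lim_seq u 1 -> Ccv (fun k => Rcpow (u k) s) 1.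
Proof.
  intros Hu Hl. apply Ccv_eq with (Cexp (s * RtoC (ln 1))).
  rewrite ln_1, Cmult_0_r; apply Cexp_0.
  apply Ccv_Cexp. apply Ccv_scal. apply Ccv_RtoC.
  apply (is_lim_seq_continuous ln u 1); auto.
  apply derivable_continuous_pt. exists (/ 1). apply derivable_pt_lim_ln; lra.
Qed.

(* [1/Gamma] along Gauss's sequence. *)
Definition RG (k : nat) (s : C) : C := (rising s k / (RtoC (INR (fact k)) * Rcpow (INR k) s))%C.

(** The product of [1 + 1/j] for [j <= k] telescopes to [k + 1], whereas Gauss's sequence carries
    [k^s]. The two differ by a power of [(k + 1) / k], which [RG_cv] lets tend to 1. *)
Lemma rising_gfac s k : rising s k = (s * cprod (gfac s) k * RtoC (INR (fact k)) * Rcpow (INR (S k)) s)%C.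
Proof.
  induction k.
  - simpl. rewrite Rcpow_one. ring.
  - cbn [rising cprod]. rewrite IHk.
    change (gfac s k) with ((1 + s / RtoC (INR (S k))) * Rcpow (1 + / INR (S k)) (- s))%C.
    assert (Hk : 0 < INR (S k)) by (apply lt_0_INR; lia).
    assert (E : INR (S (S k)) = INR (S k) * (1 + / INR (S k))).
    { rewrite (S_INR (S k)). field. lra. }
    rewrite E, Rcpow_mult_base; auto.
    2:{ assert (0 < / INR (S k)) by (apply Rinv_0_lt_compat; auto). lra. }
    rewrite Rcpow_opp, fact_simpl, mult_INR, RtoC_mult. field.
    split; [apply Rcpow_neq0|apply RtoC_neq0; lra].
Qed.

Lemma lim_INR_ratio (p q : nat) : is_lim_seq (fun k => INR (S k + p) / INR (S k + q)) 1.
Proof.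
  apply is_lim_seq_ext with (fun k => 1 + (INR p - INR q) * / INR (S k + q)).
  - intros k. rewrite !plus_INR. field. assert (0 < INR (S k)) by (apply lt_0_INR; lia). generalize (pos_INR q); lra.
  - replace (Finite 1) with (Finite (1 + (INR p - INR q) * 0)) by (f_equal; ring).
    apply is_lim_seq_plus'. apply is_lim_seq_const.
    apply (is_lim_seq_scal_l _ (INR p - INR q) 0).
    apply (is_lim_seq_ext (fun k => / INR (k + S q))). intros k; do 2 f_equal; lia.
    apply (is_lim_seq_inv (fun k => INR (k + S q)) p_infty); [|discriminate].
    apply (is_lim_seq_incr_n INR (S q)). apply is_lim_seq_INR.
Qed.

Lemma RG_cv s : Ccv (fun k => RG k s) (RGam s).
Proof.
  apply Ccv_unshift.
  apply Ccv_ext with (fun k => s * cprod (gfac s) (S k) * Rcpow (INR (S k + 1) / INR (S k + 0)) s)%C.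
  - intros k. unfold RG. rewrite rising_gfac.
    assert (Hk : 0 < INR (S k)) by (apply lt_0_INR; lia).
    assert (Hk' : 0 < INR (S (S k))) by (apply lt_0_INR; lia).
    replace (S k + 1)%nat with (S (S k)) by lia. replace (S k + 0)%nat with (S k) by lia.
    unfold Rdiv. rewrite Rcpow_mult_base, Rcpow_inv_base; auto. 2: apply Rinv_0_lt_compat; auto.
    field. split; [apply Rcpow_neq0|apply fact_neq0].
  - apply Ccv_eq with (RGam s * 1)%C; [ring|]. apply Ccv_mult.
    + unfold RGam. apply Ccv_scal. apply (Ccv_subseq S). intros; lia. apply cprod_gfac_cv.
    + apply Ccv_Rcpow_1.
      * intros k. apply Rdiv_lt_0_compat; apply lt_0_INR; lia.
      * apply lim_INR_ratio.
Qed.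

Lemma Gamma_RGam s : nonpole s -> Gamma s = (/ RGam s)%C.
Proof.
  intros H. apply Ccv_Clim_seq. apply Ccv_ext with (fun k => / RG k s)%C.
  - intros k. unfold RG.
    assert (Hr : rising s k <> RtoC 0).
    { clear -H. induction k; simpl. specialize (H O). simpl in H. rewrite Cplus_0_r in H. auto.
      apply Cmult_neq_0; auto. apply (H (S k)). }
    field. split; auto. split; [apply Rcpow_neq0|apply fact_neq0].
  - apply Ccv_inv. apply RGam_neq0; auto. apply RG_cv.
Qed.

Lemma rising_shift s k : rising s (S k) = (s * rising (s + 1) k)%C.
Proof.
  induction k. simpl. ring.
  change (rising s (S (S k))) with (rising s (S k) * (s + RtoC (INR (S (S k)))))%C.
  rewrite IHk. change (rising (s + 1) (S k)) with (rising (s + 1) k * (s + 1 + RtoC (INR (S k))))%C.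
  rewrite (S_INR (S k)), RtoC_plus. ring.
Qed.

Lemma RGam_rec s : RGam s = (s * RGam (s + 1))%C.
Proof.
  (* Pulling out the factor [s] lowers the index by one, so [RG] at [k + 2] is compared with [RG] at
     [k + 1]; the mismatch is a power of [(k + 1) / (k + 2)] and tends to 1. *)
  apply (Ccv_unique (fun k => RG (S (S k)) s)).
  - apply (Ccv_subseq (fun k => S (S k)) (fun k => RG k s)); [intros; lia|]. apply RG_cv.
  - apply Ccv_ext with (fun k => s * RG (S k) (s + 1) * Rcpow (INR (S k + 0) / INR (S k + 1)) (s + 1))%C.
    + intros k. unfold RG. rewrite (rising_shift s (S k)).
      assert (Hk : 0 < INR (S k)) by (apply lt_0_INR; lia).
      assert (Hk' : 0 < INR (S (S k))) by (apply lt_0_INR; lia).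
      replace (S k + 1)%nat with (S (S k)) by lia. replace (S k + 0)%nat with (S k) by lia.
      unfold Rdiv. rewrite Rcpow_mult_base, Rcpow_inv_base; auto. 2: apply Rinv_0_lt_compat; auto.
      rewrite (Rcpow_plus (INR (S (S k)))), Rcpow_1 by auto.
      rewrite (fact_simpl (S k)), mult_INR, RtoC_mult. field.
      repeat split; try apply Rcpow_neq0; try apply fact_neq0; apply RtoC_neq0; lra.
    + apply Ccv_eq with (s * RGam (s + 1) * 1)%C; [ring|]. apply Ccv_mult.
      * apply Ccv_scal. apply (Ccv_subseq S (fun k => RG k (s + 1))); [intros; lia|]. apply RG_cv.
      * apply Ccv_Rcpow_1. intros k. apply Rdiv_lt_0_compat; apply lt_0_INR; lia. apply lim_INR_ratio.
Qed.

(** [rising s n] has [n + 1] factors. The [2 k + 2] factors [2 z + i] split by parity into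
    [2 (z + j)] and [2 (z + 1/2 + j)]. *)
Lemma rising_dup z k : rising (2 * z) (2 * k + 1) = (RtoC (2 ^ (2 * k + 2)) * rising z k * rising (z + RtoC (/ 2)) k)%C.
Proof.
  assert (H2 : (RtoC 2 * RtoC (/ 2))%C = 1) by (rewrite <- RtoC_mult; f_equal; field).
  induction k.
  - simpl. replace (RtoC (2 * (2 * 1))) with (2 * 2)%C by (rewrite <- RtoC_mult; f_equal; ring).
    transitivity (2 * z * (2 * z + 2 * RtoC (/2)))%C. rewrite H2; ring. ring.
  - replace (2 * S k + 1)%nat with (S (S (2 * k + 1))) by lia.
    replace (2 * S k + 2)%nat with (S (S (2 * k + 2))) by lia.
    cbn [rising]. rewrite IHk.
    replace (INR (S (2 * k + 1))) with (2 * INR (S k)) by (rewrite !S_INR, plus_INR, mult_INR; simpl; ring).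
    replace (INR (S (S (2 * k + 1)))) with (2 * INR (S k) + 2 * / 2) by (rewrite !S_INR, plus_INR, mult_INR; simpl; field).
    replace (2 ^ S (S (2 * k + 2))) with (2 * 2 * 2 ^ (2 * k + 2)) by (simpl; ring).
    rewrite !RtoC_plus, !RtoC_mult. ring.
Qed.

Definition dupc (k : nat) : R := / 2 ^ (2 * k + 2) * INR (fact (2 * k + 1)) / (INR (fact k) ^ 2 * exp (/ 2 * ln (INR k))).

Lemma RG_dup z k : (1 <= k)%nat ->
  (RG k z * RG k (z + RtoC (/2)) = RtoC (dupc k) * Rcpow (INR (2 * k + 1) / INR k) (2 * z) * RG (2 * k + 1) (2 * z))%C.
Proof.
  intros Hk1. unfold RG. rewrite rising_dup.
  assert (Hk : 0 < INR k) by (apply lt_0_INR; lia).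
  assert (Hk' : 0 < INR (2 * k + 1)) by (apply lt_0_INR; lia).
  unfold Rdiv. rewrite Rcpow_mult_base, Rcpow_inv_base; auto. 2: apply Rinv_0_lt_compat; auto.
  rewrite (Rcpow_plus _ z), Rcpow_RtoC.
  replace (Rcpow (INR k) (2 * z)) with (Rcpow (INR k) z * Rcpow (INR k) z)%C by (rewrite <- Rcpow_plus; f_equal; ring).
  unfold dupc, Rdiv.
  assert (P2 : 2 ^ (2 * k + 2) <> 0) by (apply pow_nonzero; lra).
  assert (Pe := exp_pos (/ 2 * ln (INR k))).
  assert (Pf := INR_fact_lt_0 k).
  rewrite !RtoC_mult, !RtoC_inv, RtoC_mult; auto.
  2:{ apply Rgt_not_eq. apply Rmult_lt_0_compat; auto. apply pow_lt; auto. }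
  simpl (INR (fact k) ^ 2). rewrite !RtoC_mult. field.
  repeat split; try apply Rcpow_neq0; try apply fact_neq0; apply RtoC_neq0; try lra; auto.
Qed.

(** The constant does not depend on [z], so its convergence is read off at [z = 1], where all the
    other factors have nonzero limits. This takes the place of Stirling's formula; positivity
    follows since a limit of positive numbers that is nonzero is positive. *)
Lemma dupc_cv : exists kap, 0 < kap /\ is_lim_seq dupc kap.
Proof.
  assert (L := Ccv_mult _ _ _ _ (RG_cv 1) (RG_cv (1 + RtoC (/2)))).
  assert (L2 : Ccv (fun k => RG (2 * k + 1) (2 * 1)) (RGam (2 * 1))).
  { apply (Ccv_subseq (fun k => 2 * k + 1)%nat (fun k => RG k (2 * 1))); [intros; lia|apply RG_cv]. }
  assert (Hn2 : RGam (2 * 1) <> RtoC 0) by (apply RGam_neq0, nonpole_pos; simpl; lra).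
  assert (Hn1 : RGam 1 <> RtoC 0) by (apply RGam_neq0, nonpole_pos; simpl; lra).
  assert (Hn3 : RGam (1 + RtoC (/2)) <> RtoC 0) by (apply RGam_neq0, nonpole_pos; simpl; lra).
  assert (L3 : Ccv (fun k => Rcpow (INR (2 * S k + 1) / INR (S k)) (2 * 1)) (Rcpow 2 (2 * 1))).
  { apply Ccv_ext with (fun k => Rcpow 2 (2 * 1) * Rcpow ((INR (2 * S k + 1) / INR (S k)) / 2) (2 * 1))%C.
    - intros k. rewrite <- Rcpow_mult_base; try lra. f_equal. field. apply not_0_INR; lia.
      apply Rdiv_lt_0_compat; [|lra]. apply Rdiv_lt_0_compat; apply lt_0_INR; lia.
    - apply Ccv_eq with (Rcpow 2 (2 * 1) * 1)%C; [ring|]. apply Ccv_scal. apply Ccv_Rcpow_1.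
      intros k. apply Rdiv_lt_0_compat; [|lra]. apply Rdiv_lt_0_compat; apply lt_0_INR; lia.
      apply is_lim_seq_ext with (fun k => 1 + / 2 * / INR (S k)).
      { intros k. rewrite plus_INR, mult_INR. simpl (INR 2). simpl (INR 1). field. apply not_0_INR; lia. }
      replace (Finite 1) with (Finite (1 + / 2 * 0)) by (f_equal; ring).
      apply is_lim_seq_plus'. apply is_lim_seq_const. apply (is_lim_seq_scal_l _ (/2) 0).
      apply (is_lim_seq_inv (fun k => INR (S k)) p_infty); [|discriminate].
      apply (is_lim_seq_incr_1 INR). apply is_lim_seq_INR. }
  set (A := (RGam 1 * RGam (1 + RtoC (/2)) / (Rcpow 2 (2 * 1) * RGam (2 * 1)))%C).
  assert (LA : Ccv (fun k => RtoC (dupc (S k))) A).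
  { apply Ccv_ext_loc with (fun k => (RG (S k) 1 * RG (S k) (1 + RtoC (/2))) / (Rcpow (INR (2 * S k + 1) / INR (S k)) (2 * 1) * RG (2 * S k + 1) (2 * 1)))%C.
    - assert (Hnz : exists N, forall k, (N <= k)%nat -> RG (2 * k + 1) (2 * 1) <> RtoC 0).
      { destruct (L2 (Cmod (RGam (2 * 1)))) as [N HN]. apply Cmod_gt_0; auto.
        exists N. intros k Hk E. specialize (HN k Hk). rewrite E in HN.
        replace (0 - RGam (2 * 1))%C with (- RGam (2 * 1))%C in HN by ring. rewrite Cmod_opp in HN. lra. }
      destruct Hnz as [N HN]. exists N. intros k Hk. rewrite (RG_dup 1 (S k)) by lia.
      field. split; [apply (HN (S k)); lia|apply Rcpow_neq0].
    - apply Ccv_div.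
      + apply Cmult_neq_0; auto. apply Rcpow_neq0.
      + apply (Ccv_subseq S (fun k => RG k 1 * RG k (1 + RtoC (/2)))%C); auto.
      + apply Ccv_mult; auto. apply (Ccv_subseq S (fun k => RG (2 * k + 1) (2 * 1))); auto. }
  assert (HA : A <> RtoC 0).
  { unfold A. apply Cmult_neq_0. apply Cmult_neq_0; auto.
    assert (D : (Rcpow 2 (2 * 1) * RGam (2 * 1))%C <> RtoC 0) by (apply Cmult_neq_0; auto; apply Rcpow_neq0).
    intros E. apply C1_nz. rewrite <- (Cinv_r _ D), E. ring. }
  clearbody A. assert (LR := Ccv_fst _ _ LA). simpl in LR.
  assert (LI := Ccv_snd _ _ LA). simpl in LI.
  assert (A2 : snd A = 0).
  { assert (E := is_lim_seq_unique _ _ LI). rewrite Lim_seq_const in E. injection E; auto. }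
  assert (A1 : 0 <= fst A).
  { apply (is_lim_seq_le (fun _ => 0) (fun k => dupc (S k)) 0 (fst A)); auto. 2: apply is_lim_seq_const.
    intros k. unfold dupc. apply Rlt_le, Rdiv_lt_0_compat.
    apply Rmult_lt_0_compat; [apply Rinv_0_lt_compat, pow_lt; lra|apply INR_fact_lt_0].
    apply Rmult_lt_0_compat; [apply pow_lt, INR_fact_lt_0|apply exp_pos]. }
  exists (fst A). split.
  - destruct A1 as [|E]; auto. exfalso. apply HA. destruct A as [p q]; simpl in *; subst; auto.
  - apply is_lim_seq_incr_1. auto.
Qed.

Lemma RGam_dup : exists kap, 0 < kap /\ forall z, (RGam z * RGam (z + RtoC (/2)) = RtoC kap * Rcpow 2 (2 * z) * RGam (2 * z))%C.
Proof.
  destruct dupc_cv as [kap [Hk L]]. exists kap; split; auto. intros z.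
  apply (Ccv_unique (fun k => RG (S k) z * RG (S k) (z + RtoC (/2)))%C).
  - apply Ccv_mult; [apply (Ccv_subseq S (fun k => RG k z))|apply (Ccv_subseq S (fun k => RG k (z + RtoC (/2))))]; auto; apply RG_cv.
  - apply Ccv_ext with (fun k => RtoC (dupc (S k)) * Rcpow (INR (2 * S k + 1) / INR (S k)) (2 * z) * RG (2 * S k + 1) (2 * z))%C.
    { intros k. rewrite RG_dup by lia. auto. }
    apply Ccv_mult. apply Ccv_mult.
    + apply Ccv_RtoC. apply is_lim_seq_incr_1 in L. auto.
    (* The powers [(2 k + 1)^(2 z)] and [k^(2 z)] have quotient tending to [2^(2 z)]. *)
    + apply Ccv_ext with (fun k => Rcpow 2 (2 * z) * Rcpow ((INR (2 * S k + 1) / INR (S k)) / 2) (2 * z))%C.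
      * intros k. rewrite <- Rcpow_mult_base; try lra. f_equal. field. apply not_0_INR; lia.
        apply Rdiv_lt_0_compat; [|lra]. apply Rdiv_lt_0_compat; apply lt_0_INR; lia.
      * apply Ccv_eq with (Rcpow 2 (2 * z) * 1)%C; [ring|]. apply Ccv_scal. apply Ccv_Rcpow_1.
        intros k. apply Rdiv_lt_0_compat; [|lra]. apply Rdiv_lt_0_compat; apply lt_0_INR; lia.
        apply is_lim_seq_ext with (fun k => 1 + / 2 * / INR (S k)).
        { intros k. rewrite plus_INR, mult_INR. simpl (INR 2). simpl (INR 1). field. apply not_0_INR; lia. }
        replace (Finite 1) with (Finite (1 + / 2 * 0)) by (f_equal; ring).
        apply is_lim_seq_plus'. apply is_lim_seq_const. apply (is_lim_seq_scal_l _ (/2) 0).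
        apply (is_lim_seq_inv (fun k => INR (S k)) p_infty); [|discriminate].
        apply (is_lim_seq_incr_1 INR). apply is_lim_seq_INR.
    + apply (Ccv_subseq (fun k => 2 * S k + 1)%nat (fun k => RG k (2 * z))). intros; lia. apply RG_cv.
Qed.

(** * The sine product and the reflection formula *)

Definition ccosh (a : C) (t : R) : C := ((Cexp (a * RtoC t) + Cexp (- a * RtoC t)) / 2)%C.
Definition csinh (a : C) (t : R) : C := ((Cexp (a * RtoC t) - Cexp (- a * RtoC t)) / 2)%C.

Lemma C2_neq0 : RtoC 2 <> RtoC 0.
Proof. apply RtoC_neq0; lra. Qed.

Lemma cder_ccosh a t : cder (ccosh a) t (a * csinh a t)%C.
Proof.
  unfold ccosh, csinh. replace (a * ((Cexp (a * RtoC t) - Cexp (- a * RtoC t)) / 2))%C with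
    (/ 2 * (a * Cexp (a * RtoC t) + - a * Cexp (- a * RtoC t)))%C by field.
  eapply cder_ext; [|apply cder_scal, cder_plus; apply cder_Cexp_lin]. intros; simpl; field.
Qed.

Lemma cder_csinh a t : cder (csinh a) t (a * ccosh a t)%C.
Proof.
  unfold ccosh, csinh. replace (a * ((Cexp (a * RtoC t) + Cexp (- a * RtoC t)) / 2))%C with
    (/ 2 * (a * Cexp (a * RtoC t) - - a * Cexp (- a * RtoC t)))%C by field.
  eapply cder_ext; [|apply cder_scal, cder_minus; apply cder_Cexp_lin]. intros; simpl; field.
Qed.

Lemma Cexp_quad w : Cmod (Cexp w - 1 - w)%C <= Cmod w ^ 2 * exp (Cmod w).
Proof.
  assert (H := CW_exp2 0 _ _ (Rle_refl 0) (CW_const 0 w)).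
  apply (CW_bound _ _ _ (RtoC 0) H). rewrite Cmod_0; lra.
Qed.

Lemma ccosh_m1 a t : 0 <= t <= 2 -> Cmod (ccosh a t - 1)%C <= Cmod a ^ 2 * exp (2 * Cmod a) * t ^ 2.
Proof.
  intros Ht. assert (Ha := Cmod_ge_0 a). unfold ccosh.
  replace ((Cexp (a * RtoC t) + Cexp (- a * RtoC t)) / 2 - 1)%C with
   (RtoC (/ 2) * ((Cexp (a * RtoC t) - 1 - a * RtoC t) + (Cexp (- a * RtoC t) - 1 - (- a * RtoC t))))%C.
  2:{ rewrite RtoC_inv by lra. field. }
  rewrite Cmod_mult, Cmod_RtoC_pos by lra.
  assert (H1 := Cexp_quad (a * RtoC t)%C). assert (H2 := Cexp_quad (- a * RtoC t)%C).
  rewrite Cmod_mult, Cmod_RtoC_pos in H1 by lra. rewrite Cmod_mult, Cmod_opp, Cmod_RtoC_pos in H2 by lra.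
  assert (E : exp (Cmod a * t) <= exp (2 * Cmod a)).
  { assert (E : Cmod a * t <= 2 * Cmod a) by nra. destruct E as [E|E]. left; apply exp_increasing; auto. rewrite E; lra. }
  assert (B : (Cmod a * t) ^ 2 * exp (Cmod a * t) <= Cmod a ^ 2 * exp (2 * Cmod a) * t ^ 2).
  { replace (Cmod a ^ 2 * exp (2 * Cmod a) * t ^ 2) with ((Cmod a * t) ^ 2 * exp (2 * Cmod a)) by ring.
    apply Rmult_le_compat_l; auto. apply pow2_ge_0. }
  assert (T := Cmod_triangle (Cexp (a * RtoC t) - 1 - a * RtoC t)%C (Cexp (- a * RtoC t) - 1 - (- a * RtoC t))%C).
  lra.
Qed.

(** For [a = 2 i z] these are the integrals of [cos (2 z t) cos^(2 k) t]; their recurrence in [k]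
    produces the factors of the sine product one at a time. *)
Definition cosint (a : C) (k : nat) : C := CInt (fun t => ccosh a t * RtoC (cos t ^ (2 * k)))%C 0 (PI / 2).

Lemma cder_cos_pow j t : cder (fun u => RtoC (cos u ^ j)) t (RtoC (- INR j * cos t ^ pred j * sin t)).
Proof.
  apply cder_RtoC. evar_last. apply is_derive_pow, is_derive_cos. simpl. ring.
Qed.

Lemma ccont_cosint a k t : ccont (fun t => ccosh a t * RtoC (cos t ^ (2 * k)))%C t.
Proof. apply ccont_mult; eapply cder_ccont; [apply cder_ccosh|apply cder_cos_pow]. Qed.

Lemma PI2_pos : 0 <= PI / 2.
Proof. generalize PI_RGT_0; lra. Qed.

Lemma cosint_correct a k : cint (fun t => ccosh a t * RtoC (cos t ^ (2 * k)))%C 0 (PI / 2) (cosint a k).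
Proof. apply CInt_correct. apply PI2_pos. intros; apply ccont_cosint. Qed.

Lemma cosint_rec a k : let n := INR (S k) in
  ((a * a + RtoC (4 * n * n)) * cosint a (S k) = RtoC (2 * n * (2 * n - 1)) * cosint a k)%C.
Proof.
  intros n.
  (* The boundary terms of two integrations by parts. [H] vanishes at both ends, through [cos] at
     [PI / 2] and through [sinh] and [sin] at 0, and its derivative [h] is the difference of the two
     integrands. *)
  set (H := fun t => (a * (csinh a t * RtoC (cos t ^ (2 * S k))) +
     RtoC (2 * n) * (ccosh a t * (RtoC (cos t ^ (2 * k + 1)) * RtoC (sin t))))%C).
  set (h := fun t => ((a * a + RtoC (4 * n * n)) * (ccosh a t * RtoC (cos t ^ (2 * S k)))
     - RtoC (2 * n * (2 * n - 1)) * (ccosh a t * RtoC (cos t ^ (2 * k))))%C).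
  assert (Hn : n = INR k + 1) by (unfold n; rewrite S_INR; auto).
  assert (N1 : INR (2 * S k) = 2 * n) by (rewrite mult_INR; reflexivity).
  assert (N2 : INR (2 * k + 1) = 2 * n - 1) by (rewrite Hn, plus_INR, mult_INR; simpl; ring).
  assert (D : forall t, cder H t (h t)).
  { intros t.
    assert (C1 := cder_cos_pow (2 * S k) t). assert (C2 := cder_cos_pow (2 * k + 1) t).
    rewrite N1 in C1. rewrite N2 in C2.
    replace (pred (2 * S k)) with (S (2 * k)) in C1 by lia.
    replace (pred (2 * k + 1)) with (2 * k)%nat in C2 by lia.
    assert (D1 := cder_scal a _ t _ (cder_mult _ _ t _ _ (cder_csinh a t) C1)).
    assert (D2 := cder_scal (RtoC (2 * n)) _ t _ (cder_mult _ _ t _ _ (cder_ccosh a t)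
       (cder_mult _ _ t _ _ C2 (cder_RtoC sin t _ (is_derive_sin t))))).
    assert (D3 := cder_plus _ _ t _ _ D1 D2). cbv beta in D3.
    match type of D3 with cder _ _ ?l => replace (h t) with l; [exact D3|] end.
    clear D1 D2 D3 C1 C2. unfold h.
    assert (S2 : sin t * sin t = 1 - cos t * cos t) by (generalize (sin2_cos2 t); unfold Rsqr; lra).
    replace (cos t ^ (2 * S k)) with (cos t ^ (2 * k) * (cos t * cos t))
      by (replace (2 * S k)%nat with (2 * k + 2)%nat by lia; rewrite pow_add; simpl; ring).
    replace (cos t ^ (2 * k + 1)) with (cos t ^ (2 * k) * cos t) by (rewrite pow_add; simpl; ring).
    change (cos t ^ S (2 * k)) with (cos t * cos t ^ (2 * k)).
    set (p := cos t ^ (2 * k)).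
    replace (- (2 * n - 1) * p * sin t) with (- (2 * n - 1) * (p * sin t)) by ring.
    apply Ceq_minus.
    transitivity (RtoC (2 * n) * RtoC (2 * n - 1) * ccosh a t * RtoC p * (1 - RtoC (cos t) * RtoC (cos t) - RtoC (sin t) * RtoC (sin t)))%C.
    - repeat rewrite ?RtoC_mult, ?RtoC_opp, ?RtoC_minus. ring.
    - rewrite <- !RtoC_mult, <- !RtoC_minus, S2.
      replace (1 - cos t * cos t - (1 - cos t * cos t)) with 0 by ring. ring. }
  assert (I : cint h 0 (PI / 2) (H (PI / 2)%R - H 0)%C).
  { apply cint_FTC; auto. apply PI2_pos. intros t _. unfold h.
    apply ccont_minus; apply ccont_mult; try apply ccont_const; apply ccont_cosint. }
  assert (H0 : (H (PI / 2)%R - H 0 = 0)%C).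
  { unfold H. rewrite cos_PI2, sin_0. unfold csinh at 2. rewrite !Cmult_0_r, Cexp_0.
    rewrite !(pow_i) by lia. unfold Cdiv. ring. }
  rewrite H0 in I.
  assert (I2 := cint_minus _ _ _ _ _ _ (cint_scal (a * a + RtoC (4 * n * n))%C _ _ _ _ (cosint_correct a (S k)))
      (cint_scal (RtoC (2 * n * (2 * n - 1))) _ _ _ _ (cosint_correct a k))).
  assert (E := cint_unique _ _ _ _ I). assert (E2 := cint_unique _ _ _ _ I2).
  unfold h in E. cbv beta in E2. rewrite E2 in E. apply Ceq_minus. exact E.
Qed.

Lemma ccosh_0 t : ccosh 0 t = 1.
Proof. unfold ccosh. replace (- 0 * RtoC t)%C with (0 * RtoC t)%C by ring. rewrite Cmult_0_l, Cexp_0. field. Qed.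

Definition wallis (k : nat) : R := RInt (fun t => cos t ^ (2 * k)) 0 (PI / 2).

Lemma is_RInt_wallis k : is_RInt (fun t => cos t ^ (2 * k)) 0 (PI / 2) (wallis k).
Proof.
  apply (RInt_correct (V:=R_CompleteNormedModule)), (ex_RInt_continuous (V:=R_CompleteNormedModule)).
  intros t _. apply (ex_derive_continuous (K:=R_AbsRing) (V:=R_NormedModule)). eexists. apply is_derive_pow, is_derive_cos.
Qed.

Lemma cosint_0 k : cosint 0 k = RtoC (wallis k).
Proof.
  apply cint_unique. apply (cint_ext (fun t => RtoC (cos t ^ (2 * k)))). apply PI2_pos.
  - intros t _. rewrite ccosh_0; ring.
  - split; [exact (is_RInt_wallis k)|]. change (is_RInt (fun _ : R => 0) 0 (PI / 2) 0).
    evar_last. apply (is_RInt_const (V:=R_NormedModule)). unfold scal; simpl; unfold mult; simpl; ring.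
Qed.

Lemma wallis_rec k : 2 * INR (S k) * wallis (S k) = (2 * INR (S k) - 1) * wallis k.
Proof.
  assert (H := cosint_rec 0 k). cbv zeta in H. rewrite !cosint_0 in H.
  rewrite Cmult_0_l, Cplus_0_l, <- !RtoC_mult in H. apply RtoC_inj in H.
  assert (0 < INR (S k)) by (apply lt_0_INR; lia). apply (Rmult_eq_reg_l (2 * INR (S k))); [|lra].
  rewrite <- !Rmult_assoc, <- H. ring.
Qed.

Lemma wallis_pos k : 0 < wallis k.
Proof.
  induction k.
  - unfold wallis. simpl. rewrite RInt_const. unfold scal; simpl; unfold mult; simpl. generalize PI_RGT_0; lra.
  - assert (H := wallis_rec k). assert (1 <= INR (S k)) by (apply (le_INR 1); lia). nra.
Qed.

Lemma cosint_base a : a <> RtoC 0 -> cosint a 0 = (csinh a (PI / 2)%R / a)%C.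
Proof.
  intros Ha. apply cint_unique.
  replace (csinh a (PI / 2)%R / a)%C with (/ a * csinh a (PI / 2)%R - / a * csinh a 0)%C.
  2:{ unfold csinh at 2. rewrite !Cmult_0_r, Cexp_0. field. auto. }
  apply (cint_FTC (fun u => / a * csinh a u)%C). apply PI2_pos.
  - intros t _. simpl. replace (ccosh a t * 1)%C with (/ a * (a * ccosh a t))%C by (field; auto).
    apply cder_scal, cder_csinh.
  - intros t _. apply (ccont_cosint a 0).
Qed.

(** The inequality [t <= tan t]. It gives [t^2 cos^(2k+2) t <= cos^(2k) t - cos^(2k+2) t], a
    difference of consecutive Wallis integrands. *)
Lemma mul_cos_le_sin t : 0 <= t -> t <= PI / 2 -> 0 <= t * cos t <= sin t.
Proof.
  intros H0 H1. assert (Hp := PI_RGT_0).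
  assert (Hc : forall u, 0 <= u <= t -> 0 <= cos u) by (intros; apply cos_ge_0; lra).
  split. apply Rmult_le_pos; auto. apply Hc; lra.
  destruct (MVT_gen (fun u => sin u - u * cos u) 0 t (fun u => u * sin u)) as [c [Hcc E]].
  - intros u _. auto_derive; auto. ring.
  - intros u _. apply derivable_continuous_pt. apply derivable_pt_minus. apply derivable_pt_sin.
    apply derivable_pt_mult. apply derivable_pt_id. apply derivable_pt_cos.
  - rewrite Rmin_left, Rmax_right in Hcc by auto. rewrite sin_0 in E.
    assert (0 <= sin c) by (apply sin_ge_0; lra).
    assert (0 <= c * sin c * (t - 0)) by (apply Rmult_le_pos; [apply Rmult_le_pos|]; lra). lra.
Qed.

(** High powers of the cosine concentrate at 0, where [ccosh a t] is 1 up to [K * t^2]. The weight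
    [t^2] is traded for the difference of two Wallis integrals, smaller than either by a factor of
    order [1 / k]. *)
Lemma cosint_ratio a : Ccv (fun k => cosint a (S k) / RtoC (wallis (S k)))%C 1.
Proof.
  set (K := Cmod a ^ 2 * exp (2 * Cmod a)).
  assert (HK : 0 <= K) by (apply Rmult_le_pos; [apply pow2_ge_0|left; apply exp_pos]).
  apply Ccv_dom with (fun k => 2 * K * / INR (S k)).
  - exists O; intros k _.
    assert (Hw := wallis_pos (S k)).
    assert (Hn : 1 <= INR (S k)) by (apply (le_INR 1); lia).
    replace (cosint a (S k) / RtoC (wallis (S k)) - 1)%C with ((cosint a (S k) - RtoC (wallis (S k))) / RtoC (wallis (S k)))%C
      by (field; apply RtoC_neq0; lra).
    rewrite Cmod_div, Cmod_RtoC_pos by (try apply RtoC_neq0; lra).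
    apply Rle_div_l; auto.
    rewrite <- cosint_0.
    assert (I := cint_minus _ _ _ _ _ _ (cosint_correct a (S k)) (cosint_correct 0 (S k))).
    assert (B := fun X Y => cint_bound _ (fun t => K * (cos t ^ (2 * k) - cos t ^ (2 * S k))) _ _ _ (K * (wallis k - wallis (S k))) PI2_pos X I Y).
    (* With [n = S k], the recurrence makes the difference [wallis n / (2 n - 1)], and
       [2 n - 1 >= n]. *)
    assert (E : wallis k - wallis (S k) <= wallis (S k) * / INR (S k)).
    { assert (R := wallis_rec k). apply (Rmult_le_reg_l (2 * INR (S k) - 1)); [lra|].
      rewrite Rmult_minus_distr_l, <- R.
      replace (2 * INR (S k) * wallis (S k) - (2 * INR (S k) - 1) * wallis (S k)) with (wallis (S k) * (INR (S k) * / INR (S k))) by (field; lra).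
      replace ((2 * INR (S k) - 1) * (wallis (S k) * / INR (S k))) with (wallis (S k) * ((2 * INR (S k) - 1) * / INR (S k))) by ring.
      apply Rmult_le_compat_l; [lra|]. apply Rmult_le_compat_r; [left; apply Rinv_0_lt_compat; lra|lra]. }
    eapply Rle_trans; [apply B|].
    + intros t Ht. rewrite ccosh_0.
      replace (ccosh a t * RtoC (cos t ^ (2 * S k)) - 1 * RtoC (cos t ^ (2 * S k)))%C with
       ((ccosh a t - 1) * RtoC (cos t ^ (2 * S k)))%C by ring.
      assert (Hp4 := PI_4).
      assert (Hcp : 0 <= cos t) by (apply cos_ge_0; lra).
      rewrite Cmod_mult, (Cmod_RtoC_pos (cos t ^ (2 * S k))) by (apply pow_le; auto).
      assert (M := ccosh_m1 a t ltac:(lra)). fold K in M.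
      assert (Hq : 0 <= cos t ^ (2 * k)) by (apply pow_le; auto).
      replace (cos t ^ (2 * S k)) with (cos t ^ (2 * k) * (cos t * cos t))
      by (replace (2 * S k)%nat with (2 * k + 2)%nat by lia; rewrite pow_add; simpl; ring).
      apply Rle_trans with (K * t ^ 2 * (cos t ^ (2 * k) * (cos t * cos t))).
      { apply Rmult_le_compat_r; auto. apply Rmult_le_pos; auto. nra. }
      replace (K * t ^ 2 * (cos t ^ (2 * k) * (cos t * cos t))) with (K * (cos t ^ (2 * k) * ((t * cos t) * (t * cos t)))) by ring.
      replace (cos t ^ (2 * k) - cos t ^ (2 * k) * (cos t * cos t)) with (cos t ^ (2 * k) * (sin t * sin t)).
      2:{ generalize (sin2_cos2 t). unfold Rsqr. intros S2. replace (sin t * sin t) with (1 - cos t * cos t) by lra. ring. }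
      apply Rmult_le_compat_l; auto. apply Rmult_le_compat_l; auto.
      assert (Q := mul_cos_le_sin t ltac:(lra) ltac:(lra)). apply Rmult_le_compat; lra.
    + apply (is_RInt_scal (V:=R_NormedModule)). apply (is_RInt_minus (V:=R_NormedModule)); apply is_RInt_wallis.
    + replace (2 * K * / INR (S k) * wallis (S k)) with (2 * (K * (wallis (S k) * / INR (S k)))) by ring.
      apply Rmult_le_compat_l; [lra|]. apply Rmult_le_compat_l; auto.
  - replace (Finite 0) with (Finite (2 * K * 0)) by (f_equal; ring).
    apply (is_lim_seq_scal_l _ (2 * K) 0).
    apply (is_lim_seq_inv (fun k => INR (S k)) p_infty); [|discriminate].
    apply (is_lim_seq_incr_1 INR). apply is_lim_seq_INR.
Qed.

Definition sinfac (z : C) (k : nat) : C := (1 - z * z / RtoC (INR (S k) * INR (S k)))%C.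

(** At [k = 0] the integral is elementary and gives the sine itself. Each use of [cosint_rec],
    divided by the case [a = 0], releases one factor [1 - z^2 / n^2]. *)
Lemma Csin_prod_fin z k : z <> RtoC 0 ->
  (Csin (RtoC PI * z) = RtoC PI * z * cprod (sinfac z) k * (cosint (2 * Ci * z) k / RtoC (wallis k)))%C.
Proof.
  intros Hz. set (a := (2 * Ci * z)%C).
  assert (Ha : a <> RtoC 0) by (apply Cmult_neq_0; auto; apply Cmult_neq_0; [apply C2_neq0|apply Ci_nz]).
  assert (Ci2 : (Ci * Ci = - (1))%C) by (unfold Ci, Cmult, Copp, RtoC; simpl; f_equal; ring).
  induction k.
  - rewrite cosint_base by auto. unfold wallis. simpl. rewrite RInt_const. unfold scal; simpl; unfold mult; simpl.
    replace ((PI / 2 - 0) * 1) with (PI * / 2) by field. rewrite RtoC_mult, RtoC_inv by lra.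
    assert (HP : RtoC PI <> RtoC 0) by (apply RtoC_neq0, PI_neq0).
    unfold Csin, csinh. replace (PI / 2) with (PI * / 2) by field. rewrite RtoC_mult, RtoC_inv by lra.
    replace (a * (RtoC PI * / 2))%C with (Ci * (RtoC PI * z))%C by (unfold a; field).
    replace (- a * (RtoC PI * / 2))%C with (- (Ci * (RtoC PI * z)))%C by (unfold a; field).
    unfold a. field. repeat split; auto; apply Ci_nz.
  - rewrite IHk. simpl cprod. unfold sinfac at 3.
    assert (R := cosint_rec a k). cbv zeta in R.
    assert (W := wallis_rec k). assert (Hw := wallis_pos k). assert (Hw' := wallis_pos (S k)).
    assert (Hn : 1 <= INR (S k)) by (apply (le_INR 1); lia).
    set (n := INR (S k)) in *.
    assert (E : wallis k = 2 * n * wallis (S k) / (2 * n - 1)) by (rewrite W; field; lra).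
    assert (Hn0 : RtoC n <> RtoC 0) by (apply RtoC_neq0; lra).
    assert (Hn1 : RtoC (2 * n - 1) <> RtoC 0) by (apply RtoC_neq0; lra).
    assert (Hw0 : RtoC (wallis (S k)) <> RtoC 0) by (apply RtoC_neq0; lra).
    assert (E2 : cosint a k = ((a * a + RtoC (4 * n * n)) * cosint a (S k) / RtoC (2 * n * (2 * n - 1)))%C).
    { rewrite R. field. rewrite RtoC_mult. apply Cmult_neq_0; auto. rewrite RtoC_mult; apply Cmult_neq_0; auto. apply C2_neq0. }
    rewrite E2, E. rewrite RtoC_div by lra. rewrite !RtoC_mult.
    replace (a * a)%C with (- (2 * 2 * (z * z)))%C by (unfold a; replace (2 * Ci * z * (2 * Ci * z))%C with (Ci * Ci * (2 * 2 * (z * z)))%C by ring; rewrite Ci2; ring).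
    replace (RtoC 4) with (2 * 2)%C by (rewrite <- RtoC_mult; f_equal; ring).
    field. repeat split; auto.
Qed.

Lemma Csin_prod z : z <> RtoC 0 -> Ccv (fun k => RtoC PI * z * cprod (sinfac z) (S k))%C (Csin (RtoC PI * z)).
Proof.
  intros Hz.
  assert (L := cosint_ratio (2 * Ci * z)).
  apply Ccv_ext_loc with (fun k => Csin (RtoC PI * z) / (cosint (2 * Ci * z) (S k) / RtoC (wallis (S k))))%C.
  - destruct (L 1 ltac:(lra)) as [N HN]. exists N. intros k Hk. rewrite (Csin_prod_fin z (S k) Hz).
    assert (Hnz : (cosint (2 * Ci * z) (S k) / RtoC (wallis (S k)))%C <> RtoC 0).
    { intros E. specialize (HN k Hk). rewrite E in HN. replace (0 - 1)%C with (- (1))%C in HN by ring.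
      rewrite Cmod_opp, Cmod_1 in HN. lra. }
    set (q := (cosint (2 * Ci * z) (S k) / RtoC (wallis (S k)))%C) in *. field. auto.
  - apply Ccv_eq with (Csin (RtoC PI * z) / 1)%C; [field|]. apply Ccv_div; auto. apply C1_nz. apply Ccv_const.
Qed.

(** The factors [z + j] and [j - z] pair up for [1 <= j <= k]; the first factor [z] and the last one
    [k + 1 - z] remain. *)
Lemma rising_refl z k : (rising z k * rising (1 - z) k = z * cprod (sinfac z) k * RtoC (INR (fact k) * INR (fact k)) * (RtoC (INR (S k)) - z))%C.
Proof.
  induction k.
  - simpl. replace (RtoC (1 * 1)) with (RtoC 1) by (f_equal; ring). ring.
  - cbn [rising cprod]. replace (rising z k * (z + RtoC (INR (S k))) * (rising (1 - z) k * (1 - z + RtoC (INR (S k)))))%C with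
     ((rising z k * rising (1 - z) k) * ((z + RtoC (INR (S k))) * (1 - z + RtoC (INR (S k)))))%C by ring.
    rewrite IHk. change (sinfac z k) with (1 - z * z / RtoC (INR (S k) * INR (S k)))%C.
    rewrite fact_simpl, mult_INR, (S_INR (S k)), RtoC_plus. rewrite !RtoC_mult. field.
    apply RtoC_neq0, not_0_INR; lia.
Qed.

Lemma RGam_refl z : z <> RtoC 0 -> (RGam z * RGam (1 - z) = Csin (RtoC PI * z) / RtoC PI)%C.
Proof.
  intros Hz. assert (HP : RtoC PI <> RtoC 0) by (apply RtoC_neq0, PI_neq0).
  apply (Ccv_unique (fun k => RG (S k) z * RG (S k) (1 - z))%C).
  - apply Ccv_mult; [apply (Ccv_subseq S (fun k => RG k z))|apply (Ccv_subseq S (fun k => RG k (1 - z)))]; auto; apply RG_cv.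
  - apply Ccv_ext with (fun k => (RtoC PI * z * cprod (sinfac z) (S k)) / RtoC PI * (RtoC (INR (S k + 1) / INR (S k + 0)) - z * RtoC (/ INR (S k))))%C.
    + intros k. unfold RG.
      assert (Hk : 0 < INR (S k)) by (apply lt_0_INR; lia).
      replace (S k + 1)%nat with (S (S k)) by lia. replace (S k + 0)%nat with (S k) by lia.
      transitivity ((rising z (S k) * rising (1 - z) (S k)) / (RtoC (INR (fact (S k)) * INR (fact (S k))) * (Rcpow (INR (S k)) z * Rcpow (INR (S k)) (1 - z))))%C.
      * rewrite rising_refl. rewrite <- Rcpow_plus. replace (z + (1 - z))%C with (RtoC 1) by ring. rewrite Rcpow_1 by auto.
        unfold Rdiv. rewrite RtoC_mult, !RtoC_inv by lra. rewrite RtoC_mult. field. repeat split; auto; try apply fact_neq0; apply RtoC_neq0; lra.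
      * rewrite RtoC_mult. field. repeat split; try apply Rcpow_neq0; apply fact_neq0.
    + apply Ccv_eq with (Csin (RtoC PI * z) / RtoC PI * (1 - z * 0))%C; [field; auto|].
      apply Ccv_mult. apply Ccv_div; auto. apply Csin_prod; auto. apply Ccv_const.
      apply Ccv_minus. apply Ccv_RtoC. apply lim_INR_ratio. apply Ccv_scal. apply Ccv_RtoC.
      apply (is_lim_seq_inv (fun k => INR (S k)) p_infty); [|discriminate].
      apply (is_lim_seq_incr_1 INR). apply is_lim_seq_INR.
Qed.

(** * Polynomial approximations of the cosine *)

(* Coefficients of the even Gegenbauer polynomial of degree [2 m] and parameter [-1/2], with value [1] at [0]. *)
Fixpoint gc (m k : nat) : R :=
  match k with
  | O => 1
  | S j => gc m j * ((2 * INR j - 2 * INR m) * (2 * INR j + 2 * INR m - 1)) / ((2 * INR j + 2) * (2 * INR j + 1))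
  end.

Lemma gc_S m k : (2 * INR k + 2) * (2 * INR k + 1) * gc m (S k) = gc m k * ((2 * INR k - 2 * INR m) * (2 * INR k + 2 * INR m - 1)).
Proof. simpl gc. generalize (pos_INR k); intros. field. lra. Qed.

Lemma gc_zero m k : (m < k)%nat -> gc m k = 0.
Proof.
  induction k; intros H; [lia|]. simpl gc. destruct (Nat.eq_dec m k) as [->|].
  - replace (2 * INR k - 2 * INR k) with 0 by ring. unfold Rdiv; ring.
  - rewrite IHk by lia. unfold Rdiv; ring.
Qed.

Lemma rsum_shift a k : rsum a (S k) = a O + rsum (fun j => a (S j)) k.
Proof. induction k. simpl; ring. change (rsum a (S (S k))) with (rsum a (S k) + a (S k)). rewrite IHk. simpl; ring. Qed.

Lemma csum_shift a k : csum a (S k) = (a O + csum (fun j => a (S j)) k)%C.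
Proof. induction k. simpl; ring. change (csum a (S (S k))) with (csum a (S k) + a (S k))%C. rewrite IHk. simpl; ring. Qed.

Lemma rsum_zero a k : (forall j, a j = 0) -> rsum a k = 0.
Proof. intros H; induction k; simpl; auto. rewrite IHk, H; ring. Qed.

Lemma is_derive_rsum (f : nat -> R -> R) (l : nat -> R) k x :
  (forall j, is_derive (f j) x (l j)) -> is_derive (fun u => rsum (fun j => f j u) k) x (rsum l k).
Proof.
  intros H; induction k; simpl. apply (is_derive_const (K:=R_AbsRing) (V:=R_NormedModule)).
  apply (is_derive_plus (K:=R_AbsRing) (V:=R_NormedModule)); auto.
Qed.

Definition gp (m : nat) (x : R) : R := rsum (fun k => gc m k * x ^ (2 * k)) (S m).
Definition gp1 (m : nat) (x : R) : R := rsum (fun k => (2 * INR k + 2) * gc m (S k) * x ^ (2 * k + 1)) m.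
Definition gp2 (m : nat) (x : R) : R := rsum (fun k => (2 * INR k + 2) * (2 * INR k + 1) * gc m (S k) * x ^ (2 * k)) m.

Lemma is_derive_gp m x : is_derive (gp m) x (gp1 m x).
Proof.
  unfold gp, gp1. apply is_derive_ext with (fun u => gc m 0 * 1 + rsum (fun k => gc m (S k) * u ^ (2 * S k)) m).
  { intros t. rewrite rsum_shift. reflexivity. }
  replace (rsum (fun k => (2 * INR k + 2) * gc m (S k) * x ^ (2 * k + 1)) m) with
    (0 + rsum (fun k => (2 * INR k + 2) * gc m (S k) * x ^ (2 * k + 1)) m) by ring.
  apply (is_derive_plus (K:=R_AbsRing) (V:=R_NormedModule)).
  apply (is_derive_const (K:=R_AbsRing) (V:=R_NormedModule)).
  apply is_derive_rsum. intros j.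
  evar_last. apply is_derive_scal, is_derive_pow, (is_derive_id (K:=R_AbsRing)).
  change (gc m (S j) * (INR (2 * S j) * 1 * x ^ pred (2 * S j)) = (2 * INR j + 2) * gc m (S j) * x ^ (2 * j + 1)).
  replace (pred (2 * S j)) with (2 * j + 1)%nat by lia. rewrite mult_INR, (S_INR j). simpl (INR 2). ring.
Qed.

Lemma is_derive_gp1 m x : is_derive (gp1 m) x (gp2 m x).
Proof.
  unfold gp1, gp2. apply is_derive_rsum. intros j.
  evar_last. apply is_derive_scal, is_derive_pow, (is_derive_id (K:=R_AbsRing)).
  change ((2 * INR j + 2) * gc m (S j) * (INR (2 * j + 1) * 1 * x ^ pred (2 * j + 1)) = (2 * INR j + 2) * (2 * INR j + 1) * gc m (S j) * x ^ (2 * j)).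
  replace (pred (2 * j + 1)) with (2 * j)%nat by lia. rewrite plus_INR, mult_INR. simpl (INR 2). simpl (INR 1). ring.
Qed.

(** Gegenbauer's equation, which for the parameter -1/2 has no first-order term. *)
Lemma gp_ode m x : (1 - x * x) * gp2 m x = - (2 * INR m * (2 * INR m - 1)) * gp m x.
Proof.
  assert (E1 : gp2 m x = rsum (fun k => gc m k * ((2 * INR k - 2 * INR m) * (2 * INR k + 2 * INR m - 1)) * x ^ (2 * k)) (S m)).
  { rewrite (rsum_ext _ (fun k => (2 * INR k + 2) * (2 * INR k + 1) * gc m (S k) * x ^ (2 * k))).
    2:{ intros j _. rewrite gc_S; auto. }
    unfold gp2. change (rsum ?a (S m)) with (rsum a m + a m). cbv beta. rewrite (gc_zero m (S m)) by lia. ring. }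
  assert (E2 : x * x * gp2 m x = rsum (fun k => gc m k * (2 * INR k * (2 * INR k - 1)) * x ^ (2 * k)) (S m)).
  { rewrite rsum_shift. unfold gp2. rewrite <- rsum_scal.
    rewrite (rsum_ext _ (fun j => gc m (S j) * (2 * INR (S j) * (2 * INR (S j) - 1)) * x ^ (2 * S j))).
    change (INR 0) with 0. ring. intros j _. replace (2 * S j)%nat with (2 * j + 2)%nat by lia.
    rewrite pow_add, S_INR. simpl (x ^ 2). ring. }
  rewrite Rmult_minus_distr_r, Rmult_1_l, E2, E1. unfold gp.
  replace (rsum (fun k => gc m k * ((2 * INR k - 2 * INR m) * (2 * INR k + 2 * INR m - 1)) * x ^ (2 * k)) (S m)) with
   (rsum (fun k => gc m k * (2 * INR k * (2 * INR k - 1)) * x ^ (2 * k) + - (2 * INR m * (2 * INR m - 1)) * (gc m k * x ^ (2 * k))) (S m)).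
  2:{ apply rsum_ext. intros; ring. }
  rewrite rsum_plus, rsum_scal. ring.
Qed.

(* Sonin's argument: [g^2 + (1 - x^2) g'^2 / N] decreases on [0, 1]. *)
Lemma gp_bound m x : (1 <= m)%nat -> 0 <= x <= 1 -> Rabs (gp m x) <= 1.
Proof.
  intros Hm Hx. assert (Hm1 : 1 <= INR m) by (apply (le_INR 1); auto).
  set (N := 2 * INR m * (2 * INR m - 1)). assert (HN : 0 < N) by (unfold N; nra).
  set (h := fun u => gp m u * gp m u + / N * ((1 - u * u) * (gp1 m u * gp1 m u))).
  assert (D : forall u, is_derive h u (- 2 * u * (gp1 m u * gp1 m u) / N)).
  { intros u. assert (D1 := is_derive_gp m u). assert (D2 := is_derive_gp1 m u).
    assert (Dq : is_derive (fun u => 1 - u * u) u (- 2 * u)) by (auto_derive; auto; ring).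
    assert (K := is_derive_plus (K:=R_AbsRing) (V:=R_NormedModule) _ _ _ _ _ (is_derive_mul_R _ _ _ _ _ D1 D1)
      (is_derive_scal _ _ (/ N) _ (is_derive_mul_R _ _ _ _ _ Dq (is_derive_mul_R _ _ _ _ _ D2 D2)))).
    evar_last. exact K. unfold plus; simpl.
    assert (O := gp_ode m u). fold N in O.
    replace ((1 - u * u) * (gp2 m u * gp1 m u + gp1 m u * gp2 m u)) with (2 * gp1 m u * ((1 - u * u) * gp2 m u)) by ring.
    rewrite O. field. lra. }
  destruct (MVT_gen h 0 x (fun u => - 2 * u * (gp1 m u * gp1 m u) / N)) as [c [Hc E]].
  - intros u _. apply D.
  - intros u _. apply derivable_continuous_pt. exists (- 2 * u * (gp1 m u * gp1 m u) / N). apply is_derive_Reals, D.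
  - rewrite Rmin_left, Rmax_right in Hc by lra.
    assert (H0 : h 0 = 1).
    { unfold h. assert (G1 : gp1 m 0 = 0).
      { unfold gp1. apply rsum_zero. intros j. rewrite pow_i by lia. ring. }
      assert (G0 : gp m 0 = 1).
      { unfold gp. rewrite rsum_shift. simpl gc. simpl (0 ^ (2 * 0)).
        rewrite rsum_zero. ring. intros j. rewrite pow_i by lia. ring. }
      rewrite G1, G0. ring. }
    assert (Hneg : - 2 * c * (gp1 m c * gp1 m c) / N * (x - 0) <= 0).
    { replace (- 2 * c * (gp1 m c * gp1 m c) / N * (x - 0)) with (- (2 * c * (gp1 m c * gp1 m c) * x * / N)) by (field; lra).
      assert (0 <= 2 * c * (gp1 m c * gp1 m c) * x * / N); [|lra].
      apply Rmult_le_pos; [|left; apply Rinv_0_lt_compat; auto].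
      apply Rmult_le_pos; [|lra]. apply Rmult_le_pos; [lra|nra]. }
    assert (Hh : h x <= 1) by lra.
    assert (P : 0 <= / N * ((1 - x * x) * (gp1 m x * gp1 m x))).
    { apply Rmult_le_pos; [left; apply Rinv_0_lt_compat; auto|]. apply Rmult_le_pos; nra. }
    unfold h in Hh. apply Rabs_le. split; nra.
Qed.

(** Coefficients after the substitution [x = y / (2 m)]. The differential equation becomes [(1 - y^2
    / (4 m^2)) G'' = - (1 - 1 / (2 m)) G], a perturbation of the one for the cosine. *)
Definition ge (m k : nat) : R := gc m k / (2 * INR m) ^ (2 * k).

Lemma fact_2S k : INR (fact (2 * S k)) = (2 * INR k + 2) * (2 * INR k + 1) * INR (fact (2 * k)).
Proof.
  replace (2 * S k)%nat with (S (S (2 * k))) by lia. rewrite !fact_simpl, !mult_INR, !S_INR, mult_INR. simpl (INR 2). ring.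
Qed.

Lemma ge_bound m k : (1 <= m)%nat -> Rabs (ge m k) <= / INR (fact (2 * k)).
Proof.
  intros Hm. assert (Hm1 : 1 <= INR m) by (apply (le_INR 1); auto).
  destruct (Nat.lt_ge_cases m k) as [Hk|Hk].
  { unfold ge. rewrite gc_zero by auto. unfold Rdiv. rewrite Rmult_0_l, Rabs_R0. left; apply Rinv_0_lt_compat, INR_fact_lt_0. }
  assert (B : Rabs (gc m k) * INR (fact (2 * k)) <= (2 * INR m) ^ (2 * k)).
  { induction k.
    - simpl. rewrite Rabs_R1. lra.
    - specialize (IHk ltac:(lia)). assert (Hk1 : INR k + 1 <= INR m) by (rewrite <- S_INR; apply le_INR; auto).
      assert (Hk0 := pos_INR k).
      rewrite fact_2S. assert (E := gc_S m k). apply (f_equal Rabs) in E. rewrite !Rabs_mult in E.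
      rewrite (Rabs_pos_eq (2 * INR k + 2)), (Rabs_pos_eq (2 * INR k + 1)) in E by lra.
      rewrite (Rabs_left (2 * INR k - 2 * INR m)), (Rabs_pos_eq (2 * INR k + 2 * INR m - 1)) in E by lra.
      replace (Rabs (gc m (S k)) * ((2 * INR k + 2) * (2 * INR k + 1) * INR (fact (2 * k)))) with
        (((2 * INR k + 2) * (2 * INR k + 1) * Rabs (gc m (S k))) * INR (fact (2 * k))) by ring.
      rewrite E. replace (2 * S k)%nat with (2 * k + 2)%nat by lia. rewrite pow_add.
      replace (Rabs (gc m k) * (- (2 * INR k - 2 * INR m) * (2 * INR k + 2 * INR m - 1)) * INR (fact (2 * k))) with
        ((Rabs (gc m k) * INR (fact (2 * k))) * (- (2 * INR k - 2 * INR m) * (2 * INR k + 2 * INR m - 1))) by ring.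
      apply Rmult_le_compat; auto.
      + apply Rmult_le_pos; [apply Rabs_pos|left; apply INR_fact_lt_0].
      + apply Rmult_le_pos; lra.
      + simpl. nra. }
  unfold ge, Rdiv. rewrite Rabs_mult, Rabs_inv, (Rabs_pos_eq (_ ^ _)) by (apply pow_le; lra).
  assert (P : 0 < (2 * INR m) ^ (2 * k)) by (apply pow_lt; lra).
  assert (F := INR_fact_lt_0 (2 * k)).
  apply (Rmult_le_reg_r ((2 * INR m) ^ (2 * k))); auto. rewrite Rmult_assoc, Rinv_l, Rmult_1_r by lra.
  apply (Rmult_le_reg_l (INR (fact (2 * k)))); auto. rewrite <- Rmult_assoc, Rinv_r, Rmult_1_l by lra. lra.
Qed.

Lemma ge_lim k : is_lim_seq (fun j => ge (S j) k) ((-1) ^ k / INR (fact (2 * k))).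
Proof.
  induction k.
  - apply is_lim_seq_ext with (fun _ => 1). intros; unfold ge; simpl; field.
    simpl. replace (1 / 1) with 1 by field. apply is_lim_seq_const.
  - apply is_lim_seq_ext with (fun j => ge (S j) k * (((INR k * / INR (S j) - 1) * (INR k * / INR (S j) + 1 - / 2 * / INR (S j))) * / ((2 * INR k + 2) * (2 * INR k + 1)))).
    + intros j. assert (Hj : 0 < INR (S j)) by (apply lt_0_INR; lia). assert (Hk := pos_INR k).
      unfold ge. change (gc (S j) (S k)) with (gc (S j) k * ((2 * INR k - 2 * INR (S j)) * (2 * INR k + 2 * INR (S j) - 1)) / ((2 * INR k + 2) * (2 * INR k + 1))).
      replace (2 * S k)%nat with (2 * k + 2)%nat by lia. rewrite pow_add.
      field. repeat split; try (apply pow_nonzero); lra.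
    + assert (L := is_lim_seq_inv (fun k => INR (S k)) p_infty (proj1 (is_lim_seq_incr_1 INR p_infty) is_lim_seq_INR) ltac:(discriminate)).
      change (Rbar_inv p_infty) with (Finite 0) in L.
      replace (Finite ((-1) ^ S k / INR (fact (2 * S k)))) with
        (Finite ((-1) ^ k / INR (fact (2 * k)) * (((INR k * 0 - 1) * (INR k * 0 + 1 - / 2 * 0)) * / ((2 * INR k + 2) * (2 * INR k + 1))))).
      2:{ f_equal. rewrite fact_2S. simpl. assert (Hk := pos_INR k). field. split; [apply INR_fact_neq_0|lra]. }
      apply is_lim_seq_mult'; auto. apply is_lim_seq_mult'; [|apply is_lim_seq_const].
      apply is_lim_seq_mult'.
      * apply is_lim_seq_minus'; [|apply is_lim_seq_const]. apply (is_lim_seq_scal_l _ (INR k) 0); auto.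
      * apply is_lim_seq_minus'; [apply is_lim_seq_plus'; [|apply is_lim_seq_const]|].
        apply (is_lim_seq_scal_l _ (INR k) 0); auto. apply (is_lim_seq_scal_l _ (/ 2) 0); auto.
Qed.

Lemma cos_series y : Ccv (csum (fun k => RtoC ((-1) ^ k / INR (fact (2 * k)) * y ^ (2 * k)))) (RtoC (cos y)).
Proof.
  assert (H : infinite_sum (fun i => cos_n i * Rsqr y ^ i) (cos y)).
  { unfold cos. destruct (exist_cos (Rsqr y)) as [a Ha]. exact Ha. }
  apply Ccv_unshift.
  apply Ccv_ext with (fun k => RtoC (sum_f_R0 (fun i => cos_n i * Rsqr y ^ i) k)).
  - assert (E : forall k, RtoC (cos_n k * Rsqr y ^ k) = RtoC ((-1) ^ k / INR (fact (2 * k)) * y ^ (2 * k))).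
    { intros k. unfold cos_n. rewrite pow_mult, Rsqr_pow2. auto. }
    intros k. induction k.
    + cbn [sum_f_R0 csum]. rewrite E. ring.
    + cbn [sum_f_R0]. rewrite RtoC_plus, IHk, E. reflexivity.
  - apply Ccv_RtoC. apply is_lim_seq_Reals. exact H.
Qed.

Lemma summable_cosh A : 0 <= A -> summable (fun k => / INR (fact (2 * k)) * A ^ (2 * k)).
Proof.
  intros HA. destruct (summable_exp A HA) as [B HB]. exists B. intros k.
  eapply Rle_trans; [|apply (HB (2 * k)%nat)].
  induction k. simpl; lra. replace (2 * S k)%nat with (S (S (2 * k))) by lia.
  cbn [rsum].
  assert (0 <= A ^ S (2 * k) / INR (fact (S (2 * k)))).
  { apply Rmult_le_pos. apply pow_le; auto. left; apply Rinv_0_lt_compat, INR_fact_lt_0. }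
  unfold Rdiv in *. lra.
Qed.

Definition gG (m : nat) (y : R) : R := rsum (fun k => ge m k * y ^ (2 * k)) (S m).

Lemma RtoC_rsum a k : RtoC (rsum a k) = csum (fun j => RtoC (a j)) k.
Proof. induction k; simpl; auto. rewrite RtoC_plus, IHk; auto. Qed.

(** The rescaled image of [gp_bound]. It holds only up to [2 m], and this is where the approximating
    Mellin integrals are cut off. *)
Lemma gG_bound m y : (1 <= m)%nat -> 0 <= y <= 2 * INR m -> Rabs (gG m y) <= 1.
Proof.
  intros Hm Hy. assert (Hm1 : 1 <= INR m) by (apply (le_INR 1); auto).
  replace (gG m y) with (gp m (y / (2 * INR m))).
  - apply gp_bound; auto. split. apply Rmult_le_pos; [lra|left; apply Rinv_0_lt_compat; lra].
    apply Rle_div_l; lra.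
  - unfold gp, gG. apply rsum_ext. intros j _. unfold ge, Rdiv. rewrite Rpow_mult_distr, pow_inv. ring.
Qed.

(** On [[0, A]] the error is at most the sum of [A^(2 k)] times the coefficient errors, and
    [tannery] sends this sum to 0 with the terms of twice [cosh A] as majorant. *)
Lemma gG_cos_unif A eta : 0 <= A -> 0 < eta -> exists M, forall m y, (M <= m)%nat -> 0 <= y <= A -> Rabs (gG (S m) y - cos y) <= eta.
Proof.
  intros HA He.
  set (al := fun k => (-1) ^ k / INR (fact (2 * k))).
  set (b := fun k => 2 * (/ INR (fact (2 * k)) * A ^ (2 * k))).
  set (u := fun m k => RtoC (Rabs (ge (S m) k - al k) * A ^ (2 * k))).
  assert (Hb : summable b) by (apply summable_scal; [lra|apply summable_cosh; auto]).
  assert (Hal : forall k, Rabs (al k) = / INR (fact (2 * k))).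
  { intros k. unfold al, Rdiv. rewrite Rabs_mult, pow_1_abs, Rabs_inv, Rabs_pos_eq by (left; apply INR_fact_lt_0). ring. }
  assert (Hd : forall m k, Rabs (ge (S m) k - al k) <= 2 * / INR (fact (2 * k))).
  { intros m k. eapply Rle_trans; [apply Rabs_triang|]. rewrite Rabs_Ropp, Hal.
    assert (K := ge_bound (S m) k ltac:(lia)). lra. }
  assert (Hu : forall m k, Cmod (u m k) <= b k).
  { intros m k. unfold u, b. rewrite Cmod_RtoC_pos by (apply Rmult_le_pos; [apply Rabs_pos|apply pow_le; auto]).
    rewrite <- Rmult_assoc. apply Rmult_le_compat_r. apply pow_le; auto. apply Hd. }
  assert (L : Ccv (fun m => Cser (u m)) (Cser (fun _ => RtoC 0))).
  { apply tannery with b; auto. exists O; auto. intros k.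
    apply Ccv_RtoC. replace (Finite 0) with (Finite (Rabs (al k - al k) * A ^ (2 * k))).
    2:{ f_equal. rewrite Rminus_diag, Rabs_R0; ring. }
    apply (is_lim_seq_scal_r _ (A ^ (2 * k)) (Rabs (al k - al k))).
    apply (is_lim_seq_abs _ (al k - al k)). apply is_lim_seq_minus'. apply ge_lim. apply is_lim_seq_const. }
  rewrite (Cser_fin _ O) in L by auto. simpl in L.
  destruct (L eta He) as [M HM]. exists M. intros m y Hm Hy. specialize (HM m Hm).
  replace (Cser (u m) - 0)%C with (Cser (u m)) in HM by ring.
  rewrite <- Cmod_R. rewrite RtoC_minus.
  apply (Ccv_bound (fun k => csum (fun j => RtoC (ge (S m) j * y ^ (2 * j))) k - csum (fun j => RtoC (al j * y ^ (2 * j))) k)%C).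
  - exists O; intros k _. rewrite <- csum_minus.
    apply Rle_trans with (rsum (fun j => Rabs (ge (S m) j - al j) * A ^ (2 * j)) k).
    + apply csum_Cmod. intros j _. rewrite <- RtoC_minus, <- Rmult_minus_distr_r, Cmod_R, Rabs_mult.
      apply Rmult_le_compat_l; [apply Rabs_pos|]. rewrite Rabs_pos_eq by (apply pow_le; lra). apply pow_incr; lra.
    + apply Rle_trans with (Cmod (Cser (u m))); [|lra].
      assert (LC := csum_cv (u m) b (Hu m) Hb).
      assert (LM := Ccv_Cmod _ _ LC).
      refine (is_lim_seq_le_loc (fun _ => rsum (fun j => Rabs (ge (S m) j - al j) * A ^ (2 * j)) k) _ (rsum (fun j => Rabs (ge (S m) j - al j) * A ^ (2 * j)) k) (Cmod (Cser (u m))) _ _ LM).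
      * exists k. intros n Hn. unfold u. rewrite <- RtoC_rsum, Cmod_RtoC_pos.
        apply rsum_incr; auto. intros; apply Rmult_le_pos; [apply Rabs_pos|apply pow_le; auto].
        apply rsum_pos. intros; apply Rmult_le_pos; [apply Rabs_pos|apply pow_le; auto].
      * apply is_lim_seq_const.
  - apply Ccv_minus; [|apply cos_series].
    apply Ccv_ext_loc with (fun _ => RtoC (gG (S m) y)); [|apply Ccv_const].
    exists (S (S m)). intros k Hk. unfold gG. rewrite RtoC_rsum.
    induction Hk as [|j Hj IH]; auto. rewrite IH. cbn [csum].
    assert (Z : ge (S m) j = 0) by (unfold ge; rewrite gc_zero by lia; unfold Rdiv; ring).
    rewrite Z, Rmult_0_l. ring.
Qed.

(** * Partial fractions *)

(** The residue at [k] of [1 / (v (v - 1) ... (v - m))]. *)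
Definition wt (m k : nat) : R := (-1) ^ (m - k) / (INR (fact k) * INR (fact (m - k))).

Lemma wt_S1 m k : (k <= m)%nat -> wt (S m) k * (INR k - INR (S m)) = wt m k.
Proof.
  intros H. unfold wt. replace (S m - k)%nat with (S (m - k)) by lia.
  rewrite fact_simpl, mult_INR. replace (INR k - INR (S m)) with (- INR (S (m - k))).
  2:{ replace (S m) with (k + S (m - k))%nat by lia. rewrite plus_INR. replace (k + S (m - k) - k)%nat with (S (m - k)) by lia. ring. }
  simpl pow. field. repeat split; try apply INR_fact_neq_0. apply not_0_INR; lia.
Qed.

Lemma wt_S2 m k : INR (S k) * wt (S m) (S k) = wt m k.
Proof.
  unfold wt. simpl Nat.sub. rewrite fact_simpl, mult_INR. field.
  repeat split; try apply INR_fact_neq_0. apply not_0_INR; lia.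
Qed.

Definition Qh (p : nat) (z : C) : C := cprod (fun j => z + RtoC (/ 2 + INR j))%C p.

Definition Zs (m : nat) (q : nat -> C) : C := csum (fun k => RtoC (wt m k) * q k)%C (S m).
Definition Ss (m : nat) (q : nat -> C) (v : C) : C := csum (fun k => RtoC (wt m k) * q k / (v - RtoC (INR k)))%C (S m).

Lemma Zs_step m q : Zs (S m) (fun k => (RtoC (INR k) - RtoC (INR (S m))) * q k)%C = Zs m q.
Proof.
  unfold Zs. change (csum ?a (S (S m))) with (csum a (S m) + a (S m))%C.
  replace (RtoC (INR (S m)) - RtoC (INR (S m)))%C with (RtoC 0) by ring.
  rewrite (csum_ext _ (fun k => RtoC (wt m k) * q k)%C). ring.
  intros j Hj. rewrite <- (wt_S1 m j) by lia. rewrite RtoC_mult, RtoC_minus. ring.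
Qed.

Lemma Zs_one m : Zs (S m) (fun _ => RtoC 1) = RtoC 0.
Proof.
  assert (E1 := Zs_step m (fun _ => RtoC 1)).
  assert (E2 : Zs (S m) (fun k => RtoC (INR k) * 1)%C = Zs m (fun _ => RtoC 1)).
  { unfold Zs. rewrite csum_shift. simpl (INR 0). replace (RtoC (wt (S m) 0) * (0 * 1))%C with (RtoC 0) by ring.
    rewrite Cplus_0_l. apply csum_ext. intros j _. rewrite <- (wt_S2 m j), RtoC_mult. ring. }
  assert (Hm : RtoC (INR (S m)) <> RtoC 0) by (apply RtoC_neq0, not_0_INR; lia).
  assert (E3 : (RtoC (INR (S m)) * Zs (S m) (fun _ => RtoC 1) = 0)%C).
  { replace (RtoC (INR (S m)) * Zs (S m) (fun _ => RtoC 1))%C with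
     (Zs (S m) (fun k => RtoC (INR k) * 1)%C - Zs (S m) (fun k => (RtoC (INR k) - RtoC (INR (S m))) * 1)%C)%C.
    rewrite E1, E2. ring.
    unfold Zs. rewrite <- csum_scal, <- csum_minus. apply csum_ext. intros; ring. }
  replace (Zs (S m) (fun _ => RtoC 1)) with (/ RtoC (INR (S m)) * (RtoC (INR (S m)) * Zs (S m) (fun _ => RtoC 1)))%C by (field; auto).
  rewrite E3. ring.
Qed.

(** [Zs m] is the divided difference over [0, ..., m], which kills polynomials of degree below [m].
    The induction on the degree rewrites the last factor of [Qh] around the node [S m], dropping
    that node. *)
Lemma Zs_zero p : forall m, (p < m)%nat -> Zs m (fun k => Qh p (RtoC (INR k))) = RtoC 0.
Proof.
  induction p; intros m Hm; (destruct m as [|m]; [lia|]).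
  - apply Zs_one.
  - assert (E : Zs (S m) (fun k => Qh (S p) (RtoC (INR k))) =
      (Zs (S m) (fun k => (RtoC (INR k) - RtoC (INR (S m))) * Qh p (RtoC (INR k)))
       + (RtoC (INR (S m)) + RtoC (/ 2 + INR p)) * Zs (S m) (fun k => Qh p (RtoC (INR k))))%C).
    { unfold Zs. rewrite <- csum_scal, <- csum_plus. apply csum_ext. intros j _. unfold Qh; simpl. ring. }
    rewrite E, Zs_step, !IHp by lia. ring.
Qed.

Lemma Ss_step m q v : (forall k : nat, (v - RtoC (INR k))%C <> RtoC 0) ->
  ((v - RtoC (INR (S m))) * Ss (S m) q v = Ss m q v + Zs (S m) q)%C.
Proof.
  intros Hv. unfold Ss, Zs.
  change (csum ?a (S (S m))) with (csum a (S m) + a (S m))%C.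
  rewrite Cmult_plus_distr_l, <- csum_scal, Cplus_assoc, <- csum_plus. f_equal.
  - apply csum_ext. intros j Hj. rewrite <- (wt_S1 m j) by lia. rewrite RtoC_mult, RtoC_minus.
    field. apply Hv.
  - field. apply Hv.
Qed.

Definition poles (m : nat) (v : C) : C := cprod (fun k => v - RtoC (INR k))%C (S m).

(** Partial fractions of a polynomial of degree at most [m] over the [m + 1] simple poles
    [0, ..., m]. Adding a pole costs a divided difference, by [Ss_step], which vanishes for low
    degree. *)
Lemma Ss_closed m : forall p v, (p <= m)%nat -> (forall k : nat, (v - RtoC (INR k))%C <> RtoC 0) ->
  Ss m (fun k => Qh p (RtoC (INR k))) v = (Qh p v / poles m v)%C.
Proof.
  induction m; intros p v Hp Hv.
  - replace p with O by lia. unfold Ss, Qh, poles, wt. simpl. assert (H := Hv O). simpl in H.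
    replace (1 / (1 * 1)) with 1 by field.
    assert (H' : v <> RtoC 0) by (intros E; apply H; rewrite E; ring).
    field. repeat split; auto.
  - assert (Hpol : forall k, poles k v <> RtoC 0) by (intros; apply cprod_neq0; intros; apply Hv).
    assert (C1 : forall p, (p <= m)%nat -> Ss (S m) (fun k => Qh p (RtoC (INR k))) v = (Qh p v / poles (S m) v)%C).
    { intros q Hq. assert (E := Ss_step m (fun k => Qh q (RtoC (INR k))) v Hv).
      rewrite IHm, Zs_zero, Cplus_0_r in E by (auto; lia).
      change (poles (S m) v) with (poles m v * (v - RtoC (INR (S m))))%C.
      replace (Ss (S m) (fun k => Qh q (RtoC (INR k))) v) with
       ((v - RtoC (INR (S m))) * Ss (S m) (fun k => Qh q (RtoC (INR k))) v / (v - RtoC (INR (S m))))%C by (field; auto).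
      rewrite E. field. split; auto. }
    (* In the top degree the induction hypothesis does not apply. The last factor at [k] is written
       as [(v + c) - (v - k)]: the first part is the lower-degree case and the second a vanishing
       divided difference. *)
    destruct (Nat.eq_dec p (S m)) as [->|Hne]; [|apply C1; lia].
    transitivity ((v + RtoC (/ 2 + INR m)) * Ss (S m) (fun k => Qh m (RtoC (INR k))) v - Zs (S m) (fun k => Qh m (RtoC (INR k))))%C.
    + unfold Ss, Zs. rewrite <- csum_scal, <- csum_minus. apply csum_ext. intros j _. unfold Qh; simpl.
      field. apply Hv.
    + rewrite C1, Zs_zero by lia. change (Qh (S m) v) with (Qh m v * (v + RtoC (/ 2 + INR m)))%C. field. auto.
Qed.

Lemma Qh_rising p z : Qh (S p) z = rising (z + RtoC (/ 2)) p.
Proof.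
  induction p. unfold Qh; simpl. rewrite Rplus_0_r. ring.
  change (Qh (S (S p)) z) with (Qh (S p) z * (z + RtoC (/ 2 + INR (S p))))%C. rewrite IHp.
  cbn [rising]. rewrite RtoC_plus. ring.
Qed.

Lemma Qh_shift p z : (Qh p (z + 1) * (z + RtoC (/ 2)) = Qh p z * (z + RtoC (/ 2 + INR p)))%C.
Proof.
  induction p. unfold Qh; simpl. rewrite Rplus_0_r. ring.
  change (Qh (S p) ?z) with (Qh p z * (z + RtoC (/ 2 + INR p)))%C.
  replace (Qh p (z + 1) * (z + 1 + RtoC (/ 2 + INR p)) * (z + RtoC (/ 2)))%C with
   ((Qh p (z + 1) * (z + RtoC (/ 2))) * (z + 1 + RtoC (/ 2 + INR p)))%C by ring.
  rewrite IHp, S_INR, !RtoC_plus. ring.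
Qed.

(** Identifies the Gegenbauer coefficients, up to normalization at [k = 0], as residues of
    [Qh / poles]: both sides obey the same two-term recurrence in [k]. *)
Lemma gc_wt n k : (k <= S (S n))%nat ->
  (RtoC (gc (S (S n)) k) * (RtoC (wt (S (S n)) 0) * Qh (S n) 0) = RtoC (wt (S (S n)) k) * Qh (S n) (RtoC (INR k)))%C.
Proof.
  set (m := S (S n)). induction k; intros Hk.
  - simpl. ring.
  - assert (Hk0 := pos_INR k).
    assert (Q := Qh_shift (S n) (RtoC (INR k))). rewrite <- !RtoC_plus, <- S_INR in Q.
    assert (W : wt m (S k) * INR (S k) = wt m k * (INR k - INR m)).
    { unfold m. rewrite Rmult_comm, wt_S2. rewrite <- (wt_S1 (S n) k) by lia. auto. }
    assert (G := gc_S m k). specialize (IHk ltac:(lia)).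
    assert (Em : INR m - / 2 = / 2 + INR (S n) + 0) by (unfold m; rewrite (S_INR (S n)); field).
    assert (N1 : RtoC ((2 * INR k + 2) * (2 * INR k + 1)) <> RtoC 0) by (apply RtoC_neq0; nra).
    apply Ceq_minus.
    assert (Z : (RtoC ((2 * INR k + 2) * (2 * INR k + 1)) * (RtoC (gc m (S k)) * (RtoC (wt m 0) * Qh (S n) 0) - RtoC (wt m (S k)) * Qh (S n) (RtoC (INR (S k)))) = 0)%C).
    { transitivity ((RtoC ((2 * INR k + 2) * (2 * INR k + 1) * gc m (S k)) * (RtoC (wt m 0) * Qh (S n) 0)) -
        4 * RtoC (wt m (S k) * INR (S k)) * (Qh (S n) (RtoC (INR (S k))) * RtoC (INR k + / 2)))%C.
      { replace ((2 * INR k + 2) * (2 * INR k + 1)) with (4 * INR (S k) * (INR k + / 2)) by (rewrite S_INR; field).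
        rewrite !RtoC_mult. ring. }
      rewrite G, Q, W.
      replace (RtoC (gc m k * ((2 * INR k - 2 * INR m) * (2 * INR k + 2 * INR m - 1))) * (RtoC (wt m 0) * Qh (S n) 0))%C with
       (RtoC ((2 * INR k - 2 * INR m) * (2 * INR k + 2 * INR m - 1)) * (RtoC (gc m k) * (RtoC (wt m 0) * Qh (S n) 0)))%C by (rewrite !RtoC_mult; ring).
      rewrite IHk.
      replace (INR k + (/ 2 + INR (S n))) with (INR k + INR m - / 2) by (rewrite <- (Rplus_0_r (/ 2 + INR (S n))), <- Em; ring).
      replace ((2 * INR k - 2 * INR m) * (2 * INR k + 2 * INR m - 1)) with (4 * (INR k - INR m) * (INR k + INR m - / 2)) by field.
      rewrite !RtoC_mult. ring. }
    replace (RtoC (gc m (S k)) * (RtoC (wt m 0) * Qh (S n) 0) - RtoC (wt m (S k)) * Qh (S n) (RtoC (INR (S k))))%C with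
     (/ RtoC ((2 * INR k + 2) * (2 * INR k + 1)) * (RtoC ((2 * INR k + 2) * (2 * INR k + 1)) * (RtoC (gc m (S k)) * (RtoC (wt m 0) * Qh (S n) 0) - RtoC (wt m (S k)) * Qh (S n) (RtoC (INR (S k))))))%C by (field; auto).
    rewrite Z. ring.
Qed.

Lemma poles_rising m v : poles (S m) v = (RtoC ((-1) ^ S m) * v * rising (1 - v) m)%C.
Proof.
  induction m.
  - unfold poles. simpl. rewrite RtoC_mult. replace (RtoC (-1)) with (- (1))%C by (rewrite <- RtoC_opp; auto). ring.
  - change (poles (S (S m)) v) with (poles (S m) v * (v - RtoC (INR (S (S m)))))%C. rewrite IHm.
    cbn [rising]. rewrite (S_INR (S m)), RtoC_plus. change ((-1) ^ S (S m)) with (-1 * (-1) ^ S m).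
    rewrite (RtoC_mult (-1)). replace (RtoC (-1)) with (- (1))%C by (rewrite <- RtoC_opp; auto). ring.
Qed.

(** The right-hand side is built from Gauss products, so that its growth in [n] is governed by
    [Gamma (1 - v) / (v * Gamma (v + 1/2))]. This is how the Gamma function enters the transform of
    [1 - cos]. *)
Lemma gc_frac n v : (forall k : nat, (v - RtoC (INR k))%C <> RtoC 0) ->
  csum (fun k => RtoC (gc (S (S n)) k) / (v - RtoC (INR k)))%C (S (S (S n))) =
  (rising (v + RtoC (/2)) n * RtoC (INR (fact (S (S n)))) / (rising (RtoC (/2)) n * (v * rising (1 - v) (S n))))%C.
Proof.
  intros Hv. set (m := S (S n)).
  assert (Hr : rising (RtoC (/2)) n <> RtoC 0).
  { rewrite <- (Cplus_0_l (RtoC (/2))), <- Qh_rising. apply cprod_neq0. intros j _. rewrite <- RtoC_plus. apply RtoC_neq0.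
    generalize (pos_INR j); lra. }
  assert (Hp : poles m v <> RtoC 0) by (apply cprod_neq0; intros; apply Hv).
  assert (Hp' := Hp). unfold m in Hp'. rewrite poles_rising in Hp'.
  assert (Hs : RtoC ((-1) ^ m) <> RtoC 0) by (apply RtoC_neq0, pow_nonzero; lra).
  assert (Hf : RtoC (INR (fact m)) <> RtoC 0) by apply fact_neq0.
  assert (Hw : RtoC (wt m 0) = (RtoC ((-1) ^ m) / RtoC (INR (fact m)))%C).
  { unfold wt. rewrite Nat.sub_0_r. simpl (fact 0). simpl (INR 1). rewrite Rmult_1_l, RtoC_div; auto. apply INR_fact_neq_0. }
  assert (E : csum (fun k => RtoC (gc m k) / (v - RtoC (INR k)))%C (S m) = (/ (RtoC (wt m 0) * Qh (S n) 0) * Ss m (fun k => Qh (S n) (RtoC (INR k))) v)%C).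
  { unfold Ss. rewrite <- csum_scal. apply csum_ext. intros j Hj.
    assert (G := gc_wt n j ltac:(unfold m in *; lia)). fold m in G. rewrite <- G. rewrite Qh_rising, Cplus_0_l, Hw. field. repeat split; auto. }
  rewrite E, Ss_closed by (auto; unfold m; lia).
  rewrite !Qh_rising, Cplus_0_l, Hw. unfold m in Hp |- *. rewrite poles_rising in Hp |- *. fold m in Hp |- *.
  assert (Hss : (RtoC ((-1) ^ m) * RtoC ((-1) ^ m) = 1)%C).
  { rewrite <- RtoC_mult, <- Rpow_mult_distr. replace (-1 * -1) with 1 by ring. rewrite pow1; auto. }
  assert (Hv0 : v <> RtoC 0) by (intros E0; apply Hp; rewrite E0; ring).
  assert (Hr0 : rising (1 - v) (S n) <> RtoC 0) by (intros E0; apply Hp; rewrite E0; ring).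
  transitivity (rising (v + RtoC (/2)) n * RtoC (INR (fact m)) / ((RtoC ((-1) ^ m) * RtoC ((-1) ^ m)) * (rising (RtoC (/2)) n * (v * rising (1 - v) (S n)))))%C.
  field. repeat split; auto. rewrite Hss, Cmult_1_l. auto.
Qed.

(** * The Mellin transform of [1 - cos] *)

Definition pw (y r : R) : R := exp (r * ln y).

Lemma pw_pos y r : 0 < pw y r.
Proof. apply exp_pos. Qed.

Lemma pw_plus y r s : pw y (r + s) = pw y r * pw y s.
Proof. unfold pw. rewrite Rmult_plus_distr_r, exp_plus; auto. Qed.

Lemma exp_le a b : a <= b -> exp a <= exp b.
Proof. intros [H|H]. left; apply exp_increasing; auto. rewrite H; lra. Qed.

Lemma pw_le_exp y r s : 1 <= y -> r <= s -> pw y r <= pw y s.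
Proof.
  intros Hy Hr. apply exp_le. apply Rmult_le_compat_r; auto. rewrite <- ln_1. apply ln_le; lra.
Qed.

Lemma pw_ge_exp y r s : 0 < y <= 1 -> r <= s -> pw y s <= pw y r.
Proof.
  intros Hy Hr. apply exp_le. assert (ln y <= 0) by (rewrite <- ln_1; apply ln_le; lra). nra.
Qed.

Lemma pw_neg_base x y r : 0 < x <= y -> r <= 0 -> pw y r <= pw x r.
Proof.
  intros Hy Hr. apply exp_le. assert (ln x <= ln y) by (apply ln_le; lra). nra.
Qed.

Lemma pw_INR y k : 0 < y -> pw y (INR k) = y ^ k.
Proof.
  intros Hy; induction k. unfold pw; simpl. rewrite Rmult_0_l, exp_0; auto.
  rewrite S_INR, pw_plus, IHk. unfold pw. rewrite Rmult_1_l, exp_ln by auto. simpl; ring.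
Qed.

Lemma Cmod_Rcpow_pw y s : Cmod (Rcpow y s) = pw y (fst s).
Proof. apply Cmod_Rcpow. Qed.

Lemma is_derive_pw r y : 0 < y -> is_derive (fun u => pw u r) y (r * pw y (r - 1)).
Proof.
  intros Hy. unfold Rminus. rewrite pw_plus. unfold pw.
  auto_derive; auto. replace (exp (- (1) * ln y)) with (/ y).
  ring. replace (- (1) * ln y) with (- ln y) by ring. rewrite exp_Ropp, exp_ln; auto.
Qed.

Lemma cder_Rcpow al y : 0 < y -> cder (fun u => Rcpow u al) y (al * Rcpow y (al - 1))%C.
Proof.
  intros Hy. unfold Rcpow at 1.
  replace (al * Rcpow y (al - 1))%C with (al * RtoC (/ y) * Cexp (al * RtoC (ln y)))%C.
  - apply (cder_Cexp (fun u => al * RtoC (ln u))%C). apply cder_scal. apply cder_RtoC. apply is_derive_ln; auto.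
  - unfold Cminus. rewrite Rcpow_plus, Rcpow_opp, Rcpow_1, RtoC_inv by lra. fold (Rcpow y al). ring.
Qed.

Lemma ccont_Rcpow al y : 0 < y -> ccont (fun u => Rcpow u al) y.
Proof. intros; eapply cder_ccont, cder_Rcpow; auto. Qed.

Lemma is_RInt_pw r a b : r <> 0 -> 0 < a <= b -> is_RInt (fun u => pw u (r - 1)) a b ((pw b r - pw a r) / r).
Proof.
  intros Hr Hab. replace ((pw b r - pw a r) / r) with (minus (/ r * pw b r) (/ r * pw a r)).
  2:{ unfold minus, plus, opp; simpl. field; auto. }
  apply (is_RInt_derive (V:=R_CompleteNormedModule) (fun u => / r * pw u r) (fun u => pw u (r - 1)));
  rewrite Rmin_left, Rmax_right by lra; intros u Hu.
  - evar_last. apply is_derive_scal, is_derive_pw; lra. simpl. field; auto.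
  - apply (ex_derive_continuous (K:=R_AbsRing) (V:=R_NormedModule)). eexists. apply is_derive_pw; lra.
Qed.

Definition mker (v : C) (y : R) : C := Rcpow y (- (2 * v) - 1)%C.

Lemma Cmod_mker (v : C) y : Cmod (mker v y) = pw y (- (2 * fst v) - 1).
Proof. unfold mker. rewrite Cmod_Rcpow_pw. f_equal. simpl. ring. Qed.

Definition Mint (v : C) (e A : R) : C := CInt (fun y => RtoC (1 - cos y) * mker v y)%C e A.

Lemma ccont_mcos v y : 0 < y -> ccont (fun y => RtoC (1 - cos y) * mker v y)%C y.
Proof.
  intros Hy. apply ccont_mult; [|apply ccont_Rcpow; auto].
  eapply cder_ccont, cder_RtoC. auto_derive; auto.
Qed.

Lemma Mint_correct v e A : 0 < e <= A -> cint (fun y => RtoC (1 - cos y) * mker v y)%C e A (Mint v e A).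
Proof. intros H. apply CInt_correct. lra. intros t Ht. apply ccont_mcos; lra. Qed.

(** A primitive of [(gG m - 1)] times the kernel. The constant term of [gG m] is removed by the 1,
    so every exponent has positive real part in the strip and [Phi] is small near 0. *)
Definition Phi (m : nat) (v : C) (y : R) : C :=
  csum (fun k => RtoC (ge m (S k)) / (RtoC (2 * INR (S k)) - 2 * v) * Rcpow y (RtoC (2 * INR (S k)) - 2 * v))%C m.

Lemma gap_re (v : C) k : 0 < fst v < 1 -> 2 - 2 * fst v <= fst (RtoC (2 * INR (S k)) - 2 * v)%C.
Proof.
  intros Hv. assert (1 <= INR (S k)) by (apply (le_INR 1); lia).
  unfold Cminus, Cplus, Copp, Cmult, RtoC. cbn [fst snd]. lra.
Qed.

Lemma gap_neq0 (v : C) k : 0 < fst v < 1 -> (RtoC (2 * INR (S k)) - 2 * v)%C <> RtoC 0.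
Proof. intros Hv E. assert (G := gap_re v k Hv). rewrite E in G. simpl in G. lra. Qed.

Lemma Phi_der m (v : C) y : 0 < fst v < 1 -> 0 < y -> cder (Phi m v) y (- (RtoC (1 - gG m y) * mker v y))%C.
Proof.
  intros Hv Hy.
  replace (- (RtoC (1 - gG m y) * mker v y))%C with
   (csum (fun k => RtoC (ge m (S k)) / (RtoC (2 * INR (S k)) - 2 * v) * ((RtoC (2 * INR (S k)) - 2 * v) * Rcpow y (RtoC (2 * INR (S k)) - 2 * v - 1)))%C m).
  - apply (cder_csum (fun k y => RtoC (ge m (S k)) / (RtoC (2 * INR (S k)) - 2 * v) * Rcpow y (RtoC (2 * INR (S k)) - 2 * v))%C).
    intros j _. apply cder_scal, cder_Rcpow; auto.
  - unfold gG. rewrite rsum_shift. replace (ge m 0 * y ^ (2 * 0)) with 1 by (unfold ge; simpl; field).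
    replace (1 - (1 + rsum (fun j => ge m (S j) * y ^ (2 * S j)) m)) with (- rsum (fun j => ge m (S j) * y ^ (2 * S j)) m) by ring.
    rewrite RtoC_opp, RtoC_rsum.
    replace (- (- csum (fun j => RtoC (ge m (S j) * y ^ (2 * S j))) m * mker v y))%C with
      (mker v y * csum (fun j => RtoC (ge m (S j) * y ^ (2 * S j))) m)%C by ring.
    rewrite <- csum_scal. apply csum_ext. intros j _.
    replace (RtoC (2 * INR (S j)) - 2 * v - 1)%C with (RtoC (INR (2 * S j)) + (- (2 * v) - 1))%C.
    2:{ rewrite mult_INR. simpl (INR 2). replace (1 + 1) with 2 by ring. ring. }
    rewrite Rcpow_plus, Rcpow_INR, (RtoC_mult (ge m (S j))) by auto. unfold mker. field. apply gap_neq0; auto.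
Qed.

Definition Tm (m : nat) (v : C) : C := csum (fun k => RtoC (gc m k) / (v - RtoC (INR k)))%C (S m).

Lemma strip_neq0 (v : C) k : 0 < fst v < 1 -> (v - RtoC (INR k))%C <> RtoC 0.
Proof.
  intros Hv E. apply (f_equal fst) in E. simpl in E.
  destruct k. simpl in E. lra. rewrite S_INR in E. generalize (pos_INR k); lra.
Qed.

(** At [y = 2 m] the powers of [2 m] cancel the scaling in [ge], leaving the partial fraction sum
    without its term [1 / v] at [k = 0]. *)
Lemma Phi_end m (v : C) : (1 <= m)%nat -> 0 < fst v < 1 ->
  Phi m v (2 * INR m) = (- (/ 2 * Rcpow (2 * INR m) (- (2 * v)) * (Tm m v - / v)))%C.
Proof.
  intros Hm Hv. assert (Hm1 : 1 <= INR m) by (apply (le_INR 1); auto).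
  unfold Tm. rewrite csum_shift. simpl (gc m 0). simpl (INR 0).
  assert (Hv0 : v <> RtoC 0) by (intros E; rewrite E in Hv; simpl in Hv; lra).
  replace (v - 0)%C with v by ring.
  replace (1 / v + csum (fun j => RtoC (gc m (S j)) / (v - RtoC (INR (S j)))) m - / v)%C with
    (csum (fun j => RtoC (gc m (S j)) / (v - RtoC (INR (S j)))) m)%C by (field; auto).
  replace (- (/ 2 * Rcpow (2 * INR m) (- (2 * v)) * csum (fun j => RtoC (gc m (S j)) / (v - RtoC (INR (S j)))) m))%C with
    ((- (/ 2 * Rcpow (2 * INR m) (- (2 * v)))) * csum (fun j => RtoC (gc m (S j)) / (v - RtoC (INR (S j)))) m)%C by ring.
  rewrite <- csum_scal. unfold Phi. apply csum_ext. intros j _.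
  assert (G := gap_neq0 v j Hv). assert (S0 := strip_neq0 v (S j) Hv).
  replace (Rcpow (2 * INR m) (RtoC (2 * INR (S j)) - 2 * v)) with (RtoC ((2 * INR m) ^ (2 * S j)) * Rcpow (2 * INR m) (- (2 * v)))%C.
  2:{ rewrite <- Rcpow_INR, <- Rcpow_plus by lra. f_equal. rewrite mult_INR. simpl (INR 2). replace (1 + 1) with 2 by ring. ring. }
  unfold ge. assert (P : (2 * INR m) ^ (2 * S j) <> 0) by (apply pow_nonzero; lra).
  rewrite RtoC_div by auto.
  replace (RtoC (2 * INR (S j)) - 2 * v)%C with (- (2 * (v - RtoC (INR (S j)))))%C in * by (rewrite RtoC_mult; ring).
  field. split; auto. apply RtoC_neq0; auto.
Qed.

(** Uniform in [m], since by [ge_bound] the coefficients are dominated by those of [cosh]. *)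
Lemma Phi_bound : exists B, 0 <= B /\ forall m (v : C) e, (1 <= m)%nat -> 0 < fst v < 1 -> 0 < e <= 1 ->
  Cmod (Phi m v e) <= B * / (2 - 2 * fst v) * pw e (2 - 2 * fst v).
Proof.
  destruct (summable_cosh 1 ltac:(lra)) as [B HB].
  exists B. split. { specialize (HB O). simpl in HB. auto. }
  intros m v e Hm Hv He.
  apply Rle_trans with (rsum (fun k => / (2 - 2 * fst v) * pw e (2 - 2 * fst v) * / INR (fact (2 * S k))) m).
  - apply csum_Cmod. intros j _. rewrite Cmod_mult, Cmod_div, Cmod_Rcpow_pw, Cmod_R by (apply gap_neq0; auto).
    assert (G := gap_re v j Hv).
    assert (G2 : 2 - 2 * fst v <= Cmod (RtoC (2 * INR (S j)) - 2 * v)%C).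
    { eapply Rle_trans; [apply G|]. eapply Rle_trans; [apply Rle_abs|apply Cmod_fst]. }
    assert (H1 := ge_bound m (S j) Hm).
    assert (H2 : pw e (fst (RtoC (2 * INR (S j)) - 2 * v)%C) <= pw e (2 - 2 * fst v)) by (apply pw_ge_exp; auto).
    assert (H3 : / Cmod (RtoC (2 * INR (S j)) - 2 * v)%C <= / (2 - 2 * fst v)) by (apply Rinv_le_contravar; lra).
    assert (H4 : 0 < / Cmod (RtoC (2 * INR (S j)) - 2 * v)%C) by (apply Rinv_0_lt_compat; lra).
    replace (/ (2 - 2 * fst v) * pw e (2 - 2 * fst v) * / INR (fact (2 * S j))) with
      ((/ INR (fact (2 * S j)) * / (2 - 2 * fst v)) * pw e (2 - 2 * fst v)) by ring.
    apply Rmult_le_compat; auto.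
    + apply Rmult_le_pos; [apply Rabs_pos|left; auto].
    + left; apply pw_pos.
    + apply Rmult_le_compat; auto; [apply Rabs_pos|left; auto].
  - rewrite rsum_scal.
    replace (B * / (2 - 2 * fst v) * pw e (2 - 2 * fst v)) with (/ (2 - 2 * fst v) * pw e (2 - 2 * fst v) * B) by ring.
    apply Rmult_le_compat_l.
    + apply Rmult_le_pos; [left; apply Rinv_0_lt_compat; lra|left; apply pw_pos].
    + eapply Rle_trans; [|apply (HB (S m))]. rewrite rsum_shift.
      assert (0 <= / INR (fact (2 * 0)) * 1 ^ (2 * 0)) by (simpl; lra).
      assert (E : rsum (fun k => / INR (fact (2 * S k))) m = rsum (fun j => / INR (fact (2 * S j)) * 1 ^ (2 * S j)) m).
      { apply rsum_ext. intros; rewrite pow1; ring. }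
      rewrite E. lra.
Qed.

(** The value [Gamma (1/2) Gamma (1 - v) / (2^(2 v + 1) v Gamma (v + 1/2))] of the integral of
    [(1 - cos y) y^(- 2 v - 1)] over the half-line, for [0 < Re v < 1]. *)
Definition Mv (v : C) : C :=
  (/ 2 * Rcpow 2 (- (2 * v)) * (RGam (v + RtoC (/2)) / (RGam (RtoC (/2)) * (v * RGam (1 - v)))))%C.

(** Each rising product in [gc_frac] is normalized to [RG]; what is left over consists of powers of
    ratios of consecutive integers and tends to 1. The three successors keep all indices and
    logarithms positive. *)
Lemma Tm_lim (v : C) : 0 < fst v < 1 ->
  Ccv (fun n => / 2 * Rcpow (2 * INR (S (S (S n)))) (- (2 * v)) * Tm (S (S (S n))) v)%C (Mv v).
Proof.
  intros Hv.
  assert (Hv0 : v <> RtoC 0) by (intros E; rewrite E in Hv; simpl in Hv; lra).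
  assert (N1 : RGam (RtoC (/2)) <> RtoC 0) by (apply RGam_neq0, nonpole_pos; simpl; lra).
  assert (N2 : RGam (1 - v) <> RtoC 0) by (apply RGam_neq0, nonpole_pos; simpl; lra).
  set (q := fun n : nat => (RG (S n) (v + RtoC (/2)) / (RG (S n) (RtoC (/2)) * (v * RG (S (S n)) (1 - v))))%C).
  assert (Hq : Ccv q (RGam (v + RtoC (/2)) / (RGam (RtoC (/2)) * (v * RGam (1 - v))))%C).
  { apply Ccv_div. apply Cmult_neq_0; [auto|apply Cmult_neq_0; auto].
    apply (Ccv_subseq S (fun n => RG n (v + RtoC (/2)))); auto; apply RG_cv.
    apply Ccv_mult. apply (Ccv_subseq S (fun n => RG n (RtoC (/2)))); auto; apply RG_cv.
    apply Ccv_scal. apply (Ccv_subseq (fun n => S (S n)) (fun n => RG n (1 - v))); auto; apply RG_cv. }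
  apply Ccv_ext with (fun n => / 2 * Rcpow 2 (- (2 * v)) * (q n * (Rcpow (INR (S n + 0) / INR (S n + 2)) v * Rcpow (INR (S n + 1) / INR (S n + 2)) v
     * RtoC (INR (S n + 2) / INR (S n + 1)))))%C.
  - intros n. unfold Tm. rewrite gc_frac by (intros; apply strip_neq0; auto).
    replace (S n + 0)%nat with (S n) by lia. replace (S n + 1)%nat with (S (S n)) by lia. replace (S n + 2)%nat with (S (S (S n))) by lia.
    assert (P1 : 0 < INR (S n)) by (apply lt_0_INR; lia).
    assert (P2 : 0 < INR (S (S n))) by (apply lt_0_INR; lia).
    assert (P3 : 0 < INR (S (S (S n)))) by (apply lt_0_INR; lia).
    unfold q, RG, Rdiv.
    rewrite !Rcpow_mult_base, !Rcpow_inv_base by (auto; try lra; apply Rinv_0_lt_compat; auto).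
    rewrite (Rcpow_plus (INR (S n))). unfold Cminus at 2. rewrite (Rcpow_plus (INR (S (S n)))), (Rcpow_opp (INR (S (S n))) v), (Rcpow_1 (INR (S (S n)))) by auto.
    replace (Rcpow (INR (S (S (S n)))) (- (2 * v))) with (/ (Rcpow (INR (S (S (S n)))) v * Rcpow (INR (S (S (S n)))) v))%C.
    2:{ rewrite <- Rcpow_plus, <- Rcpow_opp. f_equal. ring. }
    rewrite (fact_simpl (S (S n))), (mult_INR (S (S (S n)))), !RtoC_mult, (RtoC_inv (INR (S (S n)))) by lra.
    assert (R1 : rising (RtoC (/2)) (S n) <> RtoC 0).
    { rewrite <- (Cplus_0_l (RtoC (/2))), <- Qh_rising. apply cprod_neq0. intros j _. rewrite <- RtoC_plus. apply RtoC_neq0.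
      generalize (pos_INR j); lra. }
    assert (R2 : rising (1 - v) (S (S n)) <> RtoC 0).
    { assert (K := poles_rising (S (S n)) v). intros E. rewrite E, Cmult_0_r in K.
      revert K. apply cprod_neq0. intros; apply strip_neq0; auto. }
    unfold Cminus in *. field. repeat split; auto; try apply Rcpow_neq0; try apply fact_neq0; apply RtoC_neq0; lra.
  - unfold Mv. apply Ccv_scal.
    eapply Ccv_eq; [|apply Ccv_mult; [apply Hq|apply Ccv_mult; [apply Ccv_mult; apply Ccv_Rcpow_1|apply Ccv_RtoC]]].
    + instantiate (1 := 1). ring.
    + intros; apply Rdiv_lt_0_compat; apply lt_0_INR; lia.
    + apply lim_INR_ratio.
    + intros; apply Rdiv_lt_0_compat; apply lt_0_INR; lia.
    + apply lim_INR_ratio.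
    + apply lim_INR_ratio.
Qed.

(** On [[e, A]] the cosine is replaced by [gG m], whose integral over [[e, 2 m]] is known exactly
    through [Phi]. The part beyond [A] is controlled by [gG_bound]. *)
Lemma Mint_estimate (v : C) : 0 < fst v < 1 -> exists K, 0 <= K /\ forall e A, 0 < e <= 1 -> 1 <= A ->
  Cmod (Mint v e A - Mv v)%C <= K * (pw e (2 - 2 * fst v) + pw A (- (2 * fst v))).
Proof.
  intros Hv. set (sg := fst v) in *.
  destruct Phi_bound as [B [HB0 HB]].
  assert (Hv0 : v <> RtoC 0) by (intros E; unfold sg in Hv; rewrite E in Hv; simpl in Hv; lra).
  assert (Hcv : 0 < Cmod v) by (apply Cmod_gt_0; auto).
  (* The three contributions are the lower end [Phi m v e], the term [1 / v] missing in [Phi_end],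
     and the tail over [[A, 2 m]]. *)
  set (K := B * / (2 - 2 * sg) + (/ Cmod v + 2 * / sg)).
  assert (K1 : 0 <= B * / (2 - 2 * sg)) by (apply Rmult_le_pos; auto; left; apply Rinv_0_lt_compat; lra).
  assert (K2 : 0 < / Cmod v) by (apply Rinv_0_lt_compat; auto).
  assert (K3 : 0 < / sg) by (apply Rinv_0_lt_compat; lra).
  exists K. split. { unfold K; lra. }
  intros e A He HA.
  (* With [e] and [A] fixed, the bound is proved up to [eta] with [Mv v] replaced by its
     approximants, and then passes to the limit. *)
  assert (L := Ccv_minus _ _ _ _ (Ccv_const (Mint v e A)) (Tm_lim v Hv)). cbv beta in L.
  apply le_epsilon. intros eta Heta.
  set (W := pw e (- (2 * sg) - 1)). assert (HW : 0 < W) by apply pw_pos.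
  set (D := 2 * (W * (A - e)) + 1).
  assert (HD0 : 0 <= W * (A - e)) by (apply Rmult_le_pos; lra).
  assert (HD : 0 < D) by (unfold D; lra).
  destruct (gG_cos_unif A (eta / D) ltac:(lra) ltac:(apply Rdiv_lt_0_compat; lra)) as [M HM].
  destruct (nfloor_ex A ltac:(lra)) as [a [_ Ha]].
  refine (Ccv_bound _ _ _ _ L).
  exists (max M (S a)). intros n Hn.
  set (m := S (S (S n))).
  assert (Hm1 : (1 <= m)%nat) by (unfold m; lia).
  assert (Hm2 : A <= 2 * INR m).
  { assert (INR (S a) <= INR m) by (apply le_INR; unfold m; lia). rewrite S_INR in H. generalize (pos_INR m); lra. }
  assert (F1 : cint (fun y => RtoC (1 - gG m y) * mker v y)%C e (2 * INR m) (Phi m v e - Phi m v (2 * INR m)%R)%C).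
  { replace (Phi m v e - Phi m v (2 * INR m)%R)%C with ((- (1) * Phi m v (2 * INR m)%R) - (- (1) * Phi m v e))%C by ring.
    apply (cint_FTC (fun y => - (1) * Phi m v y)%C). lra.
    - intros t Ht. replace (RtoC (1 - gG m t) * mker v t)%C with (- (1) * (- (RtoC (1 - gG m t) * mker v t)))%C by ring.
      apply cder_scal, Phi_der; auto; lra.
    - intros t Ht. apply ccont_mult; [|apply ccont_Rcpow; lra]. apply ccont_RtoC.
      apply (continuous_minus (K:=R_AbsRing) (V:=R_NormedModule)). apply continuous_const.
      apply (ex_derive_continuous (K:=R_AbsRing) (V:=R_NormedModule)). eexists.
      unfold gG. apply is_derive_rsum. intros j. apply is_derive_scal, is_derive_pow, (is_derive_id (K:=R_AbsRing)). }
  assert (CG : forall t, 0 < t -> ccont (fun y => RtoC (1 - gG m y) * mker v y)%C t).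
  { intros t Ht. apply ccont_mult; [|apply ccont_Rcpow; lra]. apply ccont_RtoC.
      apply (continuous_minus (K:=R_AbsRing) (V:=R_NormedModule)). apply continuous_const.
      apply (ex_derive_continuous (K:=R_AbsRing) (V:=R_NormedModule)). eexists.
      unfold gG. apply is_derive_rsum. intros j. apply is_derive_scal, is_derive_pow, (is_derive_id (K:=R_AbsRing)). }
  assert (F2 : cint (fun y => RtoC (1 - gG m y) * mker v y)%C e A (CInt (fun y => RtoC (1 - gG m y) * mker v y)%C e A)).
  { apply CInt_correct. lra. intros; apply CG; lra. }
  assert (F3 : cint (fun y => RtoC (1 - gG m y) * mker v y)%C A (2 * INR m) (CInt (fun y => RtoC (1 - gG m y) * mker v y)%C A (2 * INR m))).
  { apply CInt_correct. lra. intros; apply CG; lra. }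
  set (X := CInt (fun y => RtoC (1 - gG m y) * mker v y)%C e A) in *.
  set (Y := CInt (fun y => RtoC (1 - gG m y) * mker v y)%C A (2 * INR m)) in *.
  assert (E : (X + Y = Phi m v e - Phi m v (2 * INR m)%R)%C).
  { rewrite <- (cint_unique _ _ _ _ F1). symmetry. apply cint_unique. eapply cint_Chasles; eauto. }
  rewrite Phi_end in E by auto.
  (* [X] and [Y] are the integrals with [gG m] over [[e, A]] and [[A, 2 m]]; their sum is the
     difference of [Phi] at the ends, whose upper value contains the subtracted approximant. *)
  replace (Mint v e A - / 2 * Rcpow (2 * INR m) (- (2 * v)) * Tm m v)%C with
    ((Mint v e A - X) + (Phi m v e + - (/ 2 * Rcpow (2 * INR m) (- (2 * v)) * / v) + - Y))%C.
  2:{ replace X with ((X + Y) - Y)%C by ring. rewrite E. ring. }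
  assert (B1 : Cmod (Mint v e A - X)%C <= eta).
  { assert (I := cint_minus _ _ _ _ _ _ (Mint_correct v e A ltac:(lra)) F2).
    eapply Rle_trans; [apply (cint_bound_const _ e A _ (eta / D * W)) with (3 := I); [lra|]|].
    - intros t Ht. replace (RtoC (1 - cos t) * mker v t - RtoC (1 - gG m t) * mker v t)%C with
        (RtoC (gG m t - cos t) * mker v t)%C by (rewrite !RtoC_minus; ring).
      rewrite Cmod_mult, Cmod_R, Cmod_mker. apply Rmult_le_compat; try apply Rabs_pos. left; apply pw_pos.
      apply (HM (S (S n)) t); [lia|lra]. unfold W. apply pw_neg_base; [lra|]. unfold sg in *; lra.
    - apply Rle_trans with (eta / D * D). 2: apply Req_le; field; lra.
      replace (2 * (eta / D * W * (A - e))) with (eta / D * (2 * (W * (A - e)))) by ring.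
      apply Rmult_le_compat_l. left; apply Rdiv_lt_0_compat; lra. unfold D; lra. }
  assert (B2 := HB m v e Hm1 Hv He). fold sg in B2.
  assert (P2m : pw (2 * INR m) (- (2 * sg)) <= pw A (- (2 * sg))) by (apply pw_neg_base; lra).
  assert (B3 : Cmod (- (/ 2 * Rcpow (2 * INR m) (- (2 * v)) * / v))%C <= / Cmod v * pw A (- (2 * sg))).
  { rewrite Cmod_opp, !Cmod_mult, Cmod_Rcpow_pw, !Cmod_inv, Cmod_RtoC_pos by (auto; try lra; apply C2_neq0 || (apply RtoC_neq0; lra)).
    replace (fst (- (2 * v))%C) with (- (2 * sg)) by (unfold sg; simpl; ring).
    assert (Hp := pw_pos (2 * INR m) (- (2 * sg))).
    rewrite (Rmult_comm (/ Cmod v)). apply Rmult_le_compat_r; lra. }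
  assert (B4 : Cmod (- Y)%C <= 2 * / sg * pw A (- (2 * sg))).
  { rewrite Cmod_opp.
    eapply Rle_trans; [apply (cint_bound _ (fun t => 2 * pw t (- (2 * sg) - 1)) _ _ _ (2 * ((pw (2 * INR m) (- (2 * sg)) - pw A (- (2 * sg))) / (- (2 * sg))))) with (3 := F3); [lra| |]|].
    - intros t Ht. rewrite Cmod_mult, Cmod_R, Cmod_mker. apply Rmult_le_compat_r. left; apply pw_pos.
      assert (Hb := gG_bound m t Hm1 ltac:(lra)). apply Rabs_le_between in Hb. apply Rabs_le; lra.
    - apply (is_RInt_scal (V:=R_NormedModule)). apply is_RInt_pw; lra.
    - assert (Hp := pw_pos (2 * INR m) (- (2 * sg))).
      replace (2 * (2 * ((pw (2 * INR m) (- (2 * sg)) - pw A (- (2 * sg))) / - (2 * sg)))) with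
        (2 * / sg * (pw A (- (2 * sg)) - pw (2 * INR m) (- (2 * sg)))) by (field; lra).
      apply Rmult_le_compat_l; lra. }
  assert (T1 := Cmod_triangle (Mint v e A - X)%C (Phi m v e + - (/ 2 * Rcpow (2 * INR m) (- (2 * v)) * / v) + - Y)%C).
  assert (T2 := Cmod_triangle (Phi m v e + - (/ 2 * Rcpow (2 * INR m) (- (2 * v)) * / v))%C (- Y)%C).
  assert (T3 := Cmod_triangle (Phi m v e) (- (/ 2 * Rcpow (2 * INR m) (- (2 * v)) * / v))%C).
  assert (Q1 := pw_pos e (2 - 2 * sg)). assert (Q2 := pw_pos A (- (2 * sg))).
  unfold K. set (p1 := pw e (2 - 2 * sg)) in *. set (p2 := pw A (- (2 * sg))) in *.
  assert (0 <= B * / (2 - 2 * sg) * p2) by (apply Rmult_le_pos; lra).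
  assert (0 <= (/ Cmod v + 2 * / sg) * p1) by (apply Rmult_le_pos; lra).
  lra.
Qed.

Lemma pw_lim_0 a r : 0 < a -> 0 < r -> is_lim_seq (fun k => pw (a / (INR k + 1)) r) 0.
Proof.
  intros Ha Hr. apply is_lim_seq_spec. intros eps.
  assert (L := lim_seq_point a). apply is_lim_seq_spec in L.
  destruct (L (mkposreal (exp (/ r * ln eps)) (exp_pos _))) as [N HN]. simpl in HN.
  exists N. intros k Hk. specialize (HN k Hk).
  destruct (seq_point a k Ha) as [_ [_ P]].
  rewrite Rminus_0_r in *. rewrite Rabs_pos_eq in HN by lra. rewrite Rabs_pos_eq by (left; apply pw_pos).
  unfold pw. rewrite <- (exp_ln eps) by apply cond_pos. apply exp_increasing.
  apply ln_increasing in HN; [|lra]. rewrite ln_exp in HN.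
  replace (ln eps) with (r * (/ r * ln eps)) by (field; lra). apply Rmult_lt_compat_l; auto.
Qed.

(** The parameter [a] is present because the substitution [y = 2 PI n x] turns common cut-offs in
    [x] into cut-offs scaled by [2 PI n]. *)
Lemma Mint_lim (v : C) a : 0 < fst v < 1 -> 0 < a ->
  Ccv (fun k => Mint v (a / (INR k + 1)) (a * (INR k + 1))) (Mv v).
Proof.
  intros Hv Ha. destruct (Mint_estimate v Hv) as [K [HK H]].
  apply Ccv_dom with (fun k => K * (pw (a / (INR k + 1)) (2 - 2 * fst v) + pw (/ a / (INR k + 1)) (2 * fst v))).
  - assert (L1 := lim_seq_point a). apply is_lim_seq_spec in L1.
    assert (L2 := lim_seq_point (/ a)). apply is_lim_seq_spec in L2.
    destruct (L1 (mkposreal 1 ltac:(lra))) as [N1 H1]. destruct (L2 (mkposreal 1 ltac:(lra))) as [N2 H2]. simpl in *.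
    exists (max N1 N2). intros k Hk. specialize (H1 k ltac:(lia)). specialize (H2 k ltac:(lia)).
    assert (Ha' : 0 < / a) by (apply Rinv_0_lt_compat; auto).
    destruct (seq_point a k Ha) as [_ [_ P]]. destruct (seq_point (/ a) k Ha') as [_ [_ P']].
    rewrite Rminus_0_r, Rabs_pos_eq in H1, H2 by lra. assert (Hk0 := pos_INR k).
    assert (E : / a / (INR k + 1) = / (a * (INR k + 1))) by (field; lra).
    assert (HA : 1 <= a * (INR k + 1)).
    { rewrite E in H2. assert (HX : 0 < a * (INR k + 1)) by (apply Rmult_lt_0_compat; lra).
      assert (HX' := Rinv_0_lt_compat _ HX).
      apply (Rmult_le_reg_l (/ (a * (INR k + 1)))); auto. rewrite Rinv_l; lra. }
    eapply Rle_trans; [apply H; lra|]. apply Req_le. do 2 f_equal. unfold pw. rewrite E, ln_Rinv by lra. f_equal; ring.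
  - replace (Finite 0) with (Finite (K * (0 + 0))) by (f_equal; ring).
    apply (is_lim_seq_scal_l _ K (0 + 0)). apply is_lim_seq_plus'; apply pw_lim_0; auto; try lra. apply Rinv_0_lt_compat; auto.
Qed.

(** The modulus of the integrand is the integrand at the real point [Re v], which is nonnegative, so
    the integral grows with the interval and the estimate for the real parameter bounds it. This
    serves as the majorant for dominated convergence. *)
Lemma Mint_bounded (v : C) : 0 < fst v < 1 -> exists B, forall e A, 0 < e <= A -> Cmod (Mint v e A) <= B.
Proof.
  intros Hv. set (sg := RtoC (fst v)).
  assert (Hs : 0 < fst sg < 1) by (simpl; auto).
  destruct (Mint_estimate sg Hs) as [K [HK H]].
  exists (2 * (Cmod (Mv sg) + K * 2)). intros e A He.
  set (f := fun y => (1 - cos y) * pw y (- (2 * fst v) - 1)).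
  assert (Hf0 : forall y, 0 <= f y).
  { intros y. apply Rmult_le_pos; [|left; apply pw_pos]. generalize (COS_bound y); lra. }
  assert (Hfc : forall y, 0 < y -> continuous f y).
  { intros y Hy. apply (ex_derive_continuous (K:=R_AbsRing) (V:=R_NormedModule)). eexists.
    apply is_derive_mul_R. apply (is_derive_minus (K:=R_AbsRing) (V:=R_NormedModule)). apply (is_derive_const (K:=R_AbsRing) (V:=R_NormedModule)). apply is_derive_cos.
    apply is_derive_pw; auto. }
  assert (Hex : forall p q, 0 < p <= q -> ex_RInt f p q).
  { intros p q Hp. apply (ex_RInt_continuous (V:=R_CompleteNormedModule)). rewrite Rmin_left, Rmax_right by lra.
    intros; apply Hfc; lra. }
  (* [Mint_estimate] requires cut-offs on either side of 1, so the interval is enlarged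
     accordingly. *)
  set (e' := Rmin e 1). set (A' := Rmax A 1).
  assert (E1 : 0 < e' <= 1) by (unfold e'; split; [apply Rmin_glb_lt; lra|apply Rmin_r]).
  assert (E2 : e' <= e) by apply Rmin_l. assert (E3 : 1 <= A') by apply Rmax_r. assert (E4 : A <= A') by apply Rmax_l.
  assert (Hmono : RInt f e A <= RInt f e' A').
  { rewrite <- (RInt_Chasles f e' e A') by (apply Hex; lra).
    rewrite <- (RInt_Chasles f e A A') by (apply Hex; lra). unfold plus; simpl.
    assert (0 <= RInt f e' e) by (apply RInt_ge_0; [lra|apply Hex; lra|auto]).
    assert (0 <= RInt f A A') by (apply RInt_ge_0; [lra|apply Hex; lra|auto]). lra. }
  assert (HR : Mint sg e' A' = RtoC (RInt f e' A')).
  { apply cint_unique.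
    assert (Hker : forall y, mker sg y = RtoC (pw y (- (2 * fst v) - 1))).
    { intros y. unfold mker, sg. replace (- (2 * RtoC (fst v)) - 1)%C with (RtoC (- (2 * fst v) - 1)).
      rewrite Rcpow_RtoC. auto. rewrite RtoC_minus, RtoC_opp, RtoC_mult. auto. }
    apply (cint_ext (fun y => RtoC (f y))). lra. intros t _. unfold f. rewrite Hker, RtoC_mult; auto.
    split. apply (RInt_correct (V:=R_CompleteNormedModule)), Hex; lra.
    change (is_RInt (fun _ : R => 0) e' A' 0). evar_last. apply (is_RInt_const (V:=R_NormedModule)).
    unfold scal; simpl; unfold mult; simpl; ring. }
  assert (HB : RInt f e' A' <= Cmod (Mv sg) + K * 2).
  { assert (Q := H e' A' E1 E3). rewrite HR in Q.
    assert (T := Cmod_triangle_rev (RtoC (RInt f e' A')) (Mv sg)).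
    rewrite Cmod_R in T. assert (T2 := Rle_abs (RInt f e' A')).
    assert (P1 : pw e' (2 - 2 * fst sg) <= 1).
    { replace 1 with (pw e' 0) by (unfold pw; rewrite Rmult_0_l, exp_0; auto). apply pw_ge_exp; auto. lra. }
    assert (P2 : pw A' (- (2 * fst sg)) <= 1).
    { replace 1 with (pw A' 0) by (unfold pw; rewrite Rmult_0_l, exp_0; auto). apply pw_le_exp; auto. lra. }
    assert (K * (pw e' (2 - 2 * fst sg) + pw A' (- (2 * fst sg))) <= K * 2) by (apply Rmult_le_compat_l; lra).
    lra. }
  eapply Rle_trans; [apply (cint_bound _ f e A _ (RInt f e A)) with (3 := Mint_correct v e A He); [lra| |]|].
  - intros t Ht. rewrite Cmod_mult, Cmod_mker, Cmod_RtoC_pos. unfold f; lra. generalize (COS_bound t); lra.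
  - apply (RInt_correct (V:=R_CompleteNormedModule)), Hex; lra.
  - lra.
Qed.

Lemma PD_Rcpow_line y a b : 0 < y -> PD (fun t => Rcpow y (a, b * t)%R).
Proof.
  intros Hy. eapply PD_ext; [|apply (PD_scal (pw y a) _ ltac:(left; apply pw_pos) (PD_exp (b * ln y)))].
  intros t. unfold pw. rewrite <- Cexp_RtoC, <- Cexp_plus. unfold Rcpow. f_equal.
  unfold Ci, RtoC, Cmult, Cplus; simpl. f_equal; ring.
Qed.

Lemma PD_Mv sg r : 0 < sg < 1 -> PD (fun t => Mv (sg, r * t)).
Proof.
  intros Hs. apply (PD_lim (fun k t => Mint (sg, r * t) (1 / (INR k + 1)) (1 * (INR k + 1)))).
  - exists O. intros k _. assert (Hk := pos_INR k). destruct (seq_point 1 k ltac:(lra)) as [_ [_ P]].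
    apply (PD_int (fun y t => RtoC (1 - cos y) * mker (sg, (r * t)%R) y)%C _ (1 / (INR k + 1)) (1 * (INR k + 1))). lra.
    + intros u Hu. apply PD_scal. generalize (COS_bound u); lra.
      eapply PD_ext; [|apply (PD_Rcpow_line u (- (2 * sg) - 1) (- (2 * r))); lra].
      intros t. simpl. unfold mker. f_equal. unfold Cminus, Cplus, Copp, Cmult, RtoC; simpl. f_equal; ring.
    + intros t. apply Mint_correct. lra.
  - intros t. apply Mint_lim; simpl; lra.
Qed.

(** * The Dirichlet series of zeta *)

(** Comparison with the integral of [x^(-r)] by the mean value theorem on each unit interval; the
    strengthened bound carries the integral still to come. *)
Lemma summable_zeta r : 1 < r -> summable (fun k => pw (INR (S k)) (- r)).
Proof.
  intros Hr. exists (1 + / (r - 1)). intros k.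
  assert (Hc : 0 < / (r - 1)) by (apply Rinv_0_lt_compat; lra).
  assert (H : rsum (fun j => pw (INR (S j)) (- r)) (S k) <= 1 + / (r - 1) - / (r - 1) * pw (INR (S k)) (1 - r)).
  { induction k.
    - cbn [rsum]. replace (INR 1) with 1 by auto. unfold pw. rewrite ln_1, !Rmult_0_r, exp_0. lra.
    - change (rsum (fun j => pw (INR (S j)) (- r)) (S (S k))) with (rsum (fun j => pw (INR (S j)) (- r)) (S k) + pw (INR (S (S k))) (- r)).
      assert (Hk : 0 < INR (S k)) by (apply lt_0_INR; lia).
      assert (Hk2 : INR (S (S k)) = INR (S k) + 1) by (rewrite S_INR; auto).
      destruct (MVT_gen (fun u => pw u (1 - r)) (INR (S k)) (INR (S (S k))) (fun u => (1 - r) * pw u (1 - r - 1))) as [c [Hc1 E]];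
      rewrite ?Rmin_left, ?Rmax_right in * by lra.
      + intros u Hu. apply is_derive_pw; lra.
      + intros u Hu. apply derivable_continuous_pt. eexists. apply is_derive_Reals, is_derive_pw; lra.
      + replace (1 - r - 1) with (- r) in E by ring.
        assert (P : pw (INR (S (S k))) (- r) <= pw c (- r)) by (apply pw_neg_base; lra).
        rewrite Hk2 in E at 2. replace (INR (S k) + 1 - INR (S k)) with 1 in E by ring.
        assert (E2 : / (r - 1) * pw (INR (S k)) (1 - r) - / (r - 1) * pw (INR (S (S k))) (1 - r) = pw c (- r)).
        { rewrite <- Rmult_minus_distr_l. replace (pw (INR (S k)) (1 - r) - pw (INR (S (S k))) (1 - r)) with ((r - 1) * pw c (- r)) by lra.
          field. lra. }
        lra. }
  cbn [rsum] in H. assert (H1 := pw_pos (INR (S k)) (- r)). assert (H2 := pw_pos (INR (S k)) (1 - r)).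
  assert (0 <= / (r - 1) * pw (INR (S k)) (1 - r)) by (apply Rmult_le_pos; lra). lra.
Qed.

Definition zD (s : C) : C := Cser (fun k => Rcpow (INR (S k)) (- s)).

Lemma Cmod_zterm k s : Cmod (Rcpow (INR (S k)) (- s)) = pw (INR (S k)) (- fst s).
Proof. rewrite Cmod_Rcpow_pw. auto. Qed.

Lemma zD_cv (s : C) : 1 < fst s -> Ccv (csum (fun k => Rcpow (INR (S k)) (- s))) (zD s).
Proof.
  intros Hs. apply csum_cv with (fun k => pw (INR (S k)) (- fst s)).
  intros k. rewrite Cmod_zterm; lra. apply summable_zeta; auto.
Qed.

Lemma CW_Rcpow rho y (s0 c : C) : 0 <= rho -> 1 <= y -> Cmod c <= 1 ->
  CW rho (pw y (fst s0 + rho)) (fun z => Rcpow y (s0 + c * z)).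
Proof.
  intros Hr Hy Hc. assert (Hl : 0 <= ln y) by (rewrite <- ln_1; apply ln_le; lra).
  apply CW_ext with (fun z => Rcpow y s0 * Cexp (c * (z * RtoC (ln y))))%C.
  { intros z _. rewrite Rcpow_plus. unfold Rcpow. f_equal. f_equal. ring. }
  rewrite pw_plus, <- Cmod_Rcpow_pw. apply CW_scal; auto.
  unfold pw. apply CW_exp; auto.
  eapply CW_le; [|apply CW_scal; [auto|apply CW_mult; [auto|apply CW_id|apply CW_const]]].
  rewrite Cmod_RtoC_pos by auto. rewrite <- (Rmult_1_l (rho * ln y)) at 2. apply Rmult_le_compat_r; auto.
  apply Rmult_le_pos; auto.
Qed.

Lemma Hol_zD (s : C) : 1 < fst s -> Hol zD s.
Proof.
  intros Hs. set (rho := (fst s - 1) / 2).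
  destruct (summable_zeta (fst s - rho) ltac:(unfold rho; lra)) as [B HB].
  exists rho, B. split. unfold rho; lra.
  apply (CW_Cser rho (fun k => pw (INR (S k)) (- (fst s - rho))) B (fun k z => Rcpow (INR (S k)) (- (s + z)))); auto.
  intros k. replace (- (fst s - rho)) with (fst (- s)%C + rho) by (simpl; ring).
  apply CW_ext with (fun z => Rcpow (INR (S k)) (- s + - (1) * z)). intros; f_equal; ring.
  apply CW_Rcpow. unfold rho; lra. apply (le_INR 1); lia. rewrite Cmod_opp, Cmod_1; lra.
Qed.

Lemma pw_half2 : pw 2 (- / 2) <= 3 / 4.
Proof.
  assert (P := pw_pos 2 (- / 2)).
  assert (E : pw 2 (- / 2) * pw 2 (- / 2) = / 2).
  { rewrite <- pw_plus. replace (- / 2 + - / 2) with (- (1)) by field. unfold pw.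
    replace (- (1) * ln 2) with (- ln 2) by ring. rewrite exp_Ropp, exp_ln; lra. }
  nra.
Qed.

(** For [n >= 2], [n^(-5/2) <= (3/4) n^(-2) <= (3/4) (1 / (n - 1/2) - 1 / (n + 1/2))], which
    telescopes to at most [(3/4) (2/3) = 1/2]. The value 1/2 is what makes the geometric series of
    [1 / zeta] have non-constant part of norm at most 1. *)
Lemma zeta_tail_half k : rsum (fun j => pw (INR (S (S j))) (- (5 / 2))) k <= / 2.
Proof.
  assert (B : forall j, pw (INR (S (S j))) (- (5 / 2)) <= 3 / 4 * (/ (INR j + 3 / 2) - / (INR (S j) + 3 / 2))).
  { intros j. assert (Hj := pos_INR j).
    assert (Hn : INR (S (S j)) = INR j + 2) by (rewrite !S_INR; ring).
    replace (- (5 / 2)) with (- / 2 + - INR 2) by (simpl; field). rewrite pw_plus.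
    assert (P1 : pw (INR (S (S j))) (- / 2) <= 3 / 4).
    { eapply Rle_trans; [|apply pw_half2]. apply pw_neg_base; lra. }
    assert (P2 : pw (INR (S (S j))) (- INR 2) = / (INR j + 2) ^ 2).
    { rewrite <- Hn. rewrite <- (pw_INR (INR (S (S j))) 2) by lra. unfold pw.
      rewrite Ropp_mult_distr_l_reverse, exp_Ropp. auto. }
    rewrite P2. apply Rmult_le_compat; auto.
    - left; apply pw_pos. - left; apply Rinv_0_lt_compat, pow_lt; lra.
    - rewrite S_INR. replace (/ (INR j + 3 / 2) - / (INR j + 1 + 3 / 2)) with (/ ((INR j + 3 / 2) * (INR j + 5 / 2))) by (field; lra).
      apply Rinv_le_contravar; nra. }
  assert (H : rsum (fun j => pw (INR (S (S j))) (- (5 / 2))) k <= 3 / 4 * (2 / 3 - / (INR k + 3 / 2))).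
  { induction k. simpl. lra. cbn [rsum]. specialize (B k). lra. }
  assert (0 < / (INR k + 3 / 2)) by (apply Rinv_0_lt_compat; generalize (pos_INR k); lra). lra.
Qed.

Definition wtail (k : nat) (s : C) : C := csum (fun j => Rcpow (INR (S (S j))) (- s)) k.

Lemma wtail_cv (s : C) : 1 < fst s -> Ccv (fun k => wtail k s) (zD s - 1).
Proof.
  intros Hs. apply Ccv_ext with (fun k => csum (fun k => Rcpow (INR (S k)) (- s)) (S k) - 1)%C.
  - intros k. rewrite csum_shift. replace (INR 1) with 1 by auto. rewrite Rcpow_one. unfold wtail. ring.
  - apply Ccv_minus; [|apply Ccv_const]. apply (Ccv_subseq S (csum (fun k => Rcpow (INR (S k)) (- s)))); auto. apply zD_cv; auto.
Qed.

Lemma wtail_bound k (s : C) : 5 / 2 <= fst s -> Cmod (wtail k s) <= / 2.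
Proof.
  intros Hs. eapply Rle_trans; [|apply (zeta_tail_half k)]. apply csum_Cmod.
  intros j _. rewrite Cmod_zterm. apply pw_le_exp; [apply (le_INR 1); lia|lra].
Qed.

Lemma zD_m1_bound (s : C) : 5 / 2 <= fst s -> Cmod (zD s - 1)%C <= / 2.
Proof.
  intros Hs. apply (Ccv_bound (fun k => wtail k s)). exists O; intros; apply wtail_bound; auto. apply wtail_cv; lra.
Qed.

Lemma zD_neq0 (s : C) : 5 / 2 <= fst s -> zD s <> RtoC 0.
Proof.
  intros Hs E. assert (H := zD_m1_bound s Hs). rewrite E in H.
  replace (0 - 1)%C with (- (1))%C in H by ring. rewrite Cmod_opp, Cmod_1 in H. lra.
Qed.

(* Exponential polynomials in [(sg, t)] with coefficient norm at most [A]. *)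
Inductive EP (sg : R) : R -> (R -> C) -> Prop :=
| EP_exp c u : 0 <= u -> EP sg (Rabs c) (fun t => RtoC c * Cexp (- RtoC u * (sg, t)))%C
| EP_plus A B f g : EP sg A f -> EP sg B g -> EP sg (A + B) (fun t => f t + g t)%C
| EP_ext A B f g : (forall t, f t = g t) -> A <= B -> EP sg A f -> EP sg B g.

Lemma EP_pos sg A f : EP sg A f -> 0 <= A.
Proof. intros H; induction H; try lra. apply Rabs_pos. Qed.

Lemma EP_mult_exp sg c u A f : 0 <= u -> EP sg A f ->
  EP sg (Rabs c * A) (fun t => RtoC c * Cexp (- RtoC u * (sg, t)) * f t)%C.
Proof.
  intros Hu H; induction H.
  - eapply EP_ext; [| |apply (EP_exp sg (c * c0) (u + u0)); lra].
    + intros t; simpl. rewrite RtoC_mult, RtoC_plus.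
      replace (- (RtoC u + RtoC u0) * (sg, t))%C with (- RtoC u * (sg, t) + - RtoC u0 * (sg, t))%C by ring.
      rewrite Cexp_plus. ring.
    + rewrite Rabs_mult; lra.
  - eapply EP_ext; [| |apply (EP_plus _ _ _ _ _ IHEP1 IHEP2)]; intros; simpl; [ring|lra].
  - eapply EP_ext; [| |apply IHEP]; intros; simpl. rewrite H; auto. apply Rmult_le_compat_l; auto; apply Rabs_pos.
Qed.

Lemma EP_mult sg A B f g : EP sg A f -> EP sg B g -> EP sg (A * B) (fun t => f t * g t)%C.
Proof.
  intros H Hg. assert (HB := EP_pos _ _ _ Hg). induction H.
  - apply EP_mult_exp; auto.
  - eapply EP_ext; [| |apply (EP_plus _ _ _ _ _ IHEP1 IHEP2)]; intros; simpl; [ring|lra].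
  - eapply EP_ext; [| |apply IHEP]; intros; simpl. rewrite H; auto. apply Rmult_le_compat_r; auto.
Qed.

Lemma EP_pow sg A f k : EP sg A f -> EP sg (A ^ S k) (fun t => f t ^ S k)%C.
Proof.
  intros H; induction k.
  - eapply EP_ext; [| |apply H]; intros; simpl; [ring|lra].
  - apply (EP_mult sg A (A ^ S k) f (fun t => f t ^ S k)%C); auto.
Qed.

Lemma EP_0 sg : EP sg 0 (fun _ => RtoC 0).
Proof.
  eapply EP_ext; [| |apply (EP_exp sg 0 0)]; intros; simpl; try lra. ring. rewrite Rabs_R0; lra.
Qed.

Lemma EP_csum sg (B : nat -> R) (f : nat -> R -> C) k : (forall j, EP sg (B j) (f j)) ->
  EP sg (rsum B k) (fun t => csum (fun j => f j t) k).
Proof. intros H; induction k; simpl. apply EP_0. apply EP_plus; auto. Qed.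

(** The constant [A] is shared out among the exponentials, each receiving the modulus of its own
    coefficient, so that [PD_one_plus_exp_div] applies termwise; slack in the norm contributes
    multiples of [1 / s]. *)
Lemma EP_PD sg A f : 0 < sg -> EP sg A f -> PD (fun t => (RtoC A + f t) / (sg, t))%C.
Proof.
  intros Hs H; induction H.
  - apply PD_one_plus_exp_div; auto.
  - eapply PD_ext; [|apply (PD_plus _ _ IHEP1 IHEP2)]. intros t; simpl. rewrite RtoC_plus. field. apply line_neq0; auto.
  - eapply PD_ext; [|apply (PD_plus _ _ IHEP (PD_scal (B - A) _ ltac:(lra) (PD_inv_line sg Hs)))].
    intros t; simpl. rewrite H, RtoC_minus. field. apply line_neq0; auto.
Qed.

(** A double limit: truncate the Dirichlet series at [k], then the geometric series in [- wtail k]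
    at [J]. Each stage is 1 plus an exponential polynomial of norm at most the sum of [2^(-j)] over
    [j >= 1], which is 1, so [EP_PD] applies. *)
Lemma PD_inv_zeta sg : 0 < sg -> PD (fun t => / ((sg, t) * zD (RtoC (5 / 2) + (sg, t))))%C.
Proof.
  intros Hs.
  assert (Hre : forall t, 5 / 2 <= fst (RtoC (5 / 2) + (sg, t))%C) by (intros; simpl; lra).
  assert (Hq : forall k t, (1 - - wtail k (RtoC (5 / 2) + (sg, t)))%C <> RtoC 0).
  { intros k t E. assert (Hb := wtail_bound k _ (Hre t)).
    replace (wtail k (RtoC (5 / 2) + (sg, t))) with (- (1))%C in Hb.
    rewrite Cmod_opp, Cmod_1 in Hb; lra.
    replace (wtail k (RtoC (5 / 2) + (sg, t))) with ((1 - - wtail k (RtoC (5 / 2) + (sg, t))) - 1)%C by ring. rewrite E; ring. }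
  apply (PD_lim (fun k t => / (1 - - wtail k (RtoC (5 / 2) + (sg, t))) * / (sg, t))%C).
  - exists O; intros k _.
    (* The fixed part [5/2] of the argument turns into the coefficient [n^(-5/2)], and the rest into
       an exponential with nonnegative exponent [ln n]. *)
    assert (HE : EP sg (/ 2) (fun t => - wtail k (RtoC (5 / 2) + (sg, t)))%C).
    { eapply EP_ext; [| |apply (EP_csum sg (fun j => Rabs (- pw (INR (S (S j))) (- (5 / 2))))
        (fun j t => RtoC (- pw (INR (S (S j))) (- (5 / 2))) * Cexp (- RtoC (ln (INR (S (S j)))) * (sg, t)))%C k)].
      - intros t. cbv beta. unfold wtail.
        replace (- csum (fun j => Rcpow (INR (S (S j))) (- (RtoC (5 / 2) + (sg, t)))) k)%C with
         (- (1) * csum (fun j => Rcpow (INR (S (S j))) (- (RtoC (5 / 2) + (sg, t)))) k)%C by ring.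
        rewrite <- csum_scal. apply csum_ext. intros j _. rewrite RtoC_opp.
        replace (- (RtoC (5 / 2) + (sg, t)))%C with (RtoC (- (5 / 2)) + - (sg, t))%C by (rewrite RtoC_opp; ring).
        rewrite Rcpow_plus, Rcpow_RtoC. unfold pw, Rcpow.
        replace (- (sg, t) * RtoC (ln (INR (S (S j)))))%C with (- RtoC (ln (INR (S (S j)))) * (sg, t))%C by ring. ring.
      - rewrite (rsum_ext _ (fun j => pw (INR (S (S j))) (- (5 / 2)))). apply zeta_tail_half.
        intros j _. rewrite Rabs_Ropp, Rabs_pos_eq; auto. left; apply pw_pos.
      - intros j. apply EP_exp. rewrite <- ln_1. apply ln_le; [lra|]. apply (le_INR 1); lia. }
    apply (PD_lim (fun J t => csum (fun j => (- wtail k (RtoC (5 / 2) + (sg, t))) ^ j) (S J) * / (sg, t))%C).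
    + exists O. intros J _.
      assert (HJ : EP sg 1 (fun t => csum (fun j => (- wtail k (RtoC (5 / 2) + (sg, t))) ^ S j)%C J)).
      { eapply EP_ext; [| |apply (EP_csum sg (fun j => (/ 2) ^ S j) (fun j t => (- wtail k (RtoC (5 / 2) + (sg, t))) ^ S j)%C J)].
        - intros; auto.
        - rewrite (rsum_ext _ (fun j => / 2 * (/ 2) ^ j)) by (intros; simpl; auto). rewrite rsum_scal.
          assert (G := rsum_geom_le (/ 2) J ltac:(lra)).
          replace (/ (1 - / 2)) with 2 in G by field. change (rsum (pow (/ 2)) J) with (rsum (fun j => (/ 2) ^ j) J). lra.
        - intros j. apply EP_pow; auto. }
      eapply PD_ext; [|apply (EP_PD sg 1 _ Hs HJ)].
      intros t. cbv beta. rewrite csum_shift. simpl. auto.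
    + intros t. apply Ccv_mult; [|apply Ccv_const].
      apply (Ccv_subseq S (csum (fun j => (- wtail k (RtoC (5 / 2) + (sg, t))) ^ j)%C)); auto. apply Ccv_geom.
      rewrite Cmod_opp. assert (Hb := wtail_bound k _ (Hre t)). lra.
  - intros t. assert (Hz := zD_neq0 _ (Hre t)).
    apply Ccv_eq with (/ (1 - - (zD (RtoC (5 / 2) + (sg, t)) - 1)) * / (sg, t))%C.
    + field. replace (1 - - (zD (RtoC (5 / 2) + (sg, t)) - 1))%C with (zD (RtoC (5 / 2) + (sg, t))) by ring.
      repeat split; auto. apply line_neq0; auto.
    + apply Ccv_mult; [|apply Ccv_const]. apply Ccv_inv.
      replace (1 - - (zD (RtoC (5 / 2) + (sg, t)) - 1))%C with (zD (RtoC (5 / 2) + (sg, t))) by ring; auto.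
      apply Ccv_minus; [apply Ccv_const|]. apply Ccv_opp. apply wtail_cv. specialize (Hre t). lra.
Qed.

(** * The Fourier series of [u (1 - u)] *)

(** The series of [u (1 - u)] grouped as [1 - cos], so that every term is nonnegative and vanishes
    at integers, and matches the integrand of [Mint]. *)
Definition fterm (k : nat) (u : R) : R := (1 - cos (2 * PI * INR (S k) * u)) / (PI ^ 2 * INR (S k) ^ 2).
Definition fS (N : nat) (u : R) : R := rsum (fun k => fterm k u) N.
Definition fE (N : nat) (u : R) : R := rsum (fun k => 2 * sin (2 * PI * INR (S k) * u) / (PI * INR (S k))) N - (1 - 2 * u).

Lemma SINR_pos k : 0 < INR (S k).
Proof. apply lt_0_INR; lia. Qed.

Lemma is_derive_fterm k u : is_derive (fterm k) u (2 * sin (2 * PI * INR (S k) * u) / (PI * INR (S k))).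
Proof.
  unfold fterm. assert (Hk := SINR_pos k). assert (Hp := PI_RGT_0). set (n := INR (S k)) in *.
  auto_derive. auto. field. lra.
Qed.

Lemma is_derive_fS N u : is_derive (fun u => fS N u - u * (1 - u)) u (fE N u).
Proof.
  unfold fS, fE. apply (is_derive_minus (K:=R_AbsRing) (V:=R_NormedModule)).
  apply is_derive_rsum. intros; apply is_derive_fterm. auto_derive; auto. ring.
Qed.

Lemma is_derive_fE N u : is_derive (fE N) u (rsum (fun k => 4 * cos (2 * PI * INR (S k) * u)) N + 2).
Proof.
  unfold fE. replace (rsum (fun k => 4 * cos (2 * PI * INR (S k) * u)) N + 2) with
   (rsum (fun k => 4 * cos (2 * PI * INR (S k) * u)) N - (- 2)) by ring.
  apply (is_derive_minus (K:=R_AbsRing) (V:=R_NormedModule)).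
  - apply is_derive_rsum. intros j. assert (Hk := SINR_pos j). assert (Hp := PI_RGT_0). set (n := INR (S j)) in *.
    auto_derive. auto. field. lra.
  - auto_derive; auto. ring.
Qed.

Lemma dirichlet_kernel N u : sin (PI * u) * (rsum (fun k => 4 * cos (2 * PI * INR (S k) * u)) N + 2) = 2 * sin ((2 * INR N + 1) * PI * u).
Proof.
  induction N.
  - simpl. replace ((2 * 0 + 1) * PI * u) with (PI * u) by ring. ring.
  - cbn [rsum]. set (X := rsum _ _) in *.
    replace (sin (PI * u) * (X + 4 * cos (2 * PI * INR (S N) * u) + 2)) with
      (sin (PI * u) * (X + 2) + 4 * (sin (PI * u) * cos (2 * PI * INR (S N) * u))) by ring.
    rewrite IHN. rewrite S_INR.
    replace ((2 * INR N + 1) * PI * u) with (2 * PI * (INR N + 1) * u - PI * u) by ring.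
    replace ((2 * (INR N + 1) + 1) * PI * u) with (2 * PI * (INR N + 1) * u + PI * u) by ring.
    rewrite sin_plus, sin_minus. ring.
Qed.

Lemma sin_half_odd N : cos ((2 * INR N + 1) * PI * / 2) = 0.
Proof.
  induction N. simpl. replace ((2 * 0 + 1) * PI * / 2) with (PI / 2) by field. apply cos_PI2.
  rewrite S_INR. replace ((2 * (INR N + 1) + 1) * PI * / 2) with ((2 * INR N + 1) * PI * / 2 + PI) by field.
  rewrite neg_cos, IHN. ring.
Qed.

Lemma fE_half N : fE N (/ 2) = 0.
Proof.
  unfold fE. rewrite rsum_zero. field. intros j.
  replace (2 * PI * INR (S j) * / 2) with (INR (S j) * PI) by field.
  assert (sin (INR (S j) * PI) = 0).
  { apply sin_eq_0_1. exists (Z.of_nat (S j)). rewrite <- INR_IZR_INZ. auto. }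
  rewrite H. unfold Rdiv; ring.
Qed.

Lemma sin_PI_lower del u : 0 < del <= / 2 -> del <= u <= 1 - del -> sin (PI * del) <= sin (PI * u).
Proof.
  intros Hd Hu. assert (Hp := PI_RGT_0). destruct (Rle_dec u (/ 2)).
  - apply sin_incr_1; nra.
  - rewrite <- (sin_PI_x (PI * u)). apply sin_incr_1; nra.
Qed.

(** The derivative of [fE N] is [2 sin (q PI u) / sin (PI u)] with [q = 2 N + 1]. Integrating this
    oscillation from the common zero at 1/2 gains a factor [1 / q] away from the integers. *)
Lemma fE_bound del : 0 < del <= / 2 -> exists K, 0 <= K /\ forall N u, del <= u <= 1 - del -> Rabs (fE N u) <= K * / (2 * INR N + 1).
Proof.
  intros Hd. assert (Hp := PI_RGT_0).
  set (s := sin (PI * del)).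
  assert (Hs : 0 < s) by (apply sin_gt_0; nra).
  exists (2 / s ^ 2 + 2 / (PI * s)). split.
  { apply Rplus_le_le_0_compat; apply Rlt_le, Rdiv_lt_0_compat; try lra. apply pow_lt; auto. apply Rmult_lt_0_compat; auto. }
  intros N u Hu. assert (HN := pos_INR N). set (q := 2 * INR N + 1) in *. assert (Hq : 1 <= q) by (unfold q; lra).
  (* The correction is the boundary term of an integration by parts: it cancels the leading
     oscillation and leaves a derivative of order [1 / q]. It vanishes at 1/2 by [sin_half_odd]. *)
  set (Q := fun u => fE N u + 2 * cos (q * PI * u) / (q * PI * sin (PI * u))).
  assert (Hlow : forall w, del <= w <= 1 - del -> s <= sin (PI * w)) by (intros; apply sin_PI_lower; auto).
  assert (D : forall w, del <= w <= 1 - del -> is_derive Q w (- 2 * cos (q * PI * w) * cos (PI * w) / (q * sin (PI * w) ^ 2))).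
  { intros w Hw. specialize (Hlow w Hw).
    assert (D1 := is_derive_fE N w).
    assert (D2 : is_derive (fun u => 2 * cos (q * PI * u) / (q * PI * sin (PI * u))) w
      (- 2 * sin (q * PI * w) / sin (PI * w) - 2 * cos (q * PI * w) * cos (PI * w) / (q * sin (PI * w) ^ 2))).
    { auto_derive. apply Rmult_integral_contrapositive_currified; [apply Rmult_integral_contrapositive_currified|]; lra.
      field. lra. }
    evar_last. apply (is_derive_plus (K:=R_AbsRing) (V:=R_NormedModule) _ _ _ _ _ D1 D2). unfold plus; simpl plus.
    assert (E := dirichlet_kernel N w). fold q in E.
    replace (rsum (fun k => 4 * cos (2 * PI * INR (S k) * w)) N + 2) with (2 * sin (q * PI * w) / sin (PI * w)).
    unfold plus; simpl. field. lra. rewrite <- E. field. lra. }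
  destruct (MVT_gen Q (/ 2) u (fun w => - 2 * cos (q * PI * w) * cos (PI * w) / (q * sin (PI * w) ^ 2))) as [c [Hc E]].
  - intros w Hw. apply D. unfold Rmin, Rmax in Hw. destruct (Rle_dec (/2) u); lra.
  - intros w Hw. apply derivable_continuous_pt. eexists. apply is_derive_Reals, D.
    unfold Rmin, Rmax in Hw. destruct (Rle_dec (/2) u); lra.
  - assert (Hcd : del <= c <= 1 - del).
    { unfold Rmin, Rmax in Hc. destruct (Rle_dec (/2) u); lra. }
    assert (Q0 : Q (/ 2) = 0).
    { unfold Q. rewrite fE_half. unfold q. rewrite sin_half_odd. unfold Rdiv; ring. }
    rewrite Q0, Rminus_0_r in E.
    assert (Hcl := Hlow c Hcd). assert (Hul := Hlow u Hu).
    assert (B1 : Rabs (Q u) <= 2 / s ^ 2 * / q).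
    { rewrite E, Rabs_mult. rewrite <- (Rmult_1_r (2 / s ^ 2 * / q)).
      apply Rmult_le_compat; try apply Rabs_pos.
      - unfold Rdiv. rewrite !Rabs_mult. rewrite Rabs_inv, (Rabs_pos_eq (q * _)).
        2:{ apply Rmult_le_pos; [lra|]. apply pow2_ge_0. }
        replace (2 * / s ^ 2 * / q) with (2 * 1 * 1 * / (q * s ^ 2)) by (field; lra).
        apply Rmult_le_compat.
        + repeat apply Rmult_le_pos; apply Rabs_pos.
        + left; apply Rinv_0_lt_compat, Rmult_lt_0_compat; [lra|apply pow_lt; lra].
        + apply Rmult_le_compat; [apply Rmult_le_pos; apply Rabs_pos|apply Rabs_pos| |].
          * apply Rmult_le_compat; try apply Rabs_pos. rewrite Rabs_left; lra.
            apply Rabs_le. generalize (COS_bound (q * PI * c)); lra.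
          * apply Rabs_le. generalize (COS_bound (PI * c)); lra.
        + apply Rinv_le_contravar. apply Rmult_lt_0_compat; [lra|apply pow_lt; lra].
          apply Rmult_le_compat_l; [lra|]. apply pow_incr; lra.
      - apply Rabs_le; lra. }
    assert (B2 : Rabs (2 * cos (q * PI * u) / (q * PI * sin (PI * u))) <= 2 / (PI * s) * / q).
    { unfold Rdiv. rewrite !Rabs_mult, Rabs_inv, (Rabs_pos_eq (q * PI * _)).
      2:{ apply Rmult_le_pos; [apply Rmult_le_pos|]; lra. }
      replace (2 * / (PI * s) * / q) with (2 * 1 * / (q * PI * s)) by (field; lra).
      apply Rmult_le_compat.
      - apply Rmult_le_pos; apply Rabs_pos.
      - left; apply Rinv_0_lt_compat. apply Rmult_lt_0_compat; [apply Rmult_lt_0_compat|]; lra.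
      - apply Rmult_le_compat; try apply Rabs_pos. rewrite Rabs_pos_eq; lra. apply Rabs_le. generalize (COS_bound (q * PI * u)); lra.
      - apply Rinv_le_contravar. apply Rmult_lt_0_compat; [apply Rmult_lt_0_compat|]; lra. apply Rmult_le_compat_l; [|lra]. apply Rmult_le_pos; lra. }
    replace (fE N u) with (Q u - 2 * cos (q * PI * u) / (q * PI * sin (PI * u))) by (unfold Q; ring).
    eapply Rle_trans; [apply Rabs_triang|]. rewrite Rabs_Ropp. lra.
Qed.

Lemma one_minus_cos_le y : 0 <= 1 - cos y <= y ^ 2 / 2.
Proof.
  split. generalize (COS_bound y); lra.
  replace y with (2 * (y / 2)) at 1 by field. rewrite cos_2a_sin.
  assert (B : Rabs (sin (y / 2)) <= Rabs (y / 2)).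
  { destruct (Rle_dec 0 (y / 2)) as [h|h].
    - rewrite (Rabs_pos_eq (y / 2)) by auto. apply Rabs_le. split; [|apply sin_le_x_0 || (destruct h as [h|<-]; [left; apply sin_lt_x; auto|rewrite sin_0; lra])].
      destruct (Rle_dec (y / 2) 1).
      + assert (0 <= sin (y / 2)) by (apply sin_ge_0; [auto|generalize PI2_1; lra]). lra.
      + generalize (SIN_bound (y / 2)); lra.
    - rewrite <- Rabs_Ropp, <- sin_neg, <- (Rabs_Ropp (y / 2)). set (z := - (y / 2)). assert (Hz : 0 < z) by (unfold z; lra).
      rewrite (Rabs_pos_eq z) by lra. apply Rabs_le. split; [|left; apply sin_lt_x; auto].
      destruct (Rle_dec z 1).
      + assert (0 <= sin z) by (apply sin_ge_0; [lra|generalize PI2_1; lra]). lra.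
      + generalize (SIN_bound z); lra. }
  apply Rsqr_le_abs_1 in B. unfold Rsqr in B. nra.
Qed.

Lemma fterm_bounds k u : 0 <= fterm k u <= 2 * u ^ 2 /\ fterm k u <= (/ INR (S k)) ^ 2.
Proof.
  assert (Hk := SINR_pos k). assert (Hp := PI_RGT_0). assert (Hp4 := PI2_1).
  assert (C := one_minus_cos_le (2 * PI * INR (S k) * u)). assert (C2 := COS_bound (2 * PI * INR (S k) * u)).
  unfold fterm. set (n := INR (S k)) in *.
  assert (Hd : 0 < PI ^ 2 * n ^ 2) by (apply Rmult_lt_0_compat; apply pow_lt; lra).
  split; [split|].
  - apply Rmult_le_pos; [lra|left; apply Rinv_0_lt_compat; auto].
  - apply Rle_div_l; auto. nra.
  - apply Rle_div_l; auto. replace ((/ n) ^ 2 * (PI ^ 2 * n ^ 2)) with (PI ^ 2) by (field; lra). nra.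
Qed.

(** Away from the integers the derivative of the error tends to 0, so the error at [u] is close to
    its value at a point [del] near 0. There it is small directly, each term being at most [2 del^2]
    and the tail at most that of the inverse squares. *)
Lemma fS_lim_open u : 0 < u < 1 -> is_lim_seq (fun N => fS N u) (u * (1 - u)).
Proof.
  intros Hu. apply is_lim_seq_spec. intros eps. destruct eps as [e He]. simpl.
  destruct (summable_tail (fun j => (/ INR (S j)) ^ 2) (fun j => pow2_ge_0 _) (ex_intro _ 2 summable_inv_sq) (e / 8)) as [K HK]; [lra|].
  assert (HK0 := pos_INR K).
  (* The last bound controls both the first [K] terms at [del] and [del] itself; the others put [u]
     in [[del, 1 - del]]. *)
  set (del := Rmin (Rmin (Rmin u (1 - u)) (/ 2)) (e / (8 * (2 * INR K + 1)))).
  assert (D0 : 0 < del).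
  { repeat apply Rmin_glb_lt; try lra. apply Rdiv_lt_0_compat; lra. }
  assert (D1 : del <= e / (8 * (2 * INR K + 1))) by apply Rmin_r.
  assert (D2 : del <= Rmin (Rmin u (1 - u)) (/ 2)) by apply Rmin_l.
  assert (D3 : del <= / 2) by (eapply Rle_trans; [apply D2|apply Rmin_r]).
  assert (D4 : del <= Rmin u (1 - u)) by (eapply Rle_trans; [apply D2|apply Rmin_l]).
  assert (D5 : del <= u) by (eapply Rle_trans; [apply D4|apply Rmin_l]).
  assert (D6 : del <= 1 - u) by (eapply Rle_trans; [apply D4|apply Rmin_r]).
  destruct (fE_bound del ltac:(lra)) as [B [HB0 HB]].
  assert (HBe : exists N0, forall N, (N0 <= N)%nat -> B * / (2 * INR N + 1) <= e / 4).
  { destruct (nfloor_ex (B * / (e / 4))) as [N0 [_ HN0]].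
    apply Rmult_le_pos; auto. left; apply Rinv_0_lt_compat; lra.
    exists (S N0). intros N HN. apply le_INR in HN. rewrite S_INR in HN.
    assert (HNp := pos_INR N0). apply (Rmult_le_reg_r (2 * INR N + 1)); [lra|].
    rewrite Rmult_assoc, Rinv_l by lra.
    assert (B < e / 4 * (INR N0 + 1)). { apply (Rmult_lt_compat_l (e / 4)) in HN0; [|lra].
      replace (e / 4 * (B * / (e / 4))) with B in HN0 by (field; lra). exact HN0. }
    assert (e / 4 * (INR N0 + 1) <= e / 4 * (2 * INR N + 1)) by (apply Rmult_le_compat_l; lra). lra. }
  destruct HBe as [N0 HN0].
  exists (max N0 K). intros N HN.
  set (V := fun u => fS N u - u * (1 - u)).
  change (Rabs (V u) < e).
  assert (HV1 : Rabs (V u - V del) <= e / 4).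
  { destruct (MVT_gen V del u (fE N)) as [c [Hc E]].
    - intros x _. apply is_derive_fS.
    - intros x _. apply derivable_continuous_pt. eexists. apply is_derive_Reals, is_derive_fS.
    - rewrite Rmin_left, Rmax_right in Hc by lra. rewrite E, Rabs_mult.
      assert (Q := HB N c ltac:(lra)). specialize (HN0 N ltac:(lia)).
      rewrite (Rabs_pos_eq (u - del)) by lra.
      assert (Rabs (fE N c) * (u - del) <= e / 4 * 1) by (apply Rmult_le_compat; try lra; apply Rabs_pos). lra. }
  assert (HS1 : fS N del <= INR K * (2 * del ^ 2) + e / 8).
  { unfold fS.
    assert (T : rsum (fun k => fterm k del) N - rsum (fun k => fterm k del) K <= e / 8).
    { eapply Rle_trans; [|apply (HK N); lia].
      assert (Hi : forall j, (K <= j)%nat -> rsum (fun k => fterm k del) j - rsum (fun k => fterm k del) K <= rsum (fun j => (/ INR (S j)) ^ 2) j - rsum (fun j => (/ INR (S j)) ^ 2) K).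
      { intros j Hj. induction Hj. lra. cbn [rsum]. assert (F := proj2 (fterm_bounds m del)). lra. }
      apply Hi; lia. }
    assert (T2 : rsum (fun k => fterm k del) K <= INR K * (2 * del ^ 2)).
    { clear. clearbody del. induction K. simpl; lra. cbn [rsum]. rewrite S_INR. assert (F := proj1 (fterm_bounds K del)). lra. }
    lra. }
  assert (HS0 : 0 <= fS N del) by (apply rsum_pos; intros; apply fterm_bounds).
  assert (Hde : (2 * INR K + 1) * del <= e / 8).
  { apply Rle_trans with ((2 * INR K + 1) * (e / (8 * (2 * INR K + 1)))). apply Rmult_le_compat_l; lra. apply Req_le; field; lra. }
  assert (del ^ 2 <= del) by (simpl; nra).
  assert (INR K * (2 * del ^ 2) <= INR K * (2 * del)) by (apply Rmult_le_compat_l; lra).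
  assert (HV2 : Rabs (V del) <= e / 2).
  { unfold V. apply Rabs_le. split; nra. }
  replace (V u) with ((V u - V del) + V del) by ring.
  eapply Rle_lt_trans; [apply Rabs_triang|]. lra.
Qed.

Lemma fterm_period k j u : fterm k (INR j + u) = fterm k u.
Proof.
  unfold fterm. do 2 f_equal.
  replace (2 * PI * INR (S k) * (INR j + u)) with (2 * PI * INR (S k) * u + 2 * INR (S k * j) * PI) by (rewrite mult_INR; ring).
  apply cos_period.
Qed.

Lemma fS_lim j x : INR j <= x <= INR j + 1 -> is_lim_seq (fun N => fS N x) ((x - INR j) * (INR j + 1 - x)).
Proof.
  intros Hx. pose (u := x - INR j).
  replace ((x - INR j) * (INR j + 1 - x)) with (u * (1 - u)) by (unfold u; ring).
  assert (Hp : forall N, fS N x = fS N u).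
  { intros N. unfold fS. apply rsum_ext. intros k _. replace x with (INR j + u) by (unfold u; ring). apply fterm_period. }
  apply is_lim_seq_ext with (fun N => fS N u); auto.
  assert (Hu : 0 <= u <= 1) by (unfold u; lra). clearbody u.
  assert (H0 : forall N, fS N 0 = 0).
  { intros N. apply rsum_zero. intros k. unfold fterm. rewrite Rmult_0_r, cos_0. unfold Rdiv; ring. }
  destruct (Req_dec u 0) as [->|h0].
  - apply is_lim_seq_ext with (fun _ => 0); auto. replace (0 * (1 - 0)) with 0 by ring. apply is_lim_seq_const.
  - destruct (Req_dec u 1) as [->|h1].
    + apply is_lim_seq_ext with (fun _ => 0). intros N. rewrite <- (H0 N). unfold fS. apply rsum_ext. intros k _.
      replace 1 with (INR 1 + 0) at 1 by (simpl; ring). symmetry; apply fterm_period.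
      replace (1 * (1 - 1)) with 0 by ring. apply is_lim_seq_const.
    + apply fS_lim_open. lra.
Qed.

(** The increments of the partial sums are nonnegative and dominated by inverse squares
    independently of [x], so pointwise convergence is uniform. *)
Lemma fS_unif e : 0 < e -> exists N0, forall N j x, (N0 <= N)%nat -> INR j <= x <= INR j + 1 ->
  Rabs (fS N x - (x - INR j) * (INR j + 1 - x)) <= e.
Proof.
  intros He.
  destruct (summable_tail (fun j => (/ INR (S j)) ^ 2) (fun j => pow2_ge_0 _) (ex_intro _ 2 summable_inv_sq) e He) as [K HK].
  exists K. intros N j x HN Hx.
  assert (L := fS_lim j x Hx).
  assert (Hi : forall p, (N <= p)%nat -> 0 <= fS p x - fS N x <= rsum (fun j => (/ INR (S j)) ^ 2) p - rsum (fun j => (/ INR (S j)) ^ 2) N).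
  { intros p Hp. induction Hp. lra. unfold fS in *. cbn [rsum]. assert (F := fterm_bounds m x). lra. }
  assert (Hj : forall p, (N <= p)%nat -> Rabs (fS N x - fS p x) <= e).
  { intros p Hp. specialize (Hi p Hp). assert (Q := HK p ltac:(lia)).
    assert (Q2 := rsum_incr (fun j => (/ INR (S j)) ^ 2) K N (fun j => pow2_ge_0 _) HN).
    rewrite Rabs_minus_sym, Rabs_pos_eq; lra. }
  assert (L2 : is_lim_seq (fun p => Rabs (fS N x - fS p x)) (Rabs (fS N x - (x - INR j) * (INR j + 1 - x)))).
  { apply (is_lim_seq_abs _ (fS N x - (x - INR j) * (INR j + 1 - x))). apply is_lim_seq_minus'; auto. apply is_lim_seq_const. }
  apply (is_lim_seq_le_loc (fun p => Rabs (fS N x - fS p x)) (fun _ => e) (Rabs (fS N x - (x - INR j) * (INR j + 1 - x))) e); auto.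
  exists N; auto. apply is_lim_seq_const.
Qed.

(** * Analytic continuation of zeta *)

Definition bump (j : nat) (x : R) : R := (x - INR j) * (INR j + 1 - x).

Definition zker (s : C) (x : R) : C := Rcpow x (- s - 2).

Definition hh (s : C) (j : nat) : C := CInt (fun x => RtoC (bump j x) * zker s x)%C (INR j) (INR j + 1).

Lemma is_derive_bump j x : is_derive (bump j) x (1 - 2 * (x - INR j)).
Proof. unfold bump. auto_derive; auto. ring. Qed.

Lemma ccont_bump s j x : 0 < x -> ccont (fun x => RtoC (bump j x) * zker s x)%C x.
Proof.
  intros Hx. apply ccont_mult; [|apply ccont_Rcpow; auto].
  eapply cder_ccont, cder_RtoC, is_derive_bump.
Qed.

Lemma hh_correct s j : (1 <= j)%nat -> cint (fun x => RtoC (bump j x) * zker s x)%C (INR j) (INR j + 1) (hh s j).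
Proof.
  intros Hj. apply (le_INR 1) in Hj. simpl in Hj. apply CInt_correct. lra. intros; apply ccont_bump; lra.
Qed.

(** The trapezoidal rule with remainder for [x^(-s)] on one unit interval, from two integrations by
    parts; [bump] is minus the second-order kernel up to scale and vanishes at both ends. *)
Lemma hh_eval s j : (1 <= j)%nat -> s <> RtoC 1 ->
  (s * (s + 1) / 2 * hh s j = (Rcpow (INR j) (- s) + Rcpow (INR (S j)) (- s)) / 2
    - (Rcpow (INR (S j)) (1 - s) - Rcpow (INR j) (1 - s)) / (1 - s))%C.
Proof.
  intros Hj Hs. assert (Hj' := Hj). apply (le_INR 1) in Hj'. simpl in Hj'.
  assert (Hs1 : (1 - s)%C <> RtoC 0).
  { intros E. apply Hs. replace s with (1 - (1 - s))%C by ring. rewrite E; ring. }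
  rewrite (S_INR j).
  (* An explicit primitive collecting the boundary terms of both integrations by parts. *)
  set (G := fun x => (- (s / 2) * (RtoC (bump j x) * Rcpow x (- s - 1)) - (/ 2) * (RtoC (1 - 2 * (x - INR j)) * Rcpow x (- s))
     - / (1 - s) * Rcpow x (1 - s))%C).
  assert (D : forall x, 0 < x -> cder G x (s * (s + 1) / 2 * (RtoC (bump j x) * zker s x))%C).
  { intros x Hx.
    assert (D1 := cder_scal (- (s / 2))%C _ x _ (cder_mult _ _ x _ _ (cder_RtoC (bump j) x _ (is_derive_bump j x)) (cder_Rcpow (- s - 1) x Hx))).
    assert (Dl : is_derive (fun x => 1 - 2 * (x - INR j)) x (- 2)) by (auto_derive; auto; ring).
    assert (D2 := cder_scal (/ 2)%C _ x _ (cder_mult _ _ x _ _ (cder_RtoC _ x _ Dl) (cder_Rcpow (- s) x Hx))).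
    assert (D3 := cder_scal (/ (1 - s))%C _ x _ (cder_Rcpow (1 - s) x Hx)).
    assert (D4 := cder_minus _ _ x _ _ (cder_minus _ _ x _ _ D1 D2) D3). cbv beta in D4.
    match type of D4 with cder _ _ ?l => replace (s * (s + 1) / 2 * (RtoC (bump j x) * zker s x))%C with l; [exact D4|] end.
    clear D1 D2 D3 D4. unfold zker.
    replace (- s - 1 - 1)%C with (- s - 2)%C by ring. replace (1 - s - 1)%C with (- s)%C by ring.
    replace (RtoC (- 2)) with (- (2))%C by (rewrite <- RtoC_opp; f_equal; ring). field. auto. }
  assert (I : cint (fun x => s * (s + 1) / 2 * (RtoC (bump j x) * zker s x))%C (INR j) (INR j + 1) (G (INR j + 1)%R - G (INR j))%C).
  { apply cint_FTC. lra. intros; apply D; lra. intros t Ht. apply ccont_mult; [apply ccont_const|]. apply ccont_bump; lra. }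
  assert (I2 := cint_scal (s * (s + 1) / 2)%C _ _ _ _ (hh_correct s j Hj)).
  rewrite <- (cint_unique _ _ _ _ I2). rewrite (cint_unique _ _ _ _ I).
  unfold G, bump. replace (INR j + 1 - INR j) with 1 by ring. replace (INR j + 1 - (INR j + 1)) with 0 by ring.
  replace (INR j - INR j) with 0 by ring. rewrite Rmult_0_r, Rmult_0_l.
  replace (1 - 2 * 1) with (- (1)) by ring. replace (1 - 2 * 0) with 1 by ring. rewrite RtoC_opp. field. auto.
Qed.

(** The integral version of the closure: the kernel lies in a polynomial ball for every [x] in the
    interval, with a radius bounded by its size at the left end. *)
Lemma CW_hh rho (s0 : C) j : 0 <= rho -> fst s0 + 2 - rho >= 0 -> (1 <= j)%nat ->
  CW rho (pw (INR j) (- (fst s0 + 2 - rho))) (fun z => hh (s0 + z) j).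
Proof.
  intros Hr Hs Hj. assert (Hj' := Hj). apply (le_INR 1) in Hj'. simpl in Hj'.
  set (A := pw (INR j) (- (fst s0 + 2 - rho))).
  replace A with ((INR j + 1 - INR j) * A) by ring.
  apply (Cl_int (fun z => Cmod z <= rho) (Pol rho) (fun x z => RtoC (bump j x) * zker (s0 + z) x)%C).
  - lra.
  - left; apply pw_pos.
  - apply Pol_0; lra.
  - intros; apply Pol_plus; auto.
  - intros c B g Hc Hg. replace (c * B) with (Cmod (RtoC c) * B) by (rewrite Cmod_RtoC_pos; auto). apply Pol_scal; auto.
  - intros u Hu. change (CW rho A (fun z => RtoC (bump j u) * zker (s0 + z) u)%C).
    assert (Hb : 0 <= bump j u <= 1) by (unfold bump; split; nra).
    apply CW_le with (Cmod (RtoC (bump j u)) * pw u (fst (- s0 - 2)%C + rho)).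
    + rewrite Cmod_RtoC_pos by lra. unfold A.
      replace (fst (- s0 - 2)%C + rho) with (- (fst s0 + 2 - rho)) by (simpl; ring).
      assert (P := pw_neg_base (INR j) u (- (fst s0 + 2 - rho)) ltac:(lra) ltac:(lra)).
      assert (P2 := pw_pos u (- (fst s0 + 2 - rho))). nra.
    + apply CW_scal; auto. apply CW_ext with (fun z => Rcpow u ((- s0 - 2) + - (1) * z)).
      intros z _. unfold zker. f_equal; ring. apply CW_Rcpow; auto. lra. rewrite Cmod_opp, Cmod_1; lra.
  - intros z _. apply hh_correct; auto.
Qed.

Lemma hh_bound (s : C) j : fst s + 2 >= 0 -> (1 <= j)%nat -> Cmod (hh s j) <= pw (INR j) (- (fst s + 2)).
Proof.
  intros Hs Hj. assert (H := CW_hh 0 s j (Rle_refl 0) ltac:(lra) Hj).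
  assert (K := CW_bound _ _ _ (RtoC 0) H ltac:(rewrite Cmod_0; lra)). simpl in K.
  rewrite Cplus_0_r in K. replace (fst s + 2 - 0) with (fst s + 2) in K by ring. exact K.
Qed.

Definition Jz (s : C) : C := Cser (fun k => hh s (S k)).

Lemma Jz_cv (s : C) : -1 < fst s -> Ccv (csum (fun k => hh s (S k))) (Jz s).
Proof.
  intros Hs. apply csum_cv with (fun k => pw (INR (S k)) (- (fst s + 2))).
  intros k. apply hh_bound; [lra|lia]. apply summable_zeta; lra.
Qed.

Lemma Hol_Jz (s : C) : -1 < fst s -> Hol Jz s.
Proof.
  intros Hs. set (rho := (fst s + 1) / 2).
  destruct (summable_zeta (fst s + 2 - rho) ltac:(unfold rho; lra)) as [B HB].
  exists rho, B. split. unfold rho; lra.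
  apply (CW_Cser rho (fun k => pw (INR (S k)) (- (fst s + 2 - rho))) B (fun k z => hh (s + z) (S k))); auto.
  intros k. apply CW_hh; unfold rho; try lra; lia.
Qed.

(** The Euler-Maclaurin continuation of zeta to [Re s > -1]: summing [hh_eval] over all unit
    intervals from 1 gives the Dirichlet series when [Re s > 1]. *)
Definition Zf (s : C) : C := (/ (s - 1) + / 2 + s * (s + 1) / 2 * Jz s)%C.

Lemma Hol_Zf (s : C) : -1 < fst s -> s <> RtoC 1 -> Hol Zf s.
Proof.
  intros Hs Hs1. unfold Zf. apply Hol_plus. apply Hol_plus.
  - apply (Hol_inv (fun s => s - 1)%C). apply Cminus_eq_contra; auto. apply Hol_minus; [apply Hol_id|apply Hol_const].
  - apply Hol_const.
  - apply Hol_mult; [|apply Hol_Jz; auto]. apply Hol_mult; [|apply Hol_const].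
    apply Hol_mult; [apply Hol_id|]. apply Hol_plus; [apply Hol_id|apply Hol_const].
Qed.

Lemma Ccv_Rcpow_neg (s : C) : fst s < 0 -> Ccv (fun k => Rcpow (INR (S k)) s) 0.
Proof.
  intros Hs. apply Ccv_dom with (fun k => pw (1 / (INR k + 1)) (- fst s)).
  - exists O; intros k _. replace (Rcpow (INR (S k)) s - 0)%C with (Rcpow (INR (S k)) s) by ring.
    rewrite Cmod_Rcpow_pw. apply Req_le. unfold pw. rewrite <- S_INR. assert (Hk := SINR_pos k).
    unfold Rdiv. rewrite Rmult_1_l, ln_Rinv by auto. f_equal; ring.
  - apply pw_lim_0; lra.
Qed.

Lemma Zf_zD (s : C) : 1 < fst s -> Zf s = zD s.
Proof.
  intros Hs. assert (Hs1 : s <> RtoC 1) by (intros E; rewrite E in Hs; simpl in Hs; lra).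
  assert (Hs2 : (1 - s)%C <> RtoC 0).
  { intros E. apply Hs1. replace s with (1 - (1 - s))%C by ring. rewrite E; ring. }
  assert (E : forall k, (s * (s + 1) / 2 * csum (fun k => hh s (S k)) k = csum (fun k => Rcpow (INR (S k)) (- s)) k - / 2
     + Rcpow (INR (S k)) (- s) / 2 - (Rcpow (INR (S k)) (1 - s) - 1) / (1 - s))%C).
  { induction k.
    - simpl csum. replace (INR 1) with 1 by auto. rewrite !Rcpow_one. field. auto.
    - cbn [csum]. rewrite Cmult_plus_distr_l, IHk, hh_eval by (auto; lia). field. auto. }
  assert (L : Ccv (fun k => / (s - 1) + / 2 + s * (s + 1) / 2 * csum (fun k => hh s (S k)) k)%C (Zf s)).
  { unfold Zf. apply Ccv_plus. apply Ccv_const. apply Ccv_scal. apply Jz_cv; lra. }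
  apply (Ccv_unique _ _ _ L).
  apply Ccv_ext with (fun k => csum (fun k => Rcpow (INR (S k)) (- s)) k + Rcpow (INR (S k)) (- s) / 2 - Rcpow (INR (S k)) (1 - s) / (1 - s))%C.
  - intros k. rewrite E. field. split; auto.
    intros E0. apply Hs2. replace (1 - s)%C with (- (s - 1))%C by ring. rewrite E0; ring.
  - apply Ccv_eq with (zD s + 0 / 2 - 0 / (1 - s))%C; [field; auto|].
    apply Ccv_minus; [apply Ccv_plus|].
    + apply zD_cv; auto.
    + apply Ccv_mult; [|apply Ccv_const]. apply Ccv_Rcpow_neg. simpl; lra.
    + apply Ccv_mult; [|apply Ccv_const]. apply Ccv_Rcpow_neg. simpl; lra.
Qed.

(** * The functional equation *)

Lemma cint_comp_scal (f : R -> C) c a b l : cint f (c * a) (c * b) l -> cint (fun y => RtoC c * f (c * y)%R)%C a b l.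
Proof.
  intros [H1 H2]; split.
  - apply (is_RInt_ext (fun y => scal c (fst (f (c * y + 0))))).
    { intros y _. rewrite Rplus_0_r. simpl. unfold scal; simpl; unfold mult; simpl. ring. }
    apply (is_RInt_comp_lin (V:=R_NormedModule) (fun y => fst (f y)) c 0 a b). rewrite !Rplus_0_r. auto.
  - apply (is_RInt_ext (fun y => scal c (snd (f (c * y + 0))))).
    { intros y _. rewrite Rplus_0_r. simpl. unfold scal; simpl; unfold mult; simpl. ring. }
    apply (is_RInt_comp_lin (V:=R_NormedModule) (fun y => snd (f y)) c 0 a b). rewrite !Rplus_0_r. auto.
Qed.

(** Chosen so that the kernel [x^(- s - 2)] is [x^(- 2 v - 1)]; the strip [0 < Re v < 1] of [Mv] is
    then [-1 < Re s < 1]. *)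
Definition vz (s : C) : C := ((s + 1) / 2)%C.

Definition fcoef (s : C) (k : nat) : C :=
  (Rcpow (2 * PI * INR (S k)) (s + 1) / RtoC (PI ^ 2 * INR (S k) ^ 2))%C.

Lemma two_pi_pos k : 0 < 2 * PI * INR (S k).
Proof. apply Rmult_lt_0_compat; [generalize PI_RGT_0; lra|apply SINR_pos]. Qed.

Lemma fint_term s k e A : 0 < e <= A ->
  cint (fun x => RtoC (fterm k x) * zker s x)%C e A (fcoef s k * Mint (vz s) (2 * PI * INR (S k) * e) (2 * PI * INR (S k) * A))%C.
Proof.
  intros He. set (c := 2 * PI * INR (S k)). assert (Hc : 0 < c) by apply two_pi_pos.
  assert (Hk := SINR_pos k). assert (Hp := PI_RGT_0).
  assert (Hd : PI ^ 2 * INR (S k) ^ 2 <> 0).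
  { apply Rgt_not_eq, Rmult_lt_0_compat; apply pow_lt; auto. }
  assert (I := Mint_correct (vz s) (c * e) (c * A)).
  assert (I2 := I ltac:(split; [apply Rmult_lt_0_compat; lra|apply Rmult_le_compat_l; lra])).
  apply cint_comp_scal in I2. apply (cint_scal (fcoef s k)) in I2.
  eapply cint_ext; [lra| |exact I2].
  intros x Hx. simpl. unfold mker, zker, fcoef, fterm, vz. fold c.
  replace (- (2 * ((s + 1) / 2)) - 1)%C with (- s - 2)%C by field.
  rewrite Rcpow_mult_base, RtoC_div by (auto; lra).
  replace (- s - 2)%C with (- (s + 1) + - (1))%C by ring.
  rewrite (Rcpow_plus c (- (s + 1)) (- (1))), !(Rcpow_opp c), (Rcpow_1 c) by auto.
  field. repeat split; try apply Rcpow_neq0; apply RtoC_neq0; auto. lra.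
Qed.

Definition fpart (s : C) (N : nat) (e A : R) : C := CInt (fun x => RtoC (fS N x) * zker s x)%C e A.

Lemma ccont_fS s N x : 0 < x -> ccont (fun x => RtoC (fS N x) * zker s x)%C x.
Proof.
  intros Hx. apply ccont_mult; [|apply ccont_Rcpow; auto].
  eapply cder_ccont, cder_RtoC. apply is_derive_rsum. intros; apply is_derive_fterm.
Qed.

Lemma fpart_correct s N e A : 0 < e <= A -> cint (fun x => RtoC (fS N x) * zker s x)%C e A (fpart s N e A).
Proof. intros. apply CInt_correct. lra. intros; apply ccont_fS; lra. Qed.

Lemma fpart_csum s N e A : 0 < e <= A ->
  fpart s N e A = csum (fun k => fcoef s k * Mint (vz s) (2 * PI * INR (S k) * e) (2 * PI * INR (S k) * A))%C N.
Proof.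
  intros He. apply cint_unique.
  eapply cint_ext; [lra| |apply (cint_csum (fun k x => RtoC (fterm k x) * zker s x)%C); intros; apply fint_term; auto].
  intros x _. unfold fS. rewrite RtoC_rsum, Cmult_comm, <- csum_scal. apply csum_ext. intros; ring.
Qed.

Lemma fpart_piece s j a b : 0 < a <= b -> INR j <= a -> b <= INR j + 1 ->
  Ccv (fun N => fpart s N a b) (CInt (fun x => RtoC (bump j x) * zker s x)%C a b).
Proof.
  intros Hab Ha Hb.
  assert (I0 : cint (fun x => RtoC (bump j x) * zker s x)%C a b (CInt (fun x => RtoC (bump j x) * zker s x)%C a b)).
  { apply CInt_correct. lra. intros; apply ccont_bump; lra. }
  (* A real power is monotone in its base, so the sum of its end values bounds it in between,
     whatever the sign of the exponent. *)
  set (W := pw a (fst (- s - 2)%C) + pw b (fst (- s - 2)%C)).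
  assert (HW0 : 0 < W) by (unfold W; generalize (pw_pos a (fst (- s - 2)%C)) (pw_pos b (fst (- s - 2)%C)); lra).
  assert (HW : forall t, a <= t <= b -> Cmod (zker s t) <= W).
  { intros t Ht. unfold zker. rewrite Cmod_Rcpow_pw. unfold W.
    assert (Pa := pw_pos a (fst (- s - 2)%C)). assert (Pb := pw_pos b (fst (- s - 2)%C)).
    assert (L1 : ln a <= ln t) by (apply ln_le; lra). assert (L2 : ln t <= ln b) by (apply ln_le; lra).
    destruct (Rle_dec 0 (fst (- s - 2)%C)).
    - assert (pw t (fst (- s - 2)%C) <= pw b (fst (- s - 2)%C)) by (apply exp_le; nra). lra.
    - assert (pw t (fst (- s - 2)%C) <= pw a (fst (- s - 2)%C)) by (apply exp_le; nra). lra. }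
  intros eps Heps.
  set (D := 2 * (W * (b - a)) + 1).
  assert (HD0 : 0 <= W * (b - a)) by (apply Rmult_le_pos; lra).
  destruct (fS_unif (eps / (2 * D))) as [N0 HN0]. { apply Rdiv_lt_0_compat; unfold D; lra. }
  exists N0. intros N HN.
  assert (I := cint_minus _ _ _ _ _ _ (fpart_correct s N a b Hab) I0).
  eapply Rle_lt_trans; [apply (cint_bound_const _ a b _ (eps / (2 * D) * W)) with (3 := I); [lra|]|].
  - intros t Ht. replace (RtoC (fS N t) * zker s t - RtoC (bump j t) * zker s t)%C with (RtoC (fS N t - bump j t) * zker s t)%C by (rewrite RtoC_minus; ring).
    rewrite Cmod_mult, Cmod_R. apply Rmult_le_compat; auto; try apply Rabs_pos; try apply Cmod_ge_0.
    apply (HN0 N j t HN). lra.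
  - replace (2 * (eps / (2 * D) * W * (b - a))) with (eps / (2 * D) * (2 * (W * (b - a)))) by ring.
    apply Rle_lt_trans with (eps / (2 * D) * D).
    apply Rmult_le_compat_l. left; apply Rdiv_lt_0_compat; unfold D; lra. unfold D; lra.
    replace (eps / (2 * D) * D) with (eps / 2) by (field; unfold D; lra). lra.
Qed.

Definition h0 (s : C) (e : R) : C := CInt (fun x => RtoC (bump 0 x) * zker s x)%C e 1.

Lemma fpart_lim s e k : 0 < e <= 1 -> Ccv (fun N => fpart s N e (INR k + 1)) (h0 s e + csum (fun i => hh s (S i)) k)%C.
Proof.
  intros He. induction k.
  - simpl csum. rewrite Cplus_0_r. replace (INR 0 + 1) with 1 by (simpl; ring). apply (fpart_piece s 0); simpl; lra.
  - cbn [csum]. rewrite Cplus_assoc.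
    assert (Hk := pos_INR k).
    apply Ccv_ext with (fun N => fpart s N e (INR k + 1) + fpart s N (INR (S k)) (INR (S k) + 1))%C.
    + intros N. symmetry. apply cint_unique. eapply cint_Chasles. apply fpart_correct; lra.
      rewrite <- (S_INR k). apply fpart_correct. rewrite S_INR; lra.
    + apply Ccv_plus; auto. apply (fpart_piece s (S k)); rewrite ?S_INR; lra.
Qed.

Lemma h0_eval (s : C) e : fst s < 0 -> 0 < e <= 1 ->
  h0 s e = (- / s * (1 - Rcpow e (- s)) - / (1 - s) * (1 - Rcpow e (1 - s)))%C.
Proof.
  intros Hs He.
  assert (Hs0 : s <> RtoC 0) by (intros E; rewrite E in Hs; simpl in Hs; lra).
  assert (Hs1 : (1 - s)%C <> RtoC 0) by (intros E; apply (f_equal fst) in E; simpl in E; lra).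
  set (G := fun x => (- / s * Rcpow x (- s) - / (1 - s) * Rcpow x (1 - s))%C).
  apply cint_unique. replace (- / s * (1 - Rcpow e (- s)) - / (1 - s) * (1 - Rcpow e (1 - s)))%C with (G 1 - G e)%C.
  2:{ unfold G. rewrite !Rcpow_one. ring. }
  apply cint_FTC. lra.
  - intros t Ht. assert (Ht0 : 0 < t) by lra.
    assert (D := cder_minus _ _ t _ _ (cder_scal (- / s)%C _ t _ (cder_Rcpow (- s) t Ht0)) (cder_scal (/ (1 - s))%C _ t _ (cder_Rcpow (1 - s) t Ht0))).
    cbv beta in D. match type of D with cder _ _ ?l => replace (RtoC (bump 0 t) * zker s t)%C with l; [exact D|] end.
    unfold zker, bump. simpl (INR 0). replace ((t - 0) * (0 + 1 - t)) with (t - t * t) by ring.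
    replace (- s - 1)%C with (RtoC 1 + (- s - 2))%C by ring. replace (1 - s - 1)%C with (RtoC 1 + (RtoC 1 + (- s - 2)))%C by ring.
    rewrite !Rcpow_plus, Rcpow_1, RtoC_minus, RtoC_mult by auto. field. auto.
  - intros t Ht. apply ccont_bump; lra.
Qed.

(** The integral over [(0, 1)] converges because [Re s < 0]. Multiplied by [s (s + 1) / 2], its
    value becomes [1 / (s - 1) + 1/2], precisely the elementary part of [Zf]. *)
Lemma h0_lim (s : C) : fst s < 0 -> Ccv (fun k => h0 s (1 / (INR k + 1))) (- / s - / (1 - s))%C.
Proof.
  intros Hs.
  apply Ccv_ext with (fun k => - / s * (1 - Rcpow (INR (S k)) s) - / (1 - s) * (1 - Rcpow (INR (S k)) (s - 1)))%C.
  - intros k. destruct (seq_point 1 k ltac:(lra)) as [_ [_ P]]. rewrite h0_eval by auto.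
    rewrite <- S_INR. assert (Hk := SINR_pos k). unfold Rdiv. rewrite Rmult_1_l, !Rcpow_inv_base by auto.
    rewrite <- !Rcpow_opp. do 2 f_equal. do 2 f_equal. f_equal. ring. do 3 f_equal. ring.
  - apply Ccv_eq with (- / s * (1 - 0) - / (1 - s) * (1 - 0))%C; [ring|].
    apply Ccv_minus; apply Ccv_scal; apply Ccv_minus; try apply Ccv_const; apply Ccv_Rcpow_neg; simpl; lra.
Qed.

Lemma fcoef_eq (s : C) k : fcoef s k = (Rcpow 2 (s + 1) * Rcpow PI (s - 1) * Rcpow (INR (S k)) (- (1 - s)))%C.
Proof.
  unfold fcoef. assert (Hk := SINR_pos k). assert (Hp := PI_RGT_0).
  rewrite !Rcpow_mult_base by (auto; try lra; apply Rmult_lt_0_compat; lra).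
  replace (- (1 - s))%C with ((s + 1) + - RtoC (INR 2))%C by (simpl (INR 2); replace (1 + 1) with 2 by ring; ring).
  replace (s - 1)%C with ((s + 1) + - RtoC (INR 2))%C by (simpl (INR 2); replace (1 + 1) with 2 by ring; ring).
  rewrite (Rcpow_plus PI (s + 1) (- RtoC (INR 2))), (Rcpow_plus (INR (S k)) (s + 1) (- RtoC (INR 2))), !Rcpow_opp, !Rcpow_INR by auto. rewrite RtoC_mult. field.
  split; apply RtoC_neq0, pow_nonzero; lra.
Qed.

(** In this strip [Zf] is [s (s + 1) / 2] times the integral over the whole half-line of the
    periodic extension of [u (1 - u)] against [x^(- s - 2)]. Expanding in the Fourier series and
    rescaling each term gives [Mv] times a Dirichlet series at [1 - s]. *)
Lemma Zf_Mellin (s : C) : -1 < fst s < 0 ->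
  Zf s = (s * (s + 1) / 2 * (Rcpow 2 (s + 1) * Rcpow PI (s - 1) * Mv (vz s) * zD (1 - s)))%C.
Proof.
  intros Hs.
  assert (Hv : 0 < fst (vz s) < 1).
  { unfold vz. replace ((s + 1) / 2)%C with (RtoC (/ 2) * (s + 1))%C by (rewrite RtoC_inv by lra; field). simpl. lra. }
  assert (Hs0 : s <> RtoC 0) by (intros E; rewrite E in Hs; simpl in Hs; lra).
  assert (Hs1 : (1 - s)%C <> RtoC 0) by (intros E; apply (f_equal fst) in E; simpl in E; lra).
  assert (Hs2 : (s - 1)%C <> RtoC 0) by (intros E; apply (f_equal fst) in E; simpl in E; lra).
  destruct (Mint_bounded (vz s) Hv) as [B HB].
  set (u := fun k j : nat => (fcoef s j * Mint (vz s) (2 * PI * INR (S j) * (1 / (INR k + 1))) (2 * PI * INR (S j) * (INR k + 1)))%C).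
  set (v := fun j => (fcoef s j * Mv (vz s))%C).
  set (Q := Cmod (Rcpow 2 (s + 1) * Rcpow PI (s - 1))%C).
  assert (HQ : 0 <= Q) by apply Cmod_ge_0.
  assert (HB0 : 0 <= B) by (eapply Rle_trans; [apply Cmod_ge_0|apply (HB 1 1); lra]).
  assert (Hfc : forall j, Cmod (fcoef s j) = Q * pw (INR (S j)) (- (1 - fst s))).
  { intros j. rewrite fcoef_eq, Cmod_mult, Cmod_zterm. fold Q. f_equal. }
  assert (Hsum : summable (fun j => Q * B * pw (INR (S j)) (- (1 - fst s)))).
  { apply summable_scal. apply Rmult_le_pos; auto. apply summable_zeta. lra. }
  (* First evaluation, with cut-offs [1 / (k + 1)] and [k + 1] in [x]: the cut-offs are removed term
     by term, dominated through the uniform bound on [Mint]. *)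
  assert (L1 : Ccv (fun k => Cser (u k)) (Cser v)).
  { apply tannery with (2 := Hsum).
    - exists O. intros k j _. unfold u. rewrite Cmod_mult, Hfc.
      replace (Q * B * pw (INR (S j)) (- (1 - fst s))) with (Q * pw (INR (S j)) (- (1 - fst s)) * B) by ring.
      apply Rmult_le_compat_l. apply Rmult_le_pos; auto. left; apply pw_pos.
      apply HB. assert (Hc := two_pi_pos j). destruct (seq_point 1 k ltac:(lra)) as [_ [_ P]]. assert (Hk := pos_INR k).
      split. apply Rmult_lt_0_compat; lra. apply Rmult_le_compat_l; lra.
    - intros j. unfold u, v. apply Ccv_scal.
      eapply Ccv_ext; [|apply (Mint_lim (vz s) (2 * PI * INR (S j)) Hv (two_pi_pos j))].
      intros k. simpl. f_equal. field. generalize (pos_INR k); lra. }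
  (* Second evaluation: at fixed cut-offs the Fourier series is summed first, which restores the
     bumps over [[1 / (k + 1), 1]] and the next [k] unit intervals. *)
  assert (E1 : forall k, Cser (u k) = (h0 s (1 / (INR k + 1)) + csum (fun i => hh s (S i)) k)%C).
  { intros k. apply Cser_unique. destruct (seq_point 1 k ltac:(lra)) as [_ [_ P]]. assert (Hk := pos_INR k).
    eapply Ccv_ext; [|apply (fpart_lim s (1 / (INR k + 1)) k P)].
    intros N. simpl. rewrite fpart_csum by lra. auto. }
  assert (L2 : Ccv (fun k => Cser (u k)) ((- / s - / (1 - s)) + Jz s)%C).
  { eapply Ccv_ext; [intros k; symmetry; apply E1|]. apply Ccv_plus. apply h0_lim; lra. apply Jz_cv; lra. }
  assert (E2 := Ccv_unique _ _ _ L1 L2).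
  assert (E3 : Cser v = (Rcpow 2 (s + 1) * Rcpow PI (s - 1) * Mv (vz s) * zD (1 - s))%C).
  { unfold zD. rewrite <- (Cser_scal _ _ (fun j => pw (INR (S j)) (- (1 - fst s)))).
    - apply Cser_ext. intros j. unfold v. rewrite fcoef_eq. ring.
    - intros j. rewrite Cmod_zterm. simpl. right. f_equal.
    - apply summable_zeta. lra. }
  rewrite <- E3, E2. unfold Zf. field. repeat split; auto.
Qed.

(** The right side of the functional equation; the convergent series at [1 - s] makes it holomorphic
    for all [Re s < 0]. *)
Definition ZL (s : C) : C :=
  (Rcpow PI (s - 1) * RGam (s / 2) / (RGam (RtoC (/ 2)) * RGam ((1 - s) / 2)) * zD (1 - s))%C.

Lemma half_fst (s : C) : fst (s / 2)%C = fst s / 2.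
Proof. replace (s / 2)%C with (RtoC (/ 2) * s)%C by (rewrite RtoC_inv by lra; field). simpl. field. Qed.

Lemma Zf_ZL (s : C) : -1 < fst s < 0 -> Zf s = ZL s.
Proof.
  intros Hs. rewrite Zf_Mellin by auto. unfold Mv, ZL, vz.
  assert (N1 : RGam (RtoC (/2)) <> RtoC 0) by (apply RGam_neq0, nonpole_pos; simpl; lra).
  assert (N2 : RGam ((1 - s) / 2) <> RtoC 0) by (apply RGam_neq0, nonpole_pos; rewrite half_fst; simpl; lra).
  assert (Hs1 : (s + 1)%C <> RtoC 0) by (intros E; apply (f_equal fst) in E; simpl in E; lra).
  replace ((s + 1) / 2 + RtoC (/ 2))%C with (s / 2 + 1)%C by (rewrite RtoC_inv by lra; field).
  replace (1 - (s + 1) / 2)%C with ((1 - s) / 2)%C by field.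
  rewrite (RGam_rec (s / 2)).
  replace (- (2 * ((s + 1) / 2)))%C with (- (s + 1))%C by field. rewrite Rcpow_opp.
  field. repeat split; auto. apply Rcpow_neq0.
Qed.

Lemma Hol_ZL (s : C) : fst s < 0 -> Hol ZL s.
Proof.
  intros Hs. unfold ZL. apply Hol_mult. apply Hol_div.
  - apply Cmult_neq_0; apply RGam_neq0, nonpole_pos; rewrite ?half_fst; simpl; lra.
  - apply Hol_mult. apply Hol_Rcpow. apply Hol_minus; [apply Hol_id|apply Hol_const].
    apply Hol_ext_loc with (fun z => RGam (/ 2 * z + 0)%C). exists 1; split; [lra|]. intros; f_equal; field.
    apply Hol_comp_aff. intros E. apply (f_equal (fun z => (2 * z)%C)) in E. rewrite Cinv_r, Cmult_0_r in E by apply C2_neq0. apply C1_nz; auto. apply Hol_RGam.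
  - apply Hol_mult. apply Hol_const.
    apply Hol_ext_loc with (fun z => RGam (- / 2 * z + / 2)%C). exists 1; split; [lra|]. intros; f_equal; field.
    apply Hol_comp_aff. intros E. apply (f_equal (fun z => (- (2) * z)%C)) in E. replace (- (2) * - / 2)%C with (RtoC 1) in E by field. rewrite Cmult_0_r in E. apply C1_nz; auto. apply Hol_RGam.
  - apply Hol_ext_loc with (fun z => zD (- (1) * z + 1)%C). exists 1; split; [lra|]. intros; f_equal; ring.
    apply Hol_comp_aff. intros E. apply (f_equal fst) in E. simpl in E. lra. apply Hol_zD. simpl; lra.
Qed.

(** The two formulas agree on the overlap [-1 < Re s < 0], so each point other than 1 has a
    neighbourhood on which a single holomorphic formula applies. *)
Definition zfun (s : C) : C := if Rlt_dec (fst s) 0 then ZL s else Zf s.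

Lemma zfun_right s : -1 < fst s -> zfun s = Zf s.
Proof. intros H. unfold zfun. destruct (Rlt_dec (fst s) 0); auto. symmetry; apply Zf_ZL; auto. Qed.

Lemma zfun_left s : fst s < 0 -> zfun s = ZL s.
Proof. intros H. unfold zfun. destruct (Rlt_dec (fst s) 0); auto. lra. Qed.

Lemma Hol_zfun s : s <> RtoC 1 -> Hol zfun s.
Proof.
  intros Hs. destruct (Rlt_dec (fst s) 0).
  - apply Hol_ext_loc with ZL; [|apply Hol_ZL; auto]. exists (- fst s). split; [lra|]. intros z Hz.
    symmetry; apply zfun_left. assert (H := Cmod_fst (z - s)%C). simpl in H. assert (H2 := Rle_abs (fst z + - fst s)). lra.
  - apply Hol_ext_loc with Zf; [|apply Hol_Zf; auto; lra]. exists 1. split; [lra|]. intros z Hz.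
    symmetry; apply zfun_right. assert (H := Cmod_fst (z - s)%C). simpl in H.
    assert (H2 := Rle_abs (- (fst z + - fst s))). rewrite Rabs_Ropp in H2. lra.
Qed.

Lemma zfun_is_zeta : is_riemann_zeta zfun.
Proof.
  split.
  - intros s Hs. apply Hol_analytic, Hol_zfun; auto.
  - intros s Hs. unfold Re in Hs. rewrite zfun_right, Zf_zD by lra. apply is_series_Ccv. apply zD_cv; auto.
Qed.

Lemma zeta_spec : is_riemann_zeta zeta.
Proof. unfold zeta. apply epsilon_spec. exists zfun. apply zfun_is_zeta. Qed.

Lemma zeta_right (s : C) : 1 < fst s -> zeta s = zD s.
Proof.
  intros Hs. destruct zeta_spec as [_ H]. specialize (H s Hs). apply is_series_Ccv in H.
  symmetry. apply Cser_unique. exact H.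
Qed.

Lemma zeta_zfun (q : C) : q <> RtoC 1 -> zeta q = zfun q.
Proof.
  intros Hq. destruct (Rlt_dec 1 (fst q)) as [h|h].
  { rewrite zeta_right, zfun_right, Zf_zD by lra. auto. }
  apply Ceq_minus.
  (* The segment from [(2, y)] to [q] must avoid the pole 1. For non-real [q] it is horizontal off
     the real axis; for real [q] it comes from height 1 and meets the axis only at [q]. *)
  set (y := if Req_EM_T (snd q) 0 then 1 else snd q).
  set (p := (2, y) : C).
  assert (Hpq : p <> q) by (intros E; apply (f_equal fst) in E; unfold p in E; simpl in E; lra).
  apply (Hol_zero_segment (fun s => zeta s - zfun s)%C p q Hpq).
  - intros t Ht. set (w := (p + RtoC t * (q - p))%C).
    assert (Hw : w <> RtoC 1).
    { intros E. assert (E1 := f_equal snd E). assert (E2 := f_equal fst E). unfold w, p, y in E1, E2. simpl in E1, E2.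
      destruct (Req_EM_T (snd q) 0) as [e|e].
      - rewrite e in E1. assert (t = 1) by lra. subst t. apply Hq. destruct q as [a b]; simpl in *. unfold RtoC. f_equal; lra.
      - apply e. lra. }
    apply Hol_minus; [|apply Hol_zfun; auto]. apply analytic_Hol. apply (proj1 zeta_spec); auto.
  - exists 1. split; [lra|]. intros z Hz.
    assert (Hz1 : 1 < fst z).
    { assert (H := Cmod_fst (z - p)%C). unfold p in H. simpl in H. assert (H2 := Rle_abs (- (fst z + - (2)))).
      rewrite Rabs_Ropp in H2. fold p in H. lra. }
    rewrite zeta_right, zfun_right, Zf_zD by lra. ring.
Qed.

Lemma zeta_left (s : C) : fst s < 0 -> zeta s = ZL s.
Proof.
  intros Hs. rewrite zeta_zfun. apply zfun_left; auto. intros E. rewrite E in Hs. simpl in Hs; lra.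
Qed.

(** * The function xi *)

(** [C_lim] unfolds to limits of both components along the fixed sequence of points
    [z + 1 / (k + 1)]. *)
Lemma C_lim_seq f z l : Ccv (fun k => f (fst z + / (INR k + 1), snd z)) l -> C_lim f z = l.
Proof.
  intros H. unfold C_lim, Lim, Rbar_loc_seq.
  rewrite (is_lim_seq_unique _ _ (Ccv_fst _ _ H)), (is_lim_seq_unique _ _ (Ccv_snd _ _ H)).
  destruct l; auto.
Qed.

Lemma Ccv_loc (z : C) : Ccv (fun k => (fst z + / (INR k + 1), snd z)) z.
Proof.
  apply Ccv_pair; simpl; [|apply is_lim_seq_const].
  assert (L : is_lim_seq (fun k => / (INR k + 1)) 0).
  { eapply is_lim_seq_ext; [|apply (lim_seq_point 1)]. intros; simpl. unfold Rdiv; ring. }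
  assert (L2 := is_lim_seq_plus' _ _ _ _ (is_lim_seq_const (fst z)) L). rewrite Rplus_0_r in L2. auto.
Qed.

Definition XR (s : C) : C := (/ 2 * Rcpow PI (- s / 2) * s * (s - 1) / RGam (s / 2) * zD s)%C.

Lemma Hol_XR (s : C) : 1 < fst s -> Hol XR s.
Proof.
  intros Hs. unfold XR. apply Hol_mult; [|apply Hol_zD; auto]. apply Hol_div.
  - apply RGam_neq0, nonpole_pos. rewrite half_fst; lra.
  - apply Hol_mult. apply Hol_mult. apply Hol_mult. apply Hol_const.
    + apply Hol_Rcpow. apply Hol_mult; [|apply Hol_const]. apply Hol_opp, Hol_id.
    + apply Hol_id.
    + apply Hol_minus; [apply Hol_id|apply Hol_const].
  - apply Hol_ext_loc with (fun z => RGam (/ 2 * z + 0)%C). exists 1; split; [lra|]. intros; f_equal; field.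
    apply Hol_comp_aff. intros E. apply (f_equal (fun z => (2 * z)%C)) in E. rewrite Cinv_r, Cmult_0_r in E by apply C2_neq0. apply C1_nz; auto.
    apply Hol_RGam.
Qed.

Lemma xi_formula_right (s : C) : 1 < fst s -> xi_formula s = XR s.
Proof.
  intros Hs. unfold xi_formula, XR. rewrite Gamma_RGam, zeta_right by (auto; apply nonpole_pos; rewrite half_fst; lra).
  unfold Cdiv. ring.
Qed.

Lemma loc_pos k : 0 < / (INR k + 1).
Proof. apply Rinv_0_lt_compat. generalize (pos_INR k); lra. Qed.

Lemma xi_right (s : C) : 1 < fst s -> xi s = XR s.
Proof.
  intros Hs. apply C_lim_seq. apply Ccv_ext with (fun k => XR (fst s + / (INR k + 1), snd s)).
  - intros k. symmetry. apply xi_formula_right. simpl. generalize (loc_pos k); lra.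
  - apply Hol_continuous. apply Hol_XR; auto. apply Ccv_loc.
Qed.

(** The constant in the functional equation of [xi]. It enters [n] at both arguments alike and
    cancels in their quotient. *)
Definition kxi : C := (Rcpow PI (- / 2) / RGam (RtoC (/ 2)))%C.

Lemma kxi_neq0 : kxi <> RtoC 0.
Proof.
  unfold kxi. assert (N1 : RGam (RtoC (/2)) <> RtoC 0) by (apply RGam_neq0, nonpole_pos; simpl; lra).
  apply Cmult_neq_0. apply Rcpow_neq0. intros E. apply C1_nz. rewrite <- (Cinv_r _ N1), E. ring.
Qed.

(** The factor [RGam (s / 2)] of [ZL] cancels [Gamma (s / 2)], the powers of [PI] combine, and
    [s (s - 1)] is invariant under [s] to [1 - s]. *)
Lemma xi_formula_left (s : C) : fst s < 0 -> nonpole (s / 2) -> xi_formula s = (kxi * XR (1 - s))%C.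
Proof.
  intros Hs Hn. unfold xi_formula, XR, kxi. rewrite Gamma_RGam, zeta_left by auto. unfold ZL.
  assert (N1 : RGam (RtoC (/2)) <> RtoC 0) by (apply RGam_neq0, nonpole_pos; simpl; lra).
  assert (N2 : RGam (s / 2) <> RtoC 0) by (apply RGam_neq0; auto).
  assert (N3 : RGam ((1 - s) / 2) <> RtoC 0) by (apply RGam_neq0, nonpole_pos; rewrite half_fst; simpl; lra).
  assert (E : (Rcpow PI (- s / 2) * Rcpow PI (s - 1) = Rcpow PI (- / 2) * Rcpow PI (- (1 - s) / 2))%C).
  { rewrite <- !Rcpow_plus. f_equal. field. }
  transitivity (/ 2 * (Rcpow PI (- s / 2) * Rcpow PI (s - 1)) * s * (s - 1) / (RGam (RtoC (/ 2)) * RGam ((1 - s) / 2)) * zD (1 - s))%C.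
  - field. repeat split; auto.
  - rewrite E. field. repeat split; auto.
Qed.

(* The points at which [C_lim] evaluates [xi_formula] eventually avoid the poles of Gamma. *)
Lemma loc_nonpole (s : C) : exists N, forall k, (N <= k)%nat -> nonpole (((fst s + / (INR k + 1))%R, snd s) / 2)%C.
Proof.
  set (a := fst s / 2).
  (* Half the real part of the sampled point exceeds [a] by [1 / (2 (k + 1))], so for large [k] it
     lies strictly between the consecutive integers [up a - 1] and [up a] and is never a pole. *)
  destruct (archimed a) as [A1 A2].
  destruct (nfloor_ex (/ (IZR (up a) - a))) as [N [_ HN]].
  { left; apply Rinv_0_lt_compat; lra. }
  exists N. intros k Hk j E. apply (f_equal fst) in E.
  assert (E2 : a + / (INR k + 1) / 2 + INR j = 0).
  { change (fst (((fst s + / (INR k + 1))%R, snd s) / 2)%C + INR j = 0) in E. rewrite half_fst in E. cbn [fst] in E.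
    unfold a. lra. }
  assert (Hp := loc_pos k).
  assert (Hq : / (INR k + 1) < IZR (up a) - a).
  { apply le_INR in Hk. assert (Hd : 0 < IZR (up a) - a) by lra.
    rewrite <- (Rinv_inv (IZR (up a) - a)). apply Rinv_lt_contravar; [|lra].
    apply Rmult_lt_0_compat. apply Rinv_0_lt_compat; lra. generalize (pos_INR k); lra. }
  assert (E3 : IZR (- Z.of_nat j) = a + / (INR k + 1) / 2) by (rewrite opp_IZR, <- INR_IZR_INZ; lra).
  assert (B1 : IZR (up a - 1) < IZR (- Z.of_nat j)) by (rewrite E3, minus_IZR; lra).
  assert (B2 : IZR (- Z.of_nat j) < IZR (up a)) by (rewrite E3; lra).
  apply lt_IZR in B1. apply lt_IZR in B2. lia.
Qed.

Lemma xi_left (s : C) : fst s < 0 -> xi s = (kxi * XR (1 - s))%C.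
Proof.
  intros Hs. apply C_lim_seq.
  destruct (loc_nonpole s) as [N1 HN1].
  assert (Hneg : exists N, forall k, (N <= k)%nat -> fst s + / (INR k + 1) < 0).
  { assert (L := Ccv_fst _ _ (Ccv_loc s)). simpl in L. apply is_lim_seq_spec in L.
    destruct (L (mkposreal (- fst s) ltac:(lra))) as [N HN]. simpl in HN. exists N. intros k Hk. specialize (HN k Hk).
    apply Rabs_def2 in HN. lra. }
  destruct Hneg as [N2 HN2].
  apply Ccv_ext_loc with (fun k => kxi * XR (1 - ((fst s + / (INR k + 1))%R, snd s)))%C.
  - exists (max N1 N2). intros k Hk. symmetry. apply xi_formula_left. simpl. apply HN2; lia. apply HN1; lia.
  - apply Ccv_scal. apply Hol_continuous. apply Hol_XR. simpl; lra. apply Ccv_minus. apply Ccv_const. apply Ccv_loc.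
Qed.

Lemma half_shift_fst (s : C) : fst (/ 2 + s)%C = / 2 + fst s.
Proof. replace (/ 2)%C with (RtoC (/ 2)) by (rewrite RtoC_inv by lra; auto). simpl. auto. Qed.

Lemma n_right (s : C) : / 2 < fst s -> n s = (Csin (RtoC PI * s / 4) * (2 * XR (/ 2 + s)))%C.
Proof. intros Hs. unfold n. rewrite xi_right; auto. rewrite half_shift_fst; lra. Qed.

Lemma Csin_opp z : Csin (- z) = (- Csin z)%C.
Proof.
  unfold Csin. replace (Ci * - z)%C with (- (Ci * z))%C by ring. replace (- - (Ci * z))%C with (Ci * z)%C by ring.
  field. split; [apply Ci_nz|apply C2_neq0] || apply Ci_nz.
Qed.

Lemma n_left (s : C) : fst s < - / 2 -> n s = (- kxi * n (- s))%C.
Proof.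
  intros Hs. rewrite (n_right (- s)%C) by (simpl; lra). unfold n. rewrite xi_left by (rewrite half_shift_fst; lra).
  replace (RtoC PI * - s / 4)%C with (- (RtoC PI * s / 4))%C by (unfold Cdiv; ring). rewrite Csin_opp.
  replace (1 - (/ 2 + s))%C with (/ 2 + - s)%C by field. ring.
Qed.

(** * Positive definiteness of the reciprocal of n *)

Lemma PD_comp_scal r f : PD f -> PD (fun t => f (r * t)).
Proof.
  intros H l e He _. destruct (H (map (fun t => r * t) l) e He) as [g [Hg H1]]; auto.
  exists (fun t => g (r * t)). split.
  - clear H1. induction Hg.
    + apply Trig_0.
    + eapply Trig_ext; [|apply (Trig_exp w (lam * r)); auto]. intros t; simpl. do 4 f_equal. ring.
    + apply Trig_plus; auto.
    + eapply Trig_ext; [|apply IHHg]. intros; simpl; auto.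
  - intros x Hx. apply H1. apply in_map_iff; eauto.
Qed.

Lemma PD_cprod (f : nat -> R -> C) k : (forall j, (j < k)%nat -> PD (f j)) -> PD (fun t => cprod (fun j => f j t) k).
Proof.
  induction k; intros H; simpl. apply (PD_const 1); lra. apply PD_mult; [apply IHk; intros|]; apply H; lia.
Qed.

Lemma PD_shift_ratio (a b sg : R) : 0 <= b -> 0 < a ->
  PD (fun t => ((RtoC b + (a, (sg * t)%R)) / (a, (sg * t)%R))%C).
Proof.
  intros Hb Ha. eapply PD_ext; [|apply (PD_plus _ _ (PD_const 1 ltac:(lra)) (PD_scal b _ Hb (PD_comp_scal sg _ (PD_inv_line a Ha))))].
  intros t; simpl. field. apply line_neq0; auto.
Qed.

(** In Gauss's form the quotient is a positive power of [k] times factors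
    [(w + j + b) / (w + j) = 1 + b / (w + j)], each positive definite as [b >= 0] and the abscissa
    is positive. *)
Lemma PD_Gamma_ratio (a b r : R) : 0 <= b -> 0 < a -> PD (fun t => (RGam ((a, (r * t)%R) + RtoC b) / RGam (a, (r * t)%R))%C).
Proof.
  intros Hb Ha.
  assert (Hnp : forall t, nonpole (a, r * t)) by (intros; apply nonpole_pos; simpl; auto).
  apply (PD_lim (fun k t => RG (S k) ((a, (r * t)%R) + RtoC b) / RG (S k) (a, (r * t)%R))%C).
  - exists O. intros k _.
    assert (HR : forall j, PD (fun t => rising ((a, (r * t)%R) + RtoC b) j / rising (a, (r * t)%R) j)%C).
    { induction j.
      - eapply PD_ext; [|apply (PD_shift_ratio a b r Hb Ha)]. intros t; simpl. f_equal. apply Cplus_comm.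
      - eapply PD_ext; [|apply (PD_mult _ _ IHj (PD_shift_ratio (a + INR (S j)) b r Hb ltac:(generalize (pos_INR (S j)); lra)))].
        intros t. cbv beta. cbn [rising].
        assert (E : ((a + INR (S j), r * t) : C) = ((a, (r * t)%R) + RtoC (INR (S j)))%C).
        { unfold Cplus, RtoC; cbn [fst snd]. f_equal; ring. }
        rewrite E.
        assert (N1 : rising (a, (r * t)%R) j <> RtoC 0).
        { clear -Hnp. induction j; cbn [rising]. intros E. apply (Hnp t O). rewrite E. simpl; ring. apply Cmult_neq_0; auto. apply (Hnp t (S j)). }
        assert (N2 := Hnp t (S j)). field. split; auto. }
    assert (Hk := SINR_pos k).
    eapply PD_ext; [|apply (PD_scal (exp (- b * ln (INR (S k)))) _ ltac:(left; apply exp_pos) (HR (S k)))].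
    intros t. cbv beta. unfold RG. rewrite (Rcpow_plus _ (a, (r * t)%R)), Rcpow_RtoC.
    replace (- b * ln (INR (S k))) with (- (b * ln (INR (S k)))) by ring. rewrite exp_Ropp.
    assert (He := exp_pos (b * ln (INR (S k)))). rewrite RtoC_inv by lra.
    assert (N1 : rising (a, (r * t)%R) (S k) <> RtoC 0).
    { clear -Hnp. induction (S k); cbn [rising]. intros E. apply (Hnp t O). rewrite E. simpl; ring. apply Cmult_neq_0; auto. apply (Hnp t (S n)). }
    field. repeat split; auto; try apply Rcpow_neq0; try apply fact_neq0. apply RtoC_neq0; lra.
  - intros t. apply Ccv_div. apply RGam_neq0; auto.
    apply (Ccv_subseq S (fun k => RG k ((a, (r * t)%R) + RtoC b))); auto; apply RG_cv.
    apply (Ccv_subseq S (fun k => RG k (a, (r * t)%R))); auto; apply RG_cv.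
Qed.

(** The constant is a sign; like any nonzero constant it drops out of [n x / n (x + i t)]. *)
Lemma Csin_shift K : exists e : C, e <> RtoC 0 /\ forall z, Csin (z + RtoC PI * RtoC (INR K)) = (e * Csin z)%C.
Proof.
  assert (HP : forall z, Csin (z + RtoC PI) = (- (1) * Csin z)%C).
  { intros z. unfold Csin. assert (E : Cexp (Ci * RtoC PI) = (- (1))%C).
    { rewrite Cexp_Ci, cos_PI, sin_PI. unfold Copp, RtoC; simpl. f_equal; ring. }
    replace (Ci * (z + RtoC PI))%C with (Ci * z + Ci * RtoC PI)%C by ring.
    replace (- (Ci * z + Ci * RtoC PI))%C with (- (Ci * z) + - (Ci * RtoC PI))%C by ring.
    rewrite !Cexp_plus, (Cexp_opp (Ci * RtoC PI)), E. field. repeat split; try apply Ci_nz; try apply C2_neq0; apply C1_nz. }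
  induction K.
  - exists 1. split. apply C1_nz. intros z. simpl. rewrite Cmult_0_r, Cplus_0_r. ring.
  - destruct IHK as [e [He H]]. exists (- (1) * e)%C. split.
    + apply Cmult_neq_0; auto. intros E. apply C1_nz. replace (RtoC 1) with (- - (1))%C by ring.
      replace (- (1))%C with (RtoC 0) by (rewrite <- E; ring). ring.
    + intros z. rewrite S_INR, RtoC_plus.
      replace (z + RtoC PI * (RtoC (INR K) + 1))%C with ((z + RtoC PI * RtoC (INR K)) + RtoC PI)%C by ring.
      rewrite HP, H. ring.
Qed.

Lemma RGam_down p z : RGam (z - RtoC (INR (S p))) = (cprod (fun j => z - RtoC (INR (S (S j)))) p * ((z - 1) * RGam z))%C.
Proof.
  induction p.
  - cbn [INR cprod]. rewrite RGam_rec. replace (z - 1 + 1)%C with z by ring. ring.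
  - rewrite RGam_rec. replace (z - RtoC (INR (S (S p))) + 1)%C with (z - RtoC (INR (S p)))%C by (rewrite (S_INR (S p)), RtoC_plus; ring).
    rewrite IHp. cbn [cprod]. ring.
Qed.

(** Expresses [RGam (1/2)], which enters through [Mv], by the duplication constant, so that [kap]
    cancels in [inv_n_PD]. *)
Lemma RGam_half kap : 0 < kap -> (forall z, (RGam z * RGam (z + RtoC (/2)) = RtoC kap * Rcpow 2 (2 * z) * RGam (2 * z))%C) ->
  RGam (RtoC (/ 2)) = (2 * RtoC kap)%C.
Proof.
  intros Hk H. assert (E := H (RtoC (/ 2))).
  assert (E1 : (RtoC (/ 2) + RtoC (/ 2) = 1)%C) by (rewrite <- RtoC_plus; f_equal; field).
  assert (E2 : (2 * RtoC (/ 2) = 1)%C) by (rewrite <- RtoC_mult; f_equal; field).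
  rewrite E1, E2, Rcpow_1 in E by lra.
  assert (N : RGam 1 <> RtoC 0) by (apply RGam_neq0, nonpole_pos; simpl; lra).
  replace (RGam (RtoC (/ 2))) with (RGam (RtoC (/ 2)) * RGam 1 / RGam 1)%C by (field; auto). rewrite E. field. auto.
Qed.

Lemma cprod_inv (a : nat -> C) k : (forall j, (j < k)%nat -> a j <> RtoC 0) -> cprod (fun j => / a j)%C k = (/ cprod a k)%C.
Proof.
  induction k; intros H; simpl. field. rewrite IHk by (intros; apply H; lia). field.
  split; [|apply cprod_neq0; intros]; apply H; lia.
Qed.

(** The factor [1 / (s - 1/2)] is left outside [psi]: both [psi] and the product with it are
    positive definite, and this gap later yields strictness. Nonvanishing of [n] on the line is
    recorded for the finiteness of [m]. *)
Lemma inv_n_PD (x : R) (p : nat) : 4 * INR (S p) < x < 4 * INR (S p) + 4 ->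
  exists (e : C) (psi : R -> C), e <> RtoC 0 /\ PD psi /\
    forall t, n (x, t) <> RtoC 0 /\ (/ n (x, t) = e * (psi t * / ((x - / 2)%R, t)))%C.
Proof.
  intros Hx. assert (Hp := pos_INR p). assert (HpS := S_INR p).
  destruct (Csin_shift (S p)) as [e [He Hsin]].
  destruct RGam_dup as [kap [Hkap Hdup]].
  assert (Hhalf := RGam_half kap Hkap Hdup).
  set (z := fun t : R => (((x / 2)%R, (/ 2 * t)%R) : C)).
  set (v := fun t : R => (((x / 4 - INR (S p))%R, (/ 4 * t)%R) : C)).
  (* The argument of zeta is written [5/2 + (s - 2)] to fit [PD_inv_zeta]; the factor [s - 2] it
     needs is twice the factor [s / 2 - 1] released by the shift of [Gamma (s / 2)], so the
     remaining product starts at [j = 2]. *)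
  set (psi := fun t : R => (RtoC (2 / PI) * Rcpow PI (((x / 2 + / 4)%R, (/ 2 * t)%R) : C) *
     (/ ((x / 2 + / 4)%R, (/ 2 * t)%R)) * (/ (((x - 2)%R, t) * zD (RtoC (5 / 2) + ((x - 2)%R, t)))) * Mv (v t) * (RGam (z t + RtoC (/ 4)) / RGam (z t)) *
     cprod (fun j => / ((x / 2 - INR (S (S j)))%R, (/ 2 * t)%R)) (2 * p))%C).
  exists (/ e)%C, psi. split; [|split].
  - intros E. apply C1_nz. rewrite <- (Cinv_r _ He), E. ring.
  - unfold psi. apply PD_mult; [apply PD_mult; [apply PD_mult; [apply PD_mult; [apply PD_mult; [apply PD_mult|]|]|]|]|].
    + apply PD_const. apply Rmult_le_pos; [lra|left; apply Rinv_0_lt_compat, PI_RGT_0].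
    + apply PD_Rcpow_line, PI_RGT_0.
    + apply (PD_comp_scal (/ 2) (fun t => / ((x / 2 + / 4)%R, t))%C). apply PD_inv_line. lra.
    + apply PD_inv_zeta. lra.
    + apply PD_Mv. lra.
    + apply PD_Gamma_ratio; lra.
    + apply (PD_cprod (fun j t => / ((x / 2 - INR (S (S j)))%R, (/ 2 * t)%R))%C). intros j Hj.
      apply (PD_comp_scal (/ 2) (fun t => / ((x / 2 - INR (S (S j)))%R, t))%C). apply PD_inv_line.
      assert (INR (S (S j)) <= INR (2 * p + 1)) by (apply le_INR; lia).
      rewrite plus_INR, mult_INR in H. simpl (INR 2) in H. simpl (INR 1) in H. lra.
  - intros t. set (s := (x, t) : C).
    assert (R2 : (RtoC (/ 2) = / 2)%C) by (rewrite RtoC_inv by lra; auto).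
    assert (R4 : (RtoC (/ 4) = / 4)%C) by (rewrite RtoC_inv by lra; auto).
    assert (Ez : z t = (s / 2)%C).
    { replace (s / 2)%C with (RtoC (/ 2) * s)%C by (rewrite R2; field). unfold z, s, Cmult, RtoC; simpl. f_equal; field. }
    assert (Ev : v t = (s / 4 - RtoC (INR (S p)))%C).
    { replace (s / 4)%C with (RtoC (/ 4) * s)%C by (rewrite R4; field). unfold v, s, Cmult, Cminus, Cplus, Copp, RtoC; cbn [fst snd]. f_equal; field. }
    assert (A1 : ((x / 2 + / 4)%R, (/ 2 * t)%R) = (s / 2 + / 4)%C).
    { rewrite <- Ez, <- R4. unfold z, Cplus, RtoC; simpl. f_equal; ring. }
    assert (A3 : ((x - 2, t) : C) = (s - 2)%C).
    { unfold s, Cminus, Cplus, Copp, RtoC; simpl. f_equal; ring. }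
    assert (A4 : ((x - / 2, t) : C) = (s - / 2)%C).
    { rewrite <- R2. unfold s, Cminus, Cplus, Copp, RtoC; simpl. f_equal; ring. }
    assert (A5 : (RtoC (5 / 2) + (s - 2) = / 2 + s)%C) by (rewrite RtoC_div by lra; field).
    assert (A6 : cprod (fun j => / ((x / 2 - INR (S (S j)))%R, (/ 2 * t)%R))%C (2 * p) = (/ cprod (fun j => z t - RtoC (INR (S (S j)))) (2 * p))%C).
    { rewrite <- cprod_inv.
      - apply cprod_ext. intros j Hj. f_equal. unfold z, Cminus, Cplus, Copp, RtoC; cbn [fst snd]. f_equal; ring.
      - intros j Hj E. apply (f_equal fst) in E. unfold z in E. simpl fst in E.
        assert (INR (S (S j)) <= INR (2 * p + 1)) by (apply le_INR; lia).
        rewrite plus_INR, mult_INR in H. simpl (INR 2) in H. simpl (INR 1) in H.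
        cbn [Cminus Cplus Copp RtoC fst snd] in E. simpl in E. simpl in H. lra. }
    set (P := cprod (fun j => z t - RtoC (INR (S (S j))))%C (2 * p)) in *.
    assert (Hv : 0 < fst (v t) < 1) by (unfold v; cbn [fst]; lra).
    assert (Hv0 : v t <> RtoC 0) by (intros E; rewrite E in Hv; simpl in Hv; lra).
    assert (N1 : RGam (v t) <> RtoC 0) by (apply RGam_neq0, nonpole_pos; lra).
    assert (N2 : RGam (1 - v t) <> RtoC 0).
    { apply RGam_neq0, nonpole_pos. unfold Cminus, Cplus, Copp, RtoC. cbn [fst snd]. lra. }
    assert (N3 : RGam (z t) <> RtoC 0) by (apply RGam_neq0, nonpole_pos; unfold z; simpl; lra).
    assert (N4 : RGam (s / 2 + / 4) <> RtoC 0).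
    { rewrite <- A1. apply RGam_neq0, nonpole_pos. simpl; lra. }
    assert (N5 : zD (/ 2 + s) <> RtoC 0) by (apply zD_neq0; rewrite half_shift_fst; simpl; lra).
    assert (N6 : (s / 2 + / 4)%C <> RtoC 0) by (rewrite <- A1; apply line_neq0; lra).
    assert (N7 : (s - 2)%C <> RtoC 0) by (rewrite <- A3; apply line_neq0; lra).
    assert (N8 : (s - / 2)%C <> RtoC 0) by (rewrite <- A4; apply line_neq0; lra).
    assert (NP : RtoC PI <> RtoC 0) by (apply RtoC_neq0, PI_neq0).
    assert (NK : RtoC kap <> RtoC 0) by (apply RtoC_neq0; lra).
    assert (N9 := Rcpow_neq0 PI (s / 2 + / 4)). assert (N10 := Rcpow_neq0 2 (2 * v t)).
    (* [RGam v RGam (v + 1/2)] through duplication, then [2 v + 1 = s / 2 - (2 p + 1)] *)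
    assert (D : (RGam (v t) * RGam (v t + RtoC (/ 2)) = RtoC kap * Rcpow 2 (2 * v t) * (2 * v t * (P * ((z t - 1) * RGam (z t)))))%C).
    { rewrite Hdup, (RGam_rec (2 * v t)). f_equal. f_equal. unfold P. rewrite <- RGam_down. f_equal. rewrite Ez, Ev.
      rewrite (S_INR (2 * p)), mult_INR, HpS, !RtoC_plus, RtoC_mult. simpl (INR 2). replace (1 + 1) with 2 by ring. field. }
    assert (NV : RGam (v t + RtoC (/ 2)) <> RtoC 0) by (apply RGam_neq0, nonpole_pos; simpl; unfold v in *; simpl in *; lra).
    assert (NPZ : (P * (z t - 1))%C <> RtoC 0).
    { intros E. apply (Cmult_neq_0 _ _ N1 NV). rewrite D.
      replace (P * ((z t - 1) * RGam (z t)))%C with ((P * (z t - 1)) * RGam (z t))%C by ring. rewrite E. ring. }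
    assert (NPp : P <> RtoC 0) by (intros E; apply NPZ; rewrite E; ring).
    assert (NZ1 : (z t - 1)%C <> RtoC 0) by (intros E; apply NPZ; rewrite E; ring).
    assert (Hn : n s = (e * (RtoC PI * (RGam (v t) * RGam (1 - v t))) * (/ Rcpow PI (s / 2 + / 4) * (2 * (s / 2 + / 4)) * (s - / 2) / RGam (s / 2 + / 4) * zD (/ 2 + s)))%C).
    { rewrite n_right by (unfold s; simpl; lra).
      replace (RtoC PI * s / 4)%C with (RtoC PI * v t + RtoC PI * RtoC (INR (S p)))%C by (rewrite Ev; field).
      rewrite Hsin, (RGam_refl (v t) Hv0). unfold XR.
      replace (- (/ 2 + s) / 2)%C with (- (s / 2 + / 4))%C by field.
      replace ((/ 2 + s) / 2)%C with (s / 2 + / 4)%C by field. rewrite Rcpow_opp.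
      field. repeat split; auto. }
    assert (Hnz : n s <> RtoC 0).
    { rewrite Hn.
      repeat match goal with |- (_ * _)%C <> _ => apply Cmult_neq_0 | |- (_ / RGam _)%C <> _ => apply Cmult_neq_0 end; auto; try apply C2_neq0.
      - intros E. apply C1_nz. rewrite <- (Cinv_r _ N9), E. ring.
      - intros E. apply C1_nz. rewrite <- (Cinv_r _ N4), E. ring. }
    split; auto.
    unfold psi. rewrite A4, A1, A3, A5, A6. unfold Mv. rewrite Hhalf.
    rewrite RtoC_div by apply PI_neq0.
    replace (- (2 * v t))%C with (- (2 * v t))%C by ring. rewrite Rcpow_opp.
    replace (z t + RtoC (/ 4))%C with (s / 2 + / 4)%C by (rewrite Ez, R4; auto).
    assert (Ez1 : (s - 2 = 2 * (z t - 1))%C) by (rewrite Ez; field).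
    rewrite Ez1.
    assert (DV : RGam (v t + RtoC (/ 2)) = (RtoC kap * Rcpow 2 (2 * v t) * (2 * v t * (P * ((z t - 1) * RGam (z t)))) / RGam (v t))%C).
    { rewrite <- D. field; auto. }
    rewrite DV, Hn.
    set (Q := (s / 2 + / 4)%C) in *. set (Z1 := (z t - 1)%C) in *. set (S1 := (s - / 2)%C) in *.
    set (ZZ := zD (/ 2 + s)) in *. set (V1 := RGam (1 - v t)) in *. set (V0 := RGam (v t)) in *. set (G1 := RGam Q) in *.
    set (R1 := Rcpow PI Q) in *. set (R22 := Rcpow 2 (2 * v t)) in *. set (G0 := RGam (z t)) in *. set (vv := v t) in *.
    field. repeat split; auto.
Qed.

Lemma nfloor_quarter x : 4 < x -> ~ (exists k : Z, x = 4 * IZR k) -> exists p, 4 * INR (S p) < x < 4 * INR (S p) + 4.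
Proof.
  intros Hx Hn. destruct (nfloor_ex (x / 4)) as [q [H1 H2]]. lra.
  destruct q as [|p]. simpl in H2. lra.
  exists p. split; [|lra]. destruct (Rle_lt_or_eq_dec _ _ H1) as [h|h]; [lra|].
  exfalso. apply Hn. exists (Z.of_nat (S p)). rewrite <- INR_IZR_INZ, h. field.
Qed.

Lemma m_metric_norm_pos (x : R) : 4 < x -> ~ (exists k : Z, x = 4 * IZR k) ->
  (forall t, is_finite (m x t)) /\ metric_norm (fun t => real (m x t)).
Proof.
  intros Hx Hx4. destruct (nfloor_quarter x Hx Hx4) as [p Hp].
  destruct (inv_n_PD x p Hp) as [e [psi [He [Hpsi Hn]]]].
  assert (Hl : forall t, ((x - / 2, t) : C) <> RtoC 0) by (intros; apply line_neq0; lra).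
  set (chi := fun t : R => (psi t * / ((x - / 2)%R, t))%C).
  assert (Hchi : PD chi) by (apply PD_mult; auto; apply PD_inv_line; lra).
  destruct (PD_0_re chi Hchi) as [C0 C1].
  destruct (PD_0_re psi Hpsi) as [P0 P1].
  assert (Hchi0 : chi 0 <> RtoC 0).
  { intros E. destruct (Hn 0) as [N0 N1]. fold (chi 0) in N1. rewrite E, Cmult_0_r in N1.
    apply C1_nz. rewrite <- (Cinv_r _ N0), N1. ring. }
  set (c := Re (chi 0)) in *.
  assert (Hc : 0 < c) by (destruct C1 as [|E]; auto; exfalso; apply Hchi0; rewrite C0, <- E; auto).
  set (phi := fun t => (RtoC (/ c) * chi t)%C).
  assert (Hphi : PD phi) by (apply PD_scal; auto; left; apply Rinv_0_lt_compat; auto).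
  assert (Hphi0 : phi 0 = RtoC 1).
  { unfold phi. rewrite C0, <- RtoC_mult. f_equal. field. lra. }
  (* By [inv_n_PD] the quotient [n x / n (x + i t)] is [chi t / chi 0]; the constant [e] cancels. *)
  assert (Hm : forall t, m x t = Finite (sqrt (Cmod (1 - phi t)%C))).
  { intros t. unfold m. destruct (Ceq_dec (n (x, t)) 0) as [E|_].
    - exfalso; apply (proj1 (Hn t)); auto.
    - do 4 f_equal. destruct (Hn 0) as [N0 N1]. destruct (Hn t) as [N2 N3].
      unfold Cdiv. rewrite N3. change (n (RtoC x)) with (n (x, 0)).
      fold (chi t). fold (chi 0) in N1.
      assert (E : n (x, 0) = (/ (e * chi 0))%C). { rewrite <- N1. field. auto. }
      rewrite E, C0. unfold phi. rewrite RtoC_inv by lra. field. split; auto. apply RtoC_neq0; lra. }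
  split. { intros t. rewrite Hm. reflexivity. }
  assert (Hr : forall t, real (m x t) = sqrt (Cmod (1 - phi t)%C)) by (intros; rewrite Hm; auto).
  split; [|split; [|split]].
  - intros t. rewrite Hr. apply sqrt_pos.
  - intros t. rewrite Hr. split.
    + intros E. apply sqrt_eq_0 in E; [|apply Cmod_ge_0]. apply Cmod_eq_0 in E.
      assert (E1 : phi t = RtoC 1) by (replace (phi t) with (1 - (1 - phi t))%C by ring; rewrite E; ring).
      destruct (Req_dec t 0) as [|Ht]; auto. exfalso.
      (* If [phi t = 1] with [t <> 0], then [psi t = c (s - 1/2)] with [s = x + i t], whose modulus
         exceeds [c (x - 1/2) = psi 0], against the bound for the positive definite [psi]. *)
      assert (B1 : Cmod (psi t) <= Re (psi 0)) by (apply PD_bound; auto).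
      assert (Ec : Re (psi 0) = c * (x - / 2)).
      { assert (E2 : (psi 0 = chi 0 * ((x - / 2)%R, 0%R))%C) by (unfold chi; field; auto).
        change ((x - / 2, 0) : C) with (RtoC (x - / 2)) in E2. rewrite C0, <- RtoC_mult in E2. rewrite E2. auto. }
      assert (E3 : Cmod (psi t) = c * Cmod ((x - / 2, t) : C)).
      { assert (E4 : psi t = (RtoC c * ((x - / 2)%R, t))%C).
        { replace (psi t) with (RtoC c * phi t * ((x - / 2)%R, t))%C. rewrite E1; ring.
          unfold phi, chi. rewrite RtoC_inv by lra. field. split; auto. apply RtoC_neq0; lra. }
        rewrite E4, Cmod_mult, Cmod_RtoC_pos by lra. auto. }
      rewrite E3, Ec in B1. apply Rmult_le_reg_l in B1; auto.
      assert (Hs : x - / 2 < Cmod ((x - / 2, t) : C)).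
      { unfold Cmod; simpl fst; simpl snd. rewrite <- (sqrt_pow2 (x - / 2)) at 1 by lra. apply sqrt_lt_1_alt.
        split. apply pow2_ge_0. assert (0 < t ^ 2) by (apply pow2_gt_0; auto). lra. }
      lra.
    + intros ->. rewrite Hphi0. replace (1 - 1)%C with (RtoC 0) by ring. rewrite Cmod_0. apply sqrt_0.
  - intros t. rewrite !Hr, (PD_conj phi t Hphi). f_equal.
    rewrite <- (Cmod_conj (1 - phi t)%C), Cminus_conj. do 2 f_equal. unfold Cconj, RtoC; simpl. f_equal; ring.
  - intros t1 t2. rewrite !Hr. apply PD_subadd; auto.
Qed.

(** By [n_left] both values of [n] pick up the same nonzero factor [- kxi] under [s] to [- s], so
    their quotient is unchanged; in particular the zeros correspond. *)
Lemma m_neg (x t : R) : x < - 4 -> m x t = m (- x) (- t).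
Proof.
  intros Hx. assert (Hk := kxi_neq0).
  assert (E : forall t, n (x, t) = (- kxi * n ((- x)%R, (- t)%R))%C).
  { intros r. rewrite n_left by (simpl; lra). reflexivity. }
  assert (E0 : n (RtoC x) = (- kxi * n (RtoC (- x)))%C).
  { unfold RtoC at 1. rewrite E, Ropp_0. reflexivity. }
  assert (Hk' : (- kxi)%C <> RtoC 0).
  { intros E1. apply Hk. replace kxi with (- - kxi)%C by ring. rewrite E1; ring. }
  unfold m. destruct (Ceq_dec (n (x, t)) 0) as [e1|e1], (Ceq_dec (n (- x, - t)) 0) as [e2|e2]; auto.
  - exfalso. rewrite E in e1. apply (Cmult_neq_0 _ _ Hk' e2 e1).
  - exfalso. apply e1. rewrite E, e2. ring.
  - do 4 f_equal. rewrite E, E0. field. split; auto.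
Qed.

Lemma m_metric_norm (x : R) : x < -4 \/ x > 4 -> ~ (exists k : Z, x = 4 * IZR k) ->
  (forall t, is_finite (m x t)) /\ metric_norm (fun t => real (m x t)).
Proof.
  intros [Hx|Hx] Hx4; [|apply m_metric_norm_pos; auto].
  destruct (m_metric_norm_pos (- x)) as [H1 [H2 [H3 [H4 H5]]]]. lra.
  { intros [k Hk]. apply Hx4. exists (- k)%Z. rewrite opp_IZR. lra. }
  assert (E : forall t, m x t = m (- x) (- t)) by (intros; apply m_neg; auto).
  split; [|split; [|split; [|split]]].
  - intros t. rewrite E. apply H1.
  - intros t. rewrite E. apply H2.
  - intros t. rewrite E, H3. lra.
  - intros t. rewrite !E. apply H4.
  - intros t1 t2. rewrite !E, Ropp_plus_distr. apply H5.
Qed.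

Theorem mainTheorem3 (x : R)
  (hx : x < -4 \/ x > 4)
  (hx4 : ~ exists k : Z, x = 4 * IZR k) :
  ((forall t : R, is_finite (m x t)) /\
   metric_norm (fun t : R => real (m x t))) /\
  ((forall t1 t2 : R, is_finite (d x t1 t2)) /\
   metric (fun t1 t2 : R => real (d x t1 t2)) /\
   translation_invariant (fun t1 t2 : R => real (d x t1 t2))).
Proof.
  destruct (m_metric_norm x hx hx4) as [Hf Hm]. split; [split; auto|].
  destruct Hm as [H1 [H2 [H3 H4]]]. unfold d.
  split; [intros; apply Hf|split; [split; [|split; [|split]]|]].
  - intros a b. apply H1.
  - intros a b. rewrite H2. split; intros; lra.
  - intros a b. rewrite <- H3. do 2 f_equal. ring.
  - intros a b c. replace (a - c) with ((a - b) + (b - c)) by ring. apply H4.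
  - intros a b c. do 2 f_equal. ring.
Qed.
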